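(* Up to conjugacy under $\mathrm{SL}(8,\mathbb{R})$, there are exactly ten Cartan subspaces in $\bigwedge^4\mathbb{R}^8$.
   Context: Let $\mathfrak{g}$ be the simple complex Lie algebra of type $E_7$, with simple roots $\alpha_1,\dots,\alpha_7$ (Bourbaki numbering) and lowest root $\alpha_0$. Fix a Chevalley basis of $\mathfrak g$, and let $e_i$, $f_i$ ($0\le i\le 7$) be its elements in the root spaces of $\alpha_i$, $-\alpha_i$. Let $\theta$ be the automorphism of order 2 of $\mathfrak g$ with $\theta(e_i)=e_i$ for $i\in\{0,1,3,4,5,6,7\}$ and $\theta(e_2)=-e_2$. Let $\mathfrak g=\mathfrak g_0\oplus\mathfrak g_1$ be the decomposition into the $+1$ and $-1$ eigenspaces of $\theta$. Then $\mathfrak g_0$ is identified with $\mathfrak{sl}(8,\mathbb C)$ by the isomorphism sending the elementary matrices $e_{12},e_{23},\dots,e_{78}$ to $e_0,e_1,e_3,e_4,\dots,e_7$ and $e_{21},e_{32},\dots,e_{87}$ to $f_0,f_1,f_3,f_4,\dots,f_7$. This lifts to a surjective homomorphism from $\mathrm{SL}(8,\mathbb C)$ onto the connected subgroup $G_0$ (with Lie algebra $\mathrm{ad}\,\mathfrak g_0$) of the adjoint group of $\mathfrak g$. Via this map $\mathfrak g_1\cong\bigwedge^4\mathbb C^8$ as $\mathrm{SL}(8,\mathbb C)$-modules; the two are identified, so that $\bigwedge^4\mathbb R^8$ corresponds to the intersection $\mathfrak g_1^{\mathbb R}$ of $\mathfrak g_1$ with the real span $\mathfrak g^{\mathbb R}$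 of the Chevalley basis, and this identification is $\mathrm{SL}(8,\mathbb R)$-equivariant. A *Cartan subspace* in $\bigwedge^4\mathbb R^8=\mathfrak g_1^{\mathbb R}$ is a maximal subspace consisting of semisimple elements (that is, $x$ with $\mathrm{ad}\,x$ semisimple on $\mathfrak g$) that commute pairwise in $\mathfrak g$. *)

(* Defs.v *)
From mathcomp Require Import all_boot all_order all_algebra.
From mathcomp Require Import complex reals.

Set Implicit Arguments.
Unset Strict Implicit.
Unset Printing Implicit Defensive.

Import Order.TTheory GRing.Theory Num.Theory.

Local Open Scope ring_scope.
Local Open Scope complex_scope.

(* A Lie algebra structure on g is given by its adjoint map: the bracket of x
   and y is ad x y, and its bilinearity is carried by the type of ad. *)
Section LieAlgebra.
Variables (K : fieldType) (g : vectType K) (ad : 'Hom(g, 'End(g))).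

Definition lie_algebra : Prop :=
  (forall x, ad x x = 0) /\
  (forall x y z, ad x (ad y z) + ad y (ad z x) + ad z (ad x y) = 0).

Definition simple_lie : Prop :=
  (exists x y, ad x y != 0) /\
  (forall I : {vspace g},
     (forall x y, y \in I -> ad x y \in I) -> I = 0%VS \/ I = fullv).

Definition semisimple_endo (f : 'End(g)) : Prop :=
  forall U : {vspace g}, (f @: U <= U)%VS ->
    exists W : {vspace g},
      [/\ (f @: W <= W)%VS, (U + W)%VS = fullv & (U :&: W)%VS = 0%VS].

Definition ad_semisimple (x : g) : Prop := semisimple_endo (ad x).

Definition lie_automorphism (s : 'End(g)) : Prop :=
  (forall x y, s (ad x y) = ad (s x) (s y)) /\
  lker s = 0%VS.

(* The exponential of a nilpotent endomorphism of g, applied to x: all powers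
   of exponent at least dim g vanish. *)
Definition exp_nilp (f : 'End(g)) (x : g) : g :=
  \sum_(k < \dim {:g}) (k`!%:R)^-1 *: iter k f x.

(* Elements of the root lattice are written as row vectors of coordinates in
   the simple roots; the i-th simple root is the i-th unit vector. *)
Definition simple_root n (i : 'I_n) : 'rV[int]_n := delta_mx 0 i.

Section Chevalley.
Variables (n : nat) (A : 'M[int]_n).
Variables (Phi : seq 'rV[int]_n) (h : 'I_n -> g) (e : 'rV[int]_n -> g).

(* A i j is the value of the j-th simple root on the i-th simple coroot h i. *)
Definition weight_vector (a : 'rV[int]_n) (x : g) : Prop :=
  forall i, ad (h i) x = (\sum_j a 0 j * A i j)%:~R *: x.

Definition is_root (a : 'rV[int]_n) : Prop :=
  a <> 0 /\ exists2 x, x <> 0 & weight_vector a x.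

(* Chevalley basis of g, with roots Phi relative to the Cartan subalgebra
   spanned by the h i, whose base of simple roots has Cartan matrix A.  That
   this span is a Cartan subalgebra follows from cb_comm, cb_basis and
   cb_weight when A is invertible.  By cb_coroot, ad (e a) (e (- a)) is the
   coroot of a: the element of [g_a, g_(-a)] on which a takes the value 2. *)
Record chevalley_basis : Prop := {
  cb_uniq : uniq Phi;
  cb_roots : forall a, a \in Phi <-> is_root a;
  cb_simple : forall i, simple_root i \in Phi;
  cb_neg : forall a, a \in Phi -> - a \in Phi;
  cb_sign : forall a, a \in Phi ->
    (forall j, 0 <= a 0 j) \/ (forall j, a 0 j <= 0);
  cb_comm : forall i j, ad (h i) (h j) = 0;
  cb_weight : forall a, a \in Phi -> weight_vector a (e a);
  cb_basis : basis_of fullv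
    ([seq h i | i <- enum 'I_n] ++ [seq e a | a <- Phi]);
  cb_h : forall i, h i = ad (e (simple_root i)) (e (- simple_root i));
  cb_coroot : forall a, a \in Phi ->
    ad (ad (e a) (e (- a))) (e a) = 2%:R *: e a;
  cb_opp : forall a b, a \in Phi -> b \in Phi -> a + b \in Phi ->
    exists c : K, ad (e a) (e b) = c *: e (a + b) /\
                  ad (e (- a)) (e (- b)) = - c *: e (- (a + b))
}.

Definition lowest_root (a0 : 'rV[int]_n) : Prop :=
  a0 \in Phi /\ forall b, b \in Phi -> forall j, a0 0 j <= b 0 j.

End Chevalley.
End LieAlgebra.

(* Edges of the Dynkin diagram, with nodes numbered from 1 as in Bourbaki. *)
Definition E7_edges : seq (nat * nat) :=
  [:: (1, 3); (3, 4); (2, 4); (4, 5); (5, 6); (6, 7)]%N.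

Definition E7_cartan : 'M[int]_7 :=
  \matrix_(i < 7, j < 7)
    if i == j then 2
    else if ((i.+1, j.+1) \in E7_edges) || ((j.+1, i.+1) \in E7_edges)
         then -1 else 0.

(* The roots alpha_0, ..., alpha_7, where alpha_0 = a0. *)
Definition ext_root (a0 : 'rV[int]_7) (k : nat) : 'rV[int]_7 :=
  if k is k'.+1 then simple_root (inord k') else a0.

(* The nodes of the extended diagram other than 2: a chain of type A7. *)
Definition A7_chain : seq nat := [:: 0; 1; 3; 4; 5; 6; 7]%N.

Section Grading.
Variables (K : fieldType) (g : vectType K) (ad : 'Hom(g, 'End(g))).
Variables (e : 'rV[int]_7 -> g) (a0 : 'rV[int]_7).

Definition E7_involution (theta : 'End(g)) : Prop :=
  [/\ lie_automorphism ad theta,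
      (theta \o theta)%VF = \1%VF /\ theta <> \1%VF,
      forall k, k \in A7_chain -> theta (e (ext_root a0 k)) = e (ext_root a0 k)
    & theta (e (ext_root a0 2)) = - e (ext_root a0 2)].

Definition grade0 (theta : 'End(g)) : {vspace g} := passmx.leigenspace theta 1.
Definition grade1 (theta : 'End(g)) : {vspace g} := passmx.leigenspace theta (-1).

(* psi restricts to an isomorphism from sl(8) onto the fixed points of theta;
   its value on non-traceless matrices is irrelevant.  The elementary matrix
   at (k, k+1) goes to e_i, and the one at (k+1, k) to f_i, for i the k-th
   element of the chain. *)
Record sl8_iso (theta : 'End(g)) (psi : 'Hom('M[K]_8, g)) : Prop := {
  sl8_bracket : forall X Y : 'M[K]_8, \tr X = 0 -> \tr Y = 0 ->
    psi (X *m Y - Y *m X) = ad (psi X) (psi Y);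
  sl8_inj : forall X : 'M[K]_8, \tr X = 0 -> psi X = 0 -> X = 0;
  sl8_image : forall y,
    y \in grade0 theta <-> exists2 X : 'M[K]_8, \tr X = 0 & psi X = y;
  sl8_e : forall k : 'I_7,
    psi (delta_mx (widen_ord (leqnSn 7) k) (lift ord0 k))
      = e (ext_root a0 (nth 0%N A7_chain k));
  sl8_f : forall k : 'I_7,
    psi (delta_mx (lift ord0 k) (widen_ord (leqnSn 7) k))
      = e (- ext_root a0 (nth 0%N A7_chain k))
}.

(* Psi is the lift of ad \o psi to SL(8).  As SL(8) is generated by unipotent
   elements, the homomorphism is determined by its values on exponentials of
   nilpotent matrices, where all exponential series are finite sums.  Its
   value on matrices of determinant other than 1 is irrelevant. *)
Record sl8_lift (psi : 'Hom('M[K]_8, g)) (Psi : 'M[K]_8 -> 'End(g)) : Prop := {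
  lift_one : Psi 1%:M = \1%VF;
  lift_mul : forall P Q : 'M[K]_8, \det P = 1 -> \det Q = 1 ->
    Psi (P *m Q) = (Psi P \o Psi Q)%VF;
  lift_exp : forall X : 'M[K]_8, X ^+ 8 = 0 -> forall y,
    Psi (\sum_(k < 8) (k`!%:R)^-1 *: X ^+ k) y = exp_nilp (ad (psi X)) y
}.

End Grading.

Definition sub4 : predArgType := {I : {set 'I_8} | #|I| == 4%N}.

Definition sub4_nth (I : sub4) (k : nat) : 'I_8 := nth ord0 (enum (val I)) k.

(* The fourth exterior power of K^8, in coordinates with respect to the basis
   e_I = e_i1 /\ e_i2 /\ e_i3 /\ e_i4, I = {i1 < i2 < i3 < i4}. *)
Definition ext4 (K : fieldType) : vectType K := {ffun sub4 -> K^o}.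

Definition minor4 (K : fieldType) (P : 'M[K]_8) (I J : sub4) : K :=
  \det (\matrix_(a < 4, b < 4) P (sub4_nth I a) (sub4_nth J b)).

(* P e_J = P e_j1 /\ ... /\ P e_j4 = \sum_I minor4 P I J e_I. *)
Definition ext4_act (K : fieldType) (P : 'M[K]_8) (v : ext4 K) : ext4 K :=
  [ffun I => \sum_J minor4 P I J * v J].

Definition ext4_complexify (R : rcfType) (v : ext4 R) : ext4 R[i] :=
  [ffun I => (v I : R)%:C].

Section RealForm.
Variables (R : realType) (g : vectType R[i]) (ad : 'Hom(g, 'End(g))).

Definition real_span n (Phi : seq 'rV[int]_n) (h : 'I_n -> g)
    (e : 'rV[int]_n -> g) (x : g) : Prop :=
  exists (c : 'I_n -> R) (d : 'rV[int]_n -> R),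
    x = \sum_i (c i)%:C *: h i + \sum_(a <- Phi) (d a)%:C *: e a.

(* iota is the identification of the fourth exterior power of C^8 with the
   (-1)-eigenspace of theta, as modules over SL(8, C). *)
Record ext4_identification (Phi : seq 'rV[int]_7) (h : 'I_7 -> g)
    (e : 'rV[int]_7 -> g) (theta : 'End(g)) (Psi : 'M[R[i]]_8 -> 'End(g))
    (iota : 'Hom(ext4 R[i], g)) : Prop := {
  ident_inj : lker iota = 0%VS;
  ident_image : limg iota = grade1 theta;
  ident_equiv : forall (P : 'M[R[i]]_8) v, \det P = 1 ->
    iota (ext4_act P v) = Psi P (iota v);
  ident_real : forall y,
    (y \in grade1 theta /\ real_span Phi h e y) <->
    exists v : ext4 R, y = iota (ext4_complexify v)
}.

Variable iota : 'Hom(ext4 R[i], g).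

Definition commuting_semisimple (U : {vspace ext4 R}) : Prop :=
  (forall x, x \in U -> ad_semisimple ad (iota (ext4_complexify x))) /\
  (forall x y, x \in U -> y \in U ->
     ad (iota (ext4_complexify x)) (iota (ext4_complexify y)) = 0).

Definition cartan_subspace (U : {vspace ext4 R}) : Prop :=
  commuting_semisimple U /\
  (forall V : {vspace ext4 R},
     commuting_semisimple V -> (U <= V)%VS -> V = U).

End RealForm.

Definition SL8_conjugate (R : fieldType) (U V : {vspace ext4 R}) : Prop :=
  exists2 P : 'M[R]_8, \det P = 1 &
    forall y, y \in V <-> exists2 x, x \in U & y = ext4_act P x.

(* Main.v *)
(* Write P for gl(8) + ext4, Z/2-graded by the action of gl(8) on ext4 and an invariant
   bilinear map (moment) from ext4 to gl(8). Invariant bilinear maps are unique up to a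
   scalar, so over C the graded Lie algebra g is P modulo scalars, and a Cartan subspace
   is a maximal U in the real exterior power on which moment vanishes and which acts
   diagonalizably on the complexification of P.

   Let U be such a subspace. By Jordan decomposition U is its own centralizer in ext4,
   so dim U >= 7. Summing alpha(u) alpha(u') over the weights of U on P gives
   36 wedge u u'; as every nonzero weight has norm at most 2, by an sl2 argument,
   dim U = 7 and all these norms are 2. For a generic x in U, (ad x)^2 acts on gl(8) and
   is selfadjoint for the trace form. A signature argument gives seven commuting,
   trace-orthogonal real eigenvectors X with X^2 = 1 and trace 0: after simultaneous
   diagonalization, a Hadamard matrix of order 8. So the eight coordinates can be
   labelled by F_2^3 such that U is spanned by vectors e_A + b_A w_A, where A runs over
   the seven planes through 0 and w_A is the basis vector of the complement of A with
   e_A /\ w_A = 1. Diagonal matrices rescale b to signs, GL(3, 2) permutes these, and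
   it has ten orbits on the subsets of the Fano plane.

   Conversely, the span of the e_A + b_A w_A with b_A = eta is the set of those x in U
   for which (ad x)^2 has no real eigenvalue of the sign of - eta on gl(8): the Hodge
   star maps such an x to eta x, so that ad x is symmetric or antisymmetric. The
   dimension of this span gives the number of signs, and whether its centralizer in
   gl(8) is commutative distinguishes the lines of the Fano plane from its triangles. *)

From HB Require Import structures.
Require Import Defs.
From mathcomp Require Import all_boot all_order all_algebra all_fingroup.
From mathcomp Require Import complex reals ring lra zify.
From Stdlib Require Classical_Prop ClassicalEpsilon.

Import Order.TTheory GRing.Theory Num.Theory.
Local Open Scope ring_scope.

Set Implicit Arguments.
Unset Strict Implicit.
Unset Printing Implicit Defensive.

(** * The action of gl(8) on the fourth exterior power *)

(** The Jacobi identity of gl(8) + ext4 is never checked in coordinates. It is inherited from [g],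
    whose bracket on odd elements is a nonzero multiple of [moment]; everything about tori is proved
    under the hypothesis [jacobi]. Nor is a root system of type E_7 ever built: all that is known
    about weights comes from traces and from sl2 triples.

    The algebra is built on gl(8) rather than sl(8) so that elementary matrices can be used one at a
    time and Casimir sums run over all pairs of indices; the half-trace twist makes scalar matrices
    act by zero, so the only price is a one-dimensional centre.

    The obstacle over R is that [wedge] is indefinite in general and ad x may have nonreal
    eigenvalues whose squares are nonreal too, so real roots have to be produced one at a time. The
    matrices annihilating the coroots already found carry the trace form, whose positive index there
    exceeds half the dimension as long as fewer than seven coroots are known; a selfadjoint operator
    on such a space has a real eigenvector of positive norm, and that eigenvector is the next
    root. *)

Notation quad := {ffun 'I_4 -> 'I_8}.

Definition upd (f : quad) (b : 'I_4) (i : 'I_8) : quad :=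
  [ffun k => if k == b then i else f k].

Definition qperm (f : quad) (s : {perm 'I_4}) : quad := [ffun b => f (s b)].

Definition idx (I : sub4) : quad := [ffun b : 'I_4 => sub4_nth I b].

Lemma size_enum_sub4 (I : sub4) : size (enum (val I)) = 4%N.
Proof. by rewrite -cardE; apply/eqP/(valP I). Qed.

Lemma idx_inj (I : sub4) : injective (idx I).
Proof.
move=> a b; rewrite !ffunE => /eqP.
by rewrite nth_uniq ?size_enum_sub4 ?enum_uniq // => /eqP /val_inj.
Qed.

Lemma mem_idx (I : sub4) b : idx I b \in val I.
Proof. by rewrite ffunE -mem_enum mem_nth // size_enum_sub4. Qed.

Lemma idxP (I : sub4) i : i \in val I -> exists b, i = idx I b.
Proof.
rewrite -mem_enum => iI; have lt : (index i (enum (val I)) < 4)%N.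
  by move: iI; rewrite -index_mem size_enum_sub4.
by exists (Ordinal lt); rewrite ffunE /sub4_nth nth_index.
Qed.

Lemma im_inj_card (f : quad) : injective f -> #|f @: [set: 'I_4]| == 4%N.
Proof. by move=> fi; rewrite card_imset // cardsT card_ord. Qed.

Definition im4 (f : quad) (fi : injective f) : sub4 := Sub (f @: [set: 'I_4]) (im_inj_card fi).

Lemma inj_idx (f : quad) (fi : injective f) :
  exists s : {perm 'I_4}, f = qperm (idx (im4 fi)) s.
Proof.
have h b : exists k, f b == idx (im4 fi) k.
  have [|k ->] := @idxP (im4 fi) (f b); last by exists k.
  by apply: imset_f.
pose t b := xchoose (h b).
have tE b : f b = idx (im4 fi) (t b) by apply/eqP/(xchooseP (h b)).
have ti : injective t by move=> a b e; apply: (fi); rewrite !tE e.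
by exists (perm ti); apply/ffunP => b; rewrite ffunE permE -tE.
Qed.

Lemma noninj_quad (f : quad) : ~ injective f ->
  exists s : {perm 'I_4}, odd_perm s /\ qperm f s = f.
Proof.
move/injectiveP => /injectivePn[a [b ab e]].
exists (tperm a b); rewrite odd_tperm ab; split=> //.
apply/ffunP => k; rewrite ffunE; case: tpermP => [->|->|] //.
Qed.

(** The product e_{f 0} /\ ... /\ e_{f 3} for an arbitrary quadruple, repeated or unsorted indices
    included. Identities can then be checked on all quadruples, while the signs stay inside the
    determinant. *)
HB.lock Definition bv (K : fieldType) (f : quad) : ext4 K :=
  [ffun I => \det (\matrix_(a < 4, b < 4) (idx I a == f b)%:R)].

HB.lock Definition e4 (K : fieldType) (I : sub4) : ext4 K := [ffun J => (J == I)%:R].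

Section Alternating.
Variable K : numFieldType.
Implicit Types (v w u : ext4 K).

Lemma ext4D (u v : ext4 K) I : (u + v) I = u I + v I :> K. Proof. exact: ffunE. Qed.
Lemma ext4Z a (v : ext4 K) I : (a *: v) I = a * v I :> K. Proof. exact: ffunE. Qed.
Lemma ext4N (v : ext4 K) I : (- v) I = - v I :> K. Proof. exact: ffunE. Qed.
Lemma ext4_0 I : (0 : ext4 K) I = 0 :> K. Proof. exact: ffunE. Qed.
Lemma ext4_sum (T : Type) (r : seq T) (P : pred T) (F : T -> ext4 K) I :
  (\sum_(t <- r | P t) F t) I = \sum_(t <- r | P t) F t I :> K.
Proof. by elim/big_rec2: _ => [|t x y _ <-]; rewrite ffunE. Qed.

Definition alternating (V : lmodType K) (G : quad -> V) :=
  forall f s, G (qperm f s) = (-1) ^+ odd_perm s *: G f.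

Local Notation bv := (bv K).
Local Notation e4 := (e4 K).

Lemma bvE f I : bv f I = \det (\matrix_(a < 4, b < 4) (idx I a == f b)%:R).
Proof. by rewrite bv.unlock ffunE. Qed.

Lemma e4E I J : e4 I J = (J == I)%:R. Proof. by rewrite e4.unlock ffunE. Qed.

Lemma ext4E (v : ext4 K) : v = \sum_I v I *: e4 I.
Proof.
apply/ffunP => J; rewrite ext4_sum (bigD1 J) //= big1 => [|I IJ].
  by rewrite ext4Z e4E eqxx addr0 mulr1.
by rewrite ext4Z e4E eq_sym (negbTE IJ) mulr0.
Qed.

Lemma e4_eq (V : lmodType K) (f g : {linear ext4 K -> V}) :
  (forall I, f (e4 I) = g (e4 I)) -> forall v, f v = g v.
Proof.
move=> fg v; rewrite (ext4E v) !linear_sum; apply: eq_bigr => I _.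
by rewrite !linearZ fg.
Qed.

Lemma alternating_noninj (V : lmodType K) (G : quad -> V) :
  alternating G -> forall f : quad, ~ injective f -> G f = 0.
Proof.
move=> aG f /noninj_quad[s [os e]].
have := aG f s; rewrite e os expr1 scaleN1r => /eqP.
rewrite -addr_eq0 -mulr2n -scaler_nat scaler_eq0 pnatr_eq0 /=.
by move/eqP.
Qed.

Lemma bv_alternating : alternating bv.
Proof.
move=> f s; apply/ffunP => I; rewrite ext4Z !bvE.
set A := (X in _ = (-1) ^+ s * \det X).
rewrite (_ : \matrix_(a, b) _ = col_perm s A); last first.
  by apply/matrixP => a b; rewrite !mxE !ffunE.
by rewrite col_permE det_mulmx det_perm odd_permV mulrC.
Qed.

Lemma bv_idx I : bv (idx I) = e4 I.
Proof.
apply/ffunP => J; rewrite bvE e4E; case: eqP => [->|/eqP JI].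
  rewrite (_ : \matrix_(_, _) _ = 1%:M) ?det1 //.
  by apply/matrixP => a b; rewrite !mxE (inj_eq (@idx_inj I)).
have /subsetPn[i iJ iI] : ~~ (val J \subset val I).
  apply: contra JI => JI; rewrite -val_eqE eqEcard JI.
  by rewrite (eqP (valP I)) (eqP (valP J)).
have [a ia] := idxP iJ.
rewrite (expand_det_row _ a) big1 // => b _; rewrite mxE.
case: eqP => [e|]; last by rewrite mul0r.
by rewrite ia e mem_idx in iI.
Qed.

Lemma bv_noninj (f : quad) : ~ injective f -> bv f = 0.
Proof. exact: (alternating_noninj bv_alternating). Qed.

Lemma bv_inj (f : quad) (fi : injective f) : exists s : {perm 'I_4},
  [/\ f = qperm (idx (im4 fi)) s & bv f = (-1) ^+ odd_perm s *: e4 (im4 fi)].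
Proof.
have [s e] := inj_idx fi; exists s; split=> //.
by rewrite {1}e bv_alternating bv_idx.
Qed.

Lemma alternatingE (V : lmodType K) (G : quad -> V) :
  alternating G -> forall f, G f = \sum_I bv f I *: G (idx I).
Proof.
move=> aG f; have [/injectiveP fi|/injectiveP nfi] := boolP (injectiveb f); last first.
  rewrite (alternating_noninj aG nfi) bv_noninj // big1 // => I _.
  by rewrite ext4_0 scale0r.
have [s [e ->]] := bv_inj fi; rewrite {1}e aG.
rewrite (bigD1 (im4 fi)) //= big1 => [|I].
  by rewrite ext4Z e4E eqxx addr0 mulr1.
by move=> ne; rewrite ext4Z e4E (negbTE ne) mulr0 scale0r.
Qed.

(** A linear map is fixed by its values on the sorted quadruples [idx I]; when the right-hand side
    is alternating, the formula extends to all quadruples. *)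
Lemma linear_bvE (V : lmodType K) (G : quad -> V) (L : {linear ext4 K -> V}) :
  alternating G -> (forall I, L (e4 I) = G (idx I)) -> forall f, L (bv f) = G f.
Proof.
move=> aG LG f; rewrite (alternatingE aG) {1}(ext4E (bv f)) linear_sum.
by apply: eq_bigr => I _; rewrite linearZ LG.
Qed.

Lemma sum_quad_prod (A : 'I_4 -> 'I_8 -> K) :
  \sum_(f : quad) \prod_b A b (f b) = \prod_b \sum_i A b i.
Proof. by rewrite bigA_distr_bigA. Qed.

Lemma sum_delta_quad (V : lmodType K) (G : quad -> V) (f : quad) :
  \sum_(g : quad) (\prod_b (g b == f b)%:R : K) *: G g = G f.
Proof.
rewrite (bigD1 f) //= [X in _ + X]big1 => [|g gf]; last first.
  have /existsP[b gfb] : [exists b, g b != f b].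
    by rewrite -negb_forall; apply: contra gf => /forallP h; apply/eqP/ffunP => b; apply/eqP.
  by rewrite (bigD1 b) //= (negbTE gfb) mul0r scale0r.
by rewrite addr0 big1 ?scale1r // => b _; rewrite eqxx.
Qed.

Lemma sum_delta1_quad (V : lmodType K) (G : quad -> V) (f : quad) b0 i :
  \sum_(g : quad) ((g b0 == i)%:R * \prod_(b | b != b0) (g b == f b)%:R : K) *: G g
  = G (upd f b0 i).
Proof.
rewrite -(sum_delta_quad G); apply: eq_bigr => g _; congr (_ *: _).
rewrite [RHS](bigD1 b0) //= ffunE eqxx; congr (_ * _).
by apply: eq_bigr => b /negbTE bb; rewrite ffunE bb.
Qed.

(** The wedge product of the four columns of [c], expanded multilinearly; its coordinates are the
    minors of order 4. *)
Definition decomp (c : 'M[K]_(8, 4)) : ext4 K :=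
  \sum_(f : quad) (\prod_b c (f b) b) *: bv f.

Lemma decompE c I : decomp c I = \det (\matrix_(a < 4, b < 4) c (idx I a) b).
Proof.
rewrite ext4_sum -det_tr /determinant.
transitivity (\sum_(f : quad) \sum_s (-1) ^+ odd_perm s * (\prod_b c (f b) b * \prod_b (idx I (s b) == f b)%:R : K)).
  apply: eq_bigr => f _; rewrite ext4Z bvE -det_tr mulr_sumr.
  apply: eq_bigr => s _; rewrite mulrCA; congr (_ * (_ * _)).
  by apply: eq_bigr => b _; rewrite !mxE.
rewrite exchange_big; apply: eq_bigr => s _; rewrite -mulr_sumr; congr (_ * _).
have := sum_delta_quad (fun f => \prod_b c (f b) b : K^o) (qperm (idx I) s).
move=> e; transitivity (\prod_b c (qperm (idx I) s b) b).
  rewrite -e; apply: eq_bigr => f _; rewrite mulrC; congr (_ * _).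
  by apply: eq_bigr => b _; rewrite [qperm _ _ _]ffunE eq_sym.
by apply: eq_bigr => b _; rewrite !mxE ffunE.
Qed.

Fact ext4_act_is_linear (P : 'M[K]_8) : linear (@ext4_act K P).
Proof.
move=> a u v; apply/ffunP => I; rewrite ext4D ext4Z !ffunE mulr_sumr -big_split.
by apply: eq_bigr => J _; rewrite ext4D ext4Z mulrDr mulrCA.
Qed.
HB.instance Definition _ P :=
  GRing.isLinear.Build K (ext4 K) (ext4 K) _ (@ext4_act K P) (ext4_act_is_linear P).

Lemma prod_qperm (A : 'I_8 -> 'I_8 -> K) (g f : quad) (s : {perm 'I_4}) :
  \prod_b A (g b) (qperm f s b) = \prod_b A (qperm g s^-1%g b) (f b).
Proof.
rewrite (reindex_inj (@perm_inj _ s^-1%g)); apply: eq_bigr => b _.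
by rewrite !ffunE permKV.
Qed.

Lemma sum_qperm (V : lmodType K) (G : quad -> V) (s : {perm 'I_4}) :
  \sum_(f : quad) G (qperm f s) = \sum_(f : quad) G f.
Proof.
symmetry; apply: reindex; exists (fun f => qperm f s^-1%g) => f _;
  by apply/ffunP => b; rewrite !ffunE ?permK ?permKV.
Qed.

Lemma act_bv P f :
  ext4_act P (bv f) = \sum_(g : quad) (\prod_b P (g b) (f b)) *: bv g.
Proof.
move: f; apply: linear_bvE => [f s|I].
  rewrite scaler_sumr.
  rewrite -(sum_qperm (fun g => (-1) ^+ odd_perm s *: ((\prod_b P (g b) (f b)) *: bv g)) s^-1%g).
  apply: eq_bigr => g _; rewrite prod_qperm bv_alternating odd_permV !scalerA; congr (_ *: _).
  by rewrite mulrAC -signr_addb addbb mul1r.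
have := decompE (\matrix_(i, b) P i (idx I b)); rewrite /decomp => h.
apply/ffunP => J; have := h J.
under eq_bigr => f _ do under eq_bigr => b _ do rewrite mxE.
move=> ->; rewrite ffunE (bigD1 I) //= big1 => [|J' ne]; last first.
  by rewrite e4E (negbTE ne) mulr0.
rewrite e4E eqxx mulr1 addr0; congr (\det _); apply/matrixP => a b.
by rewrite !mxE !ffunE.
Qed.

Lemma ext4_actM P Q (v : ext4 K) : ext4_act (P *m Q) v = ext4_act P (ext4_act Q v).
Proof.
move: v; apply: (@e4_eq _ (@ext4_act K (P *m Q)) (@ext4_act K P \o @ext4_act K Q)) => I /=.
rewrite -bv_idx !act_bv linear_sum /=.
under [RHS]eq_bigr => g _ do rewrite linearZ /= act_bv scaler_sumr.
rewrite exchange_big; apply: eq_bigr => h _ /=.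
under [RHS]eq_bigr => g _ do rewrite scalerA -big_split /=.
rewrite -scaler_suml; congr (_ *: _).
rewrite (sum_quad_prod (fun b i => Q i (idx I b) * P (h b) i)).
by apply: eq_bigr => b _; rewrite mxE; apply: eq_bigr => j _; rewrite mulrC.
Qed.

Lemma ext4_act1 (v : ext4 K) : ext4_act 1%:M v = v.
Proof.
move: v; apply: (@e4_eq _ (@ext4_act K 1%:M) idfun) => I /=.
rewrite -bv_idx act_bv -[RHS](sum_delta_quad bv); apply: eq_bigr => g _.
by congr (_ *: _); apply: eq_bigr => b _; rewrite mxE.
Qed.

Lemma ext4_actK P (v : ext4 K) : P \in unitmx -> ext4_act (invmx P) (ext4_act P v) = v.
Proof. by move=> uP; rewrite -ext4_actM mulVmx // ext4_act1. Qed.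

End Alternating.

Ltac ext4ring := apply/ffunP => ?; rewrite ?(ext4D, ext4N, ext4Z, ext4_0); ring.

(** The Leibniz rule: one factor at a time is replaced by its image under [X]. *)
Definition dact (K : numFieldType) (X : 'M[K]_8) (f : quad) : ext4 K :=
  \sum_b \sum_i X i (f b) *: bv K (upd f b i).

(* The action of gl(8) on the fourth exterior power, twisted by half the trace so that
   scalar matrices act by zero. *)
HB.lock Definition lact (K : numFieldType) (X : 'M[K]_8) (v : ext4 K) : ext4 K :=
  \sum_I v I *: dact X (idx I) - (\tr X / 2%:R) *: v.

Definition cmx (K : numFieldType) (f : quad) : 'M[K]_(8, 4) :=
  \matrix_(i < 8, b < 4) (i == f b)%:R.

Definition cat8 (K : numFieldType) (c d : 'M[K]_(8, 4)) : 'M[K]_8 := row_mx c d.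
Definition lsh (b : 'I_4) : 'I_8 := lshift 4 b.
Definition rsh (b : 'I_4) : 'I_8 := @rshift 4 4 b.

(** The Levi-Civita symbol of the eight indices, written as a determinant so that its variation in
    one column is a cofactor. *)
HB.lock Definition eps8 (K : numFieldType) (f g : quad) : K :=
  \det (cat8 (cmx K f) (cmx K g)).

(* The coefficient of v /\ w on e_1 /\ ... /\ e_8. *)
HB.lock Definition wedge (K : numFieldType) (v w : ext4 K) : K :=
  \sum_I \sum_J v I * w J * eps8 K (idx I) (idx J).

(* The invariant bilinear map to gl(8) determined by
   tr (moment v w *m Y) = - wedge v (lact Y w). *)
HB.lock Definition moment (K : numFieldType) (v w : ext4 K) : 'M[K]_8 :=
  \matrix_(i, j) - wedge v (lact (delta_mx j i) w).

Lemma upd_same f b i : upd f b i b = i. Proof. by rewrite ffunE eqxx. Qed.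
Lemma upd_other f b i k : k != b -> upd f b i k = f k.
Proof. by move=> /negbTE e; rewrite ffunE e. Qed.
Lemma upd_id f b : upd f b (f b) = f.
Proof. by apply/ffunP => k; rewrite ffunE; case: eqP => [->|]. Qed.
Lemma upd_upd f b i j : upd (upd f b i) b j = upd f b j.
Proof. by apply/ffunP => k; rewrite !ffunE; case: eqP. Qed.
Lemma upd_comm f b b' i j : b != b' -> upd (upd f b i) b' j = upd (upd f b' j) b i.
Proof.
move=> bb; apply/ffunP => k; rewrite !ffunE; case: eqP => // ->.
by rewrite eq_sym (negbTE bb).
Qed.

Lemma upd_qperm f s b i : upd (qperm f s) b i = qperm (upd f (s b) i) s.
Proof. by apply/ffunP => k; rewrite !ffunE (inj_eq (@perm_inj _ s)). Qed.

Section Model.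
Variable K : numFieldType.
Implicit Types (v w u : ext4 K) (X Y : 'M[K]_8).
Local Notation bv := (bv K).
Local Notation eps8 := (eps8 K).
Local Notation cmx := (cmx K).

Lemma dact_alternating (X : 'M[K]_8) : alternating (dact X).
Proof.
move=> f s; rewrite /dact scaler_sumr (reindex_inj (@perm_inj _ s^-1%g)) /=.
apply: eq_bigr => b _; rewrite scaler_sumr; apply: eq_bigr => i _.
by rewrite ffunE permKV upd_qperm permKV bv_alternating !scalerA mulrC.
Qed.

Fact lact_is_linear (X : 'M[K]_8) : linear (lact X).
Proof.
move=> a u v; rewrite lact.unlock scalerBr addrACA; congr (_ + _); last first.
  by rewrite scalerDr opprD !scalerA mulrC.
rewrite scaler_sumr -big_split; apply: eq_bigr => I _ /=.
by rewrite ext4D ext4Z scalerDl scalerA.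
Qed.
HB.instance Definition _ X :=
  GRing.isLinear.Build K (ext4 K) (ext4 K) _ (@lact K X) (lact_is_linear X).

Lemma lactE X v : lact X v = \sum_I v I *: dact X (idx I) - (\tr X / 2%:R) *: v.
Proof. by rewrite lact.unlock. Qed.

Lemma lact_bv (X : 'M[K]_8) f : lact X (bv f) = dact X f - (\tr X / 2%:R) *: bv f.
Proof.
move: f; apply: (linear_bvE (L := @lact K X)).
  move=> f s; rewrite scalerBr dact_alternating bv_alternating !scalerA.
  by rewrite [_ * (-1) ^+ _]mulrC.
move=> I /=; rewrite lactE bv_idx; congr (_ - _).
rewrite (bigD1 I) //= big1 => [|J JI].
  by rewrite e4E eqxx scale1r addr0.
by rewrite e4E (negbTE JI) scale0r.
Qed.

Lemma lact_linl a (X Y : 'M[K]_8) v : lact (a *: X + Y) v = a *: lact X v + lact Y v.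
Proof.
rewrite lact.unlock scalerBr addrACA; congr (_ + _); last first.
  by rewrite mxtraceD mxtraceZ; ext4ring.
rewrite scaler_sumr -big_split; apply: eq_bigr => I _ /=.
rewrite scalerA mulrC -scalerA -scalerDr; congr (_ *: _).
rewrite /dact scaler_sumr -big_split; apply: eq_bigr => b _ /=.
rewrite scaler_sumr -big_split; apply: eq_bigr => i _ /=.
by rewrite !mxE scalerA -scalerDl.
Qed.

Definition lactl (v : ext4 K) (X : 'M[K]_8) : ext4 K := lact X v.
Fact lactl_is_linear v : linear (lactl v). Proof. by move=> a X Y; apply: lact_linl. Qed.
HB.instance Definition _ v :=
  GRing.isLinear.Build K 'M[K]_8 (ext4 K) _ (lactl v) (lactl_is_linear v).

Lemma lactDl (X Y : 'M[K]_8) v : lact (X + Y) v = lact X v + lact Y v.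
Proof. exact: (linearD (lactl v)). Qed.
Lemma lactBl (X Y : 'M[K]_8) v : lact (X - Y) v = lact X v - lact Y v.
Proof. exact: (linearB (lactl v)). Qed.
Lemma lactNl (X : 'M[K]_8) v : lact (- X) v = - lact X v.
Proof. exact: (linearN (lactl v)). Qed.
Lemma lactZl a (X : 'M[K]_8) v : lact (a *: X) v = a *: lact X v.
Proof. exact: (linearZZ (lactl v)). Qed.
Lemma lact0l v : lact (0 : 'M[K]_8) v = 0.
Proof. exact: (linear0 (lactl v)). Qed.
Lemma lact_suml (T : Type) (r : seq T) (P : pred T) (F : T -> 'M[K]_8) v :
  lact (\sum_(t <- r | P t) F t) v = \sum_(t <- r | P t) lact (F t) v.
Proof. exact: (linear_sum (lactl v)). Qed.

Lemma lactDr X v w : lact X (v + w) = lact X v + lact X w.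
Proof. exact: (linearD (@lact K X)). Qed.
Lemma lactBr X v w : lact X (v - w) = lact X v - lact X w.
Proof. exact: (linearB (@lact K X)). Qed.
Lemma lactNr X v : lact X (- v) = - lact X v.
Proof. exact: (linearN (@lact K X)). Qed.
Lemma lactZr a X v : lact X (a *: v) = a *: lact X v.
Proof. exact: (linearZZ (@lact K X)). Qed.
Lemma lact0r X : lact X 0 = 0.
Proof. exact: (linear0 (@lact K X)). Qed.
Lemma lact_sumr (T : Type) (r : seq T) (P : pred T) X (F : T -> ext4 K) :
  lact X (\sum_(t <- r | P t) F t) = \sum_(t <- r | P t) lact X (F t).
Proof. exact: (linear_sum (@lact K X)). Qed.

Lemma bv_eq (V : lmodType K) (f g : {linear ext4 K -> V}) :
  (forall h, f (bv h) = g (bv h)) -> forall v, f v = g v.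
Proof. by move=> fg; apply: e4_eq => I; rewrite -bv_idx. Qed.

(** The last sum, over two distinct positions, is symmetric in [X] and [Y] once the positions are
    exchanged, so it drops out of the commutator in [lact_rep]. *)
Lemma dactM (X Y : 'M[K]_8) (f : quad) :
  \sum_b \sum_i Y i (f b) *: dact X (upd f b i) =
  dact (X *m Y) f + \sum_b \sum_(b' | b' != b) \sum_i \sum_j
     (Y i (f b) * X j (f b')) *: bv (upd (upd f b i) b' j).
Proof.
rewrite /dact -big_split; apply: eq_bigr => b _ /=.
under eq_bigr => i _ do rewrite scaler_sumr (bigD1 b) //=.
rewrite big_split /=; congr (_ + _).
  transitivity (\sum_(i < 8) \sum_(j < 8) (X j i * Y i (f b)) *: bv (upd f b j)).
    apply: eq_bigr => i _; rewrite scaler_sumr; apply: eq_bigr => j _.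
    by rewrite upd_same upd_upd scalerA mulrC.
  by rewrite exchange_big; apply: eq_bigr => j _; rewrite mxE scaler_suml.
rewrite exchange_big; apply: eq_bigr => b' bb; apply: eq_bigr => i _.
by rewrite scaler_sumr; apply: eq_bigr => j _; rewrite upd_other // scalerA.
Qed.

Lemma lact_rep (X Y : 'M[K]_8) v :
  lact (X *m Y - Y *m X) v = lact X (lact Y v) - lact Y (lact X v).
Proof.
move: v; apply: (@bv_eq _ (@lact K _) ((@lact K X \o @lact K Y) \- (@lact K Y \o @lact K X))) => f /=.
have e (A B : 'M[K]_8) : lact A (lact B (bv f)) = \sum_b \sum_i B i (f b) *: dact A (upd f b i)
     - (\tr A / 2%:R) *: dact B f - (\tr B / 2%:R) *: dact A f
     + (\tr A / 2%:R * (\tr B / 2%:R)) *: bv f.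
  have h : lact A (dact B f) = \sum_b \sum_i B i (f b) *: dact A (upd f b i) - (\tr A / 2%:R) *: dact B f.
    rewrite [in LHS]/dact linear_sum [in _ *: dact B f]/dact scaler_sumr -sumrB.
    apply: eq_bigr => b _; rewrite linear_sum scaler_sumr -sumrB; apply: eq_bigr => i _.
    by rewrite linearZ /= lact_bv scalerBr !scalerA [B _ _ * _]mulrC.
  by rewrite [lact B _]lact_bv linearB linearZ /= h lact_bv; ext4ring.
rewrite !e lact_bv linearB /= mxtrace_mulC subrr mul0r scale0r subr0.
rewrite !dactM.
set c1 := \sum_b _; set c2 := \sum_b _.
have <- : c1 = c2.
  rewrite /c1 /c2 pair_big_dep [RHS]pair_big_dep /=.
  rewrite (reindex (fun p : 'I_4 * 'I_4 => (p.2, p.1))) /=; last first.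
    by exists (fun p : 'I_4 * 'I_4 => (p.2, p.1)); case.
  apply: eq_big => [[a b] /=|[a b] /= ab]; first by rewrite eq_sym.
  rewrite exchange_big; apply: eq_bigr => i _; apply: eq_bigr => j _.
  by rewrite mulrC upd_comm // eq_sym.
have -> : dact (X *m Y - Y *m X) f = dact (X *m Y) f - dact (Y *m X) f.
  rewrite /dact -sumrB; apply: eq_bigr => b _; rewrite -sumrB; apply: eq_bigr => i _.
  by rewrite !mxE -scalerBl.
move: (dact (X *m Y) f) (dact (Y *m X) f) (dact X f) (dact Y f) c1 (\tr X / _) (\tr Y / _).
by move=> a b c d c1' t u; ext4ring.
Qed.

Lemma lact_diag (d : 'rV[K]_8) f :
  lact (diag_mx d) (bv f) = (\sum_b d 0 (f b) - (\sum_i d 0 i) / 2%:R) *: bv f.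
Proof.
rewrite lact_bv scalerBl; congr (_ - _ *: _).
  rewrite /dact scaler_suml; apply: eq_bigr => b _; rewrite (bigD1 (f b)) //= big1.
    by rewrite mxE eqxx upd_id addr0.
  by move=> i /negbTE ib; rewrite mxE ib scale0r.
by congr (_ / _); apply: eq_bigr => i _; rewrite mxE eqxx.
Qed.

Lemma dact_delta i j f : dact (delta_mx i j : 'M[K]_8) f = \sum_(b | f b == j) bv (upd f b i).
Proof.
rewrite /dact [RHS]big_mkcond; apply: eq_bigr => b _ /=.
rewrite (bigD1 i) //= big1 => [|k /negbTE ki]; last by rewrite mxE ki scale0r.
by rewrite mxE eqxx addr0; case: eqP => _ /=; rewrite ?scale1r ?scale0r.
Qed.

Lemma tr_delta (i j : 'I_8) : \tr (delta_mx i j : 'M[K]_8) = (i == j)%:R.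
Proof.
rewrite /mxtrace; have [->|/eqP/negbTE ij] := i =P j.
  rewrite (bigD1 j) //= big1 => [|k /negbTE kj]; last by rewrite mxE kj.
  by rewrite mxE eqxx addr0.
by rewrite big1 // => k _; rewrite mxE; case: (k =P i) => // ->; rewrite ij.
Qed.

Lemma lact_delta i j f : i != j ->
  lact (delta_mx i j : 'M[K]_8) (bv f) = \sum_(b | f b == j) bv (upd f b i).
Proof.
by move=> /negbTE ij; rewrite lact_bv dact_delta tr_delta ij mul0r scale0r subr0.
Qed.

Lemma lact_delta1 i b (f : quad) : injective f -> i != f b ->
  lact (delta_mx i (f b) : 'M[K]_8) (bv f) = bv (upd f b i).
Proof.
move=> fi ib; rewrite lact_delta // (big_pred1 b) // => k.
by rewrite /= (inj_eq fi).
Qed.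

Lemma lact_delta0 i j (f : quad) : i != j -> (forall b, f b != j) ->
  lact (delta_mx i j : 'M[K]_8) (bv f) = 0.
Proof. by move=> ij h; rewrite lact_delta // big1 // => b; rewrite (negbTE (h b)). Qed.

(** There is no term in t^2 because a basis four-vector contains e_j at most once. Transvections
    thus connect the group action with [lact] without any limit process. *)
Lemma act_transvection i j t v : i != j ->
  ext4_act (1%:M + t *: delta_mx i j) v = v + t *: lact (delta_mx i j : 'M[K]_8) v.
Proof.
move=> ij; move: v; apply: (@e4_eq _ _ (@ext4_act K _) (idfun \+ (t \*: @lact K (delta_mx i j)))) => I /=.
rewrite -bv_idx act_bv // lact_delta //; set f := idx I.
have fi : injective f := @idx_inj I.
have [[b0 /eqP fb]|nj] := altP (@existsP _ (fun b => f b == j)); last first.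
  have -> : \sum_(b | f b == j) bv (upd f b i) = 0.
    by apply: big_pred0 => b; apply/negbTE; apply: contra nj => h; apply/existsP; exists b.
  rewrite scaler0 addr0.
  rewrite -[RHS](sum_delta_quad bv); apply: eq_bigr => g _; congr (_ *: _).
  apply: eq_bigr => b _; rewrite !mxE; case: (f b =P j) => [e|_]; last by rewrite andbF mulr0 addr0.
  by case/negP: nj; apply/existsP; exists b; rewrite e.
rewrite (big_pred1 b0) => [|b]; last by rewrite /= -fb (inj_eq fi).
rewrite -[in RHS](sum_delta_quad bv) -(sum_delta1_quad bv) scaler_sumr -big_split.
apply: eq_bigr => g _ /=; rewrite scalerA -scalerDl; congr (_ *: _).
rewrite (bigD1 b0) //= [in RHS](bigD1 b0) //= !mxE fb eqxx andbT mulrA -mulrDl.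
congr (_ * _); apply: eq_bigr => b bb; rewrite !mxE -fb (inj_eq fi) (negbTE bb) andbF.
by rewrite mulr0 addr0.
Qed.

Lemma prod_ord8 (F : 'I_8 -> K) : \prod_i F i = \prod_b F (lsh b) * \prod_b F (rsh b).
Proof. exact: (@big_split_ord _ _ _ 4 4). Qed.
Lemma sum_ord8 (V : nmodType) (F : 'I_8 -> V) : \sum_i F i = \sum_b F (lsh b) + \sum_b F (rsh b).
Proof. exact: (@big_split_ord _ _ _ 4 4). Qed.

Lemma cat8l (c d : 'M[K]_(8, 4)) i b : cat8 c d i (lsh b) = c i b.
Proof. exact: row_mxEl. Qed.
Lemma cat8r (c d : 'M[K]_(8, 4)) i b : cat8 c d i (rsh b) = d i b.
Proof. exact: row_mxEr. Qed.

Lemma det_cat8 (c d : 'M[K]_(8, 4)) : \det (cat8 c d) = \sum_(s : 'S_8) (-1) ^+ odd_perm s *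
    (\prod_b c (s (lsh b)) b * \prod_b d (s (rsh b)) b).
Proof.
rewrite -det_tr /determinant; apply: eq_bigr => s _; congr (_ * _).
by rewrite prod_ord8; congr (_ * _); apply: eq_bigr => b _; rewrite mxE (cat8l, cat8r).
Qed.

Lemma sum_delta_quadr (F : quad -> K) (f : quad) :
  \sum_(g : quad) (\prod_b (g b == f b)%:R : K) * F g = F f.
Proof. exact: (sum_delta_quad (V := K^o)). Qed.

Lemma det_cat8l (c d : 'M[K]_(8, 4)) :
  \sum_(f : quad) (\prod_b c (f b) b) * \det (cat8 (cmx f) d) = \det (cat8 c d).
Proof.
rewrite det_cat8; under eq_bigr => f _ do rewrite det_cat8 mulr_sumr.
rewrite exchange_big; apply: eq_bigr => s _ /=.
pose h : quad := [ffun b => s (lsh b)].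
have E := sum_delta_quadr (fun f => \prod_b c (f b) b) h.
rewrite (_ : \prod_b c (s (lsh b)) b = \prod_b c (h b) b); last first.
  by apply: eq_bigr => b _; rewrite ffunE.
rewrite -E mulr_suml mulr_sumr; apply: eq_bigr => f _ /=.
rewrite (_ : \prod_b (cmx f) _ _ = \prod_b (f b == h b)%:R); last first.
  by apply: eq_bigr => b _; rewrite !mxE ffunE eq_sym.
by rewrite mulrCA; congr (_ * _); rewrite mulrCA mulrA.
Qed.

Lemma det_cat8r (c d : 'M[K]_(8, 4)) :
  \sum_(f : quad) (\prod_b d (f b) b) * \det (cat8 c (cmx f)) = \det (cat8 c d).
Proof.
rewrite det_cat8; under eq_bigr => f _ do rewrite det_cat8 mulr_sumr.
rewrite exchange_big; apply: eq_bigr => s _ /=.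
pose h : quad := [ffun b => s (rsh b)].
have E := sum_delta_quadr (fun f => \prod_b d (f b) b) h.
rewrite (_ : \prod_b d (s (rsh b)) b = \prod_b d (h b) b); last first.
  by apply: eq_bigr => b _; rewrite ffunE.
rewrite -E !mulr_sumr; apply: eq_bigr => f _ /=.
rewrite (_ : \prod_b (cmx f) _ _ = \prod_b (f b == h b)%:R); last first.
  by apply: eq_bigr => b _; rewrite !mxE ffunE eq_sym.
by rewrite mulrCA; congr (_ * _); rewrite mulrCA [X in _ * X = _]mulrC.
Qed.

(** The swap is a product of block transvections and the negation of four columns, so the sign is
    (-1)^4. *)
Lemma swap4_det : \det (block_mx 0 1%:M 1%:M 0 : 'M[K]_(4 + 4)) = 1.
Proof.
have -> : block_mx 0 1%:M 1%:M 0 = block_mx 1%:M 1%:M 0 1%:M *m block_mx 1%:M 0 (- 1%:M) 1%:M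
   *m block_mx 1%:M 1%:M 0 1%:M *m block_mx (- 1%:M) 0 0 1%:M :> 'M[K]_(4 + 4).
  rewrite !mulmx_block !(mulmx1, mul1mx, mulmx0, mul0mx, addr0, add0r, mulNmx, mulmxN, opprK).
  by rewrite subrr addNr add0r oppr0.
rewrite !det_mulmx !det_ublock det_lblock !det1 -scaleN1r detZ det1.
by rewrite !mulr1 exprS; ring.
Qed.

Lemma det_cat8C (c d : 'M[K]_(8, 4)) : \det (cat8 c d) = \det (cat8 d c).
Proof.
have -> : cat8 d c = cat8 c d *m (block_mx 0 1%:M 1%:M 0 : 'M_(4 + 4)).
  have := mul_row_block c d (0 : 'M_4) 1%:M 1%:M (0 : 'M_4).
  by rewrite !(mulmx1, mulmx0, addr0, add0r).
by rewrite det_mulmx swap4_det mulr1.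
Qed.

Lemma eps8C f g : eps8 f g = eps8 g f.
Proof. by rewrite eps8.unlock det_cat8C. Qed.

Lemma eps8_alternating g : alternating (V := K^o) (fun f => eps8 f g).
Proof.
move=> f s; rewrite eps8.unlock.
have -> : cat8 (cmx (qperm f s)) (cmx g) =
    cat8 (cmx f) (cmx g) *m (block_mx (perm_mx s^-1%g) 0 0 1%:M : 'M_(4 + 4)).
  have := mul_row_block (cmx f) (cmx g) (perm_mx s^-1%g : 'M_4) 0 0 (1%:M : 'M_4).
  rewrite !(mulmx1, mulmx0, addr0, add0r) => h; apply: etrans (esym h).
  congr row_mx; rewrite -col_permE; apply/matrixP => i b.
  by rewrite !mxE ffunE.
rewrite det_mulmx mulrC; congr (_ * _).
have := det_ublock (perm_mx s^-1%g : 'M[K]_4) 0 (1%:M : 'M[K]_4).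
by rewrite det1 mulr1 det_perm odd_permV.
Qed.

Lemma eps8_cofactor_l (f g : quad) b i :
  eps8 (upd f b i) g = cofactor (cat8 (cmx f) (cmx g)) i (lsh b).
Proof.
rewrite eps8.unlock (expand_det_col _ (lsh b)) (bigD1 i) //= big1 => [|k /negbTE ki]; last first.
  by rewrite cat8l mxE upd_same ki mul0r.
rewrite addr0 cat8l mxE upd_same eqxx mul1r; congr (_ * \det _).
apply/matrixP => k l; rewrite !mxE; case: splitP => m; rewrite !mxE // => e.
rewrite upd_other //; apply/eqP => mb.
have /negP := neq_lift (lsh b) l; apply; apply/eqP/val_inj.
by rewrite [RHS]e mb.
Qed.

Lemma eps8_cofactor_r (f g : quad) b i :
  eps8 f (upd g b i) = cofactor (cat8 (cmx f) (cmx g)) i (rsh b).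
Proof.
rewrite eps8.unlock (expand_det_col _ (rsh b)) (bigD1 i) //= big1 => [|k /negbTE ki]; last first.
  by rewrite cat8r mxE upd_same ki mul0r.
rewrite addr0 cat8r mxE upd_same eqxx mul1r; congr (_ * \det _).
apply/matrixP => k l; rewrite !mxE; case: splitP => m; rewrite !mxE // => e.
rewrite upd_other //; apply/eqP => mb.
have /negP := neq_lift (rsh b) l; apply; apply/eqP/val_inj.
by rewrite [RHS]e mb.
Qed.

(** The left side is the derivative in the direction [X] of the determinant M of the eight columns,
    taken column by column through cofactors; it equals the trace of X M adj M. *)
Lemma eps8_tr (X : 'M[K]_8) (f g : quad) :
  \sum_b \sum_i X i (f b) * eps8 (upd f b i) g + \sum_b \sum_i X i (g b) * eps8 f (upd g b i)
  = \tr X * eps8 f g.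
Proof.
set M := cat8 (cmx f) (cmx g).
have -> : \tr X * eps8 f g = \tr (X *m M *m \adj M).
  by rewrite eps8.unlock -mulmxA mul_mx_adj mul_mx_scalar mxtraceZ mulrC.
rewrite mxtrace_mulC /mxtrace sum_ord8.
have XM i b h (k : 'I_8) : (forall j, M j k = (j == h b)%:R) -> (X *m M) i k = X i (h b).
  move=> Mk; rewrite mxE (bigD1 (h b)) //= big1 => [|j /negbTE jh]; last by rewrite Mk jh mulr0.
  by rewrite Mk eqxx mulr1 addr0.
congr (_ + _); apply: eq_bigr => b _; rewrite mxE; apply: eq_bigr => i _.
  rewrite (XM _ i b f) => [|j]; last by rewrite cat8l mxE.
  by rewrite eps8_cofactor_l [in RHS]mxE mulrC.
rewrite (XM _ i b g) => [|j]; last by rewrite cat8r mxE.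
by rewrite eps8_cofactor_r [in RHS]mxE mulrC.
Qed.

Lemma regE (a : K) (b : K^o) : a *: b = a * b. Proof. by []. Qed.

Fact wedge_is_linear (v : ext4 K) : linear (wedge v : ext4 K -> K^o).
Proof.
move=> a u w; rewrite wedge.unlock scaler_sumr -big_split; apply: eq_bigr => I _ /=.
rewrite scaler_sumr -big_split; apply: eq_bigr => J _ /=.
by rewrite ext4D ext4Z regE; ring.
Qed.
HB.instance Definition _ v :=
  GRing.isLinear.Build K (ext4 K) K^o _ (@wedge K v) (wedge_is_linear v).

Lemma wedgeC (v w : ext4 K) : wedge v w = wedge w v.
Proof.
rewrite wedge.unlock exchange_big; apply: eq_bigr => I _; apply: eq_bigr => J _.
by rewrite eps8C [v _ * _]mulrC.
Qed.

Lemma wedgeDr (u v w : ext4 K) : wedge u (v + w) = wedge u v + wedge u w.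
Proof. exact: (linearD (@wedge K u)). Qed.
Lemma wedgeNr (u v : ext4 K) : wedge u (- v) = - wedge u v.
Proof. exact: (linearN (@wedge K u)). Qed.
Lemma wedgeBr (u v w : ext4 K) : wedge u (v - w) = wedge u v - wedge u w.
Proof. exact: (linearB (@wedge K u)). Qed.
Lemma wedgeZr a (u v : ext4 K) : wedge u (a *: v) = a * wedge u v.
Proof. exact: (linearZZ (@wedge K u : {linear ext4 K -> K^o})). Qed.
Lemma wedge0r (u : ext4 K) : wedge u 0 = 0.
Proof. exact: (linear0 (@wedge K u)). Qed.
Lemma wedge_sumr (T : Type) (r : seq T) (P : pred T) (F : T -> ext4 K) u :
  wedge u (\sum_(t <- r | P t) F t) = \sum_(t <- r | P t) wedge u (F t).
Proof. exact: (linear_sum (@wedge K u)). Qed.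
Lemma wedgeDl (u v w : ext4 K) : wedge (u + v) w = wedge u w + wedge v w.
Proof. by rewrite !(wedgeC _ w) wedgeDr. Qed.
Lemma wedgeNl (u v : ext4 K) : wedge (- u) v = - wedge u v.
Proof. by rewrite !(wedgeC _ v) wedgeNr. Qed.
Lemma wedgeBl (u v w : ext4 K) : wedge (u - v) w = wedge u w - wedge v w.
Proof. by rewrite !(wedgeC _ w) wedgeBr. Qed.
Lemma wedgeZl a (u v : ext4 K) : wedge (a *: u) v = a * wedge u v.
Proof. by rewrite !(wedgeC _ v) wedgeZr. Qed.
Lemma wedge0l (u : ext4 K) : wedge 0 u = 0.
Proof. by rewrite wedgeC wedge0r. Qed.
Lemma wedge_suml (T : Type) (r : seq T) (P : pred T) (F : T -> ext4 K) u :
  wedge (\sum_(t <- r | P t) F t) u = \sum_(t <- r | P t) wedge (F t) u.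
Proof. by rewrite wedgeC wedge_sumr; apply: eq_bigr => t _; rewrite wedgeC. Qed.

Lemma wedge_e4 I J : wedge (e4 K I) (e4 K J) = eps8 (idx I) (idx J).
Proof.
rewrite wedge.unlock (bigD1 I) //=; rewrite [X in _ + X]big1 => [|I' n]; last first.
  by rewrite big1 // => J' _; rewrite [e4 K I I']e4E (negbTE n) !mul0r.
rewrite addr0 (bigD1 J) //=; rewrite [X in _ + X]big1 => [|J' n]; last first.
  by rewrite [e4 K J J']e4E (negbTE n) mulr0 mul0r.
by rewrite addr0 [e4 K I I]e4E [e4 K J J]e4E !eqxx !mul1r.
Qed.

Lemma wedge_bv f g : wedge (bv f) (bv g) = eps8 f g.
Proof.
have h I : wedge (e4 K I) (bv g) = eps8 (idx I) g.
  move: g; apply: (linear_bvE (V := K^o) (L := @wedge K (e4 K I) : {linear ext4 K -> K^o})).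
    by move=> g s; rewrite eps8C eps8_alternating eps8C.
  exact: wedge_e4.
rewrite wedgeC.
move: f; apply: (linear_bvE (V := K^o) (L := @wedge K (bv g) : {linear ext4 K -> K^o})).
  exact: eps8_alternating.
by move=> I /=; rewrite wedgeC h.
Qed.

Lemma wedge_dact (X : 'M[K]_8) f g :
  wedge (dact X f) (bv g) + wedge (bv f) (dact X g) = \tr X * wedge (bv f) (bv g).
Proof.
rewrite wedge_bv -eps8_tr /dact wedge_suml wedge_sumr; congr (_ + _); apply: eq_bigr => b _.
  by rewrite wedge_suml; apply: eq_bigr => i _; rewrite wedgeZl wedge_bv.
by rewrite wedge_sumr; apply: eq_bigr => i _; rewrite wedgeZr wedge_bv.
Qed.

(** The untwisted derivation multiplies the volume form by [\tr X]; [lact] subtracts half of this on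
    each of the two factors, which is the purpose of the twist. *)
Lemma wedge_lact (X : 'M[K]_8) v w : wedge (lact X v) w = - wedge v (lact X w).
Proof.
have h f g : wedge (lact X (bv f)) (bv g) = - wedge (bv f) (lact X (bv g)).
  rewrite !lact_bv !(wedgeBl, wedgeBr, wedgeZl, wedgeZr).
  have := wedge_dact X f g; set a := wedge _ _; set b := wedge _ _; set c := wedge _ _.
  have E (a' b' c' t : K) : a' + b' = t * c' -> a' - t / 2%:R * c' = - (b' - t / 2%:R * c').
    by move=> e; have -> : a' = t * c' - b' by [rewrite -e addrK]; rewrite {1}(splitr t); ring.
  exact: E.
rewrite (ext4E v) (ext4E w) !(linear_sum (@lact K X)) /= !wedge_suml -sumrN.
apply: eq_bigr => I _; rewrite !wedge_sumr -sumrN; apply: eq_bigr => J _.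
by rewrite !lactZr !(wedgeZl, wedgeZr) -!bv_idx h !mulrN mulrCA.
Qed.

Definition compl4_proof (I : sub4) : #|~: val I| == 4%N.
Proof. by rewrite cardsCs setCK (eqP (valP I)) card_ord. Qed.
Definition compl4 (I : sub4) : sub4 := Sub (~: val I) (compl4_proof I).

Lemma compl4K : involutive compl4.
Proof. by move=> I; apply: val_inj; rewrite /= setCK. Qed.

Lemma eps8_share (f g : quad) b c : f b = g c -> eps8 f g = 0.
Proof.
move=> e; rewrite eps8.unlock -det_tr.
apply: (@determinant_alternate _ _ _ (lsh b) (rsh c)).
  by apply/eqP => h; have := ltn_ord b; rewrite -[val b]/(val (lsh b)) h /= ltnNge leq_addr.
by move=> i; rewrite ![_^T _ _]mxE cat8l cat8r !mxE e.
Qed.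

Lemma wedge_e4_neq I J : J != compl4 I -> wedge (e4 K I) (e4 K J) = 0.
Proof.
move=> ne; have /subsetPn[i iI] : ~~ (val I \subset ~: val J).
  apply: contra ne => s; rewrite -(compl4K J) (inj_eq (can_inj compl4K)) eq_sym.
  by rewrite -val_eqE eqEcard s (eqP (valP I)) (eqP (valP (compl4 J))).
rewrite inE negbK => iJ.
have [b ib] := idxP iI; have [c ic] := idxP iJ.
by rewrite wedge_e4 (eps8_share (b := b) (c := c)) // -ib -ic.
Qed.

Definition sg4 I : K := wedge (e4 K I) (e4 K (compl4 I)).

Lemma sg4_sqr I : sg4 I ^+ 2 = 1.
Proof.
rewrite /sg4 wedge_e4 eps8.unlock; set M := cat8 _ _.
rewrite expr2 -{1}det_tr -det_mulmx.
suff -> : M^T *m M = 1%:M by rewrite det1.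
pose h (k : 'I_(4 + 4)) := match split k with inl b => idx I b | inr c => idx (compl4 I) c end.
have ME i k : M i k = (i == h k)%:R.
  by rewrite /M /cat8 /h mxE; case: split => b; rewrite mxE.
have hi : injective h.
  move=> k l; rewrite /h; case: (splitP k) => a ka; case: (splitP l) => b lb e; apply: val_inj => /=.
  - by rewrite ka lb (idx_inj e).
  - by have := mem_idx I a; rewrite e => m; have := mem_idx (compl4 I) b; rewrite inE m.
  - by have := mem_idx I b; rewrite -e => m; have := mem_idx (compl4 I) a; rewrite inE m.
  - by rewrite ka lb (idx_inj e).
apply/matrixP => k l; rewrite !mxE (bigD1 (h k)) //= big1 => [|i ik]; last first.
  by rewrite mxE ME (negbTE ik) mul0r.
by rewrite mxE !ME eqxx mul1r addr0 (inj_eq hi).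
Qed.

Lemma sg4_neq0 I : sg4 I != 0.
Proof.
by apply/eqP => e; have := sg4_sqr I; rewrite e expr0n /= => /eqP; rewrite eq_sym oner_eq0.
Qed.

Lemma sg4C I : sg4 (compl4 I) = sg4 I.
Proof. by rewrite /sg4 compl4K; apply: wedgeC. Qed.

Lemma wedgeE v w : wedge v w = \sum_I v I * w (compl4 I) * sg4 I.
Proof.
rewrite {1}(ext4E v) wedge_suml; apply: eq_bigr => I _.
rewrite wedgeZl {1}(ext4E w) wedge_sumr (bigD1 (compl4 I)) //= big1 => [|J n].
  by rewrite addr0 wedgeZr mulrA.
by rewrite wedgeZr wedge_e4_neq ?mulr0.
Qed.

Lemma wedge_e4r v I : wedge v (e4 K I) = v (compl4 I) * sg4 I.
Proof.
rewrite wedgeE (bigD1 (compl4 I)) //= big1 => [|J n].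
  by rewrite addr0 compl4K e4E eqxx mulr1 sg4C.
rewrite [X in _ * X * _]e4E -(inj_eq (can_inj compl4K)) compl4K (negbTE n).
by rewrite mulr0 mul0r.
Qed.

Lemma wedge_nondeg v : (forall w, wedge v w = 0) -> v = 0.
Proof.
move=> h; apply/ffunP => I; rewrite ext4_0; have := h (e4 K (compl4 I)).
rewrite wedge_e4r compl4K sg4C => /eqP; rewrite mulf_eq0 (negbTE (sg4_neq0 I)) orbF.
by move/eqP.
Qed.

Lemma moment_entry v w i j : moment v w i j = - wedge v (lact (delta_mx j i) w).
Proof. by rewrite moment.unlock mxE. Qed.

Lemma tr_moment v w (Y : 'M[K]_8) : \tr (moment v w *m Y) = - wedge v (lact Y w).
Proof.
rewrite {2}(matrix_sum_delta Y) lact_suml wedge_sumr -sumrN.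
rewrite /mxtrace (eq_bigr (fun i => \sum_j moment v w i j * Y j i)) => [|i _]; last by rewrite mxE.
rewrite exchange_big; apply: eq_bigr => j _ /=.
rewrite lact_suml wedge_sumr -sumrN; apply: eq_bigr => i _.
by rewrite lactZl wedgeZr moment_entry mulNr mulrC.
Qed.

Lemma tr_nondeg n (X : 'M[K]_n) : (forall Y : 'M[K]_n, \tr (X *m Y) = 0) -> X = 0.
Proof.
move=> h; apply/matrixP => i j; rewrite mxE -(h (delta_mx j i)).
rewrite /mxtrace (bigD1 i) //= big1 => [|k ki].
  rewrite mxE (bigD1 j) //= big1 => [|l lj]; first by rewrite mxE !eqxx mulr1 !addr0.
  by rewrite mxE (negbTE lj) mulr0.
by rewrite mxE big1 // => l _; rewrite mxE (negbTE ki) andbF mulr0.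
Qed.

Lemma moment_eqP v w (X : 'M[K]_8) :
  (forall Y, \tr (X *m Y) = - wedge v (lact Y w)) -> moment v w = X.
Proof.
move=> h; apply/eqP; rewrite -subr_eq0; apply/eqP/tr_nondeg => Y.
by rewrite mulmxBl linearB /= tr_moment h subrr.
Qed.

Lemma momentC v w : moment v w = - moment w v.
Proof.
apply: moment_eqP => Y.
by rewrite mulNmx linearN /= tr_moment opprK -wedge_lact wedgeC.
Qed.

Fact moment_is_linear v : linear (moment v).
Proof.
move=> a u w; apply: moment_eqP => Y.
by rewrite mulmxDl -scalemxAl linearD linearZ /= !tr_moment linearP wedgeDr wedgeZr opprD mulrN.
Qed.
HB.instance Definition _ v :=
  GRing.isLinear.Build K (ext4 K) 'M[K]_8 _ (@moment K v) (moment_is_linear v).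

Lemma momentDl u v w : moment (u + v) w = moment u w + moment v w.
Proof. by rewrite !(momentC _ w) linearD opprD. Qed.
Lemma momentNl u w : moment (- u) w = - moment u w.
Proof. by rewrite !(momentC _ w) linearN. Qed.
Lemma momentZl a u w : moment (a *: u) w = a *: moment u w.
Proof. by rewrite !(momentC _ w) linearZ scalerN. Qed.
Lemma moment0l w : moment 0 w = 0.
Proof. by rewrite momentC linear0 oppr0. Qed.
Lemma moment_same v : moment v v = 0.
Proof.
have /eqP := momentC v v; rewrite -addr_eq0 -mulr2n -scaler_nat scaler_eq0 pnatr_eq0.
by move/eqP.
Qed.

Lemma lact1 v : lact (1%:M : 'M[K]_8) v = 0.
Proof.
move: v; apply: (@bv_eq _ (@lact K 1%:M) \0) => f /=.
rewrite -diag_const_mx lact_diag; set a := _ - _; suff -> : a = 0 by rewrite scale0r.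
rewrite /a (eq_bigr (fun=> 1)) => [|b _]; last by rewrite mxE.
rewrite [X in _ - X / _](eq_bigr (fun=> 1)) => [|b _]; last by rewrite mxE.
by rewrite !sumr_const !card_ord; field.
Qed.

Lemma tr_moment0 v w : \tr (moment v w) = 0.
Proof. by rewrite -[moment v w]mulmx1 tr_moment lact1 wedge0r oppr0. Qed.

Lemma moment_lact (X : 'M[K]_8) v w :
  X *m moment v w - moment v w *m X = moment (lact X v) w + moment v (lact X w).
Proof.
apply/eqP; rewrite -subr_eq0; apply/eqP/tr_nondeg => Y.
rewrite !mulmxBl mulmxDl !(linearB, linearD) /= !tr_moment -!mulmxA mxtrace_mulC -mulmxA !tr_moment.
have := lact_rep X Y w; rewrite lactBl => e.
have -> : wedge (lact X v) (lact Y w) = - wedge v (lact (X *m Y) w - lact (Y *m X) w + lact Y (lact X w)).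
  by rewrite wedge_lact e subrK.
rewrite wedgeDr wedgeBr.
move: (wedge _ _) (wedge _ _) (wedge _ _) => a b c; ring.
Qed.

End Model.

Section Equivariance.
Variable K : numFieldType.
Implicit Types (v w u : ext4 K) (X Y P : 'M[K]_8).
Local Notation bv := (bv K).

Lemma dact_lact X f : dact X f = lact X (bv f) + (\tr X / 2%:R) *: bv f.
Proof. by rewrite lact_bv subrK. Qed.

Lemma swap_upd (f : quad) b b' : b' != b ->
  bv (upd (upd f b (f b')) b' (f b)) = - bv f.
Proof.
move=> bb; rewrite -scaleN1r -[-1]expr1.
have -> : upd (upd f b (f b')) b' (f b) = qperm f (tperm b b').
  apply/ffunP => k; rewrite !ffunE; case: tpermP => [->|->|/eqP/negbTE-> /eqP/negbTE->] //.
    by rewrite eq_sym (negbTE bb) eqxx.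
  by rewrite eqxx.
by rewrite bv_alternating odd_tperm eq_sym bb.
Qed.

Lemma sum_delta_mx_diag : \sum_i delta_mx i i = 1%:M :> 'M[K]_8.
Proof.
apply/matrixP => i j; rewrite summxE (bigD1 i) //= big1 => [|k ki].
  by rewrite !mxE eqxx addr0 eq_sym.
by rewrite mxE eq_sym (negbTE ki).
Qed.

Lemma sum_preimage (V : nmodType) (f : quad) (F : 'I_8 -> 'I_4 -> V) :
  \sum_j \sum_(b | f b == j) F j b = \sum_b F (f b) b.
Proof.
under eq_bigr => j _ do rewrite big_mkcond.
rewrite exchange_big; apply: eq_bigr => b _ /=.
rewrite (bigD1 (f b)) //= eqxx big1 ?addr0 // => j jb.
by rewrite eq_sym (negbTE jb).
Qed.

(** On the untwisted fourth exterior power the Casimir element of gl(8) is 4 (8 - 4 + 1) = 20; the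
    twist removes 4^2 / 8 = 2. *)
Lemma casimir v :
  \sum_i \sum_j lact (delta_mx j i) (lact (delta_mx i j) v) = 18%:R *: v.
Proof.
have lin : linear (fun v => \sum_i \sum_j lact (delta_mx j i : 'M[K]_8) (lact (delta_mx i j) v)).
  move=> a x y; rewrite scaler_sumr -big_split; apply: eq_bigr => i _ /=.
  rewrite scaler_sumr -big_split; apply: eq_bigr => j _ /=.
  by rewrite !(lactDr, lactZr).
pose L := GRing.isLinear.Build K (ext4 K) (ext4 K) _ _ lin.
pose L' : {linear ext4 K -> ext4 K} := HB.pack (fun v => \sum_i \sum_j lact (delta_mx j i : 'M[K]_8) (lact (delta_mx i j) v)) L.
move: v; apply: (@e4_eq _ _ L' (18%:R \*: idfun)) => I /=.
rewrite -bv_idx; set f := idx I.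
have e i j : lact (delta_mx j i : 'M[K]_8) (lact (delta_mx i j) (bv f)) =
   \sum_(b | f b == j) \sum_(b' | upd f b i b' == i) bv (upd (upd f b i) b' j)
   - (i == j)%:R *: (lact (delta_mx i j) (bv f) + (4%:R^-1 : K) *: bv f).
  rewrite [lact (delta_mx i j) _ in LHS]lact_bv lactBr lactZr tr_delta.
  have -> : lact (delta_mx j i) (dact (delta_mx i j) f) =
     \sum_(b | f b == j) \sum_(b' | upd f b i b' == i) bv (upd (upd f b i) b' j)
     - ((j == i)%:R / 2%:R) *: dact (delta_mx i j : 'M[K]_8) f.
    rewrite dact_delta lact_sumr scaler_sumr -sumrB; apply: eq_bigr => b _.
    by rewrite lact_bv dact_delta tr_delta.
  have [<-|ij] := eqVneq i j; last by rewrite !mul0r !scale0r !subr0.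
  rewrite dact_lact tr_delta ?eqxx scale1r.
  rewrite -!addrA (_ : true%:R = 1 :> K) //; congr (_ + _).
  move: (lact (delta_mx i i) (bv f)) (bv f) => b c.
  by apply/ffunP => J; rewrite ?(ext4D, ext4N, ext4Z); field.
under eq_bigr => i _ do under eq_bigr => j _ do rewrite e.
under eq_bigr => i _ do rewrite sumrB sum_preimage.
rewrite sumrB.
have -> : \sum_i \sum_j (i == j)%:R *: (lact (delta_mx i j) (bv f) + (4%:R^-1 : K) *: bv f)
   = (2%:R : K) *: bv f.
  transitivity (\sum_i (lact (delta_mx i i) (bv f) + (4%:R^-1 : K) *: bv f)).
    apply: eq_bigr => i _; rewrite (bigD1 i) //= big1 => [|j ji]; last first.
      by rewrite eq_sym (negbTE ji) scale0r.
    by rewrite eqxx scale1r addr0.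
  rewrite big_split /= -lact_suml sum_delta_mx_diag lact1 add0r sumr_const card_ord.
  by rewrite -scaler_nat scalerA; congr (_ *: _); field.
have -> : \sum_i \sum_b \sum_(b' | upd f b i b' == i) bv (upd (upd f b i) b' (f b)) =
   (20%:R : K) *: bv f.
  transitivity (\sum_(i < 8) \sum_(b < 4) (bv f + \sum_(b' | (b' != b) && (f b' == i)) bv (upd (upd f b i) b' (f b)))).
    apply: eq_bigr => i _; apply: eq_bigr => b _.
    rewrite (bigD1 b) /=; last by rewrite upd_same.
    rewrite upd_upd upd_id; congr (_ + _); apply: eq_bigl => b'.
    by rewrite andbC; case: (boolP (b' == b)) => //= bb; rewrite upd_other.
  rewrite exchange_big /=.
  under eq_bigr => b _.
    rewrite big_split /= sumr_const card_ord.
    rewrite (_ : \sum_i _ = \sum_(b' | b' != b) - bv f); last first.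
      under eq_bigr => i _ do rewrite big_mkcondl.
      under eq_bigr => i _ do rewrite (eq_bigl (fun b' => f b' == i)) //.
      rewrite (sum_preimage f (fun i b' => if b' != b then bv (upd (upd f b i) b' (f b)) else 0)).
      by rewrite -big_mkcond; apply: eq_bigr => b' bb; rewrite swap_upd.
    rewrite sumr_const cardC1 card_ord.
  over.
  by rewrite sumr_const card_ord /= mulNrn -mulrnBr // -mulrnA scaler_nat.
rewrite -scalerBl; congr (_ *: _); ring.
Qed.

Lemma act_dact P Y f :
  \sum_(g : quad) (\prod_k P (g k) (f k)) *: dact Y g =
  \sum_(b < 4) \sum_(g : quad) ((Y *m P) (g b) (f b) * \prod_(k | k != b) P (g k) (f k)) *: bv g.
Proof.
under eq_bigr => g _ do rewrite scaler_sumr.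
rewrite exchange_big; apply: eq_bigr => b _ /=.
transitivity (\sum_(g : quad) \sum_(i < 8) (Y i (g b) * P (g b) (f b) * \prod_(k | k != b) P (g k) (f k)) *: bv (upd g b i)).
  apply: eq_bigr => g _; rewrite scaler_sumr; apply: eq_bigr => i _.
  by rewrite scalerA (bigD1 b) //= mulrC mulrA.
transitivity (\sum_(g : quad) \sum_(i < 8) (Y (g b) i * P i (f b) * \prod_(k | k != b) P (g k) (f k)) *: bv g); last first.
  apply: eq_bigr => g _; rewrite -scaler_suml; congr (_ *: _).
  by rewrite mxE mulr_suml.
rewrite !pair_big /= (reindex (fun p : quad * 'I_8 => (upd p.1 b p.2, p.1 b))) /=; last first.
  by exists (fun p : quad * 'I_8 => (upd p.1 b p.2, p.1 b)); case=> g i _ /=;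
    rewrite upd_same upd_upd upd_id.
apply: eq_bigr => [[g i] _] /=; rewrite upd_same upd_upd upd_id; congr (_ * _ *: _).
by apply: eq_bigr => k kb; rewrite upd_other.
Qed.

Lemma act_dact2 P X f :
  ext4_act P (dact X f) =
  \sum_(b < 4) \sum_(g : quad) ((P *m X) (g b) (f b) * \prod_(k | k != b) P (g k) (f k)) *: bv g.
Proof.
rewrite linear_sum; apply: eq_bigr => b _ /=; rewrite linear_sum /=.
under eq_bigr => i _ do rewrite linearZ /= act_bv scaler_sumr.
rewrite exchange_big; apply: eq_bigr => g _ /=.
rewrite mxE mulr_suml scaler_suml; apply: eq_bigr => i _.
rewrite scalerA (bigD1 b) //= upd_same mulrCA mulrA; congr (_ * _ *: _).
by apply: eq_bigr => k kb; rewrite upd_other.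
Qed.

Lemma lact_act_comm P X Y v : P *m X = Y *m P -> \tr X = \tr Y ->
  ext4_act P (lact X v) = lact Y (ext4_act P v).
Proof.
move=> PX tXY; move: v.
apply: (@e4_eq _ _ (@ext4_act K P \o @lact K X) (@lact K Y \o @ext4_act K P)) => I /=.
rewrite -bv_idx lact_bv linearB linearZ /= act_dact2 PX -act_dact act_bv.
rewrite scaler_sumr -sumrB lact_sumr; apply: eq_bigr => g _.
by rewrite lactZr lact_bv scalerBr !scalerA tXY [X in _ - X *: _]mulrC.
Qed.

Lemma lact_act P X v : P \in unitmx ->
  ext4_act P (lact X v) = lact (P *m X *m invmx P) (ext4_act P v).
Proof.
move=> uP; apply: lact_act_comm; first by rewrite mulmxKV.
by rewrite mxtrace_mulC mulmxA mulVmx // mul1mx.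
Qed.

Lemma wedge_act P v w : wedge (ext4_act P v) (ext4_act P w) = \det P * wedge v w.
Proof.
have h f g : wedge (ext4_act P (bv f)) (ext4_act P (bv g)) = \det P * wedge (bv f) (bv g).
  rewrite !act_bv wedge_suml wedge_bv eps8.unlock.
  have -> : \det P * \det (cat8 (cmx K f) (cmx K g)) = \det (cat8 (P *m cmx K f) (P *m cmx K g)).
    by rewrite -det_mulmx; congr (\det _); apply: (@mul_mx_row _ 8 8 4 4).
  have PE (k : quad) i b : (P *m cmx K k) i b = P i (k b).
    rewrite mxE (bigD1 (k b)) //= big1 => [|j jb]; last by rewrite mxE (negbTE jb) mulr0.
    by rewrite mxE eqxx mulr1 addr0.
  rewrite -det_cat8l; apply: eq_bigr => f' _.
  rewrite wedgeZl wedge_sumr -det_cat8r; congr (_ * _); first by apply: eq_bigr => b _; rewrite PE.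
  apply: eq_bigr => g' _; rewrite wedgeZr wedge_bv eps8.unlock; congr (_ * _).
  by apply: eq_bigr => b _; rewrite PE.
rewrite (ext4E v) (ext4E w) !(linear_sum (@ext4_act K P)) /= !wedge_suml mulr_sumr.
apply: eq_bigr => I _; rewrite !wedge_sumr mulr_sumr.
apply: eq_bigr => J _; rewrite !(linearZZ (@ext4_act K P)) /= !(wedgeZl, wedgeZr) -!bv_idx h.
by rewrite [RHS]mulrCA; congr (_ * _); rewrite mulrCA.
Qed.

Lemma moment_act P v w : P \in unitmx ->
  moment (ext4_act P v) (ext4_act P w) = \det P *: (P *m moment v w *m invmx P).
Proof.
move=> uP; apply: moment_eqP => Y.
rewrite -scalemxAl mxtraceZ -!mulmxA mxtrace_mulC -!mulmxA tr_moment mulrN; congr (- _).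
rewrite -wedge_act lact_act //; congr (wedge _ (lact _ _)).
by rewrite !mulmxA mulmxV // mul1mx -mulmxA mulmxV // mulmx1.
Qed.

End Equivariance.

(** * Diagonalizable endomorphisms and Jordan decomposition *)

Section PolyEval.
Variables (K : fieldType) (V : vectType K).
Implicit Types (f g : 'End(V)) (p q : {poly K}) (x y : V).

Definition peval f p x : V := \sum_(i < size p) p`_i *: iter i f x.

Lemma peval_wide f p x n : (size p <= n)%N -> peval f p x = \sum_(i < n) p`_i *: iter i f x.
Proof.
move=> pn; rewrite /peval (big_ord_widen n (fun i => p`_i *: iter i f x)) // big_mkcond.
apply: eq_bigr => i _; case: ltnP => // /(nth_default 0) ->; by rewrite scale0r.
Qed.

Lemma iter_lin f i : linear (fun x => iter i f x).
Proof. by elim: i => [|i IH] a x y //=; rewrite IH linearP. Qed.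

Lemma peval_is_linear f p : linear (peval f p).
Proof.
move=> a x y; rewrite /peval scaler_sumr -big_split; apply: eq_bigr => i _ /=.
by rewrite iter_lin scalerDr !scalerA mulrC.
Qed.
HB.instance Definition _ f p :=
  GRing.isLinear.Build K V V _ (peval f p) (peval_is_linear f p).

Lemma pevalD f p q x : peval f (p + q) x = peval f p x + peval f q x.
Proof.
set n := maxn (size p) (size q).
rewrite (@peval_wide f (p + q) x n) ?size_polyD // (@peval_wide f p x n) ?leq_maxl //.
rewrite (@peval_wide f q x n) ?leq_maxr // -big_split; apply: eq_bigr => i _ /=.
by rewrite coefD scalerDl.
Qed.

Lemma pevalZ f a p x : peval f (a *: p) x = a *: peval f p x.
Proof.
rewrite (@peval_wide f _ x (size p)) ?size_scale_leq // scaler_sumr.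
by apply: eq_bigr => i _; rewrite coefZ scalerA.
Qed.

Lemma peval0 f x : peval f 0 x = 0.
Proof. by rewrite -(scale0r 0) pevalZ scale0r. Qed.

Lemma peval_sum f (T : Type) (r : seq T) (F : T -> {poly K}) x :
  peval f (\sum_(t <- r) F t) x = \sum_(t <- r) peval f (F t) x.
Proof.
by elim: r => [|t r IH]; rewrite ?big_nil ?peval0 // !big_cons pevalD IH.
Qed.

Lemma pevalC f c x : peval f c%:P x = c *: x.
Proof.
rewrite (@peval_wide f _ x 1) ?size_polyC ?leq_b1 //.
by rewrite big_ord_recl big_ord0 addr0 coefC.
Qed.

Lemma pevalMX f p x : peval f (p * 'X) x = peval f p (f x).
Proof.
rewrite (@peval_wide f _ x (size p).+1) ?(leq_trans (size_polyMleq _ _)) ?size_polyX ?addn2 //.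
rewrite big_ord_recl coefMX eqxx scale0r add0r /peval; apply: eq_bigr => i _.
by rewrite coefMX /= -iterSr.
Qed.

Lemma peval_comm f p x : peval f p (f x) = f (peval f p x).
Proof.
rewrite /peval linear_sum; apply: eq_bigr => i _; rewrite linearZ /=; congr (_ *: _).
by rewrite -iterSr.
Qed.

Lemma pevalM f p q x : peval f (p * q) x = peval f p (peval f q x).
Proof.
elim/poly_ind: q x => [|q c IH] x; first by rewrite mulr0 !peval0 linear0.
rewrite mulrDr mulrA !pevalD linearD /= !pevalMX IH mulrC mul_polyC pevalZ pevalC.
by rewrite linearZ.
Qed.

Lemma pevalX f x : peval f 'X x = f x.
Proof. by rewrite -['X]mul1r pevalMX -[1]/(1%:P) pevalC scale1r. Qed.

Lemma pevalN f p x : peval f (- p) x = - peval f p x.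
Proof. by rewrite -scaleN1r pevalZ scaleN1r. Qed.

Lemma pevalXsubC f a x : peval f ('X - a%:P) x = f x - a *: x.
Proof. by rewrite pevalD pevalN pevalX pevalC. Qed.

Lemma peval_swap f g p x : (forall y, f (g y) = g (f y)) -> peval f p (g x) = g (peval f p x).
Proof.
move=> fg; rewrite /peval linear_sum; apply: eq_bigr => i _; rewrite linearZ /=; congr (_ *: _).
by elim: (i : nat) => //= k ->.
Qed.

Lemma peval_eigen f p a x : f x = a *: x -> peval f p x = p.[a] *: x.
Proof.
move=> fx; elim/poly_ind: p => [|p c IH]; first by rewrite peval0 horner0 scale0r.
by rewrite pevalD pevalMX pevalC fx linearZ /= IH !hornerE scalerDl scalerA mulrC.
Qed.

Lemma peval_stable f p (U : {vspace V}) x :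
  (forall y, y \in U -> f y \in U) -> x \in U -> peval f p x \in U.
Proof.
move=> fU xU; apply: rpred_sum => i _; apply: rpredZ.
by elim: (i : nat) => //= k IH; apply: fU.
Qed.

(* Equivalent to diagonalizability over K. *)
Definition split_semisimple f := exists2 rs : seq K, uniq rs &
  forall x, peval f (\prod_(r <- rs) ('X - r%:P)) x = 0.

Lemma coprimep_XsubC_pow (a b : K) m n : a != b ->
  coprimep (('X - a%:P) ^+ m) (('X - b%:P) ^+ n).
Proof.
move=> ab; apply: coprimep_expl; apply: coprimep_expr.
by rewrite coprimep_XsubC root_XsubC eq_sym.
Qed.

Lemma coprimep_prod_XsubC_pow (rs : seq K) a m n : a \notin rs ->
  coprimep (\prod_(r <- rs) ('X - r%:P) ^+ m) (('X - a%:P) ^+ n).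
Proof.
elim: rs => [|r rs IH]; first by rewrite big_nil coprime1p.
rewrite inE negb_or => /andP[ar /IH h]; rewrite big_cons coprimepMl h andbT.
by apply: coprimep_XsubC_pow; rewrite eq_sym.
Qed.

Lemma dvd_prod_XsubC_pow (rs : seq K) m (p : {poly K}) : uniq rs ->
  (forall r, r \in rs -> ('X - r%:P) ^+ m %| p) -> \prod_(r <- rs) ('X - r%:P) ^+ m %| p.
Proof.
elim: rs => [|r rs IH] /=; first by rewrite big_nil dvd1p.
case/andP=> rrs urs h; rewrite big_cons Gauss_dvdp; last first.
  by rewrite coprimep_sym coprimep_prod_XsubC_pow.
by rewrite h ?mem_head // IH // => s srs; rewrite h // inE srs orbT.
Qed.

Lemma crt (rs : seq K) m (a : K -> K) : uniq rs ->
  exists p : {poly K}, forall r, r \in rs -> ('X - r%:P) ^+ m %| p - (a r)%:P.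
Proof.
elim: rs => [|r rs IH] /=; first by exists 0.
case/andP=> rrs /IH[p hp].
have /Bezout_eq1_coprimepP[[u v] /= uv] := @coprimep_prod_XsubC_pow rs r m m rrs.
exists (p + ((a r)%:P - p) * u * \prod_(r <- rs) ('X - r%:P) ^+ m) => s.
rewrite inE => /predU1P[->|srs].
  have -> : ((a r)%:P - p) * u * \prod_(r <- rs) ('X - r%:P) ^+ m =
     (a r)%:P - p - ((a r)%:P - p) * v * ('X - r%:P) ^+ m.
    by rewrite -mulrA (canRL (addrK _) uv) mulrBr mulr1 mulrA.
  have -> : p + ((a r)%:P - p - ((a r)%:P - p) * v * ('X - r%:P) ^+ m) - (a r)%:P
     = - (((a r)%:P - p) * v) * ('X - r%:P) ^+ m by ring.
  by rewrite dvdp_mull.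
rewrite addrAC dvdp_addr ?hp // (big_rem s) //= mulrCA.
by rewrite dvdp_mulr.
Qed.

(** [L r] is congruent to 1 modulo X - r and to 0 modulo the other factors, so its value at [f] is
    the projector onto the eigenspace of [r]. *)
Lemma split_semisimple_decomp f rs : uniq rs ->
  (forall x, peval f (\prod_(r <- rs) ('X - r%:P)) x = 0) ->
  exists L : K -> {poly K}, forall x,
    [/\ x = \sum_(r <- rs) peval f (L r) x,
     forall r, r \in rs -> f (peval f (L r) x) = r *: peval f (L r) x &
     {in rs &, forall r s, peval f (L r) (peval f (L s) x) =
        if r == s then peval f (L s) x else 0}].
Proof.
move=> urs kill.
have kill' p x : (forall r, r \in rs -> 'X - r%:P %| p) -> peval f p x = 0.
  move=> h; have : \prod_(r <- rs) ('X - r%:P) ^+ 1 %| p by apply: dvd_prod_XsubC_pow.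
  case/dvdpP=> q ->; rewrite pevalM.
  by under eq_bigr => r _ do rewrite expr1; rewrite kill linear0.
have Lex r : exists p : {poly K}, all (fun s => 'X - s%:P %| p - ((s == r)%:R)%:P) rs.
  by have [p hp] := @crt rs 1 (fun s => (s == r)%:R) urs; exists p; apply/allP.
pose L r := xchoose (Lex r).
have hL r s : s \in rs -> 'X - s%:P %| L r - ((s == r)%:R)%:P.
  exact: (allP (xchooseP (Lex r))).
have eig x r : r \in rs -> f (peval f (L r) x) = r *: peval f (L r) x.
  move=> rrs; apply/eqP; rewrite -subr_eq0 -pevalXsubC -pevalM; apply/eqP/kill' => s srs.
  have := hL r s srs; case: eqP => [->|_]; first by rewrite dvdp_mulr.
  by rewrite subr0 => h; rewrite dvdp_mull.
exists L => x; split=> //; [|by move=> r; apply: eig|]; last first.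
  move=> r s rrs srs; rewrite (peval_eigen _ (eig x s srs)).
  have := hL r s srs; rewrite dvdp_XsubCl rootE !hornerE subr_eq0 => /eqP->.
  by rewrite eq_sym; case: eqP; rewrite ?scale1r ?scale0r.
  apply/eqP; rewrite -subr_eq0 -{1}[x]scale1r -(pevalC f) -peval_sum -pevalN -pevalD.
  apply/eqP/kill' => r rrs; rewrite dvdp_XsubCl rootE !hornerE horner_sum.
  rewrite (bigD1_seq r) //= big1_seq => [|s /andP[sr srs]].
    have := hL r r rrs; rewrite eqxx dvdp_XsubCl rootE !hornerE => /eqP.
    by move=> e; rewrite -oppr_eq0 opprB e.
  have := hL s r rrs; rewrite eq_sym (negbTE sr) subr0 dvdp_XsubCl rootE.
  by move/eqP.
Qed.

Lemma split_semisimple_eigen f (I : finType) (b : I -> V) (a : I -> K) :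
  (forall i, f (b i) = a i *: b i) ->
  (forall x, exists c : I -> K, x = \sum_i c i *: b i) -> split_semisimple f.
Proof.
move=> fb sp; exists (undup [seq a i | i <- enum I]); first exact: undup_uniq.
move=> x; have [c ->] := sp x; rewrite linear_sum big1 // => i _; rewrite linearZ /=.
rewrite (peval_eigen _ (fb i)) horner_prod (big_rem (a i)) /=; last first.
  by rewrite mem_undup map_f // mem_enum.
by rewrite hornerXsubC subrr mul0r scale0r scaler0.
Qed.

(** An arbitrary projection onto [U] is compressed to each eigenspace. The result [q] commutes with
    [f], has values in [U] and is the identity on [U], so its kernel is an invariant complement. *)
Lemma semisimple_of_split f : split_semisimple f -> semisimple_endo f.
Proof.
case=> rs urs kill U fU.
have [L hL] := split_semisimple_decomp urs kill.
have fUm y : y \in U -> f y \in U by move=> yU; apply: (subvP fU); rewrite memv_img.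
pose q x := \sum_(r <- rs) peval f (L r) (projv U (peval f (L r) x)).
have qlin : linear q.
  move=> a x y; rewrite /q scaler_sumr -big_split; apply: eq_bigr => r _ /=.
  by rewrite !linearP.
pose ql : {linear V -> V} := HB.pack q (GRing.isLinear.Build K V V _ _ qlin).
have qE x : linfun ql x = q x by rewrite lfunE.
have qU x : q x \in U.
  by apply: rpred_sum => r _; apply: peval_stable => //; apply: memv_proj.

have qid x : x \in U -> q x = x.
  move=> xU; have [xE _ orth] := hL x; rewrite [RHS]xE /q [LHS]big_seq [RHS]big_seq.
  apply: eq_bigr => r rrs; rewrite projv_id; last exact: peval_stable.
  by rewrite orth // eqxx.
have qf x : q (f x) = f (q x).
  rewrite /q linear_sum !big_seq; apply: eq_bigr => r rrs /=.
  have [_ h1 _] := hL x; have [_ h2 _] := hL (projv U (peval f (L r) x)).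
  by rewrite peval_comm h1 // linearZ /= linearZ /= h2.
exists (lker (linfun ql)); split.
- apply/subvP => _ /memv_imgP[x xk ->]; move: xk; rewrite !memv_ker !qE qf => /eqP->.
  by rewrite linear0.
- apply/eqP; rewrite eqEsubv subvf /=; apply/subvP => x _.
  rewrite -[x](subrKC (q x)); apply: memv_add => //.
  have qB : q (x - q x) = q x - q (q x) by apply: (linearB ql).
  by rewrite memv_ker qE qB (qid (q x)) // subrr.
- apply/eqP; rewrite -subv0; apply/subvP => x; rewrite memv_cap memv_ker qE => /andP[xU].
  by rewrite qid // memv0.
Qed.

End PolyEval.

Section Killing.
Import VectorInternalTheory.
Lemma killing_poly (K : fieldType) (V : vectType K) (f : 'End(V)) :
  exists2 p : {poly K}, p != 0 & forall x, peval f p x = 0.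
Proof.
have mxk n (A : 'M[K]_n) : exists2 p : {poly K}, p != 0 &
    forall v : 'rV_n, \sum_(i < size p) p`_i *: iter i (mulmxr A) v = 0.
  case: n A => [|n] A; first by exists 1; rewrite ?oner_eq0 // => v; rewrite [LHS]thinmx0.
  exists (char_poly A) => [|v]; first by rewrite monic_neq0 // char_poly_monic.
  have it i : iter i (mulmxr A) v = v *m A ^+ i.
    by elim: i => [|i IH] /=; rewrite ?expr0 ?mulmx1 // IH -mulmxA exprSr.
  transitivity (v *m (0 : 'M_n.+1)); last by rewrite mulmx0.
  have hE p : horner_mx A p = \sum_(i < size p) p`_i *: A ^+ i.
    rewrite -{1}[p]coefK poly_def linear_sum.
    by apply: eq_bigr => i _; rewrite linearZ /= rmorphXn /= horner_mx_X.
  rewrite -(Cayley_Hamilton A) hE mulmx_sumr.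
  by apply: eq_bigr => i _; rewrite it scalemxAr.
have [p p0 pk] := mxk _ (f2mx f); exists p => // x.
apply: v2r_inj; rewrite linear0 -(pk (v2r x)).
rewrite /peval linear_sum; apply: eq_bigr => i _; rewrite linearZ /=; congr (_ *: _).
elim: (i : nat) => //= k IH; rewrite -IH.
by rewrite unlock /= r2vK.
Qed.
End Killing.

(** Let N be the squarefree part of an annihilating polynomial. An invariant complement [W] of ker
    N(f) meets that kernel in 0, so N(f) is injective on [W]; being nilpotent there as well, it
    forces [W] to be 0. *)
Lemma split_of_semisimple (K : closedFieldType) (V : vectType K) (f : 'End(V)) :
  semisimple_endo f -> split_semisimple f.
Proof.
move=> ss.
have [rs kill] : exists rs, forall x, peval f (\prod_(r <- rs) ('X - r%:P)) x = 0.
  have [p p0 pk] := killing_poly f; have [rs pE] := closed_field_poly_normal p.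
  exists rs => x; have := pk x; rewrite pE pevalZ => /eqP.
  by rewrite scaler_eq0 lead_coef_eq0 (negbTE p0) => /eqP.
pose N := \prod_(r <- undup rs) ('X - r%:P).
have [m Nm] : exists m, \prod_(r <- rs) ('X - r%:P) %| N ^+ m.
  exists (size rs); have: {subset rs <= undup rs} by move=> r; rewrite mem_undup.
  elim: {1 3 4}rs => [|r s IH] h; first by rewrite big_nil dvd1p.
  rewrite big_cons exprS dvdp_mul //; last by apply: IH => t ts; rewrite h // inE ts orbT.
  by rewrite /N (big_rem r) /= ?dvdp_mulr // h ?mem_head.
pose Nl := linfun (peval f N).
have NE x : Nl x = peval f N x by rewrite lfunE.
have [|W [fW UW UW0]] := ss (lker Nl).
  apply/subvP => _ /memv_imgP[x xk ->]; move: xk; rewrite !memv_ker !NE peval_comm => /eqP->.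
  by rewrite linear0.
exists (undup rs) => [|x]; first exact: undup_uniq.
rewrite -/N -NE; apply/eqP; rewrite -memv_ker.
have fWm y : y \in W -> f y \in W by move=> yW; apply: (subvP fW); rewrite memv_img.
have W0 y : y \in W -> y = 0.
  move=> yW; have : peval f (N ^+ m) y = 0.
    by case/dvdpP: Nm => q ->; rewrite pevalM kill linear0.
  elim: m {Nm} => [|m IH]; first by rewrite expr0 -[1]/(1%:P) pevalC scale1r.
  rewrite exprS pevalM => e; apply: IH.
  have : peval f (N ^+ m) y \in (lker Nl :&: W)%VS.
    by rewrite memv_cap memv_ker NE e eqxx peval_stable.
  by rewrite UW0 memv0 => /eqP.
have : x \in (lker Nl + W)%VS by rewrite UW memvf.
by case/memv_addP=> u uU [w wW ->]; rewrite (W0 w wW) addr0.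
Qed.

Section EigenBasis.
Import VectorInternalTheory.
Variables (K : fieldType) (V : vectType K).
Implicit Types (f g : 'End(V)) (x y : V).

Lemma f2mxE f x : v2r (f x) = v2r x *m f2mx f.
Proof. by rewrite unlock /= r2vK. Qed.

Lemma f2mxE' f v : f (r2v v) = r2v (v *m f2mx f).
Proof. by apply: v2r_inj; rewrite f2mxE !r2vK. Qed.

Lemma split_diagonalizable f : split_semisimple f -> diagonalizable (f2mx f).
Proof.
case=> rs urs kill; apply/diagonalizablePeigen; exists rs => //.
have [L hL] := split_semisimple_decomp urs kill.
apply/eqmxP; rewrite submx1 /=; apply/row_subP => i.
set v := row i _; have [vE eig _] := hL (r2v v).
rewrite -[X in (X <= _)%MS]r2vK vE linear_sum /= big_seq.
apply: summx_sub => r rrs; rewrite (big_rem r) //=; apply: submx_trans (addsmxSl _ _).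
by apply/eigenspaceP; rewrite -f2mxE eig // linearZ.
Qed.

Lemma common_eigenbasis (fs : seq 'End(V)) :
  {in fs &, forall f g, forall x, f (g x) = g (f x)} ->
  {in fs, forall f, split_semisimple f} ->
  exists (b : 'I_(dim V) -> V) (phi : 'I_(dim V) -> 'Hom(V, K^o)),
  [/\ forall x, x = \sum_k phi k x *: b k, forall k l, phi k (b l) = (k == l)%:R &
      {in fs, forall f k, f (b k) = phi k (f (b k)) *: b k}].
Proof.
move=> com ss.
have [P Pu /allP Pd] : codiagonalizable (map (@f2mx _ _ _) fs).
  apply/codiagonalizableP; split=> [_ _ /mapP[f ff ->] /mapP[g gg ->]|_ /mapP[f ff ->]].
    apply/row_matrixP => i; rewrite !rowE !mulmxA -[delta_mx _ _]r2vK.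
    by rewrite -!f2mxE com.
  exact/split_diagonalizable/ss.
pose ph k x : K^o := (v2r x *m invmx P) 0 k.
have phl k : linear (ph k) by move=> a x y; rewrite /ph linearP mulmxDl -scalemxAl !mxE.
pose phL k : {linear V -> K^o} := HB.pack (ph k) (GRing.isLinear.Build K V K^o _ _ (phl k)).
pose b k := r2v (row k P).
have phE k x : linfun (phL k) x = ph k x by rewrite lfunE.
exists b, (fun k => linfun (phL k)); split=> [x|k l|f ff k].
- apply: v2r_inj; rewrite linear_sum /= -[LHS](mulmxKV Pu).
  rewrite (mulmx_sum_row (v2r x *m invmx P)); apply: eq_bigr => k _.
  by rewrite phE linearZ /= r2vK.
- by rewrite phE /ph r2vK -row_mul mulmxV // !mxE eq_sym.
have /= := Pd _ (map_f _ ff); move/diagonalizable_forPex => [d /(simmxP Pu) Pf].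
have e : f (b k) = d 0 k *: b k.
  rewrite f2mxE' -row_mul Pf row_mul row_diag_mx -scalemxAl -rowE linearZ /= //.
rewrite {1}e; congr (_ *: _).
by rewrite phE /ph e linearZ /= r2vK -scalemxAl -row_mul mulmxV // !mxE eqxx mulr1.
Qed.

Definition end_trace f : K := \tr (f2mx f).

(** The hypothesis writes the identity as the sum of the tensors of phi_k and b_k; the trace is the
    contraction of [f] with this sum. *)
Lemma end_traceE (I : finType) (b : I -> V) (phi : I -> {linear V -> K^o}) f :
  (forall x, x = \sum_k phi k x *: b k) -> end_trace f = \sum_k phi k (f (b k)).
Proof.
move=> h; rewrite /end_trace /mxtrace.
have e i j : f2mx f i j = \sum_k (phi k (f (r2v (delta_mx 0 i))) : K) * v2r (b k) 0 j.
  have -> : f2mx f i j = v2r (f (r2v (delta_mx 0 i))) 0 j.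
    by rewrite f2mxE r2vK -rowE mxE.
  rewrite {1}(h (f _)) linear_sum summxE; apply: eq_bigr => k _.
  by rewrite linearZ mxE.
under eq_bigr => i _ do rewrite e.
rewrite exchange_big; apply: eq_bigr => k _ /=.
have -> : f (b k) = \sum_i v2r (b k) 0 i *: f (r2v (delta_mx 0 i)).
  apply: v2r_inj; rewrite -{1}[b k]v2rK {1}(row_sum_delta (v2r (b k))) !linear_sum /=.
  by apply: eq_bigr => i _; rewrite !linearZ.
by rewrite linear_sum; apply: eq_bigr => i _; rewrite linearZ /= mulrC.
Qed.

End EigenBasis.

Section Jordan.
Variables (K : closedFieldType) (V : vectType K).
Implicit Types (f g : 'End(V)) (x y z : V).
Import VectorInternalTheory.

Lemma end_trace_nilp f m : (forall x, iter m f x = 0) -> end_trace f = 0.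
Proof.
move=> h; rewrite /end_trace.
have [rs pE] := closed_field_poly_normal (char_poly (f2mx f)).
rewrite (eqP (char_poly_monic _)) scale1r in pE.
have r0 r : r \in rs -> r = 0.
  move=> rrs; have : root (char_poly (f2mx f)) r by rewrite pE root_prod_XsubC.
  rewrite -eigenvalue_root_char => /eigenvalueP[v vE v0].
  have it k : iter k f (r2v v) = r ^+ k *: r2v v.
    elim: k => [|k IH]; first by rewrite expr0 scale1r.
    by rewrite /= IH linearZ /= f2mxE' vE linearZ /= scalerA exprSr.
  have := h (r2v v); rewrite it => /eqP; rewrite scaler_eq0 expf_eq0.
  case/orP=> [/andP[_ /eqP]|/eqP e] //; case/eqP: v0; apply: r2v_inj.
  by rewrite e linear0.
have cX : char_poly (f2mx f) = 'X^(size rs).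
  rewrite pE big_seq (eq_bigr (fun=> 'X)) => [|r /r0 ->]; last by rewrite subr0.
  by rewrite -big_seq big_const_seq count_predT; elim: (size rs) => //= k ->; rewrite exprS.
have sz := size_char_poly (f2mx f); rewrite cX size_polyXn in sz; case: sz => sz.
have [n0|n0] := posnP (dim V).
  by rewrite /mxtrace big1 // => i; have := ltn_ord i; rewrite {2}n0.
have := char_poly_trace (f2mx f) n0; rewrite cX coefXn sz.
have -> : ((dim V).-1 == dim V) = false by rewrite -{2}(prednK n0) eqn_leq ltnn andbF.
by move/esym/eqP; rewrite oppr_eq0 => /eqP.
Qed.

(** The root list may be enlarged at will, which [jordan_ext4] uses to make it stable under negation
    and conjugation. *)
Lemma jordan_roots f : exists (rs0 : seq K) (m : nat), forall rs : seq K,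
  uniq rs -> {subset rs0 <= rs} -> forall x, peval f (\prod_(r <- rs) ('X - r%:P) ^+ m) x = 0.
Proof.
have [p p0 pk] := killing_poly f; have [rs0 pE] := closed_field_poly_normal p.
have kill x : peval f (\prod_(r <- rs0) ('X - r%:P)) x = 0.
  have := pk x; rewrite pE pevalZ => /eqP.
  by rewrite scaler_eq0 lead_coef_eq0 (negbTE p0) => /eqP.
exists rs0, (size rs0) => rs urs sub x.
suff /dvdpP[q ->] : \prod_(r <- rs0) ('X - r%:P) %| \prod_(r <- rs) ('X - r%:P) ^+ size rs0.
  by rewrite pevalM kill linear0.
rewrite prodrXl; move: sub.
elim: rs0 {pE kill} => [|r s IH] h; first by rewrite big_nil dvd1p.
rewrite big_cons exprS dvdp_mul //; last by apply: IH => t ts; rewrite h // inE ts orbT.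
by rewrite (big_rem r) /= ?dvdp_mulr // h ?mem_head.
Qed.

Variables (f : 'End(V)) (rs : seq K) (m : nat) (p : {poly K}).
Hypothesis urs : uniq rs.
Hypothesis kill : forall x, peval f (\prod_(r <- rs) ('X - r%:P) ^+ m) x = 0.
(** The exponent is doubled because the product of two vectors killed by m-th powers is only killed
    by a power of order 2m. *)
Hypothesis hp : forall r, r \in rs -> ('X - r%:P) ^+ (m + m) %| p - r%:P.

Lemma jordan_kill q x : (forall r, r \in rs -> ('X - r%:P) ^+ m %| q) -> peval f q x = 0.
Proof.
by move=> h; have /dvdpP[s ->] := dvd_prod_XsubC_pow urs h; rewrite pevalM kill linear0.
Qed.

Lemma semisimple_part_split : split_semisimple (linfun (peval f p)).
Proof.
exists rs => // x.
have comp q y : peval (linfun (peval f p)) q y = peval f (q \Po p) y.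
  elim/poly_ind: q y => [|q c IH] y; first by rewrite comp_poly0 !peval0.
  by rewrite pevalD pevalMX pevalC IH lfunE comp_poly_MXaddC pevalD pevalM pevalC.
rewrite comp; apply: jordan_kill => r rrs; rewrite rmorph_prod /= (big_rem r) //=.
rewrite rmorphB /= comp_polyX comp_polyC dvdp_mulr //.
by apply: dvdp_trans (hp rrs); rewrite exprD dvdp_mulr.
Qed.

Lemma nilpotent_part x : (0 < m)%N -> peval f (('X - p) ^+ m) x = 0.
Proof.
move=> m0; apply: jordan_kill => r rrs; apply: dvdp_exp2r.
have -> : 'X - p = ('X - r%:P) - (p - r%:P) by ring.
rewrite dvdp_sub //; apply: dvdp_trans (hp rrs).
by rewrite -{1}['X - r%:P]expr1 dvdp_exp2l // addn_gt0 m0.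
Qed.

(** If [c] is not among the roots, its generalized eigenspace is zero by coprimality; this case
    occurs when [c] is a sum of two roots. *)
Lemma semisimple_part_eigen c x : peval f (('X - c%:P) ^+ (m + m)) x = 0 ->
  peval f p x = c *: x.
Proof.
move=> h; have [crs|crs] := boolP (c \in rs).
  apply/eqP; rewrite -subr_eq0 -(pevalC f) -pevalN -pevalD; apply/eqP.
  by have /dvdpP[q ->] := hp crs; rewrite pevalM h linear0.
have /Bezout_eq1_coprimepP[[u v] /= uv] := @coprimep_prod_XsubC_pow _ rs c m (m + m) crs.
have -> : x = 0.
  by rewrite -[x]scale1r -(pevalC f) polyC1 -uv pevalD !pevalM kill h !linear0 addr0.
by rewrite linear0 scaler0.
Qed.

(** By the Leibniz rule, the product of generalized eigenvectors for a and b is one for a + b, and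
    p(f) acts on the three of them by a, b and a + b. *)
Lemma semisimple_part_derivation (br : V -> V -> V) :
  (forall x, linear (br x)) -> (forall y, linear (br^~ y)) ->
  (forall x y, f (br x y) = br (f x) y + br x (f y)) ->
  forall x y, peval f p (br x y) = br (peval f p x) y + br x (peval f p y).
Proof.
move=> linr linl der.
pose R x : {linear V -> V} := HB.pack (br x) (GRing.isLinear.Build K V V _ _ (linr x)).
pose L y : {linear V -> V} := HB.pack (br^~ y) (GRing.isLinear.Build K V V _ _ (linl y)).
have br0l y : br 0 y = 0 by apply: (linear0 (L y)).
have br0r x : br x 0 = 0 by apply: (linear0 (R x)).
have brBl x x' y : br (x - x') y = br x y - br x' y by apply: (linearB (L y)).
have brBr x y y' : br x (y - y') = br x y - br x y' by apply: (linearB (R x)).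
have brZl a x y : br (a *: x) y = a *: br x y by apply: (linearZZ (L y)).
have brZr a x y : br x (a *: y) = a *: br x y by apply: (linearZZ (R x)).
have gen a b i j x y : peval f (('X - a%:P) ^+ i) x = 0 -> peval f (('X - b%:P) ^+ j) y = 0 ->
    peval f (('X - (a + b)%:P) ^+ (i + j)) (br x y) = 0.
  elim: {i j}(i + j)%N {-2}i {-2}j (erefl (i + j)%N) x y => [|k IH] i j ij x y.
    move/eqP: ij; rewrite addn_eq0 => /andP[/eqP-> /eqP->].
    rewrite !expr0 -[1]/(1%:P) !pevalC !scale1r => -> _.
    by rewrite br0l.
  case: i ij => [|i] ij.
    rewrite expr0 -[1]/(1%:P) pevalC scale1r => -> _.
    by rewrite br0l linear0.
  case: j ij => [|j] ij.
    rewrite expr0 -[1]/(1%:P) pevalC scale1r => _ ->.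
    by rewrite br0r linear0.
  move=> hx hy.
  have e : peval f ('X - (a + b)%:P) (br x y) = br (peval f ('X - a%:P) x) y + br x (peval f ('X - b%:P) y).
    rewrite !pevalXsubC der brBl brBr brZl brZr.
    by rewrite scalerDl opprD addrACA.
  have e1 : peval f (('X - (a + b)%:P) ^+ (i + j.+1)) (br (peval f ('X - a%:P) x) y) = 0.
    by apply: IH hy; [move: ij; rewrite addSn => -[] | rewrite -pevalM -exprSr].
  have e2 : peval f (('X - (a + b)%:P) ^+ (i.+1 + j)) (br x (peval f ('X - b%:P) y)) = 0.
    by apply: IH hx _; [move: ij; rewrite addnS => -[] | rewrite -pevalM -exprSr].
  by rewrite addSn exprSr pevalM e linearD /= e1 -addSnnS e2 addr0.
have [LL hL] : exists LL : K -> {poly K}, forall x, x = \sum_(r <- rs) peval f (LL r) x /\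
    (forall r, r \in rs -> peval f (('X - r%:P) ^+ m) (peval f (LL r) x) = 0).
  have Lex r : exists q : {poly K}, all (fun s => ('X - s%:P) ^+ m %| q - ((s == r)%:R)%:P) rs.
    by have [q hq] := crt m (fun s => (s == r)%:R) urs; exists q; apply/allP.
  pose LL r := xchoose (Lex r); exists LL => x.
  have hLL r s : s \in rs -> ('X - s%:P) ^+ m %| LL r - ((s == r)%:R)%:P.
    exact: (allP (xchooseP (Lex r))).
  split.
    apply/eqP; rewrite -subr_eq0 -{1}[x]scale1r -(pevalC f) -peval_sum -pevalN -pevalD.
    apply/eqP/jordan_kill => r rrs; rewrite -dvdpNr opprB (bigD1_seq r) //= addrAC.
    rewrite dvdp_add //; first by have := hLL r r rrs; rewrite eqxx.
    rewrite big_seq_cond; apply: (big_ind (fun q => ('X - r%:P) ^+ m %| q)).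
    - exact: dvdp0.
    - by move=> q1 q2; apply: dvdp_add.
    move=> s /andP[srs sr]; have := hLL s r rrs.
    by rewrite eq_sym (negbTE sr) subr0.
  move=> r rrs; rewrite -pevalM; apply: jordan_kill => s srs.
  have := hLL r s srs; case: eqP => [->|_]; first by rewrite dvdp_mulr.
  by rewrite subr0 => h; rewrite dvdp_mull.
have Sm r x : peval f (('X - r%:P) ^+ m) x = 0 -> peval f p x = r *: x.
  by move=> h; apply: semisimple_part_eigen; rewrite exprD pevalM h linear0.
move=> x y; have [xE hx] := hL x; have [yE hy] := hL y.
have brE u v (X Y : K -> V) : u = \sum_(r <- rs) X r -> v = \sum_(s <- rs) Y s ->
    br u v = \sum_(r <- rs) \sum_(s <- rs) br (X r) (Y s).
  move=> -> ->; etransitivity; first exact: (linear_sum (L _)).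
  by apply: eq_bigr => r _; apply: (linear_sum (R _)).
have SE z : (forall r, r \in rs -> peval f (('X - r%:P) ^+ m) (peval f (LL r) z) = 0) ->
    z = \sum_(r <- rs) peval f (LL r) z -> peval f p z = \sum_(r <- rs) r *: peval f (LL r) z.
  move=> hz {1}->; rewrite linear_sum /= [LHS]big_seq [RHS]big_seq.
  by apply: eq_bigr => r rrs; apply/Sm/hz.
rewrite (brE _ _ _ _ (SE x hx xE) yE) (brE _ _ _ _ xE (SE y hy yE)) (brE _ _ _ _ xE yE).
rewrite linear_sum -big_split /= [LHS]big_seq [RHS]big_seq; apply: eq_bigr => r rrs.
rewrite linear_sum -big_split /= [LHS]big_seq [RHS]big_seq; apply: eq_bigr => s srs.
rewrite brZl brZr -scalerDl.
by apply: semisimple_part_eigen; apply: gen; [apply: hx | apply: hy].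
Qed.

End Jordan.

(** Indexed by arbitrary subsets, with value 0 off cardinality 4, so that index sets can be modified
    without carrying proofs of their size. *)
HB.lock Definition eS (K : numFieldType) (S : {set 'I_8}) : ext4 K :=
  [ffun J => (val J == S)%:R].

(** * Uniqueness of the invariant bilinear map to gl(8) *)

Section Unique.
Variable K : numFieldType.
Implicit Types (v w : ext4 K) (S T : {set 'I_8}) (X : 'M[K]_8).
Local Notation eS := (eS K).
Local Notation bv := (bv K).
Local Notation e4 := (e4 K).

Lemma eSE S I : eS S I = (val I == S)%:R.
Proof. by rewrite eS.unlock ffunE. Qed.

Lemma e4_eS I : e4 I = eS (val I).
Proof. by apply/ffunP => J; rewrite eSE e4E val_eqE. Qed.

Lemma eS_card S : #|S| != 4%N -> eS S = 0.
Proof.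
move=> h; apply/ffunP => J; rewrite eSE ext4_0; case: eqP => // e.
by rewrite -e (valP J) in h.
Qed.

Lemma bv_eS (f : quad) : injective f -> exists2 s : K, s != 0 & bv f = s *: eS (f @: [set: 'I_4]).
Proof.
move=> fi; have [s [_ ->]] := bv_inj K fi; exists ((-1) ^+ s); last by rewrite e4_eS.
by rewrite signr_eq0.
Qed.

Lemma lact_delta_eS S k l : l \in S -> k \notin S ->
  exists2 s : K, s != 0 & lact (delta_mx k l) (eS S) = s *: eS (k |: S :\ l).
Proof.
move=> lS kS; have kl : k != l by apply: contraNneq kS => ->.
have [S4|S4] := boolP (#|S| == 4%N); last first.
  exists 1; rewrite ?oner_eq0 // (eS_card S4) linear0 eS_card ?scaler0 //.
  by rewrite cardsU1 !inE kl (negbTE kS) /= (cardsD1 l S) lS in S4 *.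
pose I : sub4 := Sub S S4; have /idxP[b lb] : l \in val I by [].
have fi := @idx_inj I.
have kf : k != idx I b by rewrite -lb.
rewrite -[S]/(val I) -e4_eS -bv_idx lb (lact_delta1 K fi kf).
have ui : injective (upd (idx I) b k).
  move=> x y; case: (eqVneq x b) => [->|xb]; case: (eqVneq y b) => [->|yb] //.
  - by rewrite upd_same upd_other // => e; case/negP: kS; rewrite e mem_idx.
  - by rewrite upd_same upd_other // => e; case/negP: kS; rewrite -e mem_idx.
  - by rewrite !upd_other // => /fi.
have [s s0 ->] := bv_eS ui; exists s => //; congr (_ *: eS _).
apply/setP => x; rewrite !inE; apply/imsetP/idP => [[c _ ->]|].
  case: (eqVneq c b) => [->|cb]; first by rewrite upd_same eqxx.
  by rewrite upd_other // mem_idx (inj_eq fi) cb orbT.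
case/orP=> [/eqP->|/andP[xl /idxP[c xc]]]; first by exists b; rewrite ?upd_same.
exists c => //; rewrite upd_other //; apply: contraNneq xl => cb.
by rewrite xc cb.
Qed.

Lemma lact_diag_eS S k : lact (delta_mx k k) (eS S) = ((k \in S)%:R - 2%:R^-1) *: eS S.
Proof.
have [S4|S4] := boolP (#|S| == 4%N); last by rewrite (eS_card S4) linear0 scaler0.
pose I : sub4 := Sub S S4; rewrite -[S]/(val I) -e4_eS -bv_idx.
have -> : delta_mx k k = diag_mx (delta_mx 0 k) :> 'M[K]_8.
  apply/matrixP => i j; rewrite !mxE eqxx /=; case: (i =P j) => [->|ij].
    by rewrite andbb mulr1n.
  by rewrite mulr0n; case: (i =P k) => // ik; case: (j =P k) => // jk; case: ij; rewrite ik jk.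
rewrite lact_diag; congr ((_ - _) *: _).
  have [/idxP[b kb]|kI] := boolP (k \in val I).
    rewrite (bigD1 b) //= big1 ?addr0 => [|c cb]; first by rewrite mxE kb !eqxx.
    by rewrite mxE kb (inj_eq (@idx_inj I)) (negbTE cb) andbF.
  rewrite big1 // => b _; rewrite mxE; case: eqP => //= _; case: eqP => // e.
  by rewrite -e mem_idx in kI.
rewrite (bigD1 k) //= big1 => [|j jk]; last by rewrite mxE (negbTE jk) andbF.
by rewrite mxE !eqxx addr0 mul1r.
Qed.

Lemma eS_ind (V : lmodType K) (f : ext4 K -> V) : linear f ->
  (forall S, #|S| = 4%N -> f (eS S) = 0) -> forall v, f v = 0.
Proof.
move=> lf h v; pose F : {linear ext4 K -> V} := HB.pack f (GRing.isLinear.Build K _ _ _ _ lf).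
apply: (e4_eq (f := F) (g := \0)) => I /=; rewrite e4_eS h //; exact/eqP/(valP I).
Qed.

Section Fix.
Variables a b : 'I_8.
Hypothesis ab : a != b.

Definition partner S : {set 'I_8} := a |: (~: S :\ b).

Variable phi : ext4 K -> ext4 K -> 'M[K]_8.
Hypothesis linr : forall v, linear (phi v).
Hypothesis linl : forall w, linear (phi^~ w).
Hypothesis equiv : forall X v w,
  X *m phi v w - phi v w *m X = phi (lact X v) w + phi v (lact X w).

Lemma equiv_entry k l c d v w :
  (c == k)%:R * phi v w l d - phi v w c k * (d == l)%:R =
  phi (lact (delta_mx k l) v) w c d + phi v (lact (delta_mx k l) w) c d.
Proof.
have /matrixP/(_ c d) := equiv (delta_mx k l) v w; rewrite !mxE => <-.
congr (_ - _).
  rewrite (bigD1 l) //= big1 => [|j jl]; last by rewrite mxE (negbTE jl) andbF mul0r.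
  by rewrite mxE eqxx andbT addr0.
rewrite (bigD1 k) //= big1 => [|j jk]; last by rewrite mxE (negbTE jk) mulr0.
by rewrite mxE eqxx addr0.
Qed.

Lemma phiZl s v w c d : phi (s *: v) w c d = s * phi v w c d.
Proof.
pose L : {linear ext4 K -> 'M[K]_8} := HB.pack (phi^~ w) (GRing.isLinear.Build K _ _ _ _ (linl w)).
have -> : phi (s *: v) w = s *: phi v w by apply: (linearZZ L).
by rewrite mxE.
Qed.

Lemma phiZr s v w c d : phi v (s *: w) c d = s * phi v w c d.
Proof.
pose L : {linear ext4 K -> 'M[K]_8} := HB.pack (phi v) (GRing.isLinear.Build K _ _ _ _ (linr v)).
have -> : phi v (s *: w) = s *: phi v w by apply: (linearZZ L).
by rewrite mxE.
Qed.

(** Weights under diagonal matrices must match: together [S] and [T] cover every index once, except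
    a, covered twice, and b, not covered at all. *)
Lemma equiv_weight S T : phi (eS S) (eS T) a b != 0 -> [/\ a \in S, b \notin S & T = partner S].
Proof.
set F := phi _ _ a b => F0.
have h k : (a == k)%:R - (b == k)%:R = (k \in S)%:R + (k \in T)%:R - 1 :> K.
  have := equiv_entry k k a b (eS S) (eS T).
  rewrite !lact_diag_eS phiZl phiZr -/F => e; apply: (mulIf F0).
  have ea : (a == k)%:R * phi (eS S) (eS T) k b = (a == k)%:R * F.
    by case: eqP => [<-|]; rewrite ?mul0r.
  have eb : phi (eS S) (eS T) a k * (b == k)%:R = F * (b == k)%:R.
    by case: eqP => [<-|]; rewrite ?mulr0.
  have -> : ((a == k)%:R - (b == k)%:R) * F = (a == k)%:R * F - F * (b == k)%:R by ring.
  by rewrite -ea -eb e; field.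
have wt k : ((a == k) + 1 = (b == k) + (k \in S) + (k \in T))%N.
  apply/eqP; rewrite -(eqr_nat K) !natrD; have /eqP := h k.
  by rewrite subr_eq => /eqP->; apply/eqP; ring.
have := wt a; have := wt b; rewrite !eqxx (negbTE ab) [b == a]eq_sym (negbTE ab).
case bS : (b \in S); case bT : (b \in T) => // _.
case aS : (a \in S); case aT : (a \in T) => // _.
split=> //; apply/setP => k; rewrite !inE.
case: (eqVneq k a) => [->|ka] //=; case: (eqVneq k b) => [->|kb] //=.
have := wt k; rewrite eq_sym (negbTE ka) [b == k]eq_sym (negbTE kb).
by case: (k \in S); case: (k \in T).
Qed.

Variable I0 : {set 'I_8}.
Hypotheses (aI0 : a \in I0) (bI0 : b \notin I0) (I04 : #|I0| = 4%N).
Hypothesis base : phi (eS I0) (eS (partner I0)) a b = 0.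

(** An elementary matrix E_kl with k in I0 but not in S and l in S but not in I0 moves [S] one step
    towards [I0]. As k and l differ from a and b, the commutator has (a, b) entry 0, which makes the
    two neighbouring values proportional. *)
Lemma equiv_ab0 S T : #|S| = 4%N -> phi (eS S) (eS T) a b = 0.
Proof.
move=> S4; apply/eqP/negP => /negP h; have [aS bS TE] := equiv_weight h.
case/negP: h; apply/eqP; rewrite TE {T TE}.
have [n] := ubnP #|I0 :\: S|; elim: n S S4 aS bS => // n IH S S4 aS bS ltn.
have [/eqP sub|/set0Pn[k]] := boolP (I0 :\: S == set0).
  have -> : S = I0 by apply/eqP; rewrite eq_sym eqEcard S4 I04 leqnn -setD_eq0 sub eqxx.
  exact: base.
rewrite inE => /andP[kS kI].
have /set0Pn[l] : S :\: I0 != set0.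
  apply: contraNneq kS => /eqP; rewrite setD_eq0 => sub.
  suff -> : S = I0 by [].
  by apply/eqP; rewrite eqEcard sub S4 I04.
rewrite inE => /andP[lI lS].
have kl : k != l by apply: contraNneq kS => ->.
have la : l != a by apply: contraNneq lI => ->.
have lb : l != b by apply: contraNneq bS => <-.
have ka : k != a by apply: contraNneq kS => ->.
have kb : k != b by apply: contraNneq bI0 => <-.
set S' := k |: S :\ l.
have lS' : l \in partner S' by rewrite !inE lb eqxx (eq_sym l k) (negbTE kl) orbT.
have kS' : k \notin partner S' by rewrite !inE (negbTE ka) eqxx /= andbF.
have pS : k |: partner S' :\ l = partner S.
  apply/setP => x; rewrite !inE; case: (x =P k) => [->|xk] /=; first by rewrite kb kS orbT.
  case: (x =P l) => [->|xl] //=; first by rewrite lS (negbTE la) andbF.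
have [s s0 sE] := lact_delta_eS lS kS; have [t t0 tE] := lact_delta_eS lS' kS'.
have := equiv_entry k l a b (eS S) (eS (partner S')).
rewrite (eq_sym a k) (negbTE ka) (eq_sym b l) (negbTE lb) mul0r mulr0 subrr.
rewrite sE tE phiZl phiZr pS -/S' IH ?mulr0 ?add0r.
- by move/esym/eqP; rewrite mulf_eq0 (negbTE t0) => /eqP.
- by rewrite cardsU1 !inE kl (negbTE kS) /=; move: S4; rewrite (cardsD1 l S) lS.
- by rewrite !inE aS (eq_sym a l) la orbT.
- by rewrite !inE negb_or (eq_sym b k) kb negb_and bS orbT.
- move: ltn; rewrite ltnS; apply: leq_trans; apply: proper_card; apply/properP; split.
    apply/subsetP => x; rewrite !inE negb_or negb_and negbK.
    case/andP=> /andP[_ /orP[/eqP->|->]] xI; last by rewrite xI.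
    by rewrite xI in lI.
  by exists k; rewrite !inE ?kS ?kI ?eqxx.
Qed.

Hypothesis tr0 : forall v w, \tr (phi v w) = 0.

(** Commutators with elementary matrices carry the vanishing from the entry (a, b) to column b, then
    to all off-diagonal entries, and they make the diagonal constant; the trace condition
    finishes. *)
Lemma equivariant_eq0 v w : phi v w = 0.
Proof.
have F0 x y : phi x y a b = 0.
  move: x; apply: (eS_ind (V := K^o) (f := fun x => phi x y a b)) => [s u u'|S S4].
    by rewrite linl !mxE.
  move: y; apply: (eS_ind (V := K^o) (f := fun y => phi (eS S) y a b)) => [s u u'|T T4].
    by rewrite linr !mxE.
  exact: equiv_ab0.
have cb c x y : c != b -> phi x y c b = 0.
  move=> cb; have := equiv_entry a c a b x y.
  by rewrite !F0 addr0 eqxx mul1r eq_sym (negbTE cb) mulr0 subr0.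
have cd c d x y : c != b -> c != d -> phi x y c d = 0.
  move=> nb nd; have := equiv_entry d b c b x y.
  rewrite !(cb c) // addr0 eqxx mulr1 (negbTE nd) mul0r sub0r => /eqP.
  by rewrite oppr_eq0 => /eqP.
have bd d x y : d != b -> phi x y b d = 0.
  move=> db; have /set0Pn[c] : I0 :\ d != set0.
    by apply: contraTneq isT => e; move: I04; rewrite (cardsD1 d) e cards0; case: (d \in I0).
  rewrite !inE => /andP[nd cI]; have nb : c != b by apply: contraNneq bI0 => <-.
  have := equiv_entry c b c d x y.
  by rewrite !(cd c d) // addr0 eqxx mul1r (negbTE db) mulr0 subr0.
have off c d x y : c != d -> phi x y c d = 0.
  by have [->|nb] := eqVneq c b => nd; [rewrite bd // eq_sym | rewrite cd].
have dg c d x y : phi x y c c = phi x y d d.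
  have [->|nd] // := eqVneq c d; have := equiv_entry c d c d x y.
  rewrite !(off c d) // addr0 !eqxx mul1r mulr1 => /eqP.
  by rewrite subr_eq0 eq_sym => /eqP.
have dia c : phi v w c c = 0.
  have := tr0 v w; rewrite /mxtrace (eq_bigr (fun=> phi v w c c)) => [|d _]; last exact: dg.
  by rewrite sumr_const card_ord => /eqP; rewrite mulrn_eq0 => /eqP.
by apply/matrixP => c d; rewrite mxE; have [->|/off->] := eqVneq c d.
Qed.
End Fix.

Lemma moment_partner_neq0 a b (I0 : {set 'I_8}) : a != b -> a \in I0 -> b \notin I0 -> #|I0| = 4%N ->
  moment (eS I0) (eS (partner a b I0)) a b != 0.
Proof.
move=> ab aI bI I04; rewrite moment_entry oppr_eq0.
have aP : a \in partner a b I0 by rewrite !inE eqxx.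
have bP : b \notin partner a b I0 by rewrite !inE eqxx (eq_sym b a) (negbTE ab).
have [s s0 ->] := lact_delta_eS aP bP; rewrite wedgeZr mulf_neq0 //.
have -> : b |: partner a b I0 :\ a = ~: I0.
  apply/setP => x; rewrite !inE; case: (eqVneq x b) => [->|xb] /=; first by rewrite bI.
  by case: (eqVneq x a) => [->|xa] //=; rewrite ?aI.
have I4 : #|I0| == 4%N by rewrite I04.
by have := sg4_neq0 K (Sub I0 I4 : sub4); rewrite /sg4 !e4_eS.
Qed.

(** Since one entry at one pair of basis vectors determines the map, it suffices to subtract the
    multiple of [moment] that agrees with it there. *)
Lemma equivariant_moment (phi : ext4 K -> ext4 K -> 'M[K]_8) :
  (forall v, linear (phi v)) -> (forall w, linear (phi^~ w)) ->
  (forall X v w, X *m phi v w - phi v w *m X = phi (lact X v) w + phi v (lact X w)) ->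
  (forall v w, \tr (phi v w) = 0) ->
  exists c, forall v w, phi v w = c *: moment v w.
Proof.
move=> linr linl eqv tr0.
pose a := ord0 : 'I_8; pose b := Ordinal (isT : 1 < 8)%N.
pose I0 : {set 'I_8} := [set ord0; Ordinal (isT : 2 < 8)%N; Ordinal (isT : 3 < 8)%N; Ordinal (isT : 4 < 8)%N].
have ab : a != b by [].
have aI : a \in I0 by rewrite !inE.
have bI : b \notin I0 by rewrite !inE.
have I04 : #|I0| = 4%N by rewrite /I0 -!setUA !cardsU1 !inE cards1.
have m0 := moment_partner_neq0 ab aI bI I04.
pose c := phi (eS I0) (eS (partner a b I0)) a b / moment (eS I0) (eS (partner a b I0)) a b.
exists c => v w; apply/eqP; rewrite -subr_eq0; apply/eqP.
apply: (@equivariant_eq0 a b ab (fun v w => phi v w - c *: moment v w) _ _ _ I0) => //.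
- by move=> x s y z; rewrite linr linearP scalerDr scalerBr opprD addrACA !scalerA [c * s]mulrC.
- move=> y s x z; rewrite linl momentDl momentZl scalerDr scalerBr opprD addrACA !scalerA.
  by rewrite [c * s]mulrC.
- move=> X x y; rewrite mulmxBr mulmxBl -scalemxAr -scalemxAl.
  rewrite [RHS]addrACA -opprD -scalerDr -moment_lact -eqv.
  by rewrite scalerBr !opprD !opprK [RHS]addrACA.
- by rewrite !mxE /c divfK // subrr.
- by move=> x y; rewrite linearB linearZ /= tr0 tr_moment0 mulr0 subrr.
Qed.
End Unique.

(** Each coordinate is a polynomial in t with infinitely many roots. This serves to extract the
    linear term of an exponential. *)
Lemma poly_vector_eq0 (K : numFieldType) (V : vectType K) n (u : 'I_n -> V) :
  (forall t : K, \sum_(k < n) t ^+ k *: u k = 0) -> forall k, u k = 0.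
Proof.
move=> h k; have := coord_vbasis (memvf (u k)) => ->; rewrite big1 // => i _.
pose c k := coord (vbasis fullv) i (u k); rewrite -/(c k).
pose p := \poly_(j < n) (if insub j is Some k then c k else 0).
have pt t : p.[t] = 0.
  rewrite horner_poly; have := congr1 (coord (vbasis fullv) i) (h t).
  rewrite linear_sum linear0 => e; rewrite -[RHS]e; apply: eq_bigr => j _.
  by rewrite linearZ /= valK mulrC.
have p0 : p = 0.
  apply/eqP; apply: contraT => np; have := @max_poly_roots _ p [seq j%:R | j <- iota 0 (size p)] np.
  rewrite size_map size_iota ltnn => -> //.
    by apply/allP => _ /mapP[j _ ->]; rewrite rootE pt.
  by rewrite map_inj_uniq ?iota_uniq //; apply: (@mulrIn K); rewrite oner_eq0.
have : p`_k = 0 by rewrite p0 coef0.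
by rewrite coef_poly ltn_ord valK => ->; rewrite scale0r.
Qed.

(** * Reading the bracket of the given Lie algebra off its grading *)

Section Lie.
Variables (K : fieldType) (g : vectType K) (ad : 'Hom(g, 'End(g))).
Hypothesis lie_g : lie_algebra ad.

Lemma adDl x y z : ad (x + y) z = ad x z + ad y z.
Proof. by rewrite (linearD ad) add_lfunE. Qed.
Lemma adNl x z : ad (- x) z = - ad x z.
Proof. by rewrite (linearN ad) opp_lfunE. Qed.
Lemma adZl a x z : ad (a *: x) z = a *: ad x z.
Proof. by rewrite linearZ scale_lfunE. Qed.

Lemma ad_anti x y : ad x y = - ad y x.
Proof.
have [h _] := lie_g; have := h (x + y); rewrite adDl !linearD /= !h.
by rewrite add0r addr0 => /eqP; rewrite addr_eq0 => /eqP.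
Qed.

Lemma ad_jacobi x y z : ad (ad x y) z = ad x (ad y z) - ad y (ad x z).
Proof.
have [_ h] := lie_g; have := h x y z; rewrite (ad_anti z x) (ad_anti z (ad x y)) linearN /=.
by move/eqP; rewrite subr_eq0 => /eqP <-.
Qed.
End Lie.

Section ReadOff.
Variables (K : numFieldType) (g : vectType K) (ad : 'Hom(g, 'End(g))).
Hypotheses (lie_g : lie_algebra ad) (simple_g : simple_lie ad).
Variables (theta : 'End(g)) (psi : 'Hom('M[K]_8, g)) (Psi : 'M[K]_8 -> 'End(g)).
Variable iota : 'Hom(ext4 K, g).
Hypothesis theta_ad : forall x y, theta (ad x y) = ad (theta x) (theta y).
Hypothesis theta2 : (theta \o theta)%VF = \1%VF.
Hypothesis psi_bracket : forall X Y : 'M[K]_8, \tr X = 0 -> \tr Y = 0 ->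
    psi (X *m Y - Y *m X) = ad (psi X) (psi Y).
Hypothesis psi_inj : forall X : 'M[K]_8, \tr X = 0 -> psi X = 0 -> X = 0.
Hypothesis psi_image : forall y,
    y \in grade0 theta <-> exists2 X : 'M[K]_8, \tr X = 0 & psi X = y.
Hypothesis lift_exp : forall X : 'M[K]_8, X ^+ 8 = 0 -> forall y,
    Psi (\sum_(k < 8) (k`!%:R)^-1 *: X ^+ k) y = exp_nilp (ad (psi X)) y.
Hypothesis iota_inj : lker iota = 0%VS.
Hypothesis iota_image : limg iota = grade1 theta.
Hypothesis iota_equiv : forall (P : 'M[K]_8) v, \det P = 1 ->
    iota (ext4_act P v) = Psi P (iota v).

Lemma grade0E x : (x \in grade0 theta) = (theta x == x).
Proof.
by rewrite memv_ker !(add_lfunE, opp_lfunE, scale_lfunE, id_lfunE) scale1r subr_eq0.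
Qed.

Lemma grade1E x : (x \in grade1 theta) = (theta x == - x).
Proof.
by rewrite memv_ker !(add_lfunE, opp_lfunE, scale_lfunE, id_lfunE) scaleN1r opprK addr_eq0.
Qed.

(** [exp_nilp] is truncated at the dimension of [g], so its term of degree one is present only when
    this dimension exceeds 1. *)
Lemma dim_g_gt1 : (1 < \dim {:g})%N.
Proof.
have [[x [y xy]] _] := simple_g; rewrite ltnNge; apply: contra xy => dg.
have x0 : x != 0 \/ x = 0 by case: eqVneq; [right | left].
case: x0 => [x0|->]; last by rewrite linear0 lfunE.
have /eqP xf : (<[x]> == fullv)%VS by rewrite eqEdim subvf dim_vline x0.
have : y \in <[x]>%VS by rewrite xf memvf.
by case/vlineP=> a ->; rewrite linearZ /= (lie_g.1 x) scaler0.
Qed.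

Lemma det_transvection i j (t : K) : i != j -> \det (1%:M + t *: delta_mx i j : 'M[K]_8) = 1.
Proof.
move=> ij; have dg k : (1%:M + t *: delta_mx i j : 'M[K]_8) k k = 1.
  rewrite !mxE eqxx; case: (k =P i) => [->|_]; last by rewrite mulr0 addr0.
  by rewrite (negbTE ij) mulr0 addr0.
have [lt|ge] := ltnP j i.
  rewrite det_trig; first by rewrite big1.
  apply/is_trig_mxP => k l kl; rewrite !mxE -val_eqE /= (ltn_eqF kl) add0r.
  case: (k =P i) => [ki|_]; last by rewrite mulr0.
  by case: (l =P j) => [lj|_]; rewrite ?andbF ?mulr0 //; move: lt; rewrite -ki -lj ltnNge (ltnW kl).
rewrite -det_tr det_trig; first by rewrite big1 // => k _; rewrite mxE dg.
apply/is_trig_mxP => k l kl; rewrite !mxE -val_eqE /= (gtn_eqF kl) add0r.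
case: (l =P i) => [li|_]; last by rewrite mulr0.
case: (k =P j) => [kj|_]; rewrite ?andbF ?mulr0 //.
by move: ge; rewrite -li -kj leqNgt kl.
Qed.

(** On [iota v], both exp (t ad (psi E)) and the action of 1 + t E are polynomial in t; comparing
    the coefficients of t differentiates the equivariance of [iota]. *)
Lemma ad_psi_delta i j v : i != j ->
  ad (psi (delta_mx i j)) (iota v) = iota (lact (delta_mx i j) v).
Proof.
move=> ij; set E : 'M[K]_8 := delta_mx i j; set A := ad (psi E).
have EE : E *m E = 0 by rewrite /E mul_delta_mx_0 // eq_sym.
pose n := \dim {:g}.
pose u (k : 'I_n) := (k`!%:R : K)^-1 *: iter k A (iota v)
   - (if k == 0%N :> nat then iota v else if k == 1%N :> nat then iota (lact E v) else 0).
have hu t : \sum_(k < n) t ^+ k *: u k = 0.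
  have tE : (t *: E) ^+ 8 = 0.
    by rewrite (exprD _ 2 6) expr2 -mulmxE -scalemxAl -scalemxAr EE !scaler0 mul0mx.
  have := lift_exp tE (iota v).
  have -> : \sum_(k < 8) (k`!%:R)^-1 *: (t *: E) ^+ k = 1%:M + t *: E.
    rewrite 2!big_ord_recl big1 ?addr0 => [|k _].
      by rewrite /= expr0 expr1 !invr1 !scale1r.
    by rewrite /= !exprS mulrA -mulmxE -scalemxAl -scalemxAr EE !scaler0 mul0mx scaler0.
  rewrite -iota_equiv ?det_transvection // act_transvection // => e.
  have {}e : iota v + t *: iota (lact E v) = \sum_(k < n) t ^+ k *: ((k`!%:R : K)^-1 *: iter k A (iota v)).
    rewrite -linearZ -linearD /= e /exp_nilp; apply: eq_bigr => k _; rewrite scalerA mulrC -scalerA.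
    congr (_ *: _); elim: (k : nat) => [|m IH] /=; first by rewrite expr0 scale1r.
    by rewrite IH linearZ /= [psi _]linearZ /= adZl scalerA -exprSr.
  have -> : \sum_(k < n) t ^+ k *: u k = \sum_(k < n) t ^+ k *: ((k`!%:R : K)^-1 *: iter k A (iota v))
     - \sum_(k < n) t ^+ k *: (if k == 0%N :> nat then iota v else if k == 1%N :> nat then iota (lact E v) else 0).
    by rewrite -sumrB; apply: eq_bigr => k _; rewrite -scalerBr.
  rewrite -e; apply/eqP; rewrite subr_eq0; apply/eqP.
  have := dim_g_gt1; rewrite -/n; case: (n) => [|[|m]] // _.
  rewrite 2!big_ord_recl big1 ?addr0 => [|k _]; last by rewrite /= scaler0.
  by rewrite /= expr0 expr1 scale1r.
have := poly_vector_eq0 hu (Ordinal dim_g_gt1); rewrite /u /= invr1 scale1r => /eqP.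
by rewrite subr_eq0 => /eqP.
Qed.

Lemma ad_psi X v : \tr X = 0 -> ad (psi X) (iota v) = iota (lact X v).
Proof.
move=> tX.
(* A difference of diagonal units is a bracket of two off-diagonal ones, so this case follows from
   [ad_psi_delta] and the Jacobi identity. *)
have dg i : i != ord0 -> ad (psi (delta_mx i i - delta_mx ord0 ord0)) (iota v)
    = iota (lact (delta_mx i i - delta_mx ord0 ord0) v).
  move=> i0; have e : delta_mx i i - delta_mx ord0 ord0 =
     (delta_mx i ord0 : 'M[K]_8) *m delta_mx ord0 i - (delta_mx ord0 i : 'M[K]_8) *m delta_mx i ord0 :> 'M[K]_8.
    by rewrite !mul_delta_mx.
  rewrite e psi_bracket ?tr_delta ?(negbTE i0) 1?eq_sym ?(negbTE i0) // ad_jacobi //.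
  by rewrite !ad_psi_delta // 1?eq_sym // lact_rep linearB.
have -> : X = \sum_i (\sum_(j | j != i) X i j *: delta_mx i j +
      X i i *: (delta_mx i i - delta_mx ord0 ord0)).
  rewrite {1}[X]matrix_sum_delta big_split /=.
  under [X in _ + X]eq_bigr => i _ do rewrite scalerBr.
  rewrite sumrB -scaler_suml -/(\tr X) tX scale0r subr0 -big_split; apply: eq_bigr => i _.
  by rewrite (bigD1 i) //= addrC.
have ad_sum (T : Type) (r : seq T) (P : pred T) (F : T -> g) z :
   ad (\sum_(t <- r | P t) F t) z = \sum_(t <- r | P t) ad (F t) z.
  by rewrite linear_sum sum_lfunE.
rewrite linear_sum ad_sum lact_suml linear_sum; apply: eq_bigr => i _.
rewrite lactDl (linearD psi) (linearD iota) /= adDl; congr (_ + _).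
  rewrite (linear_sum psi) /= ad_sum lact_suml linear_sum /=.
  apply: eq_bigr => j ji; rewrite linearZ /= adZl ad_psi_delta; last by rewrite eq_sym.
  by rewrite lactZl linearZ.
rewrite [psi _]linearZ /= adZl lactZl linearZ /=; congr (_ *: _).
have [->|/dg->] // := eqVneq i ord0.
by rewrite subrr lact0l !linear0 lfunE.
Qed.

(** [psi] is constrained only on sl(8), while the calculus with [lact] and [moment] runs over gl(8);
    this projection mediates between the two. *)
Definition tl8 (X : 'M[K]_8) : 'M[K]_8 := X - (\tr X / 8%:R)%:M.

Lemma tr_tl8 X : \tr (tl8 X) = 0.
Proof.
by rewrite /tl8 linearB /= mxtrace_scalar -[_ *+ 8]mulr_natr divfK ?subrr // pnatr_eq0.
Qed.

Lemma tl8_id X : \tr X = 0 -> tl8 X = X.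
Proof. by rewrite /tl8 => ->; rewrite mul0r raddf0 subr0. Qed.

Fact tl8_is_linear : linear tl8.
Proof.
move=> a X Y; rewrite /tl8 linearP /= scalerBr addrACA -opprD; congr (_ - _).
by rewrite mulrDl raddfD /= -mulrA scale_scalar_mx.
Qed.

Lemma scalar_lact a v : lact (a%:M : 'M[K]_8) v = 0.
Proof. by rewrite -scalemx1 lactZl lact1 scaler0. Qed.

Lemma lact_tl8 X v : lact (tl8 X) v = lact X v.
Proof. by rewrite /tl8 lactBl scalar_lact subr0. Qed.

Lemma bracket_tl8 X Y : tl8 X *m Y - Y *m tl8 X = X *m Y - Y *m X.
Proof.
by rewrite /tl8 mulmxBl mulmxBr opprB scalar_mxC addrA subrK.
Qed.

Lemma tr_bracket (X Y : 'M[K]_8) : \tr (X *m Y - Y *m X) = 0.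
Proof. by rewrite linearB /= mxtrace_mulC subrr. Qed.

Lemma iota_grade1 v : theta (iota v) = - iota v.
Proof. by apply/eqP; rewrite -grade1E -iota_image memv_img // memvf. Qed.

(** The bracket of two odd elements is even; read through [psi] it is an invariant bilinear map with
    traceless values, to which [equivariant_moment] applies. *)
Lemma ad_iota : exists2 c, c != 0 & forall v w, ad (iota v) (iota w) = psi (c *: moment v w).
Proof.
pose tlL : {linear 'M[K]_8 -> 'M[K]_8} := HB.pack tl8 (GRing.isLinear.Build K _ _ _ _ tl8_is_linear).
pose psi0 : 'Hom('M[K]_8, g) := (psi \o linfun tlL)%VF.
have psi0E X : psi0 X = psi (tl8 X) by rewrite comp_lfunE lfunE.
pose b v w := tl8 ((psi0^-1)%VF (ad (iota v) (iota w))).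
have bE v w : psi (b v w) = ad (iota v) (iota w).
  have : ad (iota v) (iota w) \in limg psi0.
    have /psi_image[X tX <-] : ad (iota v) (iota w) \in grade0 theta.
      by rewrite grade0E theta_ad !iota_grade1 adNl linearN opprK.
    by rewrite -(tl8_id tX) -psi0E memv_img ?memvf.
  by move/limg_lfunVK; rewrite psi0E.
have btr v w : \tr (b v w) = 0 by apply: tr_tl8.
have inj X Y : \tr X = 0 -> \tr Y = 0 -> psi X = psi Y -> X = Y.
  move=> tX tY e; apply/eqP; rewrite -subr_eq0; apply/eqP/psi_inj.
    by rewrite linearB /= tX tY subrr.
  by rewrite linearB /= e subrr.
have [c hc] : exists c, forall v w, b v w = c *: moment v w.
  apply: equivariant_moment => // [v s x y|w s x y|X v w].
  - apply: inj => //; first by rewrite linearP /= !btr mulr0 addr0.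
    by rewrite linearP /= !bE !linearP.
  - apply: inj => //; first by rewrite linearP /= !btr mulr0 addr0.
    by rewrite linearP /= !bE linearP /= adDl adZl.
  rewrite -[X in X *m _ - _]/(X) -(bracket_tl8 X) -!(lact_tl8 X).
  have tX := tr_tl8 X; move: (tl8 X) tX => {}X tX.
  apply: inj; [exact: tr_bracket | by rewrite linearD /= !btr addr0 |].
  rewrite (psi_bracket tX (btr v w)) bE.
  transitivity (psi (b (lact X v) w) + psi (b v (lact X w))); last by symmetry; apply: (linearD psi).
  rewrite !bE -(ad_psi v tX) -(ad_psi w tX).
  by rewrite ad_jacobi // subrK.
exists c; last by move=> v w; rewrite -bE hc.
(* If c were 0, the image of [iota] would be an abelian ideal: it is not zero because [iota] is
   injective, and not all of [g] because [g] is not abelian. *)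
apply/eqP => c0.
have ad0 v w : ad (iota v) (iota w) = 0 by rewrite -bE hc c0 scale0r linear0.
have [[x0 [y0 xy]] ideals] := simple_g.
have t2 y : theta (theta y) = y by rewrite -comp_lfunE theta2 id_lfunE.
have split x : exists X v, \tr X = 0 /\ x = psi X + iota v.
  have /psi_image[X tX pX] : 2%:R^-1 *: (x + theta x) \in grade0 theta.
    by rewrite grade0E linearZ linearD /= t2 addrC.
  have : 2%:R^-1 *: (x - theta x) \in limg iota.
    by rewrite iota_image grade1E linearZ linearB /= t2 -scalerN opprB.
  case/memv_imgP=> v _ vE; exists X, v; split=> //.
  rewrite pX -vE -scalerDr addrACA subrr addr0 -mulr2n -scaler_nat scalerA mulVf ?scale1r //.
  by rewrite pnatr_eq0.
case: (ideals (limg iota)).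
- move=> x _ /memv_imgP[v _ ->]; have [X [w [tX ->]]] := split x.
  by rewrite adDl ad_psi // ad0 addr0 memv_img ?memvf.
- pose f0 : quad := [ffun b => lsh b].
  have li : injective f0 by move=> x y; rewrite !ffunE => h; apply: (@lshift_inj 4 4 x y h).
  pose I := im4 li; have := memv_img iota (memvf (e4 K I)).
  move=> + e; rewrite e memv0 -memv_ker iota_inj memv0 => /eqP/ffunP/(_ I)/eqP.
  by rewrite e4E eqxx ext4_0 oner_eq0.
move=> e; case/negP: xy; apply/eqP.
have /memv_imgP[v _ ->] : x0 \in limg iota by rewrite e memvf.
have /memv_imgP[w _ ->] : y0 \in limg iota by rewrite e memvf.
exact: ad0.
Qed.
End ReadOff.

(** * The graded algebra gl(8) + ext4 and its trace form *)

Notation ee K := ('M[K]_8 * ext4 K)%type.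

Definition Dfun (K : numFieldType) (u : ext4 K) (p : ee K) : ee K :=
  (moment u p.2, - lact p.1 u).

Fact Dfun_is_linear (K : numFieldType) (u : ext4 K) : linear (Dfun u).
Proof.
move=> a x y; rewrite /Dfun /= linearP lactDl lactZl opprD -scalerN.
by apply: injective_projections.
Qed.
HB.instance Definition _ (K : numFieldType) (u : ext4 K) :=
  GRing.isLinear.Build K _ _ _ (Dfun u) (Dfun_is_linear u).

HB.lock Definition Dop (K : numFieldType) (u : ext4 K) : 'End(ee K) := linfun (Dfun u).

Definition adXfun (K : numFieldType) (X : 'M[K]_8) (p : ee K) : ee K :=
  (X *m p.1 - p.1 *m X, lact X p.2).
Fact adXfun_is_linear (K : numFieldType) (X : 'M[K]_8) : linear (adXfun X).
Proof.
move=> a x y; rewrite /adXfun /= lactDr lactZr.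
apply: injective_projections => //=.
rewrite mulmxDr mulmxDl -scalemxAr -scalemxAl opprD addrACA; congr (_ + _).
by rewrite scalerBr.
Qed.
HB.instance Definition _ (K : numFieldType) (X : 'M[K]_8) :=
  GRing.isLinear.Build K _ _ _ (adXfun X) (adXfun_is_linear X).

HB.lock Definition adX (K : numFieldType) (X : 'M[K]_8) : 'End(ee K) :=
  linfun (adXfun X).

Section Bracket.
Variable K : numFieldType.
Implicit Types (u v w : ext4 K) (X Y Z : 'M[K]_8).

(* gl(8) + ext4 with this bracket is the reductive Lie algebra E_7 + center,
   provided that the Jacobi identity [moment_jacobi] holds; [Dop u] and [adX X] are the
   brackets with (0, u) and (X, 0). *)
Definition brP (x y : ee K) : ee K :=
  (x.1 *m y.1 - y.1 *m x.1 + moment x.2 y.2, lact x.1 y.2 - lact y.1 x.2).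

Lemma DopE u p : Dop u p = (moment u p.2, - lact p.1 u).
Proof. by rewrite Dop.unlock lfunE. Qed.

Fact Dop_is_linear : linear (@Dop K).
Proof.
move=> a u v; apply/lfunP => p; rewrite add_lfunE scale_lfunE !DopE.
by rewrite momentDl momentZl lactDr lactZr opprD -scalerN; apply: injective_projections.
Qed.
HB.instance Definition _ := GRing.isLinear.Build K _ _ _ (@Dop K) Dop_is_linear.

Lemma momentDr u v w : moment u (v + w) = moment u v + moment u w.
Proof. exact: (linearD (@moment K u)). Qed.
Lemma momentBr u v w : moment u (v - w) = moment u v - moment u w.
Proof. exact: (linearB (@moment K u)). Qed.
Lemma momentNr u v : moment u (- v) = - moment u v.
Proof. exact: (linearN (@moment K u)). Qed.
Lemma momentZr a u v : moment u (a *: v) = a *: moment u v.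
Proof. exact: (linearZZ (@moment K u)). Qed.
Lemma moment0r u : moment u 0 = 0.
Proof. exact: (linear0 (@moment K u)). Qed.

Fact brP_linr x : linear (brP x).
Proof.
move=> a y z; rewrite /brP; apply: injective_projections => /=.
  rewrite mulmxDr mulmxDl -scalemxAr -scalemxAl momentDr momentZr.
  move: (x.1 *m y.1) (x.1 *m z.1) (y.1 *m x.1) (z.1 *m x.1) (moment x.2 y.2) (moment x.2 z.2).
  by move=> b c d e f h; apply/matrixP => i j; rewrite !mxE; ring.
by rewrite lactDr lactZr lactDl lactZl opprD scalerBr addrACA.
Qed.

Lemma brPC x y : brP x y = - brP y x.
Proof.
rewrite /brP; apply: injective_projections => /=; last by rewrite opprB.
by rewrite opprD opprB -momentC.
Qed.

Fact brP_linl y : linear (brP^~ y).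
Proof.
by move=> a x z; rewrite brPC brP_linr opprD -scalerN -!brPC.
Qed.

Hypothesis jac : forall u v w,
  lact (moment u v) w + lact (moment v w) u + lact (moment w u) v = 0.

Lemma Dop_derivation u x y : Dop u (brP x y) = brP (Dop u x) y + brP x (Dop u y).
Proof.
rewrite !DopE /brP; apply: injective_projections => /=.
  rewrite !momentNl !momentNr momentBr.
  have h1 := moment_lact y.1 u x.2; have h2 := moment_lact x.1 u y.2.
  rewrite -(opprB (y.1 *m _)) h1 h2 (momentC x.2 (lact y.1 u)).
  move: (moment u (lact x.1 y.2)) (moment u (lact y.1 x.2)) (moment (lact y.1 u) x.2)
    (moment (lact x.1 u) y.2) => a b c d.
  by apply/matrixP => i j; rewrite !mxE; ring.
rewrite lactDl lact_rep !lactNr.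
have h := jac u x.2 y.2; rewrite (momentC y.2 u) lactNl in h.
move: (lact (moment u x.2) y.2) (lact (moment x.2 y.2) u) (lact (moment u y.2) x.2) h => a b c h.
have -> : b = c - a by apply/eqP; rewrite -subr_eq0 -h; apply/eqP; ext4ring.
by move: (lact _ (lact _ _)) (lact _ (lact _ _)) => d e; ext4ring.
Qed.

Lemma adXE X p : adX X p = (X *m p.1 - p.1 *m X, lact X p.2).
Proof. by rewrite adX.unlock lfunE. Qed.

Lemma Dop_comm u v p : Dop u (Dop v p) - Dop v (Dop u p) = adX (moment u v) p.
Proof.
rewrite !DopE adXE; apply: injective_projections => /=.
  rewrite !momentNr opprK -(opprB (p.1 *m _)) moment_lact (momentC (lact p.1 u)).
  by rewrite opprD opprK addrC.
have h := jac u v p.2; rewrite (momentC p.2 u) lactNl in h.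
by move: h; move: (lact _ p.2) (lact _ u) (lact _ v) => a b c h; rewrite -[RHS]addr0 -oppr0 -h; ext4ring.
Qed.

Lemma adX_Dop X u p : adX X (Dop u p) - Dop u (adX X p) = Dop (lact X u) p.
Proof.
rewrite !adXE !DopE; apply: injective_projections => /=.
  by rewrite moment_lact addrK.
by rewrite lactNr lact_rep; ext4ring.
Qed.

(** The blocks gl(8) and ext4 contribute the Casimir scalar 18 each. *)
Lemma trace_DD u w : end_trace (Dop u \o Dop w)%VF = 36%:R * wedge u w.
Proof.
pose I : finType := (('I_8 * 'I_8) + sub4)%type.
pose b (k : I) : ee K :=
  match k with inl ij => (delta_mx ij.1 ij.2, 0) | inr J => (0, e4 K J) end.
pose ph (k : I) (p : ee K) : K^o :=
  match k with inl ij => p.1 ij.1 ij.2 | inr J => p.2 J end.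
have phl k : linear (ph k) by case: k => [ij|J] a x y /=; rewrite ?mxE ?ext4D ?ext4Z.
pose phL k : {linear ee K -> K^o} := HB.pack (ph k) (GRing.isLinear.Build K _ _ _ _ (phl k)).
rewrite (@end_traceE _ _ I b phL) => [|p]; last first.
  rewrite big_sumType /= /b /ph /=; apply: injective_projections.
    rewrite raddfD /= !raddf_sum /= [X in _ + X]big1 ?addr0 => [|J _]; last by rewrite scaler0.
    by rewrite {1}[p.1]matrix_sum_delta pair_bigA.
  rewrite raddfD /= !raddf_sum /= [X in X + _]big1 ?add0r => [|ij _]; last by rewrite scaler0.
  exact: ext4E.
rewrite big_sumType /=.
have -> : \sum_(k : 'I_8 * 'I_8) ph (inl k) ((Dop u \o Dop w)%VF (b (inl k))) = 18%:R * wedge u w.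
  rewrite -wedgeZr -casimir wedge_sumr; under [RHS]eq_bigr => i _ do rewrite wedge_sumr.
  rewrite [RHS]pair_bigA /=; apply: eq_bigr => [[i j]] _ /=.
  by rewrite comp_lfunE !DopE /= moment_entry lactNr wedgeNr opprK.
have -> : \sum_(J : sub4) ph (inr J) ((Dop u \o Dop w)%VF (b (inr J))) = 18%:R * wedge u w.
  rewrite wedgeC -wedgeZr -casimir wedge_sumr; under [RHS]eq_bigr => i _ do rewrite wedge_sumr.
  rewrite /= .
  have e J : ((Dop u \o Dop w)%VF (0, e4 K J)).2 J =
    - \sum_i \sum_j wedge (lact (delta_mx j i) w) (e4 K J) * lact (delta_mx i j) u J.
    rewrite comp_lfunE !DopE /= ext4N; congr (- _).
    rewrite {1}[moment _ _]matrix_sum_delta lact_suml ext4_sum; apply: eq_bigr => i _.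
    rewrite lact_suml ext4_sum; apply: eq_bigr => j _.
    by rewrite lactZl ext4Z moment_entry wedge_lact.
  rewrite (eq_bigr _ (fun J _ => e J)) sumrN exchange_big -sumrN; apply: eq_bigr => i _ /=.
  rewrite exchange_big -sumrN; apply: eq_bigr => j _ /=.
  transitivity (- wedge (lact (delta_mx j i) w) (lact (delta_mx i j) u)).
    rewrite [in RHS](ext4E (lact (delta_mx i j) u)) wedge_sumr; congr (- _).
    by apply: eq_bigr => J _; rewrite wedgeZr mulrC.
  by rewrite wedge_lact opprK.
by ring.
Qed.
End Bracket.

(** * Extension of scalars *)

Section BaseChange.
Variables (K L : numFieldType) (f : {rmorphism K -> L}).
Implicit Types (v w : ext4 K) (X Y P : 'M[K]_8).

Definition emap v : ext4 L := [ffun I => f (v I)].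

Lemma emapE v I : emap v I = f (v I). Proof. exact: ffunE. Qed.

Lemma emapD v w : emap (v + w) = emap v + emap w.
Proof. by apply/ffunP => I; rewrite ext4D !emapE ext4D rmorphD. Qed.
Lemma emapN v : emap (- v) = - emap v.
Proof. by apply/ffunP => I; rewrite ext4N !emapE ext4N rmorphN. Qed.
Lemma emapB v w : emap (v - w) = emap v - emap w.
Proof. by rewrite emapD emapN. Qed.
Lemma emapZ a v : emap (a *: v) = f a *: emap v.
Proof. by apply/ffunP => I; rewrite ext4Z !emapE ext4Z rmorphM. Qed.
Lemma emap0 : emap 0 = 0.
Proof. by apply/ffunP => I; rewrite ext4_0 emapE ext4_0 rmorph0. Qed.
Lemma emap_sum (T : Type) (r : seq T) (P : pred T) (F : T -> ext4 K) :
  emap (\sum_(t <- r | P t) F t) = \sum_(t <- r | P t) emap (F t).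
Proof. exact: (big_morph _ emapD emap0). Qed.

Lemma emap_inj : injective emap.
Proof.
by move=> v w e; apply/ffunP => I; apply: (fmorph_inj f); rewrite -!emapE e.
Qed.

Lemma emap_bv g : emap (bv K g) = bv L g.
Proof.
apply/ffunP => I; rewrite emapE !bvE -det_map_mx; congr (\det _).
by apply/matrixP => a b; rewrite !mxE rmorph_nat.
Qed.

Lemma emap_e4 I : emap (e4 K I) = e4 L I.
Proof. by rewrite -!bv_idx emap_bv. Qed.

Lemma emap_lact X v : emap (lact X v) = lact (map_mx f X) (emap v).
Proof.
rewrite !lactE emapB emapZ emap_sum; congr (_ - _ *: _); last first.
  by rewrite rmorphM /= fmorphV rmorph_nat trace_map_mx.
apply: eq_bigr => I _; rewrite emapZ emapE; congr (_ *: _).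
rewrite /dact emap_sum; apply: eq_bigr => b _; rewrite emap_sum.
by apply: eq_bigr => i _; rewrite emapZ emap_bv mxE.
Qed.

Lemma eps8_map g h : f (eps8 K g h) = eps8 L g h.
Proof.
rewrite eps8.unlock -det_map_mx; congr (\det _).
by apply/matrixP => i j; rewrite !mxE; case: splitP => k _; rewrite !mxE rmorph_nat.
Qed.

Lemma emap_wedge v w : wedge (emap v) (emap w) = f (wedge v w).
Proof.
rewrite wedge.unlock rmorph_sum; apply: eq_bigr => I _.
rewrite rmorph_sum; apply: eq_bigr => J _.
by rewrite !emapE !rmorphM /= eps8_map.
Qed.

Lemma map_delta8 i j : map_mx f (delta_mx i j : 'M[K]_8) = delta_mx i j.
Proof. by apply/matrixP => a b; rewrite !mxE rmorph_nat. Qed.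

Lemma emap_moment v w : moment (emap v) (emap w) = map_mx f (moment v w).
Proof.
apply/matrixP => i j; rewrite mxE !moment_entry rmorphN /=.
by rewrite -emap_wedge emap_lact map_delta8.
Qed.

End BaseChange.

Section Complex.
Variable R : rcfType.
Local Notation C := R[i].

Lemma complexify_emap (v : ext4 R) : ext4_complexify v = emap (real_complex R) v.
Proof. by apply/ffunP => I; rewrite !ffunE. Qed.
End Complex.

(** * Transfer of commutation and semisimplicity from g to gl(8) + ext4 *)

HB.instance Definition _ (K : numFieldType) :=
  GRing.isLinear.Build K 'M[K]_8 'M[K]_8 _ (@tl8 K) (@tl8_is_linear K).

Lemma peval_intertwine (K : fieldType) (V W : vectType K) (j : {linear V -> W})
    (f : 'End(V)) (h : 'End(W)) (q : {poly K}) p :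
  (forall x, j (f x) = h (j x)) -> peval h q (j p) = j (peval f q p).
Proof.
move=> jf; elim/poly_ind: q p => [|q c IH] p; first by rewrite !peval0 linear0.
by rewrite !pevalD !pevalMX !pevalC -jf IH linearD linearZ.
Qed.

Lemma semisimple_scale (K : fieldType) (V : vectType K) (f : 'End(V)) a :
  a != 0 -> semisimple_endo f -> semisimple_endo (a *: f).
Proof.
move=> a0 ss U fU; have st W : (f @: W <= W)%VS = ((a *: f) @: W <= W)%VS.
  apply/subvP/subvP => h _ /memv_imgP[x xW ->].
    by rewrite scale_lfunE rpredZ // h // memv_img.
  have := h _ (memv_img (a *: f) xW); rewrite scale_lfunE => /(rpredZ a^-1).
  by rewrite scalerA mulVf // scale1r.
have [|W [fW h1 h2]] := ss U; first by rewrite st.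
by exists W; rewrite -st.
Qed.

Section Transfer.
Variables (K : numClosedFieldType) (g : vectType K) (ad : 'Hom(g, 'End(g))).
Hypotheses (lie_g : lie_algebra ad) (simple_g : simple_lie ad).
Variables (theta : 'End(g)) (psi : 'Hom('M[K]_8, g)).
Variable iota : 'Hom(ext4 K, g).
Hypothesis theta2 : (theta \o theta)%VF = \1%VF.
Hypothesis psi_inj : forall X : 'M[K]_8, \tr X = 0 -> psi X = 0 -> X = 0.
Hypothesis psi_image : forall y,
    y \in grade0 theta <-> exists2 X : 'M[K]_8, \tr X = 0 & psi X = y.
Hypothesis iota_inj : lker iota = 0%VS.
Hypothesis iota_image : limg iota = grade1 theta.
Hypothesis ad_psiE : forall X v, \tr X = 0 -> ad (psi X) (iota v) = iota (lact X v).
Variable c : K.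
Hypothesis c0 : c != 0.
Hypothesis ad_iotaE : forall v w, ad (iota v) (iota w) = psi (c *: moment v w).

Lemma iota_eq0 v : iota v = 0 -> v = 0.
Proof.
by move=> e; apply/eqP; rewrite -memv0 -iota_inj memv_ker e.
Qed.

Lemma ad_commuteP v w : ad (iota v) (iota w) = 0 <-> moment v w = 0.
Proof.
rewrite ad_iotaE; split=> [/psi_inj h|->]; last by rewrite scaler0 linear0.
have /eqP : c *: moment v w = 0 by apply: h; rewrite linearZ /= tr_moment0 mulr0.
by rewrite scaler_eq0 (negbTE c0) => /eqP.
Qed.

(** After multiplication by c, [iota] carries each summand to a double bracket in [g], so the
    identity is the one of [g]. *)
Lemma moment_jacobi (u v w : ext4 K) :
  lact (moment u v) w + lact (moment v w) u + lact (moment w u) v = 0.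
Proof.
have tr0 x y : \tr (c *: moment x y) = 0 by rewrite linearZ /= tr_moment0 mulr0.
apply/eqP; rewrite -[_ == 0]/(_ == 0) -(inj_eq (scalerI c0)) scaler0; apply/eqP/iota_eq0.
rewrite !scalerDr !linearD /= -!lactZl -!ad_psiE // -!ad_iotaE.
have [_ h] := lie_g; have := h (iota u) (iota v) (iota w).
rewrite (ad_anti lie_g (ad _ _) (iota w)) (ad_anti lie_g (ad _ _) (iota u)) (ad_anti lie_g (ad _ _) (iota v)).
by rewrite -!opprD => e; rewrite -addrA [X in - X]addrC e oppr0.
Qed.

Let s := sqrtC c^-1.
Lemma s2c : s * s * c = 1.
Proof. by rewrite -expr2 sqrtCK mulVf. Qed.
Lemma s_neq0 : s != 0.
Proof. by apply/eqP => e; have := s2c; rewrite e !mul0r => /eqP; rewrite eq_sym oner_eq0. Qed.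

(** A surjection onto [g], injective on pairs with traceless matrix, that carries [Dop x] to s ad
    (iota x). The square root s of 1/c absorbs the scalar between the bracket of [g] and
    [moment]. *)
Definition jmap (p : ee K) : g := psi (tl8 p.1) + s *: iota p.2.

Fact jmap_is_linear : linear jmap.
Proof.
move=> a p q; rewrite /jmap /= (linearP (@tl8 K)) (linearP psi) (linearP iota) /=.
by rewrite !scalerDr !scalerA [s * a]mulrC addrACA.
Qed.
HB.instance Definition _ := GRing.isLinear.Build K (ee K) g _ jmap jmap_is_linear.

Lemma jmap_surj x : exists p, x = jmap p.
Proof.
have t2 y : theta (theta y) = y by rewrite -comp_lfunE theta2 id_lfunE.
have /psi_image[X tX pX] : 2%:R^-1 *: (x + theta x) \in grade0 theta.
  by rewrite grade0E linearZ linearD /= t2 addrC.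
have : 2%:R^-1 *: (x - theta x) \in limg iota.
  by rewrite iota_image grade1E linearZ linearB /= t2 -scalerN opprB.
case/memv_imgP=> v _ vE; exists (X, s^-1 *: v).
rewrite /jmap /= linearZ /= scalerA divff ?s_neq0 // scale1r tl8_id // pX -vE.
rewrite -scalerDr addrACA subrr addr0 -mulr2n -scaler_nat scalerA mulVf ?scale1r //.
by rewrite pnatr_eq0.
Qed.

Lemma jmap_Dop x p : jmap (Dop x p) = (s *: ad (iota x)) (jmap p).
Proof.
rewrite DopE scale_lfunE /jmap /= tl8_id ?tr_moment0 // (linearN iota) scalerN.
rewrite (linearD (ad (iota x))) (linearZZ (ad (iota x))) /=.
rewrite (ad_anti lie_g (iota x)) ad_psiE ?tr_tl8 // lact_tl8 ad_iotaE.
by rewrite (linearZZ psi) scalerDr scalerN !scalerA s2c scale1r addrC.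
Qed.

Lemma jmap_eq0 p : \tr p.1 = 0 -> jmap p = 0 -> p = 0.
Proof.
move=> tp; rewrite /jmap tl8_id // => e.
have e0 : psi p.1 \in grade0 theta by apply/psi_image; exists p.1.
have e1 : s *: iota p.2 \in grade1 theta by rewrite rpredZ // -iota_image memv_img ?memvf.
have ps : psi p.1 = 0.
  move: e0 e1; rewrite grade0E grade1E => /eqP h0 /eqP h1.
  have := congr1 theta e; rewrite linearD linear0 /= h0 h1 => h2.
  have : psi p.1 + psi p.1 = 0 by rewrite -[RHS]addr0 -{2}h2 -[in RHS]e addrACA subrr addr0.
  rewrite -mulr2n -scaler_nat => /eqP; rewrite scaler_eq0 pnatr_eq0 /=.
  by move/eqP.
have /eqP : s *: iota p.2 = 0 by rewrite -e ps add0r.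
rewrite scaler_eq0 (negbTE s_neq0) => /eqP/iota_eq0 p2.
by apply: injective_projections; rewrite // (psi_inj tp).
Qed.

Lemma ad_semisimpleP x : ad_semisimple ad (iota x) <-> split_semisimple (Dop x).
Proof.
have it q p := peval_intertwine q p (jmap_Dop x).
split=> [ss|[rs urs kill]].
  have /split_of_semisimple[rs urs kill] := semisimple_scale s_neq0 ss.
  (* [jmap] kills scalar matrices. The factor X, one more application of [Dop x], brings the vector
     into the traceless part, where [jmap] is injective; the filter keeps the root 0 simple. *)
  exists (0 :: filter (predC1 0) rs).
    by rewrite /= filter_uniq // mem_filter /= eqxx.
  move=> p; rewrite big_cons subr0 pevalM pevalX; apply: jmap_eq0.
    by rewrite DopE /= tr_moment0.
  rewrite jmap_Dop -it -[_ (peval _ _ _)]pevalX -pevalM.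
  have /dvdpP[q ->] : \prod_(r <- rs) ('X - r%:P) %| 'X * \prod_(r <- filter (predC1 0) rs) ('X - r%:P).
    have -> : 'X * \prod_(r <- filter (predC1 0) rs) ('X - r%:P) =
        \prod_(r <- 0 :: filter (predC1 0) rs) ('X - r%:P) :> {poly K} by rewrite big_cons subr0.
    rewrite -(eq_bigr _ (fun r _ => expr1 ('X - r%:P))); apply: dvd_prod_XsubC_pow => // r rrs.
    rewrite expr1 (big_rem r) /= ?dvdp_mulr //.
    by rewrite inE mem_filter /= rrs andbT orbN.
  by rewrite pevalM kill linear0.
have ss : semisimple_endo (s *: ad (iota x)).
  apply: semisimple_of_split; exists rs => // y.
  by have [p ->] := jmap_surj y; rewrite it kill linear0.
rewrite /ad_semisimple -[ad _]scale1r -(mulVf s_neq0) -scalerA.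
by apply: semisimple_scale; rewrite ?invr_eq0 ?s_neq0.
Qed.
End Transfer.

(** * Maximal tori and their weights *)

Definition jacobi (K : numFieldType) := forall u v w : ext4 K,
  lact (moment u v) w + lact (moment v w) u + lact (moment w u) v = 0.

Section EEMap.
Variables (K L : numFieldType) (f : {rmorphism K -> L}).

Definition eemap (x : ee K) : ee L := (map_mx f x.1, emap f x.2).

Lemma eemapD x y : eemap (x + y) = eemap x + eemap y.
Proof. by apply: injective_projections => /=; rewrite ?map_mxD ?emapD. Qed.
Lemma eemapZ a x : eemap (a *: x) = f a *: eemap x.
Proof. by apply: injective_projections => /=; rewrite ?map_mxZ ?emapZ. Qed.
Lemma eemap0 : eemap 0 = 0.
Proof. by apply: injective_projections => /=; rewrite ?map_mx0 ?emap0. Qed.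

Lemma eemap_Dop u x : eemap (Dop u x) = Dop (emap f u) (eemap x).
Proof. by rewrite !DopE /eemap /= emap_moment emapN emap_lact. Qed.

Lemma eemap_peval u q x :
  eemap (peval (Dop u) q x) = peval (Dop (emap f u)) (map_poly f q) (eemap x).
Proof.
elim/poly_ind: q x => [|q c IH] x; first by rewrite rmorph0 !peval0 eemap0.
by rewrite rmorphD rmorphM /= map_polyX map_polyC !pevalD !pevalMX !pevalC eemapD eemapZ IH eemap_Dop.
Qed.
End EEMap.

(** * Odd derivations and Jordan decomposition inside ext4 *)

Section Parity.
Variable K : numFieldType.

Definition parity (x : ee K) : ee K := (x.1, - x.2).
Fact parity_is_linear : linear parity.
Proof.
move=> a x y; apply: injective_projections => //=.
by rewrite opprD scalerN.
Qed.
HB.instance Definition _ := GRing.isLinear.Build K (ee K) (ee K) _ parity parity_is_linear.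

Lemma parityD x y : parity (x + y) = parity x + parity y.
Proof. by apply: injective_projections; rewrite //= opprD. Qed.
Lemma parityZ a x : parity (a *: x) = a *: parity x.
Proof. by apply: injective_projections; rewrite //= scalerN. Qed.
Lemma parity0 : parity 0 = 0.
Proof. by apply: injective_projections; rewrite //= oppr0. Qed.

Lemma parity_Dop u x : parity (Dop u x) = - Dop u (parity x).
Proof.
by rewrite !DopE /parity /=; apply: injective_projections; rewrite //= momentNr opprK.
Qed.

Lemma parity_peval u q x :
  parity (peval (Dop u) q x) = peval (Dop u) (q \Po (- 'X)) (parity x).
Proof.
elim/poly_ind: q x => [|q c IH] x; first by rewrite comp_poly0 !peval0 parity0.
rewrite comp_poly_MXaddC !pevalD !pevalC parityD parityZ pevalMX IH parity_Dop mulrN.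
by rewrite pevalN pevalMX (linearN (peval _ _)).
Qed.

(** Weights differ: a diagonal unit acts on [eS S] by 1/2 or -1/2, but on a matrix entry by an
    integer. *)
Lemma equivariant_gl8_eq0 (b : ext4 K -> 'M[K]_8) : linear b ->
  (forall X v, b (lact X v) = X *m b v - b v *m X) -> forall v, b v = 0.
Proof.
move=> lb h v; pose B : {linear ext4 K -> 'M[K]_8} := HB.pack b (GRing.isLinear.Build K _ _ _ _ lb).
move: v; apply: eS_ind => // S S4; apply/matrixP => i j; rewrite mxE.
have [[k kS]|] : (exists k, k \in S) \/ (forall k, k \notin S); last 1 first.
- by move=> S0; move: S4; rewrite (_ : S = set0) ?cards0 //; apply/setP => k; rewrite inE (negbTE (S0 k)).
- by case: (set_0Vmem S) => [->|[x xS]]; [right=> k; rewrite inE | left; exists x].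
have e k' : ((k' \in S)%:R - 2%:R^-1) * b (eS K S) i j = ((i == k')%:R - (j == k')%:R) * b (eS K S) i j.
  clear k kS; move: k' => k; have := congr1 (fun M : 'M[K]_8 => M i j) (h (delta_mx k k) (eS K S)).
  rewrite lact_diag_eS [b _](linearZZ B) /= mxE => ->; rewrite !mxE; rewrite mulrBl; congr (_ - _).
    rewrite (bigD1 k) //= big1 => [|l lk]; last by rewrite mxE (negbTE lk) andbF mul0r.
    by rewrite mxE eqxx andbT addr0; case: eqP => [->|]; rewrite ?mul0r.
  rewrite (bigD1 k) //= big1 => [|l lk]; last by rewrite mxE (negbTE lk) mulr0.
  by rewrite mxE eqxx /= addr0 mulrC; case: eqP => [->|]; rewrite ?mul0r.
have /eqP := e k; rewrite -subr_eq0 -mulrBl mulf_eq0 => /orP[|/eqP//].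
rewrite kS => /eqP e2; exfalso.
have : (1 : K) = 2%:R * ((i == k)%:R - (j == k)%:R).
  by move/eqP: e2; rewrite subr_eq0 => /eqP <- /=; field.
case: (i == k); case: (j == k); rewrite ?subrr ?subr0 ?sub0r ?mulr0 ?mulr1 ?mulrN1 => /eqP.
- by rewrite oner_eq0.
- by rewrite (eqr_nat K 1 2).
- by rewrite -subr_eq0 opprK -(natrD _ 1 2) pnatr_eq0.
- by rewrite oner_eq0.
Qed.
End Parity.

Section OddDerivation.
Variable K : numFieldType.
Implicit Types (S : 'End(ee K)) (X Y : 'M[K]_8) (v : ext4 K).

(** The sum of the tensors of E_ji and E_ij is invariant under the adjoint action; [f] plays the
    role of a bilinear map out of the tensor square. *)
Lemma casimir_invariance (f : 'M[K]_8 -> 'M[K]_8 -> ext4 K) Y :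
  (forall X, linear (f X)) -> (forall X, linear (f^~ X)) ->
  \sum_i \sum_j (f (Y *m delta_mx j i - delta_mx j i *m Y) (delta_mx i j)
     + f (delta_mx j i) (Y *m delta_mx i j - delta_mx i j *m Y)) = 0.
Proof.
move=> linr linl.
pose R X : {linear 'M[K]_8 -> ext4 K} := HB.pack (f X) (GRing.isLinear.Build K _ _ _ _ (linr X)).
pose L X : {linear 'M[K]_8 -> ext4 K} := HB.pack (f^~ X) (GRing.isLinear.Build K _ _ _ _ (linl X)).
have YE (i j : 'I_8) : Y *m delta_mx i j = \sum_k Y k i *: delta_mx k j.
  rewrite {1}(matrix_sum_delta Y) mulmx_suml; apply: eq_bigr => k _.
  rewrite mulmx_suml (bigD1 i) //= big1 => [|l li].
    by rewrite -scalemxAl mul_delta_mx addr0.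
  by rewrite -scalemxAl mul_delta_mx_0 ?scaler0.
have EY (i j : 'I_8) : delta_mx i j *m Y = \sum_k Y j k *: delta_mx i k.
  rewrite {1}(matrix_sum_delta Y) mulmx_sumr (bigD1 j) //= [X in _ + X]big1 ?addr0 => [|l lj].
    rewrite mulmx_sumr; apply: eq_bigr => k _.
    by rewrite -scalemxAr mul_delta_mx.
  rewrite mulmx_sumr big1 // => k _.
  by rewrite -scalemxAr mul_delta_mx_0 ?scaler0 // eq_sym.
pose F a b c d := f (delta_mx a b) (delta_mx c d).
have e i j : f (Y *m delta_mx j i - delta_mx j i *m Y) (delta_mx i j)
     + f (delta_mx j i) (Y *m delta_mx i j - delta_mx i j *m Y) =
   (\sum_k Y k j *: F k i i j - \sum_k Y j k *: F j i i k)
   + (\sum_k Y k i *: F j i k j - \sum_k Y i k *: F j k i j).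
  rewrite !YE !EY.
  have -> : f (\sum_k Y k j *: delta_mx k i - \sum_k Y i k *: delta_mx j k) (delta_mx i j) =
    \sum_k Y k j *: F k i i j - \sum_k Y i k *: F j k i j.
    transitivity (L (delta_mx i j) (\sum_k Y k j *: delta_mx k i - \sum_k Y i k *: delta_mx j k)) => //.
    rewrite (linearB (L (delta_mx i j))) !(linear_sum (L (delta_mx i j))).
    by congr (_ - _); apply: eq_bigr => k _; rewrite (linearZZ (L (delta_mx i j))).
  have -> : f (delta_mx j i) (\sum_k Y k i *: delta_mx k j - \sum_k Y j k *: delta_mx i k) =
    \sum_k Y k i *: F j i k j - \sum_k Y j k *: F j i i k.
    transitivity (R (delta_mx j i) (\sum_k Y k i *: delta_mx k j - \sum_k Y j k *: delta_mx i k)) => //.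
    rewrite (linearB (R (delta_mx j i))) !(linear_sum (R (delta_mx j i))).
    by congr (_ - _); apply: eq_bigr => k _; rewrite (linearZZ (R (delta_mx j i))).
  move: (\sum_k _) (\sum_k _) (\sum_k _) (\sum_k _) => a b c d; ext4ring.
under eq_bigr => i _ do under eq_bigr => j _ do rewrite e.
under eq_bigr => i _ do rewrite big_split.
rewrite big_split /=.
have -> : \sum_i \sum_j (\sum_k Y k j *: F k i i j - \sum_k Y j k *: F j i i k) = 0.
  rewrite big1 // => i _; rewrite sumrB exchange_big subrr //.
rewrite exchange_big add0r big1 // => j _; rewrite sumrB exchange_big subrr //.
Qed.

(* The Casimir element of gl(8) acts on ext4 by the scalar 18, so the cocycle
   X |-> S (X, 0) is the coboundary of (1/18) sum_ij E_ij . S (E_ji, 0). The remaining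
   derivation is an equivariant map from ext4 to gl(8), hence 0. *)
Lemma odd_derivation_inner S :
  (forall x y, S (brP x y) = brP (S x) y + brP x (S y)) ->
  (forall x, parity (S x) = - S (parity x)) -> exists s, S = Dop s.
Proof.
move=> der odd.
have S1 X : (S (X, 0)).1 = 0.
  have := odd (X, 0); rewrite /parity /= oppr0 => /(congr1 fst) /= /eqP.
  by rewrite -addr_eq0 -mulr2n -scaler_nat scaler_eq0 pnatr_eq0 => /eqP.
have S2 v : (S (0, v)).2 = 0.
  have := odd (0, v); rewrite /parity /= (_ : (0, - v) = - (0, v)); last first.
    by apply: injective_projections; rewrite //= oppr0.
  rewrite linearN opprK => /(congr1 snd) /= /eqP.
  by rewrite eq_sym -addr_eq0 -mulr2n -scaler_nat scaler_eq0 pnatr_eq0 => /eqP.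
pose si X := (S (X, 0)).2.
have lsi : linear si.
  move=> a X Y; rewrite /si (_ : (a *: X + Y, 0) = a *: (X, 0) + (Y, 0)); last first.
    by apply: injective_projections; rewrite //= scaler0 addr0.
  by rewrite linearP.
pose SI : {linear 'M[K]_8 -> ext4 K} := HB.pack si (GRing.isLinear.Build K _ _ _ _ lsi).
have coc X Y : si (X *m Y - Y *m X) = lact X (si Y) - lact Y (si X).
  have := der (X, 0) (Y, 0); rewrite {1}/brP /= moment0l addr0 !lact0r subr0.
  move=> /(congr1 snd); rewrite /brP /= !lact0r sub0r subr0 => e; rewrite [LHS]e.
  by rewrite addrC.
pose s := - ((18%:R)^-1 *: \sum_i \sum_j lact (delta_mx j i) (si (delta_mx i j))).
have siE Y : si Y = - lact Y s.
  rewrite /s lactNr opprK lactZr.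
  suff -> : lact Y (\sum_i \sum_j lact (delta_mx j i) (si (delta_mx i j))) = 18%:R *: si Y.
    by rewrite scalerA mulVf ?scale1r // pnatr_eq0.
  rewrite -casimir lact_sumr; apply/eqP; rewrite -subr_eq0 -sumrB; apply/eqP.
  rewrite -[RHS](@casimir_invariance (fun X Z => lact X (si Z)) Y) => [||X]; last 2 first.
  - by move=> X a Z Z' /=; rewrite lsi lactDr lactZr.
  - by move=> a Z Z'; rewrite lactDl lactZl.
  apply: eq_bigr => i _; rewrite lact_sumr -sumrB; apply: eq_bigr => j _.
  rewrite lact_rep coc lactBr.
  by move: (lact Y (lact _ _)) (lact _ (lact Y _)) (lact _ (lact _ (si Y))) => a b c; ext4ring.
exists s.
pose T := S - Dop s.
have T1 X : T (X, 0) = 0.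
  rewrite /T add_lfunE opp_lfunE DopE /= moment0r; apply: injective_projections => /=.
    by rewrite S1 subr0.
  by rewrite -[_.2]/(si X) siE subrr.
pose b v := (S (0, v)).1 - moment s v.
have Tb v : T (0, v) = (b v, 0).
  rewrite /T add_lfunE opp_lfunE DopE /= lact0l; apply: injective_projections => //=.
  by rewrite S2 oppr0 subr0.
have b0 v : b v = 0.
  move: v; apply: equivariant_gl8_eq0.
    move=> a v w; rewrite /b (_ : (0, a *: v + w) = a *: (0, v) + (0, w)); last first.
      by apply: injective_projections; rewrite //= scaler0 addr0.
    rewrite linearP (linearP (@moment K s)) /= scalerBr; move: (S _).1 (S _).1 (moment _ _) (moment _ _).
    by move=> c d e f; apply/matrixP => i j; rewrite !mxE; ring.
  move=> X v; rewrite /b.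
  have := der (X, 0) (0, v); rewrite {1}/brP /= mulmx0 mul0mx subrr add0r moment0l lact0l subr0.
  move=> /(congr1 fst); rewrite /brP /= -[(S (X, 0)).2]/(si X) S1 S2 !(mulmx0, mul0mx, subr0, add0r, moment0l, addr0) => ->.
  have := moment_lact X s v; rewrite siE momentNl => h.
  rewrite (_ : moment s (lact X v) = X *m moment s v - moment s v *m X - moment (lact X s) v); last first.
    by rewrite h addrAC subrr add0r.
  rewrite mulmxBr mulmxBl; move: (_ *m _) (_ *m _) (_ *m _) (_ *m _) (moment _ _) => c d e f g.
  by apply/matrixP => i j; rewrite !mxE; ring.
apply/lfunP => x; apply/eqP; rewrite -subr_eq0 -[_ - _]/(S x - Dop s x).
have -> : x = (x.1, 0) + (0, x.2) by apply: injective_projections; rewrite /= ?addr0 ?add0r.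
by rewrite -opp_lfunE -add_lfunE linearD /= T1 add0r Tb b0.
Qed.
End OddDerivation.

Section DopLinear.
Variable K : numFieldType.
Lemma DopD (u v : ext4 K) : Dop (u + v) = Dop u + Dop v.
Proof.
apply/lfunP => p; rewrite add_lfunE !DopE momentDl lactDr opprD.
by apply: injective_projections.
Qed.

Lemma DopN (u : ext4 K) : Dop (- u) = - Dop u.
Proof. by apply/lfunP => p; rewrite opp_lfunE !DopE momentNl lactNr. Qed.
Lemma DopB (u v : ext4 K) : Dop (u - v) = Dop u - Dop v.
Proof. by rewrite DopD DopN. Qed.
Lemma DopZ a (u : ext4 K) : Dop (a *: u) = a *: Dop u.
Proof.
apply/lfunP => p; rewrite scale_lfunE !DopE momentZl lactZr -scalerN.
by apply: injective_projections.
Qed.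
End DopLinear.

Lemma Dop_eq0 (K : numFieldType) (w : ext4 K) : Dop w = 0 -> w = 0.
Proof.
move=> w0; have h X : lact X w = 0.
  have /lfunP/(_ (X, 0)) := w0; rewrite DopE lfunE => /(congr1 snd) /= /eqP.
  by rewrite oppr_eq0 => /eqP.
have := casimir w; rewrite big1 => [/esym/eqP|i _]; last by rewrite big1 // => j _; rewrite h lact0r.
by rewrite scaler_eq0 pnatr_eq0 => /eqP.
Qed.

Section Jordan.
Variable K : numClosedFieldType.
Hypothesis jac : jacobi K.

(** The semisimple part of [Dop v] is a polynomial in it, a derivation, and odd for [parity]; hence
    it is [Dop s] by [odd_derivation_inner], and the decomposition stays inside ext4. *)
Lemma jordan_ext4 (v : ext4 K) : emap Num.conj v = v ->
  exists s : ext4 K, [/\ emap Num.conj s = s, split_semisimple (Dop s),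
    exists m, forall x, iter m (Dop (v - s)) x = 0 &
    exists p, forall x, Dop s x = peval (Dop v) p x].
Proof.
move=> vr; have [rs0 [m0 hr]] := jordan_roots (Dop v).
(* Stability under negation makes the interpolating polynomial odd modulo the annihilating one,
   hence the semisimple part odd; stability under conjugation makes [s] real. *)
pose rs := undup (let r1 := rs0 ++ map Num.conj rs0 in r1 ++ map -%R r1).
have urs : uniq rs by apply: undup_uniq.
have rs0s : {subset rs0 <= rs} by move=> r h; rewrite mem_undup !mem_cat h.
have rsN r : r \in rs -> - r \in rs.
  rewrite !mem_undup /= ![_ \in (_ ++ _) ++ _]mem_cat => /orP[h|/mapP[t h ->]].
    by rewrite map_f ?orbT.
  by rewrite opprK h.
have rsC r : r \in rs -> Num.conj r \in rs.
  have c1 t : t \in rs0 ++ map Num.conj rs0 -> Num.conj t \in rs0 ++ map Num.conj rs0.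
    rewrite !mem_cat => /orP[h|/mapP[z h ->]]; first by rewrite map_f ?orbT.
    by rewrite conjCK h.
  rewrite !mem_undup /= ![_ \in (_ ++ _) ++ _]mem_cat => /orP[h|/mapP[t h ->]].
    by rewrite c1.
  by rewrite rmorphN map_f ?orbT // c1.
pose m := m0.+1.
have kill x : peval (Dop v) (\prod_(r <- rs) ('X - r%:P) ^+ m) x = 0.
  have -> : \prod_(r <- rs) ('X - r%:P) ^+ m =
    \prod_(r <- rs) ('X - r%:P) * \prod_(r <- rs) ('X - r%:P) ^+ m0.
    by rewrite -big_split; apply: eq_bigr => r _; rewrite exprS.
  by rewrite pevalM hr ?linear0.
have [p hp] := crt (m + m) (fun r => r) urs.
have sub q q' x : (forall r, r \in rs -> ('X - r%:P) ^+ (m + m) %| q - q') ->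
    peval (Dop v) q x = peval (Dop v) q' x.
  move=> h; apply/eqP; rewrite -subr_eq0 -pevalN -pevalD; apply/eqP.
  apply: (jordan_kill urs kill) => r /h; apply: dvdp_trans.
  by rewrite exprD dvdp_mulr.
pose S := linfun (peval (Dop v) p).
have [s Ss] : exists s, S = Dop s.
  apply: odd_derivation_inner => x.
    move=> y; rewrite !lfunE.
    apply: (semisimple_part_derivation urs kill hp) => [||a b].
    - exact: brP_linr. - exact: brP_linl. - exact: Dop_derivation.
  rewrite !lfunE /= parity_peval -pevalN; apply: sub => r rrs.
  have /(dvdp_comp_poly (- 'X)) := hp _ (rsN _ rrs).
  rewrite rmorphXn /= !rmorphB /= comp_polyX !comp_polyC => h.
  have -> : p \Po - 'X - - p = (p \Po - 'X - (- r)%:P) + (p - r%:P) by rewrite polyCN; ring.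
  rewrite dvdp_add ?hp //; move: h.
  have -> : - 'X - (- r)%:P = - ('X - r%:P) by rewrite polyCN; ring.
  have -> : (- ('X - r%:P)) ^+ (m + m) = ('X - r%:P) ^+ (m + m) by rewrite exprNn -signr_odd addnn odd_double mul1r.
  by [].
have SE x : Dop s x = peval (Dop v) p x by rewrite -Ss lfunE.
exists s; split; last by exists p.
- have e : Dop (emap Num.conj s) = Dop s.
    apply/lfunP => x; pose y := eemap Num.conj x.
    have yx : eemap Num.conj y = x.
      by apply: injective_projections; [apply/matrixP => i j; rewrite !mxE; apply: conjCK | apply/ffunP => I; rewrite !emapE; apply: conjCK].
    rewrite -{1}yx -eemap_Dop SE eemap_peval vr yx SE; apply: sub => r rrs.
    have -> : map_poly Num.conj p - p = map_poly Num.conj (p - (Num.conj r)%:P) - (p - r%:P).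
      by rewrite rmorphB /= map_polyC /= (conjCK r); ring.
    rewrite dvdp_sub ?hp //.
    have -> : ('X - r%:P) ^+ (m + m) = map_poly Num.conj (('X - (Num.conj r)%:P) ^+ (m + m)).
      by rewrite rmorphXn rmorphB /= map_polyX map_polyC /= (conjCK r).
    by rewrite dvdp_map hp ?rsC.
  apply/eqP; rewrite -subr_eq0; apply/eqP/Dop_eq0.
  by rewrite DopB e subrr.
- by rewrite -Ss; apply: (semisimple_part_split urs kill hp).
- exists m => x.
  have h q : iter q (Dop (v - s)) x = peval (Dop v) (('X - p) ^+ q) x.
    elim: q => [|q IH] /=; first by rewrite expr0 -[1]/(1%:P) pevalC scale1r.
    transitivity (Dop (v - s) (peval (Dop v) (('X - p) ^+ q) x)); [by congr (Dop _ _) | rewrite DopB].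
    by rewrite add_lfunE opp_lfunE SE exprS pevalM pevalD pevalN pevalX.
  by rewrite h (nilpotent_part urs kill hp).
Qed.
End Jordan.

Section CommutingSplit.
Variables (K : fieldType) (V : vectType K).

Lemma split_semisimpleD (f g : 'End(V)) a : (forall x, f (g x) = g (f x)) ->
  split_semisimple f -> split_semisimple g -> split_semisimple (f + a *: g).
Proof.
move=> fg sf sg.
have [||b [phi [bE _ be]]] := @common_eigenbasis K V [:: f; g].
- by move=> h k; rewrite !inE => /orP[]/eqP-> /orP[]/eqP-> x; rewrite ?fg.
- by move=> h; rewrite !inE => /orP[]/eqP->.
apply: (@split_semisimple_eigen _ _ _ _ b (fun k => phi k (f (b k)) + a * phi k (g (b k)))) => [k|x].
  rewrite add_lfunE scale_lfunE {1}be ?inE ?eqxx // {1}[g _]be ?inE ?eqxx ?orbT //.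
  by rewrite scalerA scalerDl.
by exists (fun k => phi k x).
Qed.

Lemma commuting_nilp (f g : 'End(V)) m : (forall x, f (g x) = g (f x)) ->
  (forall x, iter m f x = 0) -> forall x, iter m (f \o g)%VF x = 0.
Proof.
move=> fg h x; suff -> : iter m (f \o g)%VF x = iter m f (iter m g x) by rewrite h.
elim: m {h} => //= m ->; rewrite comp_lfunE; congr (f _).
have it k y : g (iter k f y) = iter k f (g y) by elim: k => //= k <-; rewrite fg.
by rewrite it.
Qed.
End CommutingSplit.

Section Form.
Variable K : numFieldType.
Implicit Types (p q : ee K) (u v w : ext4 K).

(** The invariant form of gl(8) + ext4: it is nondegenerate, and every [Dop u] is skew for it. *)
Definition kform p q : K := \tr (p.1 *m q.1) + wedge p.2 q.2.

Lemma kformC p q : kform p q = kform q p.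
Proof. by rewrite /kform mxtrace_mulC wedgeC. Qed.

Fact kform_is_linear p : linear (kform p : ee K -> K^o).
Proof.
move=> a x y; rewrite /kform /= mulmxDr -scalemxAr linearD linearZ /= wedgeDr wedgeZr.
by rewrite scalerDr addrACA.
Qed.
HB.instance Definition _ p := GRing.isLinear.Build K (ee K) K^o _ (kform p) (kform_is_linear p).

Lemma kformDr p q q' : kform p (q + q') = kform p q + kform p q'.
Proof. exact: (linearD (kform p)). Qed.
Lemma kformZr a p q : kform p (a *: q) = a * kform p q.
Proof. by rewrite /kform /= -scalemxAr linearZ /= wedgeZr mulrDr. Qed.
Lemma kform0r p : kform p 0 = 0.
Proof. exact: (linear0 (kform p)). Qed.
Lemma kformDl p q q' : kform (q + q') p = kform q p + kform q' p.
Proof. by rewrite !(kformC _ p) kformDr. Qed.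
Lemma kformZl a p q : kform (a *: q) p = a * kform q p.
Proof. by rewrite !(kformC _ p) kformZr. Qed.
Lemma kform_sumr (I : Type) (r : seq I) (F : I -> ee K) p :
  kform p (\sum_(i <- r) F i) = \sum_(i <- r) kform p (F i).
Proof. exact: (linear_sum (kform p)). Qed.

Lemma kform_Dop u p q : kform (Dop u p) q = - kform p (Dop u q).
Proof.
rewrite /kform !DopE /= tr_moment mxtrace_mulC tr_moment wedgeNl wedgeNr !wedge_lact.
have -> : wedge p.2 (lact q.1 u) = - wedge u (lact q.1 p.2) by rewrite wedgeC wedge_lact.
by ring.
Qed.

Lemma kform_nondeg p : (forall q, kform p q = 0) -> p = 0.
Proof.
move=> h; apply: injective_projections => /=.
  by apply: tr_nondeg => Y; rewrite -[RHS](h (Y, 0)) /kform /= wedge0r addr0.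
by apply: wedge_nondeg => w; rewrite -[RHS](h (0, w)) /kform /= mulmx0 mxtrace0 add0r.
Qed.

Lemma adX_eq0 (M : 'M[K]_8) : \tr M = 0 -> (forall p, adX M p = 0) -> M = 0.
Proof.
move=> tM h; have c i j k l : M k i * (j == l)%:R = (k == i)%:R * M j l.
  have /(congr1 fst)/eqP := h (delta_mx i j, 0); rewrite adXE /= subr_eq0 => /eqP.
  move/(congr1 (fun A : 'M[K]_8 => A k l)); rewrite !mxE.
  rewrite (bigD1 i) //= big1 => [|m mi]; last by rewrite mxE (negbTE mi) mulr0.
  rewrite (bigD1 j) //= big1 => [|m mj]; last by rewrite mxE (negbTE mj) andbF mul0r.
  by rewrite !mxE !eqxx /= andbT !addr0 eq_sym.
have M0 : M ord0 ord0 = 0.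
  have : \tr M = 8%:R * M ord0 ord0.
    rewrite /mxtrace (eq_bigr (fun=> M ord0 ord0)) => [|i _]; last first.
      by have := c ord0 i ord0 i; rewrite !eqxx mulr1 mul1r.
    by rewrite sumr_const card_ord mulr_natl.
  by rewrite tM => /esym/eqP; rewrite mulf_eq0 pnatr_eq0 => /eqP.
apply/matrixP => i j; rewrite mxE.
have Mj : M j j = 0 by have := c ord0 j ord0 j; rewrite !eqxx !mulr1 mul1r M0.
have := c j i i i; rewrite !eqxx mulr1.
by case: (eqVneq i j) => [->|_] ->; rewrite ?mul1r ?mul0r.
Qed.

Lemma moment_Dop_comm u v : jacobi K ->
  (forall p, Dop u (Dop v p) = Dop v (Dop u p)) <-> moment u v = 0.
Proof.
move=> jac; split=> [h|h p].
  by apply: adX_eq0 => [|p]; rewrite ?tr_moment0 // -Dop_comm // h subrr.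
apply/eqP; rewrite -subr_eq0 Dop_comm // h adXE mul0mx mulmx0 subrr lact0l.
by apply/eqP/injective_projections.
Qed.
End Form.

(* The embedding of R in R[i] is used only through this interface: unfolding the
   canonical structures of R[i] is too expensive. *)
Record complexification (R : rcfType) (K : numClosedFieldType) := Complexification {
  cxr :> {rmorphism R -> K};
  cx_re : K -> R;
  cx_im : K -> R;
  cx_conj : forall a, Num.conj (cxr a) = cxr a;
  cx_rect : forall z, z = cxr (cx_re z) + 'i * cxr (cx_im z)
}.

Section ReIm.
Variables (R : rcfType) (K : numClosedFieldType) (c : complexification R K).

Definition cx : ext4 R -> ext4 K := emap c.
Definition re_ext4 (z : ext4 K) : ext4 R := [ffun I => cx_re c (z I)].
Definition im_ext4 (z : ext4 K) : ext4 R := [ffun I => cx_im c (z I)].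

Lemma cxr_real a : c a \is Num.real.
Proof. by rewrite CrealE; apply/eqP/cx_conj. Qed.

Lemma cx_rect_eq0 a b : c a + 'i * c b = 0 -> a = 0 /\ b = 0.
Proof.
move=> h; have ra := cxr_real a; have rb := cxr_real b.
have /eqP := congr1 (@Re K) h; have /eqP := congr1 (@Im K) h.
by rewrite Re_rect // Im_rect // raddf0 raddf0 !fmorph_eq0 => /eqP -> /eqP ->.
Qed.

Lemma cx_inj : injective cx. Proof. exact: emap_inj. Qed.

Lemma cx_decomp z : z = cx (re_ext4 z) + 'i *: cx (im_ext4 z).
Proof. by apply/ffunP => I; rewrite ext4D ext4Z !emapE !ffunE [LHS](cx_rect c). Qed.

Lemma conj_cx v : emap Num.conj (cx v) = cx v.
Proof. by apply/ffunP => I; rewrite !emapE; apply: cx_conj. Qed.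

Lemma cx_realE a : a \is Num.real -> a = c (cx_re c a).
Proof.
move=> /Creal_ImP h; have e := cx_rect c a.
by move: h; rewrite {1}e Im_rect ?cxr_real // => h; rewrite {1}e h mulr0 addr0.
Qed.

Lemma cxD v w : cx (v + w) = cx v + cx w. Proof. exact: emapD. Qed.
Lemma cxB v w : cx (v - w) = cx v - cx w. Proof. exact: emapB. Qed.
Lemma cxZ a v : cx (a *: v) = c a *: cx v. Proof. exact: emapZ. Qed.
Lemma cx0 : cx 0 = 0. Proof. exact: emap0. Qed.
Lemma cx_sum (T : Type) (r : seq T) (P : pred T) (F : T -> ext4 R) :
  cx (\sum_(t <- r | P t) F t) = \sum_(t <- r | P t) cx (F t).
Proof. exact: emap_sum. Qed.
Lemma cx_lact X v : cx (lact X v) = lact (map_mx c X) (cx v).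
Proof. exact: emap_lact. Qed.
Lemma cx_wedge v w : wedge (cx v) (cx w) = c (wedge v w).
Proof. exact: emap_wedge. Qed.
Lemma cx_moment v w : moment (cx v) (cx w) = map_mx c (moment v w).
Proof. exact: emap_moment. Qed.

Lemma real_cx z : emap Num.conj z = z -> z = cx (re_ext4 z).
Proof.
move=> h; apply/ffunP => I; rewrite emapE ffunE; have /ffunP/(_ I) := h; rewrite emapE => e.
by apply: cx_realE; rewrite CrealE; apply/eqP.
Qed.

Lemma moment_cx_eq0 u z : moment (cx u) z = 0 ->
  moment u (re_ext4 z) = 0 /\ moment u (im_ext4 z) = 0.
Proof.
rewrite {1}(cx_decomp z) momentDr momentZr !emap_moment => h.
suff e i j : moment u (re_ext4 z) i j = 0 /\ moment u (im_ext4 z) i j = 0.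
  by split; apply/matrixP => i j; rewrite mxE; case: (e i j).
by apply: cx_rect_eq0; have /matrixP/(_ i j) := h; rewrite !mxE.
Qed.
End ReIm.

Section Cartan.
Variables (R : rcfType) (C : numClosedFieldType) (c : complexification R C).
Local Notation cx := (cx c).
Implicit Types (U V : {vspace ext4 R}) (u v w : ext4 R).

Definition torus U :=
  (forall x, x \in U -> split_semisimple (Dop (cx x))) /\
  (forall x y, x \in U -> y \in U -> moment x y = 0).
Definition max_torus U := torus U /\ forall V, torus V -> (U <= V)%VS -> V = U.

Lemma moment_cx u v : moment u v = 0 -> moment (cx u) (cx v) = 0.
Proof. by move=> h; rewrite cx_moment h map_mx0. Qed.

Hypothesis jac : jacobi C.

Lemma jacobi_real : jacobi R.
Proof.
move=> u v w; apply: (@cx_inj _ _ c).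
by rewrite !cxD !cx_lact -!cx_moment jac cx0.
Qed.

Lemma torus_comm U u v p : torus U -> u \in U -> v \in U ->
  Dop (cx u) (Dop (cx v) p) = Dop (cx v) (Dop (cx u) p).
Proof.
case=> _ com uU vU; move: p; apply/(moment_Dop_comm _ _ jac).
by apply: moment_cx; apply: com.
Qed.

Lemma torus_eigenbasis U : torus U ->
  exists (b : 'I_(dim (ee C)) -> ee C) (phi : 'I_(dim (ee C)) -> 'Hom(ee C, C^o)),
  [/\ forall x, x = \sum_k phi k x *: b k, forall k l, phi k (b l) = (k == l)%:R &
      forall u k, u \in U -> Dop (cx u) (b k) = phi k (Dop (cx u) (b k)) *: b k].
Proof.
move=> tU; have bU i : (vbasis U)`_i \in U.
  have [h|h] := ltnP i (size (vbasis U)); first by apply: vbasis_mem; apply: mem_nth.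
  by rewrite nth_default // mem0v.
have inU u : u \in (vbasis U : seq _) -> u \in U by exact: vbasis_mem.
have [||b [phi [bE pb be]]] := @common_eigenbasis _ (ee C) [seq Dop (cx u) | u <- vbasis U].
- move=> _ _ /mapP[u /inU uU ->] /mapP[v /inU vU ->] x; exact: torus_comm tU _ _.
- by move=> _ /mapP[u /inU uU ->]; case: tU => h _; apply: h.
exists b, phi; split=> // u k uU.
rewrite {1 2}(coord_vbasis uU) cx_sum.
have Dsum (F : 'I_(\dim U) -> ext4 C) p : Dop (\sum_i F i) p = \sum_i Dop (F i) p.
  apply: (big_morph (fun z => Dop z p)); last by rewrite DopE moment0l lact0r oppr0.
  by move=> y z; rewrite DopD add_lfunE.
rewrite !Dsum (linear_sum (phi k)) scaler_suml; apply: eq_bigr => i _ /=.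
rewrite cxZ DopZ scale_lfunE {1}be; last by apply: map_f; apply: mem_nth; rewrite size_tuple.
by rewrite (linearZZ (phi k)) -scalerA.
Qed.

(** Test [n] against a joint eigenbasis of [U]. Eigenvectors of nonzero weight are orthogonal to the
    centralizer by invariance of the form; those of weight zero have real and imaginary parts in the
    centralizer, where the hypothesis applies. *)
Lemma form_centralizer_nondeg U n : torus U ->
  (forall w, (forall u, u \in U -> moment u w = 0) -> wedge n w = 0) ->
  (forall u, u \in U -> moment u n = 0) -> n = 0.
Proof.
move=> tU hn nz; have [b [phi [bE pb be]]] := torus_eigenbasis tU.
have fb k : kform (0, cx n) (b k) = 0.
  have [/forallP h|] := boolP [forall i : 'I_(\dim U), phi k (Dop (cx (vbasis U)`_i) (b k)) == 0].
    have Db u : u \in U -> Dop (cx u) (b k) = 0.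
      move=> uU; rewrite (coord_vbasis uU) cx_sum.
      have Dsum (F : 'I_(\dim U) -> ext4 C) p : Dop (\sum_i F i) p = \sum_i Dop (F i) p.
        apply: (big_morph (fun z => Dop z p)); last by rewrite DopE moment0l lact0r oppr0.
        by move=> y z; rewrite DopD add_lfunE.
      rewrite Dsum big1 // => i _.
      have iU : (vbasis U)`_i \in U by apply: vbasis_mem; rewrite mem_nth ?size_tuple.
      by rewrite cxZ DopZ scale_lfunE (be _ _ iU) (eqP (h i)) scale0r scaler0.
    have m u : u \in U -> moment u (re_ext4 c (b k).2) = 0 /\ moment u (im_ext4 c (b k).2) = 0.
      by move=> /Db; rewrite DopE => /(congr1 fst) /= /moment_cx_eq0.
    rewrite /kform /= mul0mx mxtrace0 add0r [(b k).2](cx_decomp c) wedgeDr wedgeZr !cx_wedge.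
    rewrite !hn ?rmorph0 ?mulr0 ?addr0 // => u uU; by case: (m u uU).
  rewrite negb_forall => /existsP[i ni].
  have iU : (vbasis U)`_i \in U by apply: vbasis_mem; rewrite mem_nth ?size_tuple.
  have : kform (Dop (cx (vbasis U)`_i) (0, cx n)) (b k) = 0.
    by rewrite DopE /= moment_cx ?nz // lact0l oppr0 kformC kform0r.
  rewrite kform_Dop (be _ _ iU) kformZr => /eqP; rewrite oppr_eq0 mulf_eq0 (negbTE ni).
  by move/eqP.
have : (0, cx n) = 0 :> ee C.
  apply: kform_nondeg => q; rewrite (bE q) kform_sumr big1 // => k _.
  by rewrite kformZr fb mulr0.
by move=> /(congr1 snd) /= h; apply: (@cx_inj _ _ c); rewrite h cx0.
Qed.

(** The semisimple part [s] of [v] commutes with [U], so it lies in [U] by maximality. The remainder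
    acts nilpotently and commutes with [U] and itself; the resulting products are nilpotent, so
    their traces, multiples of [wedge], vanish. *)
Lemma max_torus_jordan U v : max_torus U -> (forall u, u \in U -> moment u v = 0) ->
  exists2 s, s \in U & (forall u, u \in U -> wedge (v - s) u = 0) /\ wedge (v - s) (v - s) = 0.
Proof.
move=> [tU mU] vz; have [s' [sr ss [m nil] [p sp]]] := jordan_ext4 jac (conj_cx c v).
pose s := re_ext4 c s'; have s'E : s' = cx s by apply: real_cx.
move: ss nil sp; rewrite s'E => ss nil sp.
have com u : u \in U -> forall x, Dop (cx u) (Dop (cx s) x) = Dop (cx s) (Dop (cx u) x).
  move=> uU x; rewrite !sp; symmetry; apply: peval_swap => y.
  by symmetry; move: y; apply/(moment_Dop_comm _ _ jac); apply: moment_cx; apply: vz.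
have us0 u : u \in U -> moment u s = 0.
  move=> uU; have /(moment_Dop_comm _ _ jac) := com u uU.
  by rewrite cx_moment -(map_mx0 (c)) => /map_mx_inj.
have tV : torus (U + <[s]>).
  split=> [x /memv_addP[u uU [y /vlineP[a ->] ->]]|x y].
    rewrite cxD cxZ DopD DopZ; case: tU => h _.
    by apply: split_semisimpleD; [exact: com | exact: h | exact: ss].
  case/memv_addP=> u uU [_ /vlineP[a ->] ->] /memv_addP[w wU [_ /vlineP[d ->] ->]].
  case: tU => _ cm; rewrite momentDl !momentDr !momentZl !momentZr cm // us0 // moment_same.
  by rewrite (momentC s w) us0 // !(oppr0, scaler0, addr0).
have sU : s \in U.
  by rewrite -(mU _ tV (addvSl _ _)); apply: subvP (addvSr _ _) _ (memv_line s).
rewrite -cxB in nil.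
have key u : (forall x, Dop (cx (v - s)) (Dop (cx u) x) = Dop (cx u) (Dop (cx (v - s)) x)) ->
    wedge (v - s) u = 0.
  move=> h; have : end_trace (Dop (cx (v - s)) \o Dop (cx u))%VF = 0.
    exact: end_trace_nilp (commuting_nilp h nil).
  rewrite trace_DD // cx_wedge => /eqP; rewrite mulf_eq0 pnatr_eq0 /=.
  by rewrite fmorph_eq0 => /eqP.
exists s => //; split=> [u uU|]; apply: key => //.
apply/(moment_Dop_comm _ _ jac); apply: moment_cx.
by rewrite momentC momentBr vz // us0 // subrr oppr0.
Qed.

(** The nilpotent part n of [v] is orthogonal to every w in the centralizer: to the semisimple part
    of w because that lies in [U], and to its nilpotent part n' by polarizing wedge (n + n') (n +
    n') = 0. Then [form_centralizer_nondeg] gives n = 0. *)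
Lemma max_torus_centralizer U v : max_torus U -> (forall u, u \in U -> moment u v = 0) -> v \in U.
Proof.
move=> mtU vz; have [tU mU] := mtU; have [s sU [ns nn]] := max_torus_jordan mtU vz.
have zU u w : u \in U -> w \in U -> moment u w = 0 by case: tU => _ h; apply: h.
suff /eqP : v - s = 0 by rewrite subr_eq0 => /eqP ->.
apply: (form_centralizer_nondeg tU) => [w wz|u uU]; last by rewrite momentBr vz // zU // subrr.
have [s' s'U [ns' nn']] := max_torus_jordan mtU wz.
have wE : w = (w - s') + s' by rewrite subrK.
have nz u : u \in U -> moment u (v - s + (w - s')) = 0.
  by move=> uU; rewrite momentDr !momentBr vz // wz // !zU // !subrr addr0.
rewrite wE; move: (v - s) (w - s') ns nn ns' nn' nz => n n' ns nn ns' nn' nz.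
have [s2 s2U [ns2 nn2]] := max_torus_jordan mtU nz.
have h1 : wedge (n + n') (n + n') = 0.
  move: nn2; rewrite wedgeBl !wedgeBr.
  rewrite (wedgeC s2) => h; move: (ns2 _ s2U); rewrite wedgeBl => h'.
  have e : wedge (n + n') s2 = 0 by rewrite wedgeDl ns // ns' // addr0.
  by move: h h'; rewrite e => h h'; rewrite -[LHS]subr0 -{1}[0](subrr 0) -h; move: h'; rewrite sub0r => /eqP; rewrite oppr_eq0 => /eqP ->; ring.
move: h1; rewrite wedgeDl !wedgeDr nn nn' add0r addr0 (wedgeC n') => h1.
rewrite [wedge n s']ns // addr0; move/eqP: h1.
by rewrite -mulr2n -mulr_natl mulf_eq0 pnatr_eq0 => /eqP.
Qed.
End Cartan.

(** * Eigenvalues in sl2 and Heisenberg triples *)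

Section Ladder.
Variables (K : numFieldType) (V : vectType K) (D H E F : 'End(V)) (e g : K).
Hypothesis DE : forall x, D (E x) = E (D x) + E x.
Hypothesis DF : forall x, D (F x) = F (D x) - F x.
Hypothesis HE : forall x, H (E x) = E (H x) + (2%:R * e) *: E x.
Hypothesis HF : forall x, H (F x) = F (H x) - (2%:R * e) *: F x.
Hypothesis EF : forall x, E (F x) = F (E x) + g *: H x.
Hypothesis g0 : g != 0.

Lemma finitely_many_eigen (f : nat -> V) (d : nat -> K) :
  injective d -> (forall n, D (f n) = d n *: f n) -> exists n, f n = 0.
Proof.
move=> dinj fd; have [p p0 pk] := killing_poly D.
have [/existsP[n /eqP fn]|] := boolP [exists n : 'I_(size p), f n == 0]; first by exists n.
rewrite negb_exists => /forallP nz.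
have : (size (map d (iota 0 (size p))) < size p)%N.
  apply: max_poly_roots => //; last by rewrite map_inj_uniq ?iota_uniq.
  apply/allP => t /mapP[n]; rewrite mem_iota add0n => /= np tE; rewrite {t}tE rootE.
  have := pk (f n); rewrite (peval_eigen _ (fd n)) => /eqP.
  by rewrite scaler_eq0 (negbTE (nz (Ordinal np))) orbF.
by rewrite size_map size_iota ltnn.
Qed.

Lemma ladder_last (f : nat -> V) (d : nat -> K) : injective d ->
  (forall n, D (f n) = d n *: f n) -> f 0 != 0 -> exists2 n, f n != 0 & f n.+1 = 0.
Proof.
move=> dinj fd f0; have [n0 fn0] := finitely_many_eigen dinj fd.
have ex : exists n, f n == 0 by exists n0; apply/eqP.
case: (ex_minnP ex) => [[|n]] /eqP fn mn; first by rewrite fn eqxx in f0.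
by exists n => //; apply/negP => /mn; rewrite ltnn.
Qed.

(** Climb with [E] to a last nonzero vector y, then descend with [F]; the formula for E F^(k+1) y at
    the bottom determines the eigenvalue. The grading operator [D] makes both ladders finite, also
    for e = 0, where the eigenvalue of [H] is constant along them. *)
Lemma ladder_eigenvalue w dl l : w != 0 -> D w = dl *: w -> H w = l *: w ->
  exists z : int, l = e * z%:~R.
Proof.
move=> w0 Dw Hw.
have [||//|n yn0 yn1] := @ladder_last (fun n => iter n E w) (fun n => dl + n%:R).
- by move=> a b /addrI /eqP; rewrite eqr_nat => /eqP.
- elim=> [|n IH] /=; first by rewrite addr0.
  by rewrite DE IH (linearZZ E) -[X in _ + X]scale1r -scalerDl -natr1 addrA.
set y := iter n E w in yn0; set l' := l + 2%:R * e * n%:R.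
have Ey : E y = 0 by [].
have Hy : H y = l' *: y.
  rewrite /y /l'; elim: (n) => [|k IH] /=; first by rewrite mulr0 addr0.
  by rewrite HE IH (linearZZ E) -scalerDl -natr1; congr (_ *: _); ring.
have Dy : D y = (dl + n%:R) *: y.
  rewrite /y; elim: (n) => [|k IH] /=; first by rewrite addr0.
  by rewrite DE IH (linearZZ E) -[X in _ + X]scale1r -scalerDl -natr1 addrA.
have [||//|m ym0 ym1] := @ladder_last (fun n => iter n F y) (fun k => dl + n%:R - k%:R).
- by move=> a b /addrI /oppr_inj /eqP; rewrite eqr_nat => /eqP.
- elim=> [|k IH] /=; first by rewrite subr0.
  rewrite DF IH (linearZZ F) -[X in _ - X]scale1r -scalerBl -natr1; congr (_ *: _); ring.
have HFy k : H (iter k F y) = (l' - 2%:R * e * k%:R) *: iter k F y.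
  elim: k => [|k IH] /=; first by rewrite mulr0 subr0.
  rewrite HF IH (linearZZ F) -scalerBl -natr1; congr (_ *: _); ring.
have EFy k : E (iter k.+1 F y) = (g * k.+1%:R * (l' - e * k%:R)) *: iter k F y.
  elim: k => [|k IH]; first by rewrite /= EF Ey linear0 add0r Hy scalerA mulr0 subr0 mulr1.
  rewrite [iter k.+2 F y]/(F (iter k.+1 F y)) EF IH (linearZZ F) HFy scalerA -scalerDl.
  congr (_ *: _); rewrite -!natr1; ring.
have := EFy m; rewrite [iter m.+1 F y]ym1 linear0 => /esym/eqP.
rewrite scaler_eq0 (negbTE ym0) orbF !mulf_eq0 (negbTE g0) pnatr_eq0 /= subr_eq0 => /eqP h.
exists (m%:Z - 2%:Z * n%:Z); have -> : l = e * m%:R - 2%:R * e * n%:R by rewrite -h /l'; ring.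
by rewrite rmorphB rmorphM /=; ring.
Qed.
End Ladder.

(** The combinations A + B and A - B are eigenvectors of ad D with eigenvalues 1 and -1, and their
    commutator is -2 H. This is a ladder with e = 0. *)
Lemma heisenberg_eigenvalue (K : numFieldType) (V : vectType K) (D A B H : 'End(V)) w dl l :
  (forall x, D (A x) = A (D x) + B x) -> (forall x, D (B x) = B (D x) + A x) ->
  (forall x, A (B x) = B (A x) + H x) ->
  (forall x, H (A x) = A (H x)) -> (forall x, H (B x) = B (H x)) ->
  w != 0 -> D w = dl *: w -> H w = l *: w -> l = 0.
Proof.
move=> DA DB AB HA HB w0 Dw Hw.
have [x|x|x|x|x||z ->] := @ladder_eigenvalue K V D H (A + B) (A - B) 0 (- 2%:R) _ _ _ _ _ _ w dl l w0 Dw Hw.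
- rewrite !add_lfunE (linearD D) /= DA DB; move: (A _) (A _) (B _) (B _) => x1 x2 x3 x4.
  by rewrite addrACA [x4 + x1]addrC.
- rewrite !(add_lfunE, opp_lfunE) (linearB D) /= DA DB; move: (A _) (A _) (B _) (B _) => x1 x2 x3 x4.
  by rewrite opprD addrACA opprB.
- by rewrite mulr0 scale0r addr0 !add_lfunE (linearD H) /= HA HB.
- by rewrite mulr0 scale0r subr0 !(add_lfunE, opp_lfunE) (linearB H) /= HA HB.
- rewrite !(add_lfunE, opp_lfunE) (linearB A) (linearB B) (linearD A) (linearD B) /= !AB.
  move: (A (A x)) (B (A x)) (B (B x)) (H x) => x1 x2 x3 x4.
  rewrite scaleNr -[2%:R]/(1 + 1) scalerDl scale1r !opprD !addrA.
  rewrite [x1 - x2 - x4 + x2]addrAC subrK [x1 + x2 + x4 - x2]addrAC addrK.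
  by rewrite [x1 + x4 - x3]addrAC addrK addrAC.
- by rewrite oppr_eq0 pnatr_eq0.
- by rewrite mul0r.
Qed.

(** * Spectra of matrices on the fourth exterior power *)

Section EigenSums.
Variable K : numFieldType.

Lemma lact_delta_e4 (i j : 'I_8) (I J : sub4) : i != j ->
  (lact (delta_mx i j) (e4 K J)) I != 0 -> [/\ j \in val J, i \notin val J & val I = i |: (val J :\ j)].
Proof.
move=> ij; have [jJ|jJ] := boolP (j \in val J); last first.
  rewrite -bv_idx lact_delta0 ?ext4_0 ?eqxx // => b; apply: contraNneq jJ => <-.
  by rewrite mem_idx.
have [iJ|iJ] := boolP (i \in val J).
  have [b jE] : exists b, j = idx J b by apply/idxP.
  have [d iE] : exists d, i = idx J d by apply/idxP.
  have db : d != b by apply: contraNneq ij => e; rewrite iE jE e.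
  rewrite -bv_idx jE lact_delta1 -?jE; [|exact: idx_inj|by []].
  rewrite bv_noninj ?ext4_0 ?eqxx // => inj.
  by case/eqP: (db); apply: inj; rewrite upd_same upd_other // iE.
rewrite e4_eS; have [s s0 ->] := lact_delta_eS K jJ iJ.
rewrite ext4Z eSE; case: (val I =P _) => [e _|_]; last by rewrite mulr0 eqxx.
by split.
Qed.

Lemma lact_diag_e4 k (J : sub4) :
  lact (delta_mx k k) (e4 K J) = ((k \in val J)%:R - 2%:R^-1) *: e4 K J.
Proof. by rewrite e4_eS lact_diag_eS. Qed.

(** Take I in the support of [w] with least sum of indices. A strictly lower triangular entry raises
    this sum, so at I only the diagonal of [T] contributes. *)
Lemma lact_trig_eigen (T : 'M[K]_8) mu w : is_trig_mx T -> w != 0 -> lact T w = mu *: w ->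
  exists I : sub4, mu = \sum_(i in val I) T i i - (\sum_i T i i) / 2%:R.
Proof.
move=> /is_trig_mxP tT w0 Tw.
pose s (I : sub4) := (\sum_(i in val I) i)%N.
have [I0 wI0] : exists I, w I != 0.
  apply/existsP; apply: contraNT w0; rewrite negb_exists => /forallP h.
  by apply/eqP/ffunP => I; rewrite ext4_0; apply/eqP/negbNE/h.
have [I wI Imin] := @arg_minnP _ I0 (fun I => w I != 0) s wI0.
exists I; have /ffunP/(_ I) := Tw; rewrite ext4Z => e.
suff h : lact T w I = (\sum_(i in val I) T i i - (\sum_i T i i) / 2%:R) * w I.
  by apply: (mulIf wI); rewrite -e h.
rewrite [in LHS](matrix_sum_delta T) lact_suml ext4_sum.
have -> : \sum_(i in val I) T i i - (\sum_i T i i) / 2%:R = \sum_i T i i * ((i \in val I)%:R - 2%:R^-1).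
  under [RHS]eq_bigr => i _ do rewrite mulrBr.
  rewrite sumrB mulr_suml; congr (_ - _); rewrite big_mkcond; apply: eq_bigr => i _.
  by case: (i \in val I); rewrite ?mulr1 ?mulr0.
rewrite mulr_suml; apply: eq_bigr => i _; rewrite lact_suml ext4_sum (bigD1 i) //= big1 => [|j ji].
  rewrite addr0 lactZl ext4Z -mulrA; congr (_ * _).
  rewrite (ext4E w) lact_sumr !ext4_sum mulr_sumr; apply: eq_bigr => J _.
  rewrite lactZr lact_diag_e4 !ext4Z e4E; case: (eqVneq I J) => [->|_]; last by rewrite !mulr0.
  by rewrite !mulr1 mulrC.
rewrite lactZl ext4Z; have [ij|] := ltnP i j; first by rewrite tT // mul0r.
rewrite leq_eqVlt (negbTE (_ : (j : nat) != i)) //= => lji.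
rewrite (ext4E w) lact_sumr ext4_sum big1 ?mulr0 // => J _; rewrite lactZr ext4Z.
apply/eqP; rewrite mulf_eq0; apply/norP => -[wJ].
case/lact_delta_e4; rewrite 1?eq_sym // => jJ iJ IE.
have := Imin _ wJ; rewrite /s IE leqNgt => /negP; apply.
rewrite (big_setD1 j jJ) /= big_setU1 ?ltn_add2r //=.
by rewrite !inE negb_and iJ orbT.
Qed.
End EigenSums.

Section Spectrum.
Variable K : numClosedFieldType.

(** The m_i are the diagonal entries of a Schur triangular form. Eigenvectors of ad M on matrices
    are a right eigenvector times a left one. *)
Lemma lact_spectrum (M : 'M[K]_8) : exists m : 'I_8 -> K,
  [/\ \tr M = \sum_i m i, \tr (M *m M) = \sum_i m i ^+ 2,
      (forall i, exists2 y : 'rV_8, y != 0 & y *m M = m i *: y) /\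
      (forall i j, exists2 Y, Y != 0 & M *m Y - Y *m M = (m i - m j) *: Y),
      horner_mx M (\prod_i ('X - (m i)%:P)) = 0 &
      forall mu w, w != 0 -> lact M w = mu *: w ->
        exists I : sub4, mu = \sum_(i in val I) m i - (\sum_i m i) / 2%:R].
Proof.
have [P Pu /= PT] := @Schur K 8 M isT.
have uP := unitarymx_unit Pu.
have [T TE tT] : exists2 T, T = P *m M *m invmx P & is_trig_mx T.
  by exists (conjmx P M) => //; rewrite conjumx.
have ME : M = invmx P *m T *m P by rewrite TE !mulmxA mulVmx // mul1mx mulmxKV.
clear Pu PT; have PT := tT.
exists (fun i => T i i); split.
- by rewrite ME -mulmxA mxtrace_mulC mulmxK.
- have -> : M *m M = invmx P *m (T *m T) *m P by rewrite ME !mulmxA mulmxK.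
  rewrite -mulmxA mxtrace_mulC mulmxK //; apply: eq_bigr => i _.
  rewrite mxE (bigD1 i) //= big1 ?addr0 ?expr2 // => j ji.
  move/is_trig_mxP: tT => tT; case: (ltngtP i j) ji => [ij|ij|/val_inj ->]; rewrite ?eqxx // => _.
    by rewrite tT // mul0r.
  by rewrite [T j i]tT // mulr0.
- have dt k : \det (T - (T k k)%:M) = 0.
    rewrite det_trig; first by rewrite (bigD1 k) //= !mxE eqxx subrr mul0r.
    by apply/is_trig_mxP => a b ab; rewrite !mxE (is_trig_mxP PT) // -val_eqE ltn_eqF // subrr.
  have yE k : exists2 y : 'rV_8, y != 0 & y *m T = T k k *: y.
    have /eqP/det0P[y y0 yT] := dt k; exists y => //.
    by move/eqP: yT; rewrite mulmxBr mul_mx_scalar subr_eq0 => /eqP.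
  split=> [i|i j].
    have [y y0 yT] := yE i; exists (y *m P).
      by apply: contraNneq y0 => e; rewrite -(mulmxK uP y) e mul0mx.
    by rewrite ME !mulmxA mulmxK // yT -scalemxAl.
  have [y y0 yT] := yE j.
  have [x x0 xT] : exists2 x : 'cV_8, x != 0 & T *m x = T i i *: x.
    have := dt i; rewrite -det_tr => /eqP/det0P[x x0 xT]; exists x^T; first by rewrite trmx_eq0.
    apply: trmx_inj; move/eqP: xT; rewrite linearB /= tr_scalar_mx mulmxBr mul_mx_scalar subr_eq0 => /eqP.
    by rewrite trmx_mul trmxK linearZ /= trmxK.
  exists ((invmx P *m x) *m (y *m P)).
    apply: contraNneq y0 => e; have : x *m y = 0.
      have -> : x *m y = P *m (invmx P *m x *m (y *m P)) *m invmx P.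
        by rewrite !mulmxA mulmxK // mulmxV // mul1mx.
      by rewrite e mulmx0 mul0mx.
    move=> /matrixP h; have [k xk] : exists k, x k 0 != 0.
      apply/existsP; apply: contraNT x0; rewrite negb_exists => /forallP h0.
      by apply/eqP/matrixP => a b; rewrite ord1 mxE; apply/eqP/negbNE/h0.
    apply/eqP/matrixP => a b; rewrite ord1 [RHS]mxE; have := h k b; rewrite !mxE big_ord1 => /eqP.
    by rewrite mulf_eq0 (negbTE xk) => /eqP.
  have h1 : M *m (invmx P *m x) = T i i *: (invmx P *m x).
    by rewrite ME mulmxA mulmxK // -mulmxA xT -scalemxAr.
  have h2 : (y *m P) *m M = T j j *: (y *m P).
    by rewrite ME !mulmxA mulmxK // yT -scalemxAl.
  by rewrite (mulmxA M) h1 -(mulmxA _ _ M) h2 -scalemxAl -scalemxAr scalerBl.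
- have ch : horner_mx T (\prod_i ('X - (T i i)%:P)) = 0.
    by rewrite -char_poly_trig //; apply: (@Cayley_Hamilton K 7).
  have hE q : horner_mx M q = invmx P *m horner_mx T q *m P.
    elim/poly_ind: q => [|q a IH]; first by rewrite !rmorph0 mulmx0 mul0mx.
    rewrite !rmorphD !rmorphM /= !horner_mx_X !horner_mx_C mulmxDr mulmxDl.
    congr (_ + _); last by rewrite mul_mx_scalar -scalemxAl mulVmx // scalemx1.
    by rewrite -![_ * _]/(_ *m _) IH ME !mulmxA mulmxK.
  by rewrite hE ch mulmx0 mul0mx.
- move=> mu w w0 Mw; apply: (@lact_trig_eigen _ T mu (ext4_act P w)) => //.
    apply: contraNneq w0 => e.
    by rewrite -(ext4_act1 w) -(mulVmx uP) ext4_actM e linear0.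
  by rewrite TE -lact_act // Mw linearZ.
Qed.

(** Compare m with the vector having entries 1/2 on I and -1/2 off I: the squared distance is the
    sum of the m_i^2 minus 2, which gives both the bound and the case of equality. *)
Lemma four_sum_bound (m : 'I_8 -> K) (I : sub4) : (forall i, m i \is Num.real) ->
  \sum_i m i = 0 -> \sum_(i in val I) m i = 2%:R ->
  2%:R <= \sum_i m i ^+ 2 /\
  (\sum_i m i ^+ 2 = 2%:R -> forall i, m i = (if i \in val I then 2%:R^-1 else - 2%:R^-1)).
Proof.
move=> mr m0 mI; pose e i : K := if i \in val I then 2%:R^-1 else - 2%:R^-1.
have er i : e i \is Num.real by rewrite /e; case: ifP; rewrite ?rpredN realV realn.
have key : \sum_i (m i - e i) ^+ 2 = \sum_i m i ^+ 2 - 2%:R.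
  have -> : \sum_i (m i - e i) ^+ 2 = \sum_i (m i ^+ 2 + (4%:R^-1 - 2%:R * e i * m i)).
    by apply: eq_bigr => i _; rewrite /e; case: ifP => _; field.
  rewrite big_split sumrB /=; congr (_ + _).
  rewrite sumr_const card_ord (bigID (fun i => i \in val I)) /=.
  have -> : \sum_(i in val I) 2%:R * e i * m i = 2%:R.
    transitivity (\sum_(i in val I) m i) => //.
    by apply: eq_bigr => i iI; rewrite /e iI; field.
  have -> : \sum_(i | i \notin val I) 2%:R * e i * m i = 2%:R.
    have h : \sum_(i | i \notin val I) m i = - 2%:R.
      by move: m0; rewrite (bigID (fun i => i \in val I)) /= mI => /eqP; rewrite addrC addr_eq0 => /eqP.
    by rewrite -[RHS]opprK -h -sumrN; apply: eq_bigr => i iI; rewrite /e (negbTE iI); field.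
  by field.
have ge i : 0 <= (m i - e i) ^+ 2 by rewrite real_exprn_even_ge0 // rpredB.
split; first by rewrite -subr_ge0 -key sumr_ge0.
move=> e2 i; move: key; rewrite e2 subrr => /eqP; rewrite psumr_eq0 // => /allP/(_ i).
by rewrite mem_index_enum => /(_ isT); rewrite /= sqrf_eq0 subr_eq0 => /eqP.
Qed.
End Spectrum.

Section HalfInvolution.
Variable K : numClosedFieldType.

(** The Jordan decomposition when all eigenvalues are 1/2 or -1/2. At this stage [M] is not known to
    be diagonalizable; the nilpotent part is removed in [weight_bound]. *)
Lemma half_involution_part (M : 'M[K]_8) (m : 'I_8 -> K) :
  (forall i, m i = 2%:R^-1 \/ m i = - 2%:R^-1) ->
  horner_mx M (\prod_i ('X - (m i)%:P)) = 0 ->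
  exists S N : 'M[K]_8, [/\ M = S + N, S *m N = N *m S, S *m S = (4%:R^-1)%:M & N ^+ 8 = 0].
Proof.
move=> hm M0; pose rs := [:: 2%:R^-1; - 2%:R^-1 : K].
have n2 : (2%:R^-1 : K) != - 2%:R^-1.
  by rewrite -subr_eq0 opprK -mulr2n -[X in X != 0]mulr_natl mulfV ?oner_eq0 // pnatr_eq0.
have urs : uniq rs by rewrite /= inE n2.
have d (q : {poly K}) : (forall r, r \in rs -> ('X - r%:P) ^+ 8 %| q) -> horner_mx M q = 0.
  move=> h; have : \prod_i ('X - (m i)%:P) %| q.
    apply: dvdp_trans (dvd_prod_XsubC_pow urs h).
    rewrite !big_cons big_nil mulr1 -exprMn.
    have -> : ((('X - (2%:R^-1)%:P) * ('X - (- 2%:R^-1)%:P)) : {poly K}) ^+ 8 =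
      \prod_(i < 8) (('X - (2%:R^-1)%:P) * ('X - (- 2%:R^-1)%:P)).
      by rewrite prodr_const card_ord.
    elim/big_rec2: _ => [|i p q0 _ pq]; first exact: dvdpp.
    apply: dvdp_mul; last exact: pq.
    by case: (hm i) => ->; [apply: dvdp_mulr | apply: dvdp_mull].
  by case/dvdpP=> s ->; rewrite rmorphM /= M0 mulr0.
have [p hp] := crt 8 (fun r => r) urs.
exists (horner_mx M p), (M - horner_mx M p); split.
- by rewrite addrC subrK.
- have c : horner_mx M p *m M = M *m horner_mx M p.
    by have := congr1 (horner_mx M) (mulrC p 'X); rewrite !rmorphM /= horner_mx_X.
  by rewrite mulmxBr mulmxBl c.
- have -> : horner_mx M p *m horner_mx M p = horner_mx M (p * p) by rewrite rmorphM.
  apply/eqP; rewrite -subr_eq0 -(horner_mx_C M) -rmorphB /=; apply/eqP/d => r rrs.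
  have -> : p * p - (4%:R^-1)%:P = (p - r%:P) * (p + r%:P).
    have -> : (4%:R^-1 : K) = r * r.
      by move: rrs; rewrite !inE => /orP[]/eqP ->; field.
    by rewrite polyCM; ring.
  by rewrite dvdp_mulr // hp.
- rewrite -{1}(horner_mx_X M) -rmorphB -rmorphXn /=; apply: d => r rrs.
  apply: dvdp_exp2r.
  have -> : 'X - p = ('X - r%:P) - (p - r%:P) by ring.
  rewrite dvdp_sub //; apply: dvdp_trans (hp _ rrs).
  by rewrite -{1}['X - r%:P]expr1 dvdp_exp2l.
Qed.

Lemma nilpotent_spectrum (N : 'M[K]_8) mu w : N ^+ 8 = 0 -> w != 0 ->
  lact N w = mu *: w -> mu = 0.
Proof.
move=> N8; have [m [_ _ [h1 _] _ h]] := lact_spectrum N.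
have m0 i : m i = 0.
  have [y y0 yN] := h1 i; have e k : y *m N ^+ k = m i ^+ k *: y.
    elim: k => [|k IH]; first by rewrite !expr0 mulmx1 scale1r.
    by rewrite exprS -[_ * _]/(_ *m _) mulmxA yN -scalemxAl IH scalerA exprS.
  have /esym/eqP := e 8; rewrite N8 mulmx0 scaler_eq0 (negbTE y0) orbF.
  by rewrite expf_eq0 => /andP[_ /eqP].
move=> w0 /(h _ _ w0)[I ->]; rewrite !big1 ?mul0r ?subr0 //; by move=> *; rewrite m0.
Qed.

Lemma lact_half_involution_split (S : 'M[K]_8) : S *m S = (4%:R^-1)%:M ->
  exists (I : finType) (b : I -> ext4 K) (a : I -> K),
    (forall i, lact S (b i) = a i *: b i) /\ forall x, exists k : I -> K, x = \sum_i k i *: b i.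
Proof.
move=> S2; have [P uP PS] : diagonalizable S.
  apply/diagonalizableP; exists [:: 2%:R^-1; - 2%:R^-1 : K].
    by rewrite /= inE andbT -subr_eq0 opprK -mulr2n -[X in X != 0]mulr_natl mulfV ?oner_eq0 // pnatr_eq0.
  apply: mxminpoly_min; rewrite !big_cons big_nil mulr1 rmorphM !rmorphB /= !horner_mx_X !horner_mx_C.
  rewrite (raddfN (@scalar_mx K 8)) /= opprK mulrBl !mulrDr.
  have -> : S * (2%:R^-1)%:M = (2%:R^-1)%:M * S by rewrite -[_ * _]/(_ *m _) scalar_mxC.
  have -> : (2%:R^-1)%:M * (2%:R^-1)%:M = S * S.
    by rewrite -![_ * _]/(_ *m _) S2 -scalar_mxM; congr (_%:M); field.
  by rewrite (addrC (S * S)) subrr.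
have {PS} [d PS] : exists d, P *m S *m invmx P = diag_mx d.
  by move: PS => /= /is_diag_mxP; rewrite conjumx // => h; apply/diag_mxP/is_diag_mxP.
exists sub4, (fun I => ext4_act (invmx P) (e4 K I)),
  (fun I => \sum_b d 0 (idx I b) - (\sum_i d 0 i) / 2%:R); split=> [I|x].
  have uP' : invmx P \in unitmx by rewrite unitmx_inv.
  have SE : S = invmx P *m diag_mx d *m invmx (invmx P).
    by rewrite invmxK -PS !mulmxA mulVmx // mul1mx mulmxKV.
  by rewrite {1}SE -lact_act // -bv_idx lact_diag linearZ.
exists (fun I => ext4_act P x I); rewrite -[LHS](ext4_act1 x) -(mulVmx uP) ext4_actM.
by rewrite {1}(ext4E (ext4_act P x)) linear_sum; apply: eq_bigr => I _; rewrite linearZ.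
Qed.

(** [S] acts diagonalizably on ext4 and commutes with [N]. On each S-component of [y], [N] acts by a
    scalar, which vanishes because [N] is nilpotent. *)
Lemma nilpotent_part_kills (S N : 'M[K]_8) mu y : S *m N = N *m S -> S *m S = (4%:R^-1)%:M ->
  N ^+ 8 = 0 -> lact (S + N) y = mu *: y -> lact N y = 0.
Proof.
move=> SN S2 N8 My.
have com x : lact S (lact N x) = lact N (lact S x).
  by apply/eqP; rewrite -subr_eq0 -lact_rep SN subrr lact0l.
have [I [b [a [Sb sp]]]] := lact_half_involution_split S2.
pose f : 'End(ext4 K) := linfun (@lact K S).
have fE x : f x = lact S x by rewrite lfunE.
have [rs urs kill] : split_semisimple f.
  by apply: (@split_semisimple_eigen _ _ _ I b a) => // i; rewrite fE.
have [L hL] := split_semisimple_decomp urs kill.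
have [yE fy _] := hL y; rewrite yE lact_sumr big1_seq // => r /= rrs.
set yr := peval f (L r) y; have Nyr : lact N yr = (mu - r) *: yr.
  have fN x : f (lact N x) = lact N (f x) by rewrite !fE com.
  pose n : 'End(ext4 K) := linfun (@lact K N).
  have nE x : n x = lact N x by rewrite lfunE.
  have sw x : peval f (L r) (n x) = n (peval f (L r) x).
    by apply: peval_swap => z; rewrite !nE fN.
  rewrite scalerBl -fy // fE -[lact N yr]nE /yr -sw nE.
  have -> : lact N y = mu *: y - f y by rewrite fE -My lactDl addrC addKr.
  by rewrite linearB linearZ /= peval_comm fE.
have [->|y0] := eqVneq yr 0; first by rewrite lact0r.
by rewrite Nyr (nilpotent_spectrum N8 y0 Nyr) scale0r.
Qed.
End HalfInvolution.

(** * Weights of a maximal torus and their norms *)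

Section Weights.
Variables (R : rcfType) (C : numClosedFieldType) (c : complexification R C).
Local Notation cx := (cx c).
Hypothesis jac : jacobi C.
Variable U : {vspace ext4 R}.
Hypothesis mtU : max_torus c U.

Let tU : torus c U. Proof. by case: mtU. Qed.

(* The complexification of U. *)
Definition ctorus (z : ext4 C) := forall u, u \in U -> moment (cx u) z = 0.

Lemma ctorus_cx u : u \in U -> ctorus (cx u).
Proof. by move=> uU v vU; apply: moment_cx; case: tU => _; apply. Qed.

Lemma ctorus_rect z : ctorus z -> exists2 u, u \in U & exists2 v, v \in U & z = cx u + 'i *: cx v.
Proof.
move=> zU; exists (re_ext4 c z); last exists (im_ext4 c z); last exact: cx_decomp.
  by apply: (max_torus_centralizer jac mtU) => u /zU /moment_cx_eq0[].
by apply: (max_torus_centralizer jac mtU) => u /zU /moment_cx_eq0[].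
Qed.

Lemma ctorusD z w : ctorus z -> ctorus w -> ctorus (z + w).
Proof. by move=> h1 h2 u uU; rewrite momentDr h1 // h2 // addr0. Qed.
Lemma ctorusZ a z : ctorus z -> ctorus (a *: z).
Proof. by move=> h1 u uU; rewrite momentZr h1 // scaler0. Qed.

Lemma ctorus_nondeg z : ctorus z -> (forall u, u \in U -> wedge z (cx u) = 0) -> z = 0.
Proof.
move=> /ctorus_rect[u uU [v vU ->]] h.
have e w : w \in U -> wedge u w = 0 /\ wedge v w = 0.
  by move=> wU; apply: (@cx_rect_eq0 _ _ c); rewrite -!cx_wedge -wedgeZl -wedgeDl h.
have z0 x : x \in U -> (forall w, w \in U -> wedge x w = 0) -> x = 0.
  move=> xU hx; apply: (form_centralizer_nondeg jac tU) => [w wz|w wU]; last by case: tU => _; apply.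
  by apply: hx; apply: (max_torus_centralizer jac mtU).
rewrite (z0 u) // => [|w /e[]//]; rewrite (z0 v) // => [|w /e[]//].
by rewrite cx0 scaler0 addr0.
Qed.

Definition weight (a : ext4 C -> C) (p : ee C) := forall z, ctorus z -> Dop z p = a z *: p.

Section WeightVector.
Variables (a : ext4 C -> C) (p : ee C).
Hypothesis ap : weight a p.
Variable u0 : ext4 R.
Hypotheses (u0U : u0 \in U) (au0 : a (cx u0) != 0).
Let X0 := p.1.
Let v0 := p.2.
Let tau := \tr (X0 *m X0).
Hypothesis tau0 : tau != 0.
Let h := lact X0 v0.

Lemma weight_moment z : ctorus z -> moment z v0 = a z *: X0.
Proof. by move=> zU; have := ap zU; rewrite DopE => /(congr1 fst). Qed.
Lemma weight_lact z : ctorus z -> lact X0 z = - (a z *: v0).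
Proof.
by move=> zU; have := ap zU; rewrite DopE => /(congr1 snd) /= <-; rewrite opprK.
Qed.

Lemma ctorus_h : ctorus h.
Proof.
move=> u uU; have hu := ctorus_cx uU; have := moment_lact X0 (cx u) v0.
rewrite weight_lact // weight_moment // -scalemxAr -scalemxAl subrr momentNl momentZl moment_same.
by rewrite scaler0 oppr0 add0r => <-.
Qed.

(** [h] is the coroot direction: up to the factor - tau it represents [a] through [wedge]. The
    vectors X0 + v0 and X0 - v0 have weights a and - a, and their bracket is - 2 h. *)
Lemma wedge_h z : ctorus z -> wedge h z = - (tau * a z).
Proof.
move=> zU; have : \tr (moment z v0 *m X0) = a z * tau.
  by rewrite weight_moment // -scalemxAl linearZ.
by rewrite tr_moment wedgeC => /eqP; rewrite eqr_oppLR mulrC => /eqP.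
Qed.

Lemma weight_adX_comm z x : ctorus z -> Dop z (adX X0 x) = adX X0 (Dop z x) + a z *: Dop v0 x.
Proof.
move=> zU; have := adX_Dop X0 z x; rewrite weight_lact // DopN DopZ opp_lfunE scale_lfunE.
by move=> /eqP; rewrite subr_eq addrC -subr_eq opprK => /eqP <-.
Qed.

Lemma weight_Dop_comm z x : ctorus z -> Dop z (Dop v0 x) = Dop v0 (Dop z x) + a z *: adX X0 x.
Proof.
move=> zU; have := Dop_comm jac z v0 x; rewrite weight_moment //.
have -> : adX (a z *: X0) x = a z *: adX X0 x.
  rewrite !adXE -scalemxAr -scalemxAl lactZl -scalerBr.
  by apply: injective_projections.
by move=> /eqP; rewrite subr_eq addrC => /eqP ->.
Qed.
Let comm3 x : adX X0 (Dop v0 x) = Dop v0 (adX X0 x) + Dop h x.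
Proof. by have /eqP := adX_Dop X0 v0 x; rewrite subr_eq addrC => /eqP ->. Qed.

Lemma ctorus_eigenbasis : exists (b : 'I_(dim (ee C)) -> ee C) (phi : 'I_(dim (ee C)) -> 'Hom(ee C, C^o)),
  [/\ forall x, x = \sum_k phi k x *: b k, forall k l, phi k (b l) = (k == l)%:R &
      forall z k, ctorus z -> Dop z (b k) = phi k (Dop z (b k)) *: b k].
Proof.
have [b [phi [bE pb be]]] := torus_eigenbasis jac tU; exists b, phi; split=> // z k.
move=> /ctorus_rect[u uU [v vU ->]]; rewrite DopD DopZ add_lfunE scale_lfunE.
by rewrite (linearD (phi k)) (linearZZ (phi k)) /= scalerDl -scalerA -!be.
Qed.

(** Otherwise X0, v0 and h would span a Heisenberg algebra graded by the torus; then h would act by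
    0 on a joint eigenbasis and vanish, against [wedge_h] at u0. *)
Lemma weight_h_neq0 : a h != 0.
Proof.
apply/eqP => ah; have hU := ctorus_h; have zU := ctorus_cx u0U.
have [b [phi [bE pb be]]] := ctorus_eigenbasis.
have b0 k : b k != 0.
  by apply/eqP => e; have := pb k k; rewrite e linear0 eqxx => /eqP; rewrite eq_sym oner_eq0.
have az0 := au0; set z := cx u0 in az0 zU; set r := (a z)^-1.
have rz : r * a z = 1 by rewrite mulVf.
have hz k : Dop h (b k) = 0.
  have rD x : (r *: Dop z) x = r *: Dop z x by rewrite scale_lfunE.
  rewrite be // (@heisenberg_eigenvalue _ _ (r *: Dop z) (adX X0) (Dop v0) (Dop h) (b k)
     (r * phi k (Dop z (b k))) (phi k (Dop h (b k)))) ?scale0r //.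
  - by move=> x; rewrite !rD weight_adX_comm // scalerDr scalerA rz scale1r (linearZZ (adX X0)).
  - by move=> x; rewrite !rD weight_Dop_comm // scalerDr scalerA rz scale1r (linearZZ (Dop v0)).
  - by move=> x; rewrite weight_adX_comm // ah scale0r addr0.
  - by move=> x; rewrite weight_Dop_comm // ah scale0r addr0.
  - by rewrite rD {1}be // scalerA.
  - exact: be.
have : h = 0.
  apply: Dop_eq0; apply/lfunP => x; rewrite lfunE (bE x) (linear_sum (Dop h)) big1 // => k _.
  by rewrite (linearZZ (Dop h)) /= hz scaler0.
have := wedge_h zU => /[swap] ->; rewrite wedge0l => /esym/eqP.
by rewrite oppr_eq0 mulf_eq0 (negbTE tau0) (negbTE az0).
Qed.

(** With this normalization M, yp and ym form an sl2 triple up to scaling: M has eigenvalues 2 and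
    -2 on yp and ym, and their bracket is ka^4 M. *)
Let ka := sqrtC (- a h).
Let ka2 : ka * ka = - a h. Proof. by rewrite -expr2 sqrtCK. Qed.
Let ka0 : ka != 0. Proof. by rewrite sqrtC_eq0 oppr_eq0 weight_h_neq0. Qed.
Let M := (2%:R / ka) *: X0.
Let yp := h + ka *: v0.
Let ym := h - ka *: v0.

Let lact_X0h : lact X0 h = (ka * ka) *: v0.
Proof. by rewrite weight_lact; [rewrite ka2 scaleNr | exact: ctorus_h]. Qed.
Let lactMp : lact M yp = 2%:R *: yp.
Proof.
rewrite /M /yp lactZl lactDr lactZr lact_X0h -/h; move: h v0 => x y.
by rewrite !scalerDr !scalerA addrC; congr (_ *: _ + _ *: _); field.
Qed.
Let lactMm : lact M ym = - (2%:R *: ym).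
Proof.
rewrite /M /ym lactZl lactBr lactZr lact_X0h -/h; move: h v0 => x y.
rewrite !scalerBr !scalerA opprB; congr (_ *: _ - _ *: _); by field.
Qed.
Let moment_pm : moment yp ym = ka ^+ 4 *: M.
Proof.
have e : moment h v0 = - (ka * ka) *: X0 by rewrite weight_moment ?ka2 ?opprK //; apply: ctorus_h.
rewrite /yp /ym momentDl !momentBr !moment_same !momentZl !momentZr (momentC v0) e /M.
rewrite sub0r subr0 !scaleNr !scalerN !opprK !scalerA -scalerDl.
by congr (_ *: _); field.
Qed.
Let X00 : X0 != 0.
Proof. by apply: contraNneq tau0; rewrite /tau => ->; rewrite mul0mx mxtrace0. Qed.
Let yp0 : yp != 0.
Proof.
apply/eqP => e; have : moment yp v0 = 0 by rewrite e moment0l.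
rewrite /yp momentDl momentZl moment_same scaler0 addr0 weight_moment; last exact: ctorus_h.
by move/eqP; rewrite scaler_eq0 (negbTE weight_h_neq0) (negbTE X00).
Qed.

Lemma adXZ b X x : adX (b *: X) x = b *: adX X x :> ee C.
Proof.
rewrite !adXE -scalemxAr -scalemxAl lactZl -scalerBr.
by apply: injective_projections.
Qed.

Lemma weight_spectrum : exists m : 'I_8 -> C, [/\ forall i, m i \is Num.real,
  \sum_i m i = 0, exists I : sub4, \sum_(i in val I) m i = 2%:R,
  \sum_i m i ^+ 2 = - (4%:R * tau / a h) & horner_mx M (\prod_i ('X - (m i)%:P)) = 0].
Proof.
have [m [trM trM2 [_ diff] ker four]] := lact_spectrum M.
have m0 : \sum_i m i = 0.
  rewrite -trM /M linearZ /=; suff -> : \tr X0 = 0 by rewrite mulr0.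
  have /(congr1 mxtrace) := weight_moment (ctorus_cx u0U).
  rewrite tr_moment0 linearZ /= => /esym/eqP; rewrite mulf_eq0 (negbTE au0).
  by move/eqP.
exists m; split=> //.
- move=> i.
  (* The differences m_i - m_j are eigenvalues of ad M on gl(8), hence integers by the sl2 ladder.
     As the m_i add up to 0, each m_i is an average of such differences. *)
  have dr j : m i - m j \is Num.real.
    have [Y Y0 YE] := diff i j.
    have [] := @ladder_eigenvalue _ _ (2%:R^-1 *: adX M) (adX M) (Dop yp) (Dop ym)
       1 (ka ^+ 4) _ _ _ _ _ _ (Y, 0) (2%:R^-1 * (m i - m j)) (m i - m j).
    + move=> x; rewrite !scale_lfunE; have /eqP := adX_Dop M yp x.
      rewrite subr_eq lactMp DopZ scale_lfunE => /eqP ->.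
      by rewrite scalerDr scalerA mulVf ?scale1r ?pnatr_eq0 // (linearZZ (Dop yp)) addrC.
    + move=> x; rewrite !scale_lfunE; have /eqP := adX_Dop M ym x.
      rewrite subr_eq lactMm DopN opp_lfunE DopZ scale_lfunE => /eqP ->.
      by rewrite scalerDr scalerN scalerA mulVf ?scale1r ?pnatr_eq0 // (linearZZ (Dop ym)) addrC.
    + move=> x; have /eqP := adX_Dop M yp x.
      by rewrite subr_eq lactMp DopZ scale_lfunE mulr1 addrC => /eqP ->.
    + move=> x; have /eqP := adX_Dop M ym x.
      by rewrite subr_eq lactMm DopN opp_lfunE DopZ scale_lfunE mulr1 addrC => /eqP ->.
    + move=> x; have /eqP := Dop_comm jac yp ym x.
      by rewrite subr_eq moment_pm adXZ addrC => /eqP ->.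
    + by rewrite expf_neq0.
    + by apply: contraNneq Y0 => -[->].
    + rewrite scale_lfunE adXE /= YE lact0r; apply: injective_projections => /=.
        by rewrite scalerA.
      by rewrite !scaler0.
    + by rewrite adXE /= YE lact0r; apply: injective_projections; rewrite /= ?scaler0.
    + by move=> n ->; rewrite mul1r realz.
  have -> : m i = 8%:R^-1 * \sum_j (m i - m j).
    rewrite sumrB m0 subr0 sumr_const card_ord -[X in _ * X]mulr_natl mulrA mulVf ?mul1r //.
    by rewrite pnatr_eq0.
  by rewrite rpredM ?rpredV ?realn // rpred_sum.
- have [I] := four _ _ yp0 lactMp; rewrite m0 mul0r subr0 => e.
  by exists I.
- rewrite -trM2 /M -scalemxAl -scalemxAr scalerA linearZ /= -/tau.
  have -> : a h = - (ka * ka) by rewrite ka2 opprK.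
  by field.
Qed.

(* A multiple M of X0 belongs to an sl2 acting on gl(8) + ext4, so its eigenvalues are
   real; one of its eigenvalues on ext4, a sum of four eigenvalues of M, is 2, and
   Cauchy-Schwarz bounds tr (M^2) = 4 / q. *)
Lemma weight_bound : let q := - (a h / tau) in [/\ 2%:R <= 4%:R / q :> C &
  q = 2%:R -> (forall N : 'M[C]_8, (forall u, u \in U -> lact N (cx u) = 0) -> exists s, N = s%:M) ->
  X0 *m X0 = (tau / 8%:R)%:M].
Proof.
have [m [mr m0 [I mI] m2 ker]] := weight_spectrum.
have [le eq] := four_sum_bound mr m0 mI; have ah := weight_h_neq0.
have qE : - (4%:R * tau / a h) = 4%:R / - (a h / tau) by field; rewrite ah tau0.
move=> q; rewrite m2 qE in le eq; split=> // q2 z0.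
have {}eq := eq (_ : 4%:R / q = 2%:R).
have mh i : m i = 2%:R^-1 \/ m i = - 2%:R^-1.
  rewrite eq; last by rewrite q2; field.
  by case: ifP; [left | right].
have [S [N [ME SN S2 N8]]] := half_involution_part mh ker.
have kill := @nilpotent_part_kills _ S N; rewrite -ME in kill.
have Np : lact N yp = 0 by apply: kill SN S2 N8 lactMp.
have Nm : lact N ym = 0.
  by apply: (kill (- 2%:R)) => //; rewrite lactMm scaleNr.
have Nh : lact N h = 0.
  have -> : h = 2%:R^-1 *: (yp + ym).
    by rewrite /yp /ym addrACA subrr addr0 -mulr2n -scaler_nat scalerA mulVf ?scale1r // pnatr_eq0.
  by rewrite lactZr lactDr Np Nm addr0 scaler0.
(* Every torus element is a multiple of h plus an element z' with a z' = 0. [M] kills z', hence so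
   does its nilpotent part N, which also kills h; thus N annihilates [U] and is scalar. *)
have [s Ns] : exists s, N = s%:M.
  apply: z0 => u uU; have hu := ctorus_cx uU; set z := cx u in hu *.
  pose z' := z - (a z / a h) *: h; have z'U : ctorus z'.
    by rewrite /z' -scaleNr; apply: ctorusD => //; apply: ctorusZ; apply: ctorus_h.
  have az' : a z' = 0.
    have := wedge_h z'U; rewrite /z' wedgeBr wedgeZr !wedge_h //; last exact: ctorus_h.
    have -> : - (tau * a z) - a z / a h * - (tau * a h) = 0 by field.
    by move=> /esym/eqP; rewrite oppr_eq0 mulf_eq0 (negbTE tau0) => /eqP.
  have Mz' : lact M z' = 0 *: z' by rewrite /M lactZl weight_lact // az' !scale0r oppr0 scaler0.
  have Nz' := kill _ _ SN S2 N8 Mz'.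
  have -> : z = z' + (a z / a h) *: h by rewrite subrK.
  by rewrite lactDr lactZr Nz' Nh scaler0 addr0.
have s0 : s = 0.
  have : (s%:M : 'M[C]_8) ^+ 8 = (s ^+ 8)%:M by rewrite -rmorphXn.
  rewrite -Ns N8 => /(congr1 (fun A : 'M[C]_8 => A ord0 ord0)); rewrite !mxE eqxx mulr1n => /esym/eqP.
  by rewrite expf_eq0 => /andP[_ /eqP].
have M2 : M *m M = (4%:R^-1)%:M by rewrite ME Ns s0 (raddf0 (@scalar_mx C 8)) addr0 S2.
have -> : X0 = (ka / 2%:R) *: M by rewrite /M scalerA (_ : ka / 2%:R * (2%:R / ka) = 1) ?scale1r //; field.
rewrite -scalemxAl -scalemxAr scalerA M2 scale_scalar_mx; congr (_%:M).
have : ka * ka = 2%:R * tau by rewrite ka2 -q2 /q; field.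
by move=> k2; rewrite (_ : ka / 2%:R * (ka / 2%:R) = ka * ka / 4%:R); [rewrite k2; field | field].
Qed.
End WeightVector.
End Weights.

Lemma nat_avoiding (K : numFieldType) (s : seq K) : exists n : nat, n.+1%:R \notin s.
Proof.
have [/existsP[n h]|] := boolP [exists n : 'I_(size s).+1, (n.+1%:R : K) \notin s]; first by exists n.
rewrite negb_exists => /forallP h.
have : (size [seq (n.+1%:R : K) | n <- iota 0 (size s).+1] <= size s)%N.
  apply: uniq_leq_size.
    rewrite map_inj_uniq ?iota_uniq // => a b /eqP; by rewrite eqr_nat => /eqP[].
  move=> t /mapP[n]; rewrite mem_iota add0n => /= ns tE; rewrite {t}tE.
  by have := h (Ordinal ns); rewrite negbK.
by rewrite size_map size_iota ltnn.
Qed.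

Section Generic.
Variables (R K : numFieldType) (c : {rmorphism R -> K}) (V : vectType R) (U : {vspace V}).

(** A functional that does not vanish on [U] is made nonzero by adding a positive integer multiple
    of some u; only finitely many multiples spoil the functionals already treated. *)
Lemma generic_point (I : eqType) (s : seq I) (f : I -> V -> K) :
  (forall i x y, f i (x + y) = f i x + f i y) -> (forall i a x, f i (a *: x) = c a * f i x) ->
  exists2 x, x \in U & {in s, forall i, f i x = 0 -> forall u, u \in U -> f i u = 0}.
Proof.
move=> fD fZ; have f0 i : f i 0 = 0 by rewrite -(scale0r 0) fZ rmorph0 mul0r.
elim: s => [|i s [x xU hx]]; first by exists 0; rewrite ?mem0v.
have [fx|fx] := eqVneq (f i x) 0; last first.
  by exists x => // j; rewrite inE => /orP[/eqP -> /eqP|/hx//]; rewrite (negbTE fx).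
have [/forallP h|] := boolP [forall k : 'I_(\dim U), f i (vbasis U)`_k == 0].
  exists x => // j; rewrite inE => /orP[/eqP -> _ u uU|/hx//].
  rewrite (coord_vbasis uU) (big_morph _ (fD i) (f0 i)) big1 // => k _.
  by rewrite fZ (eqP (h k)) mulr0.
rewrite negb_forall => /existsP[k fu]; set u := (vbasis U)`_k in fu.
have uU : u \in U by apply: vbasis_mem; rewrite mem_nth ?size_tuple.
have [n nn] := nat_avoiding [seq - f j x / f j u | j <- s].
exists (x + n.+1%:R *: u); first by rewrite rpredD // rpredZ.
have fn j : f j (x + n.+1%:R *: u) = f j x + n.+1%:R * f j u by rewrite fD fZ rmorph_nat.
move=> j; rewrite inE fn => /orP[/eqP ->|js] e.
  by move/eqP: e; rewrite fx add0r mulf_eq0 pnatr_eq0 (negbTE fu).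
have [fj|fj] := eqVneq (f j x) 0; first exact: hx.
have fju : f j u != 0 by apply: contraNneq fj => h; rewrite -e h mulr0 addr0.
case/negP: nn; apply/mapP; exists j => //.
by apply: (mulIf fju); rewrite divfK //; apply/eqP; rewrite -addr_eq0 addrC e.
Qed.
End Generic.

(** * The dimension of a maximal torus *)

Lemma card_sub4 : #|{: sub4}| = 70%N.
Proof.
rewrite card_sig; transitivity 'C(#|'I_8|, 4); last by rewrite card_ord.
by rewrite -card_draws cardsE; apply: eq_card => I; rewrite !inE.
Qed.

Lemma dim_ext4 (K : fieldType) : dim (ext4 K) = 70%N.
Proof. by rewrite /dim /= card_sub4 muln1. Qed.

Lemma dim_ee (K : numFieldType) : dim (ee K) = 134%N.
Proof. by rewrite -[LHS]/(64 + dim (ext4 K))%N dim_ext4. Qed.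

Section Structure.
Variables (R : rcfType) (C : numClosedFieldType) (c : complexification R C).
Local Notation cx := (cx c).
Hypothesis jac : jacobi C.
Variable U : {vspace ext4 R}.
Hypothesis mtU : max_torus c U.

Let tU : torus c U. Proof. by case: mtU. Qed.

(** The functionals to be avoided are the weights of a joint eigenbasis and their differences. Where
    each is nonzero unless it vanishes identically, eigenvectors of [Dop x] are joint weight
    vectors. *)
Lemma generic_element : exists2 x, x \in U & forall p l, p != 0 -> Dop (cx x) p = l *: p ->
  exists a, [/\ weight c U a p, a (cx x) = l & l = 0 -> forall z, ctorus c U z -> a z = 0].
Proof.
have [b [phi [bE pb be]]] := ctorus_eigenbasis jac mtU.
pose A k z : C := phi k (Dop z (b k)).
have AD k z w : A k (z + w) = A k z + A k w by rewrite /A DopD add_lfunE (linearD (phi k)).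
have AZ k s z : A k (s *: z) = s * A k z by rewrite /A DopZ scale_lfunE (linearZZ (phi k)).
pose f (i : 'I_(dim (ee C)) * option 'I_(dim (ee C))) (x : ext4 R) : C :=
  A i.1 (cx x) - (if i.2 is Some l then A l (cx x) else 0).
have [||x xU hx] := @generic_point _ _ c _ U _ (index_enum _) f.
- by move=> [k [l|]] x y; rewrite /f /= cxD !AD ?subr0 // opprD addrACA.
- by move=> [k [l|]] a x; rewrite /f /= cxZ !AZ ?subr0 // mulrBr.
exists x => // p l p0 Dp.
have Ak k : phi k p != 0 -> A k (cx x) = l.
  move=> kp; have := congr1 (phi k) Dp; rewrite {1}(bE p) (linear_sum (Dop _)) (linear_sum (phi k)).
  rewrite (bigD1 k) //= big1 => [|m mk].
    rewrite addr0 (linearZZ (Dop _)) !(linearZZ (phi k)) => /eqP.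
    rewrite -[phi k p *: _]/(phi k p * A k (cx x)) -[l *: _]/(l * phi k p).
    by rewrite mulrC -subr_eq0 -mulrBl mulf_eq0 (negbTE kp) orbF subr_eq0 => /eqP.
  rewrite (linearZZ (Dop _)) (linearZZ (phi k)) /= be; last exact: ctorus_cx.
  rewrite (linearZZ (phi k)) /=.
  have -> : phi k (b m) = 0 by have := pb k m; rewrite eq_sym (negbTE mk).
  by rewrite !scaler0.
have ctl (g : ext4 C -> C) : (forall z w, g (z + w) = g z + g w) -> (forall s z, g (s *: z) = s * g z) ->
    (forall u, u \in U -> g (cx u) = 0) -> forall z, ctorus c U z -> g z = 0.
  move=> gD gZ h z /(ctorus_rect jac mtU)[u uU [v vU ->]].
  by rewrite gD gZ !h // mulr0 addr0.
have [k kp] : exists k, phi k p != 0.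
  apply/existsP; apply: contraNT p0; rewrite negb_exists => /forallP h.
  by rewrite (bE p) big1 // => k _; rewrite (eqP (negbNE (h k))) scale0r.
exists (A k); split; last 1 first.
- move=> l0; apply: (ctl (A k)) => // u uU.
  have := hx (k, None); rewrite mem_index_enum /f /= subr0 Ak // => /(_ isT l0 u uU).
  by rewrite subr0.
- move=> z zU; rewrite {1}(bE p) (linear_sum (Dop z)) [in RHS](bE p) scaler_sumr; apply: eq_bigr => m _.
  have h := be z m zU; rewrite (linearZZ (Dop z)) /= [X in _ *: X = _]h.
  have [->|mp] := eqVneq (phi m p) 0; first by rewrite !scale0r scaler0.
  suff -> : phi m (Dop z (b m)) = A k z by rewrite 2!scalerA mulrC.
  rewrite -[LHS]/(A m z); apply/eqP; rewrite -subr_eq0; apply/eqP.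
  apply: (ctl (fun z => A m z - A k z)) => // [w y|s w|u uU].
  + by rewrite !AD opprD addrACA.
  + by rewrite !AZ mulrBr.
  + by have := hx (m, Some k); rewrite mem_index_enum /f /= !Ak // subrr => /(_ isT erefl u uU).
- exact: Ak.
Qed.

Lemma centralizer_generic x : x \in U -> (forall p l, p != 0 -> Dop (cx x) p = l *: p ->
  exists a, [/\ weight c U a p, a (cx x) = l & l = 0 -> forall z, ctorus c U z -> a z = 0]) ->
  forall w, moment x w = 0 -> w \in U.
Proof.
move=> xU gx w xw; have [->|w0] := eqVneq w 0; first exact: mem0v.
apply: (max_torus_centralizer jac mtU) => u uU.
have p0 : (0, cx w) != 0 :> ee C.
  by apply: contraNneq w0 => -[] e; apply/eqP/(@cx_inj _ _ c); rewrite e cx0.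
have [|a [ap _ h]] := gx (0, cx w) 0 p0.
  by rewrite DopE /= moment_cx // lact0l oppr0 scale0r; apply: injective_projections.
have := ap _ (ctorus_cx mtU uU); rewrite h //; last exact: ctorus_cx.
rewrite DopE scale0r => /(congr1 fst) /=; rewrite cx_moment -(map_mx0 c).
by move/map_mx_inj.
Qed.

Lemma dim_image_moment x : (forall w, (moment x w = 0) <-> (w \in U)) ->
  (\dim (limg (linfun (@moment R x))) + \dim U = 70)%N.
Proof.
move=> h; rewrite addnC -(dim_ext4 R) -dimvf -(limg_ker_dim (linfun (@moment R x)) fullv).
rewrite capfv; congr (\dim _ + _)%N.
by apply/vspaceP => w; rewrite memv_ker lfunE /=; apply/idP/eqP => /h.
Qed.

Lemma traceless_dim : \dim (lker (linfun (@mxtrace R 8 : 'M[R]_8 -> R^o))) = 63%N.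
Proof.
set f := linfun _.
have h1 : (\dim (lker f) + \dim (limg f) = 64)%N.
  by rewrite -[in LHS](capfv (lker f)) limg_ker_dim dimvf /dim.
suff : \dim (limg f) = 1%N by move=> e; move: h1; rewrite e addn1 => -[].
have le : (\dim (limg f) <= \dim {:R^o})%N by apply: dimvS (subvf _).
rewrite dimvf in le; apply/eqP; rewrite eqn_leq le /=.
rewrite lt0n dimv_eq0; apply/eqP => e.
have : f (delta_mx 0 0) \in limg f by apply: memv_img; apply: memvf.
by rewrite e memv0 lfunE /= tr_delta oner_eq0.
Qed.

(** [U] is the kernel of [moment x] on a space of dimension 70, and the image consists of traceless
    matrices, a space of dimension 63. *)
Lemma dim_torus_ge7 x : (forall w, (moment x w = 0) <-> (w \in U)) -> (7 <= \dim U)%N.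
Proof.
move=> h; have := dim_image_moment h.
have : (limg (linfun (@moment R x)) <= lker (linfun (@mxtrace R 8 : 'M[R]_8 -> R^o)))%VS.
  by apply/subvP => _ /memv_imgP[w _ ->]; rewrite memv_ker !lfunE /= tr_moment0.
by move/dimvS; rewrite traceless_dim => le e; rewrite -(leq_add2l 63) (leq_trans _ (leq_add le (leqnn _))) // e.
Qed.

(** In dimension 7 the image of [moment x] is all of sl(8), and a matrix annihilating [U] is
    orthogonal to that image for the trace form. *)
Lemma centralizer_scalar x : x \in U -> (forall w, (moment x w = 0) <-> (w \in U)) -> \dim U = 7%N ->
  forall N : 'M[C]_8, (forall u, u \in U -> lact N (cx u) = 0) -> exists s, N = s%:M.
Proof.
move=> xU h d7 N Nz; have := dim_image_moment h; rewrite d7 => e.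
have sub : (limg (linfun (@moment R x)) <= lker (linfun (@mxtrace R 8 : 'M[R]_8 -> R^o)))%VS.
  by apply/subvP => _ /memv_imgP[w _ ->]; rewrite memv_ker !lfunE /= tr_moment0.
have dd : \dim (limg (linfun (@moment R x))) = 63%N by apply/eqP; rewrite -(eqn_add2r 7) e.
have eqv : limg (linfun (@moment R x)) = lker (linfun (@mxtrace R 8 : 'M[R]_8 -> R^o)).
  by apply/eqP; rewrite eqEdim sub dd traceless_dim.
have trN (Y : 'M[R]_8) : \tr Y = 0 -> \tr (map_mx c Y *m N) = 0.
  move=> tY; have : Y \in limg (linfun (@moment R x)).
    by rewrite eqv memv_ker lfunE /= tY.
  case/memv_imgP=> w _ ->; rewrite lfunE /= -cx_moment tr_moment wedgeC wedge_lact wedgeC.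
  by rewrite opprK Nz // wedge0l.
have tE i j : \tr (delta_mx i j *m N) = N j i.
  rewrite /mxtrace (bigD1 i) //= big1 => [|k ki].
    rewrite addr0 mxE (bigD1 j) //= big1 => [|l lj]; first by rewrite mxE !eqxx mul1r addr0.
    by rewrite mxE (negbTE lj) andbF mul0r.
  by rewrite mxE big1 // => l _; rewrite mxE (negbTE ki) mul0r.
exists (N ord0 ord0); apply/matrixP => i j; rewrite mxE.
have [->|ij] := eqVneq i j; last first.
  rewrite -tE -(map_delta8 c) trN //= ?tr_delta ?mulr0n //.
  by rewrite eq_sym (negbTE ij).
have t0 : \tr (delta_mx j j - delta_mx ord0 ord0 : 'M[R]_8) = 0.
  by rewrite (raddfB (@mxtrace R 8)) /= !tr_delta !eqxx subrr.
have := trN _ t0; rewrite map_mxB !map_delta8 mulmxBl (raddfB (@mxtrace C 8)) /= !tE mulr1n.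
by move/eqP; rewrite subr_eq0 => /eqP.
Qed.

(** For r of weight [a], pairing r with its parity image gives 2 tr (r.1^2). Choose q of weight [a]
    whose parity image is not orthogonal to p; by polarization one of p, q and p + q is
    anisotropic. *)
Lemma nondegenerate_weight a p u0 : weight c U a p -> p != 0 -> u0 \in U -> a (cx u0) != 0 ->
  exists2 q, weight c U a q & \tr (q.1 *m q.1) != 0.
Proof.
move=> ap p0 u0U a0; have hu := ctorus_cx mtU u0U.
have [b [phi [bE pb be]]] := ctorus_eigenbasis jac mtU.
have [k pk] : exists k, kform p (b k) != 0.
  apply/existsP; apply: contraNT p0; rewrite negb_exists => /forallP h.
  apply/eqP/kform_nondeg => q; rewrite (bE q) kform_sumr big1 // => k _.
  by rewrite kformZr (eqP (negbNE (h k))) mulr0.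
have par (q : ee C) : parity (parity q) = q by rewrite /parity /= opprK; case: q.
pose q := parity (b k).
have aq : weight c U a q.
  move=> z zU; rewrite /q -[Dop z _]opprK -parity_Dop be //; set l := phi k _.
  have : kform (Dop z p) (b k) = - kform p (Dop z (b k)) by apply: kform_Dop.
  rewrite ap // be // -/l kformZl kformZr => /eqP; rewrite -addr_eq0 -mulrDl mulf_eq0 (negbTE pk) orbF.
  by rewrite addr_eq0 => /eqP ->; rewrite parityZ scaleNr.
have pq : kform p (parity q) != 0 by rewrite /q par.
have sym (r s : ee C) : kform s (parity r) = kform r (parity s).
  by rewrite /kform /parity /= !wedgeNr mxtrace_mulC wedgeC.
pose n (r : ee C) := kform r (parity r).
have nE r : weight c U a r -> n r = 2%:R * \tr (r.1 *m r.1).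
  move=> ar; have h1 := weight_moment ar hu; have h2 := weight_lact ar hu.
  have e1 : a (cx u0) * \tr (r.1 *m r.1) = - wedge (cx u0) (lact r.1 r.2).
    by rewrite -tr_moment h1 -scalemxAl linearZ.
  have e2 : - (a (cx u0) * wedge r.2 r.2) = - wedge (cx u0) (lact r.1 r.2).
    by rewrite -wedge_lact h2 wedgeNl wedgeZl.
  have e3 : \tr (r.1 *m r.1) = - wedge r.2 r.2 by apply: (mulfI a0); rewrite mulrN e1 e2.
  by rewrite /n /kform /= wedgeNr -e3; ring.
have [tp|] := eqVneq (\tr (p.1 *m p.1)) 0; last by exists p.
have [tq|] := eqVneq (\tr (q.1 *m q.1)) 0; last by exists q.
have apq : weight c U a (p + q).
  by move=> z zU; rewrite (linearD (Dop z)) /= ap // aq // scalerDr.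
exists (p + q) => //; apply/eqP => t0; case/eqP: pq.
have := nE _ apq; rewrite t0 mulr0 /n parityD kformDl !kformDr -!/(n _) !nE // tp tq !mulr0 add0r addr0.
rewrite (sym p q).
by move/eqP; rewrite -mulr2n -mulr_natl mulf_eq0 pnatr_eq0 => /eqP.
Qed.
End Structure.

Lemma cx_free (R : rcfType) (C : numClosedFieldType) (c : complexification R C) n
    (u : 'I_n -> ext4 R) (v : 'I_n -> C) :
  (forall k : 'I_n -> R, \sum_i k i *: u i = 0 -> forall i, k i = 0) ->
  \sum_i v i *: cx c (u i) = 0 -> forall i, v i = 0.
Proof.
move=> fr e.
have [e1 e2] : \sum_i cx_re c (v i) *: u i = 0 /\ \sum_i cx_im c (v i) *: u i = 0.
  suff h I : (\sum_i cx_re c (v i) *: u i) I = 0 :> R /\ (\sum_i cx_im c (v i) *: u i) I = 0 :> R.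
    by split; apply/ffunP => I; rewrite ext4_0; case: (h I).
  apply: (@cx_rect_eq0 _ _ c); have /ffunP/(_ I) := e; rewrite ext4_0 => <-.
  rewrite !ext4_sum !rmorph_sum mulr_sumr -big_split; apply: eq_bigr => i _ /=.
  by rewrite !ext4Z !rmorphM /= emapE [v i in RHS](cx_rect c); ring.
by move=> i; rewrite [v i](cx_rect c) (fr _ e1) (fr _ e2) !rmorph0 mulr0 addr0.
Qed.

Section TorusStructure.
Variables (R : rcfType) (C : numClosedFieldType) (c : complexification R C).
Local Notation cx := (cx c).
Hypothesis jac : jacobi C.
Variable U : {vspace ext4 R}.
Hypothesis mtU : max_torus c U.

Let tU : torus c U. Proof. by case: mtU. Qed.
Let d := \dim U.
Let u (i : 'I_d) := (vbasis U)`_i.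

Let uU i : u i \in U. Proof. by apply: vbasis_mem; rewrite mem_nth ?size_tuple. Qed.

Let ufree (k : 'I_d -> R) : \sum_i k i *: u i = 0 -> forall i, k i = 0.
Proof.
by move=> e i; have /freeP := basis_free (vbasisP U); apply.
Qed.

Definition gram : 'M[C]_d := \matrix_(i, j) c (wedge (u i) (u j)).

Lemma span_nondeg z : (forall j, wedge z (cx (u j)) = 0) -> ctorus c U z -> z = 0.
Proof.
move=> h zU; apply: (ctorus_nondeg jac mtU) => // w wU.
rewrite (coord_vbasis wU) cx_sum wedge_sumr big1 // => i _.
by rewrite cxZ wedgeZr h mulr0.
Qed.

Lemma ctorus_sum (I : finType) (k : I -> C) (z : I -> ext4 C) : (forall i, ctorus c U (z i)) ->
  ctorus c U (\sum_i k i *: z i).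
Proof.
move=> h; elim/big_ind: _ => [w wU|x y|i _]; first by rewrite moment0r.
  exact: ctorusD.
by apply: ctorusZ.
Qed.

Lemma gram_unit : gram \in unitmx.
Proof.
rewrite -row_free_unit -kermx_eq0; apply/rowV0P => v /sub_kermxP vG.
have vz : \sum_i v 0 i *: cx (u i) = 0.
  apply: span_nondeg => [j|].
    transitivity ((v *m gram) 0 j); last by rewrite vG mxE.
    by rewrite wedge_suml mxE; apply: eq_bigr => i _; rewrite wedgeZl cx_wedge mxE.
  by apply: (@ctorus_sum _ (v 0)) => i; apply: ctorus_cx.
by apply/rowP => i; rewrite mxE; apply: (cx_free ufree vz).
Qed.

(** The squared norm of [a] for the form dual to [wedge] on [U]. It goes through the inverse Gram
    matrix because [wedge] need not be definite on [U], so there may be no orthonormal real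
    basis. *)
Definition gram_norm (a : ext4 C -> C) : C :=
  \sum_i \sum_j invmx gram i j * (a (cx (u i)) * a (cx (u j))).

Lemma gram_normE a p u0 : weight c U a p -> u0 \in U -> a (cx u0) != 0 ->
  \tr (p.1 *m p.1) != 0 -> gram_norm a = - (a (lact p.1 p.2) / \tr (p.1 *m p.1)).
Proof.
move=> ap u0U a0 t0; set tau := \tr _ in t0 *; set h := lact _ _.
have hU := ctorus_h mtU ap; have wh := wedge_h ap; rewrite -/h in hU wh.
pose t := - tau^-1 *: h; have ctt : ctorus c U t by apply: ctorusZ.
have wt z : ctorus c U z -> wedge t z = a z.
  by move=> zU; rewrite /t wedgeZl wh // mulrN mulNr opprK mulrA mulVf // mul1r.
pose t' := \sum_j (\sum_i invmx gram i j * a (cx (u i))) *: cx (u j).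
have ctt' : ctorus c U t' by apply: ctorus_sum => i; apply: ctorus_cx.
have tt' : t' - t = 0.
  apply: span_nondeg => [l|]; last by rewrite -scaleN1r; apply: ctorusD => //; apply: ctorusZ.
  rewrite wedgeBl wt; last exact: ctorus_cx.
  apply/eqP; rewrite subr_eq0; apply/eqP; rewrite /t' wedge_suml.
  transitivity (\sum_i a (cx (u i)) * (invmx gram *m gram) i l); last first.
    rewrite mulVmx ?gram_unit // (bigD1 l) //= big1 => [|i il]; first by rewrite mxE eqxx mulr1 addr0.
    by rewrite mxE (negbTE il) mulr0.
  transitivity (\sum_j \sum_i a (cx (u i)) * (invmx gram i j * gram j l)).
    apply: eq_bigr => j _; rewrite wedgeZl mulr_suml; apply: eq_bigr => i _.
    by rewrite cx_wedge [gram j l]mxE mulrA; congr (_ * _); rewrite mulrC.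
  by rewrite exchange_big; apply: eq_bigr => i _; rewrite -mulr_sumr mxE.
have -> : gram_norm a = wedge t t'.
  rewrite /t' wedge_sumr /gram_norm exchange_big; apply: eq_bigr => j _.
  rewrite wedgeZr wt; last exact: ctorus_cx.
  by rewrite mulr_suml; apply: eq_bigr => i _; rewrite mulrA.
move/eqP: tt'; rewrite subr_eq0 => /eqP ->.
by rewrite /t wedgeZl wedgeZr wh //; field.
Qed.

(** Let d = dim U. Of the 64 + 70 = 134 weights at least d + 1 are zero. The norms of the others add
    up to 36 d, and each is at most 2, so 36 d <= 2 (133 - d), that is d <= 7. With d >= 7 all
    inequalities are equalities: there are 126 nonzero weights, each of norm 2. *)
Lemma torus_structure : [/\ \dim U = 7%N,
  forall N : 'M[C]_8, (forall w, w \in U -> lact N (cx w) = 0) -> exists s, N = s%:M &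
  forall a p u0, weight c U a p -> u0 \in U -> a (cx u0) != 0 -> \tr (p.1 *m p.1) != 0 ->
    a (lact p.1 p.2) = - (2%:R * \tr (p.1 *m p.1))].
Proof.
have [x xU gx] := generic_element jac mtU.
have cen w : moment x w = 0 <-> w \in U.
  split; first exact: (centralizer_generic jac mtU xU gx).
  by move=> wU; case: tU => _; apply.
have d7 := dim_torus_ge7 cen.
have [b [phi [bE pb be]]] := ctorus_eigenbasis jac mtU.
pose A k z : C := phi k (Dop z (b k)).
have wb k : weight c U (A k) (b k) by move=> z zU; apply: be.
have phiD k z p : ctorus c U z -> phi k (Dop z p) = A k z * phi k p.
  move=> zU; rewrite {1}(bE p) (linear_sum (Dop z)) (linear_sum (phi k)) (bigD1 k) //= big1 => [|m mk].
    by rewrite addr0 (linearZZ (Dop z)) (linearZZ (phi k)) [LHS]mulrC.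
  have h := be z m zU; rewrite (linearZZ (Dop z)) (linearZZ (phi k)) /= h (linearZZ (phi k)) /=.
  have -> : phi k (b m) = 0 by have := pb k m; rewrite eq_sym (negbTE mk).
  by rewrite !scaler0.
pose Zs := [set k | [forall i, A k (cx (u i)) == 0]].
have Zs0 k : k \notin Zs -> exists i, A k (cx (u i)) != 0.
  by rewrite inE negb_forall => /existsP.
have q2 k : k \notin Zs -> 0 <= 2%:R - gram_norm (A k).
  move=> /Zs0[i ai].
  have b0 : b k != 0.
    by apply/eqP => e; have := pb k k; rewrite e linear0 eqxx => /eqP; rewrite eq_sym oner_eq0.
  have [p ap tp] := nondegenerate_weight jac mtU (wb k) b0 (uU i) ai.
  have [h _] := weight_bound jac mtU ap (uU i) ai tp.
  rewrite (gram_normE ap (uU i) ai tp); move: (- _) h => q h.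
  have q0 : 0 < q by rewrite -invr_gt0 -(pmulr_rgt0 _ (ltr0n C 4)) (lt_le_trans _ h) ?ltr0n.
  rewrite subr_ge0; move: h; rewrite ler_pdivlMr // => h.
  by rewrite -(ler_pM2l (ltr0n C 2)) (le_trans h) // -natrM.
have sum : \sum_(k | k \notin Zs) gram_norm (A k) = (36 * d)%:R.
  have e1 : \sum_(k | k \in Zs) gram_norm (A k) = 0.
    rewrite big1 // => k; rewrite inE => /forallP h; rewrite /gram_norm big1 // => i _.
    by rewrite big1 // => j _; rewrite (eqP (h i)) mul0r mulr0.
  have -> : \sum_(k | k \notin Zs) gram_norm (A k) = \sum_k gram_norm (A k).
    by rewrite [RHS](bigID (mem Zs)) /= e1 add0r.
  rewrite /gram_norm exchange_big /=.
  have tr i j : \sum_k A k (cx (u i)) * A k (cx (u j)) = 36%:R * gram i j.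
    rewrite mxE -cx_wedge -trace_DD // (end_traceE (phi := phi) (b := b)) //.
    apply: eq_bigr => k _; rewrite comp_lfunE.
    exact: (esym (phiD k _ (Dop (cx (u j)) (b k)) (ctorus_cx mtU (uU i)))).
  transitivity (\sum_i \sum_j invmx gram i j * (36%:R * gram i j)).
    apply: eq_bigr => i _; rewrite exchange_big; apply: eq_bigr => j _.
    by rewrite -mulr_sumr tr.
  have gs i j : gram i j = gram j i by rewrite !mxE wedgeC.
  transitivity (\sum_i 36%:R * (invmx gram *m gram) i i).
    apply: eq_bigr => i _; rewrite mxE mulr_sumr; apply: eq_bigr => j _.
    by rewrite mulrCA gs.
  rewrite -mulr_sumr mulVmx ?gram_unit // -[X in _ * X]/(\tr _) mxtrace1 natrM.
  by [].
(* The identity matrix and a basis of [U] are 1 + d independent vectors annihilated by [U], so their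
   coordinates live on the zero weights. *)
have n0 : (d < #|Zs|)%N.
  rewrite ltnNge; apply/negP => le.
  pose F (o : 'I_(1 + d)) : ee C := match split o with inl _ => (1%:M, 0) | inr i => (0, cx (u i)) end.
  have DF o w : w \in U -> Dop (cx w) (F o) = 0.
    move=> wU; rewrite /F; case: (split o) => i; rewrite DopE /=.
      by rewrite moment0r lact1 oppr0; apply: injective_projections.
    rewrite moment_cx ?lact0l ?oppr0; first exact: injective_projections.
    by case: tU => _; apply.
  pose W : 'M[C]_(1 + d, #|Zs|) := \matrix_(o, j) phi (enum_val j) (F o).
  have : ~~ row_free W by rewrite /row_free neq_ltn (leq_ltn_trans (rank_leq_col W)).
  rewrite -kermx_eq0 => /rowV0Pn[v /sub_kermxP vW /negP[]]; apply/eqP.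
  have y0 : \sum_o v 0 o *: F o = 0.
    rewrite [LHS]bE big1 // => k _.
    suff -> : phi k (\sum_o v 0 o *: F o) = 0 by rewrite scale0r.
    rewrite (linear_sum (phi k)); have [kZ|/Zs0[i ai]] := boolP (k \in Zs).
      transitivity ((v *m W) 0 (enum_rank_in kZ k)); last by rewrite vW mxE.
      by rewrite mxE; apply: eq_bigr => o _; rewrite mxE enum_rankK_in // (linearZZ (phi k)).
    rewrite big1 // => o _; rewrite (linearZZ (phi k)) /=.
    suff -> : phi k (F o) = 0 by rewrite scaler0.
    have := phiD k _ (F o) (ctorus_cx mtU (uU i)); rewrite DF // linear0 => /esym/eqP.
    by rewrite mulf_eq0 (negbTE ai) => /eqP.
  move: y0; rewrite big_split_ord /= big_ord1 /F.
  rewrite (unsplitK (inl _)).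
  have -> : \sum_(i < d) v 0 (rshift 1 i) *: (match split (rshift 1 i) with inl _ => (1%:M, 0) | inr i => (0, cx (u i)) end : ee C) =
      (0, \sum_i v 0 (rshift 1 i) *: cx (u i)).
    apply: injective_projections; rewrite ?raddf_sum /=.
      by rewrite big1 // => i _; rewrite (unsplitK (inr _)) /= scaler0.
    by apply: eq_bigr => i _; rewrite (unsplitK (inr _)).
  move=> y0; have h1 := congr1 fst y0; have h2 := congr1 snd y0; rewrite /= in h1 h2.
  apply/rowP => o; rewrite mxE -[o]splitK; case: (split o) => i /=.
    move: h1; rewrite addr0 (ord1 i) => /matrixP/(_ ord0 ord0); rewrite !mxE eqxx mulr1 => e.
    by rewrite -[RHS]e; congr (v 0 (lshift d _)); apply: val_inj.
  by move: h2; rewrite scaler0 add0r => {}h2; exact: (@cx_free _ _ c _ u (fun i => v 0 (rshift 1 i)) ufree h2 i).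
have cZ : (#|~: Zs| + #|Zs| = 134)%N by rewrite addnC cardsC card_ord dim_ee.
have sum2 : \sum_(k | k \notin Zs) (2%:R - gram_norm (A k)) = (2 * #|~: Zs|)%:R - (36 * d)%:R.
  rewrite sumrB sum sumr_const -[_ *+ _]mulr_natr -natrM; congr (_%:R - _).
  by congr (2 * _)%N; apply: eq_card => k; rewrite in_setC unfold_in.
have ge0 : 0 <= \sum_(k | k \notin Zs) (2%:R - gram_norm (A k)) by apply: sumr_ge0.
have le36 : (36 * d <= 2 * #|~: Zs|)%N by move: ge0; rewrite sum2 subr_ge0 ler_nat.
have [dE cE] : d = 7%N /\ #|~: Zs| = 126%N.
  move: (#|~: Zs|) (#|Zs|) n0 cZ le36 d7; rewrite -/d => x1 x2; lia.
have q2E k : k \notin Zs -> gram_norm (A k) = 2%:R.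
  move=> kZ; have := sum2; rewrite cE dE subrr => /eqP; rewrite psumr_eq0 // => /allP/(_ k).
  by rewrite mem_index_enum kZ /= subr_eq0 => /(_ isT) /eqP.
split=> //; first exact: (centralizer_scalar xU cen dE).
move=> a p u0 ap u0U a0 tp.
have p0 : p != 0 by apply: contraNneq tp => ->; rewrite /= mul0mx mxtrace0.
have [k kp] : exists k, phi k p != 0.
  apply/existsP; apply: contraNT p0; rewrite negb_exists => /forallP h.
  by rewrite (bE p) big1 // => k _; rewrite (eqP (negbNE (h k))) scale0r.
have aA z : ctorus c U z -> a z = A k z.
  move=> zU; apply: (mulIf kp); rewrite -phiD // ap // (linearZZ (phi k)) /=; by [].
have kZ : k \notin Zs.
  rewrite inE; apply: contraNN a0 => /forallP h; rewrite aA; last exact: ctorus_cx.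
  have AE y : A k y = phi k (Dop y (b k)) by [].
  rewrite (coord_vbasis u0U) cx_sum AE.
  have Dsum (G : 'I_d -> ext4 C) q : Dop (\sum_i G i) q = \sum_i Dop (G i) q.
    apply: (big_morph (fun z => Dop z q)); last by rewrite DopE moment0l lact0r oppr0; apply: injective_projections.
    by move=> y z; rewrite DopD add_lfunE.
  rewrite Dsum (linear_sum (phi k)) big1 // => i _.
  have hi : phi k (Dop (cx (vbasis U)`_i) (b k)) = 0 by apply/eqP; apply: h i.
  by rewrite cxZ DopZ scale_lfunE (linearZZ (phi k)) /= hi scaler0.
have := gram_normE ap u0U a0 tp.
have -> : gram_norm a = gram_norm (A k).
  by apply: eq_bigr => i _; apply: eq_bigr => j _; rewrite !aA //; apply: ctorus_cx.
rewrite q2E // => e; rewrite e mulNr opprK divfK //.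
Qed.
End TorusStructure.

(** * Positive eigenvectors of selfadjoint operators *)

Section RealInterpolation.
Variables (R : rcfType) (C : numClosedFieldType) (c : complexification R C).

Lemma cx_re_add_conj z : c (cx_re c z) = (z + Num.conj z) / 2%:R.
Proof.
by rewrite {2 3}[z](cx_rect c) rmorphD rmorphM /= conjCi !cx_conj; field.
Qed.

(** Average a complex interpolating polynomial with its conjugate; the values are unchanged because
    the data are equivariant under conjugation. *)
Lemma real_interpolation (ts : seq C) (a : C -> C) : uniq ts ->
  {in ts, forall t, Num.conj t \in ts /\ a (Num.conj t) = Num.conj (a t)} ->
  exists g : {poly R}, {in ts, forall t, (map_poly c g).[t] = a t}.
Proof.
move=> uts ht; have [p hp] := crt 1 a uts.
have pt t : t \in ts -> p.[t] = a t.
  move=> /hp; rewrite expr1 dvdp_XsubCl rootE !hornerE subr_eq0 => /eqP.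
  by [].
exists (\poly_(i < size p) cx_re c p`_i) => t tts.
have -> : map_poly c (\poly_(i < size p) cx_re c p`_i) = 2%:R^-1 *: (p + map_poly Num.conj p).
  apply/polyP => i; rewrite coef_map coef_poly coefZ coefD coef_map /=.
  case: ltnP => [_|/(nth_default 0) ->]; first by rewrite cx_re_add_conj mulrC.
  by rewrite !rmorph0 addr0 mulr0.
have [tc ac] := ht t tts.
have -> : (2%:R^-1 *: (p + map_poly Num.conj p)).[t] = 2%:R^-1 * (a t + Num.conj (p.[Num.conj t])).
  have e : (map_poly Num.conj p).[t] = Num.conj p.[Num.conj t].
    by rewrite -[in LHS](conjCK t); apply: horner_map.
  by rewrite hornerZ hornerD; congr (_ * (_ + _)); [apply: pt | apply: e].
by rewrite pt // ac conjCK; field.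
Qed.
End RealInterpolation.

Section PositiveEigenvector.
Variables (R : rcfType) (C : numClosedFieldType) (c : complexification R C).
Variables (V : vectType R) (A : 'End(V)) (B : V -> V -> R).
Hypothesis Bl : forall v, linear (B v : V -> R^o).
Hypothesis Bs : forall v w, B v w = B w v.
Hypothesis Ba : forall v w, B (A v) w = B v (A w).
Variable ts : seq C.
Hypothesis uts : uniq ts.
Hypothesis cts : {in ts, forall t, Num.conj t \in ts}.
Hypothesis kill : forall q, {in ts, forall t, (map_poly c q).[t] = 0} -> forall v, peval A q v = 0.

Let BL v : {linear V -> R^o} := HB.pack (B v) (GRing.isLinear.Build R V R^o _ _ (Bl v)).
Let BDr v x y : B v (x + y) = B v x + B v y. Proof. exact: (linearD (BL v)). Qed.
Let BZr v k x : B v (k *: x) = k * B v x. Proof. exact: (linearZZ (BL v)). Qed.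
Let BNr v x : B v (- x) = - B v x. Proof. exact: (linearN (BL v)). Qed.
Let B0r v : B v 0 = 0. Proof. exact: (linear0 (BL v)). Qed.
Let Bsumr v (I : Type) (r : seq I) (P : pred I) (F : I -> V) :
  B v (\sum_(i <- r | P i) F i) = \sum_(i <- r | P i) B v (F i).
Proof. exact: (linear_sum (BL v)). Qed.

Let peval_eq p q v : {in ts, forall t, (map_poly c p).[t] = (map_poly c q).[t]} ->
  peval A p v = peval A q v.
Proof.
move=> h; apply/eqP; rewrite -subr_eq0 -pevalN -pevalD; apply/eqP/kill => t tts.
by rewrite rmorphB hornerD hornerN h // subrr.
Qed.

Let Bpeval q v w : B (peval A q v) w = B v (peval A q w).
Proof.
elim/poly_ind: q v w => [|q k IH] v w; first by rewrite !peval0 Bs !B0r.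
rewrite !pevalD !pevalMX !pevalC BDr BZr Bs BDr BZr [B w (peval _ _ _)]Bs IH Ba (Bs w v).
by rewrite peval_comm.
Qed.

(* Let J be the polynomial in A that is 0, i or -i on eigenvectors according to the sign
   of the imaginary part of the eigenvalue. If B v v <= 0 for all real eigenvectors v in
   Z, then B is nonpositive on the kernel of J, which contains v + J (J v), hence
   negative on J v for v in P; so J P and J (J P) are independent. *)
Lemma positive_eigenvector (Z P : {vspace V}) : (forall v, v \in Z -> A v \in Z) ->
  (P <= Z)%VS -> (forall v, v \in P -> v != 0 -> 0 < B v v) -> (\dim Z < 2 * \dim P)%N ->
  exists t v, [/\ v \in Z, A v = t *: v & 0 < B v v].
Proof.
move=> ZA PZ Bpos dPZ; apply: Classical_Prop.NNPP => none.
have nonpos t v : v \in Z -> A v = t *: v -> B v v <= 0.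
  by move=> vZ Av; rewrite leNgt; apply/negP => h; apply: none; exists t, v.
pose sgi (t : C) : C := if 'Im t > 0 then 'i else if 'Im t < 0 then - 'i else 0.
have [g hg] : exists g : {poly R}, {in ts, forall t, (map_poly c g).[t] = sgi t}.
  apply: real_interpolation => // t tts; split; first exact: cts.
  rewrite /sgi Im_conj oppr_gt0 oppr_lt0; case: (real_ltgt0P (Creal_Im t)) => _.
  - by rewrite conjCi.
  - by rewrite rmorphN /= conjCi opprK.
  - by rewrite rmorph0.
pose J := peval A g.
have JZ v : v \in Z -> J v \in Z by apply: peval_stable.
have J3 v : J (J (J v)) = - J v.
  rewrite /J -!pevalM -pevalN; apply: peval_eq => t tts.
  rewrite !rmorphM rmorphN /= !hornerE hg // /sgi.
  case: ifP => _; [|case: ifP => _; last by rewrite !mulr0 oppr0].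
    by rewrite -[X in X * 'i]expr2 sqrCi mulN1r.
  by rewrite mulrNN -expr2 sqrCi mulN1r.
have Jlin : linear J by apply: peval_is_linear.
have JB v w : B (J v) w = B v (J w) by apply: Bpeval.
have ker v : v \in Z -> J v = 0 -> B v v <= 0.
  move=> vZ Jv.
  pose rts := [seq t <- ts | t \is Num.real].
  have urts : uniq rts by apply: filter_uniq.
  have Lex r : exists L : {poly R}, r \in rts -> {in ts, forall t, (map_poly c L).[t] = (t == r)%:R}.
    have [rr|rr] := boolP (r \in rts); last by exists 0.
    have [|L hL] := @real_interpolation _ _ c ts (fun t => (t == r)%:R) uts.
      move=> t tts; split; first exact: cts.
      rewrite rmorph_nat; congr (_%:R); congr nat_of_bool.
      move: rr; rewrite mem_filter => /andP[/CrealP rr _].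
      by rewrite -[in LHS]rr; apply: (inj_eq (can_inj (@conjCK C))).
    by exists L.
  have {}Lex : exists L : C -> {poly R}, forall r, r \in rts -> {in ts, forall t, (map_poly c (L r)).[t] = (t == r)%:R}.
    exists (fun r => sval (ClassicalEpsilon.constructive_indefinite_description _ (Lex r))) => r.
    exact: (svalP (ClassicalEpsilon.constructive_indefinite_description _ (Lex r))).
  have [L hL] := Lex.
  pose y r := peval A (L r) v.
  have vE : v = \sum_(r <- rts) y r.
    (* g^2 is -1 at the nonreal points and 0 at the real ones, so 1 + g^2 yields the sum of the
       projectors onto the real eigenspaces; it fixes [v] because J v = 0. *)
    have {1}-> : v = peval A (1 + g * g) v.
      by rewrite pevalD pevalM -[peval A g v]/(J v) Jv linear0 addr0 -polyC1 pevalC scale1r.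
    rewrite /y -peval_sum; apply: peval_eq => t tts.
    rewrite rmorph_sum /= horner_sum (eq_big_seq (fun r => (t == r)%:R)); last by move=> r rr; apply: hL.
    rewrite rmorphD rmorphM rmorph1 /= !hornerE hg //.
    have [tr|tr] := boolP (t \is Num.real).
      rewrite (bigD1_seq t) ?mem_filter ?tr //= eqxx big1 => [|r rt]; last by rewrite eq_sym (negbTE rt).
      by rewrite /sgi (Creal_ImP _ tr) ltxx mulr0.
    rewrite big1_seq => [|r /andP[_]]; last first.
      by rewrite mem_filter => /andP[rr _]; case: eqP => // e; rewrite e rr in tr.
    have : 'Im t != 0 by apply: contra tr => /eqP h; apply/Creal_ImP.
    rewrite /sgi real_neqr_lt ?Creal_Im ?real0 // => /orP[h|h].
      by rewrite (lt_gtF h) h mulrNN -expr2 sqrCi subrr.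
    by rewrite h -expr2 sqrCi subrr.
  have Ay r : r \in rts -> exists2 k : R, c k = r & A (y r) = k *: y r.
    move=> rr; have rre : r \is Num.real by move: rr; rewrite mem_filter => /andP[].
    exists (cx_re c r); first by rewrite -cx_realE.
    rewrite /y -pevalX -pevalM -pevalZ; apply: peval_eq => t tts.
    rewrite rmorphM /= linearZ /= map_polyX !hornerE hL //.
    by case: eqP => [->|_]; rewrite ?mulr0 // -cx_realE.
  have orth r s : r \in rts -> s \in rts -> r != s -> B (y r) (y s) = 0.
    move=> /Ay[k kr Ar] /Ay[l ls As] rs; have := Ba (y r) (y s).
    rewrite Ar As Bs !BZr (Bs (y s)) => /eqP; rewrite -subr_eq0 -mulrBl mulf_eq0 => /orP[|/eqP//].
    rewrite subr_eq0 => /eqP kl; by case/eqP: rs; rewrite -kr -ls kl.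
  rewrite {2}vE Bsumr big_seq; apply: sumr_le0 => r rr.
  rewrite vE Bs Bsumr (bigD1_seq r) //= big1_seq ?addr0 => [|s /andP[sr ss]].
    have [k _ Ak] := Ay r rr; apply: nonpos Ak; apply: peval_stable => //.
  by rewrite orth // eq_sym.
have neg v : v \in P -> v != 0 -> B (J v) (J v) < 0.
  move=> vP v0; have vZ : v \in Z by apply: (subvP PZ).
  pose w := v + J (J v).
  have wZ : w \in Z by rewrite rpredD ?JZ.
  have Jw : J w = 0 by rewrite /w -{1}[v]scale1r Jlin scale1r J3 subrr.
  have e : B w w = B v v + B (J v) (J v).
    transitivity (B w v + B w (J (J v))); first exact: BDr.
    rewrite -(JB w) Jw (Bs 0) B0r addr0 (Bs w).
    transitivity (B v v + B v (J (J v))); first exact: BDr.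
    by rewrite -(JB v).
  have := ker w wZ Jw; rewrite e; have := Bpos v vP v0; move: (B v v) (B (J v) _) => b1 b2 h1 h2.
  by lra.
pose j : 'End(V) := linfun J.
have jE v : j v = J v.
  pose JL : {linear V -> V} := HB.pack J (GRing.isLinear.Build R V V _ _ Jlin).
  by rewrite /j -[J]/(JL : V -> V) lfunE.
have dim1 (f : 'End(V)) : (forall v, v \in P -> f v = 0 -> v = 0) -> \dim (f @: P) = \dim P.
  move=> h; apply: limg_dim_eq; apply/eqP; rewrite -subv0; apply/subvP => v.
  by rewrite memv_cap memv_ker memv0 => /andP[vP /eqP fv]; rewrite (h v).
have inj1 v : v \in P -> j v = 0 -> v = 0.
  move=> vP; rewrite jE => Jv; apply/eqP; apply: contraT => v0.
  by have := neg v vP v0; rewrite Jv B0r ltxx.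
have inj2 v : v \in P -> (j \o j)%VF v = 0 -> v = 0.
  move=> vP; rewrite comp_lfunE !jE => JJv; apply: inj1 => //.
  by rewrite jE -[J v]opprK -J3 JJv /J linear0 oppr0.
have cap0 : ((j @: P) :&: ((j \o j)%VF @: P))%VS = 0%VS.
  apply/eqP; rewrite -subv0; apply/subvP => y; rewrite memv_cap memv0 => /andP[].
  case/memv_imgP=> v vP ->; case/memv_imgP=> w wP; rewrite comp_lfunE !jE => e.
  apply: contraT => Jv0; have v0 : v != 0 by apply: contraNneq Jv0 => ->; rewrite /J linear0.
  have w0 : w != 0 by apply: contraNneq Jv0 => w0; rewrite e w0 /J !linear0.
  have := neg v vP v0; rewrite e JB J3 BNr oppr_lt0 => h.
  by have := lt_trans h (neg w wP w0); rewrite ltxx.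
have : (\dim (j @: P + (j \o j)%VF @: P) <= \dim Z)%N.
  apply: dimvS; rewrite subv_add; apply/andP; split; apply/subvP => _ /memv_imgP[v vP ->].
    by rewrite jE JZ // (subvP PZ).
  by rewrite comp_lfunE !jE !JZ // (subvP PZ).
rewrite dimv_disjoint_sum // !dim1 // addnn -mul2n => le.
by have := leq_trans dPZ le; rewrite ltnn.
Qed.
End PositiveEigenvector.

(** * Real roots *)

Lemma scale_cross (K : pzRingType) (V : lmodType K) (k l : K) (x y : V) :
  k *: x + l *: y + (k *: y + l *: x) = (k + l) *: (x + y).
Proof. by rewrite addrACA -scalerDr [l *: y + _]addrC -scalerDr scalerDl. Qed.

Section RootVectors.
Variables (R : rcfType) (C : numClosedFieldType) (c : complexification R C).
Local Notation cx := (cx c).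
Hypothesis jac : jacobi C.
Variable U : {vspace ext4 R}.
Hypothesis mtU : max_torus c U.

Let st := torus_structure jac mtU.

Lemma root_vector a p u0 : weight c U a p -> p != 0 -> u0 \in U -> a (cx u0) != 0 ->
  exists t, [/\ ctorus c U t, forall z, ctorus c U z -> wedge t z = a z & wedge t t = 2%:R].
Proof.
move=> ap p0 u0U a0; have [q aq tq] := nondegenerate_weight jac mtU ap p0 u0U a0.
have [_ _ /(_ a q u0 aq u0U a0 tq) ah] := st.
have hU := ctorus_h mtU aq; have wh := wedge_h aq.
set tau := \tr _ in tq ah wh; set h := lact _ _ in ah hU wh.
exists (- tau^-1 *: h); split; first exact: ctorusZ.
  by move=> z zU; rewrite wedgeZl wh // mulrN mulNr opprK mulrA mulVf // mul1r.
by rewrite wedgeZl wedgeZr wh // ah; field.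
Qed.

(** The hypotheses make [a] and [b] orthogonal of norm 2, so b + s a would have norm 4, whereas
    every nonzero weight has norm 2. *)
Lemma root_sum_eq0 a p b q s r u0 u1 : weight c U a p -> weight c U b q -> q != 0 ->
  s * s = 1 -> weight c U (fun z => b z + s * a z) r ->
  u0 \in U -> a (cx u0) != 0 -> b (cx u0) = 0 -> u1 \in U -> b (cx u1) != 0 ->
  \tr (p.1 *m p.1) != 0 -> b (lact p.1 p.2) = 0 -> r = 0.
Proof.
move=> ap bq q0 s2 gr u0U a0 b0 u1U b1 tp bh; apply/eqP; apply: contraT => r0.
have p0 : p != 0 by apply: contraNneq tp => ->; rewrite mul0mx mxtrace0.
have s0 : s != 0 by apply/eqP => e; move: s2; rewrite e mulr0 => /eqP; rewrite eq_sym oner_eq0.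
have [ta [tac tae ta2]] := root_vector ap p0 u0U a0.
have [tb [tbc tbe tb2]] := root_vector bq q0 u1U b1.
have g0 : b (cx u0) + s * a (cx u0) != 0 by rewrite b0 add0r mulf_neq0.
have [tg [tgc tge tg2]] := root_vector gr r0 u0U g0.
have tE : tg - (tb + s *: ta) = 0.
  apply: (ctorus_nondeg jac mtU) => [|w wU].
    by rewrite -scaleN1r; do !apply: ctorusD => //; do ?apply: ctorusZ => //; apply: ctorusD => //; apply: ctorusZ.
  have wc := ctorus_cx mtU wU.
  by rewrite wedgeBl wedgeDl wedgeZl tge // tbe // tae // subrr.
have ab : wedge ta tb = 0.
  have := wedge_h ap tbc; rewrite wedgeC tbe ?bh; last exact: ctorus_h ap.
  by move=> /esym/eqP; rewrite oppr_eq0 mulf_eq0 (negbTE tp) -tae //= => /eqP.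
move: tg2; move/eqP: tE; rewrite subr_eq0 => /eqP ->.
rewrite wedgeDl !wedgeDr !wedgeZl !wedgeZr tb2 ta2 ab wedgeC ab mulrA s2 !mulr0 addr0 add0r mul1r.
by move/eqP; rewrite -subr_eq0 addrK pnatr_eq0.
Qed.

(** A matrix annihilating the coroot has components only in weights orthogonal to [a]. For those,
    adding or subtracting [a] gives no weight, so brackets with X0 vanish. The hypothesis on u0
    provides a point of [U] itself on the line of the coroot. *)
Lemma root_centralizer a p u0 Y : weight c U a p -> u0 \in U -> a (cx u0) != 0 ->
  cx u0 = - (a (cx u0) / (2%:R * \tr (p.1 *m p.1))) *: lact p.1 p.2 ->
  \tr (p.1 *m p.1) != 0 -> lact Y (lact p.1 p.2) = 0 -> p.1 *m Y = Y *m p.1.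
Proof.
move=> ap u0U a0 u0E tp Yh; have [_ z0 _] := st.
have hU := ctorus_h mtU ap.
have [b [phi [bE pb be]]] := ctorus_eigenbasis jac mtU.
pose A k z : C := phi k (Dop z (b k)).
have wb k : weight c U (A k) (b k) by move=> z zU; apply: be.
have phiD k z q : ctorus c U z -> phi k (Dop z q) = A k z * phi k q.
  move=> zU; rewrite {1}(bE q) (linear_sum (Dop z)) (linear_sum (phi k)) (bigD1 k) //= big1 => [|m mk].
    by rewrite addr0 (linearZZ (Dop z)) (linearZZ (phi k)) [LHS]mulrC.
  have h := be z m zU; rewrite (linearZZ (Dop z)) (linearZZ (phi k)) /= h (linearZZ (phi k)) /=.
  have -> : phi k (b m) = 0 by have := pb k m; rewrite eq_sym (negbTE mk).
  by rewrite !scaler0.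
have comZ s : p.1 *m s%:M = s%:M *m p.1 by rewrite scalar_mxC.
have key k : A k (lact p.1 p.2) = 0 -> p.1 *m (b k).1 = (b k).1 *m p.1.
  move=> Ah; set q := b k.
  have q0 : q != 0.
    by apply/eqP => e; have := pb k k; rewrite -/q e linear0 eqxx => /eqP; rewrite eq_sym oner_eq0.
  have [none|[u1 u1U A1]] : (forall u, u \in U -> A k (cx u) = 0) \/ exists2 u1, u1 \in U & A k (cx u1) != 0.
    apply: Classical_Prop.NNPP => /Classical_Prop.not_or_and[h1 h2]; apply: h1 => u uU.
    by apply/eqP; apply: contraT => h; case: h2; exists u.
    have [s ->] : exists s, q.1 = s%:M; last exact: comZ.
    apply: z0 => u uU; have := wb k _ (ctorus_cx mtU uU); rewrite none // scale0r DopE.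
    by move=> /(congr1 snd) /= /eqP; rewrite oppr_eq0 => /eqP.
  have Au0 : A k (cx u0) = 0.
    have AZ s z : A k (s *: z) = s * A k z by rewrite /A DopZ scale_lfunE (linearZZ (phi k)).
    by rewrite u0E AZ Ah mulr0.
  have wq z : ctorus c U z -> Dop z q = A k z *: q by apply: wb.
  pose rp := adX p.1 q + Dop p.2 q; pose rm := adX p.1 q - Dop p.2 q.
  have rp0 : rp = 0.
    apply: (root_sum_eq0 ap (wb k) q0 (mulr1 1) _ u0U a0 Au0 u1U A1 tp Ah) => z zU.
    rewrite /rp (linearD (Dop z)) /= (weight_adX_comm ap) // (weight_Dop_comm jac ap) // wq //.
    rewrite (linearZZ (adX p.1)) (linearZZ (Dop p.2)) mul1r; exact: scale_cross.
  have rm0 : rm = 0.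
    apply: (root_sum_eq0 ap (wb k) q0 (_ : -1 * -1 = 1) _ u0U a0 Au0 u1U A1 tp Ah) => [|z zU]; first by rewrite mulrNN mulr1.
    rewrite /rm (linearB (Dop z)) /= (weight_adX_comm ap) // (weight_Dop_comm jac ap) // wq //.
    rewrite (linearZZ (adX p.1)) (linearZZ (Dop p.2)) mulN1r.
    rewrite opprD -scalerN -(scaleNr (a z) (adX p.1 q)).
    rewrite -[a z *: Dop p.2 q]opprK -(scaleNr (a z)) -scalerN; exact: scale_cross.
  have : adX p.1 q = 0.
    have e : adX p.1 q + adX p.1 q = 0.
      by rewrite -[RHS]addr0 -{1}rp0 -rm0 /rp /rm addrACA subrr addr0.
    by apply/eqP; move/eqP: e; rewrite -mulr2n -scaler_nat scaler_eq0 pnatr_eq0.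
  by rewrite adXE => /(congr1 fst) /= /eqP; rewrite subr_eq0 => /eqP.
have YE : Y = \sum_k phi k (Y, 0) *: (b k).1.
  by have := congr1 fst (bE (Y, 0)); rewrite /= raddf_sum.
rewrite YE mulmx_sumr mulmx_suml; apply: eq_bigr => k _; rewrite -scalemxAr -scalemxAl.
have [->|pk] := eqVneq (phi k (Y, 0)) 0; first by rewrite !scale0r.
rewrite key //; have := phiD k _ (Y, 0) hU; rewrite DopE /= moment0r Yh oppr0.
have -> : ((0, 0) : ee C) = 0 by [].
by rewrite linear0 => /esym/eqP; rewrite mulf_eq0 (negbTE pk) orbF => /eqP.
Qed.

(* The square of Dop x on gl(8). *)
Definition rootop (x : ext4 R) (Y : 'M[R]_8) : 'M[R]_8 := - moment x (lact Y x).

Variable x : ext4 R.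
Hypothesis xU : x \in U.
Hypothesis gx : forall p l, p != 0 -> Dop (cx x) p = l *: p ->
  exists a, [/\ weight c U a p, a (cx x) = l & l = 0 -> forall z, ctorus c U z -> a z = 0].
Variables (X : 'M[R]_8) (la : R).
Hypothesis Xla : rootop x X = la *: X.
Hypothesis la0 : la != 0.
Let tau := \tr (X *m X).
Hypothesis tau0 : tau != 0.
Let h := lact X (lact X x).

(** The eigenvalue of [Dop x] belonging to the root, imaginary when la < 0. Only its square enters
    the statements about [X] and [h], which can therefore be brought back to R. *)
Let al : C := sqrtC (c la).
Let Xc : 'M[C]_8 := map_mx c X.
Let v : ext4 C := - al^-1 *: lact Xc (cx x).

Let al2 : al * al = c la. Proof. by rewrite -expr2 sqrtCK. Qed.
Let al0 : al != 0.
Proof. by apply/eqP => e; move/eqP: al2; rewrite e mul0r eq_sym fmorph_eq0 (negbTE la0). Qed.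
Let lv : lact Xc (cx x) = - al *: v.
Proof. by rewrite /v scalerA mulrNN mulfV // scale1r. Qed.
Let hv : cx h = - al *: lact Xc v.
Proof. by rewrite /h !cx_lact -/Xc lv lactZr. Qed.

Lemma real_root_vector : exists a, [/\ weight c U a (Xc, v), a (cx x) = al,
  \tr (Xc *m Xc) = c tau & a (lact Xc v) = - (2%:R * c tau)].
Proof.
have tE : \tr (Xc *m Xc) = c tau by rewrite -map_mxM trace_map_mx.
have p0 : (Xc, v) != 0.
  by apply/eqP => -[e _]; move: tE; rewrite e mul0mx mxtrace0 => /esym/eqP; rewrite fmorph_eq0 (negbTE tau0).
have [|a [ap ax _]] := gx p0 (l := al).
  rewrite DopE /= lv scaleNr opprK; apply: injective_projections => //=.
  have e : moment (cx x) (lact Xc (cx x)) = - (c la *: Xc).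
    by rewrite -cx_lact cx_moment -[moment _ _]opprK -/(rootop x X) Xla map_mxN map_mxZ.
  rewrite /v momentZr e scaleNr scalerN opprK scalerA -al2 mulrA mulVf // mul1r.
  by [].
exists a; split=> //; have [_ _ /(_ a _ x ap xU)] := st; rewrite /= ax tE; apply=> //.
by rewrite fmorph_eq0.
Qed.

Lemma real_root_sqr : X *m X = (tau / 8%:R)%:M.
Proof.
have [a [ap ax tE ah]] := real_root_vector; have [_ z0 _] := st.
have ax0 : a (cx x) != 0 by rewrite ax.
have t0 : \tr (Xc *m Xc) != 0 by rewrite tE fmorph_eq0.
have [_] := weight_bound jac mtU ap xU ax0 t0; rewrite /= ah tE => /(_ _ z0) e.
apply: (@map_mx_inj _ _ c); rewrite map_mxM e; last first.
  by rewrite mulNr opprK mulfK // fmorph_eq0.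
by apply/matrixP => i j; rewrite !mxE rmorphMn /= fmorph_div rmorph_nat.
Qed.

Lemma real_root_coroot : h \in U.
Proof.
have [a [ap _ _ _]] := real_root_vector; have hU := ctorus_h mtU ap.
apply: (max_torus_centralizer jac mtU) => u uU; apply: (@map_mx_inj _ _ c).
by rewrite -cx_moment hv momentZr hU // scaler0 map_mx0.
Qed.

Lemma real_root_lact : lact X h = (2%:R * tau) *: lact X x.
Proof.
have [a [ap _ _ ah]] := real_root_vector; have hU := ctorus_h mtU ap.
apply: (@cx_inj _ _ c); rewrite cx_lact hv cxZ cx_lact -/Xc lv lactZr.
have -> : lact Xc (lact Xc v) = (2%:R * c tau) *: v.
  by rewrite (weight_lact ap hU) ah scaleNr opprK.
have -> : c (2%:R * tau) = 2%:R * c tau by rewrite rmorphM rmorph_nat.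
by rewrite [LHS]scalerA [RHS]scalerA; congr (_ *: _); ring.
Qed.

Lemma real_root_moment : moment h (lact X x) = - (2%:R * tau * la) *: X.
Proof.
have [a [ap _ _ ah]] := real_root_vector; have hU := ctorus_h mtU ap.
apply: (@map_mx_inj _ _ c); rewrite -cx_moment cx_lact hv -/Xc lv momentZl momentZr.
rewrite (weight_moment ap hU) ah !scalerA map_mxZ -/Xc; congr (_ *: _).
by rewrite !(rmorphN, rmorphM) rmorph_nat /= -al2; ring.
Qed.

Lemma real_root_wedge : wedge h h = 2%:R * la * tau ^+ 2.
Proof.
have [a [ap _ tE ah]] := real_root_vector; have hU := ctorus_h mtU ap.
apply: (fmorph_inj c); rewrite -cx_wedge hv wedgeZl wedgeZr.
rewrite (wedge_h ap hU) [\tr _]tE ah !(rmorphM, rmorphXn) rmorph_nat /= -al2; ring.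
Qed.

Lemma real_root_centralizer Y : lact Y h = 0 -> X *m Y = Y *m X /\ \tr (X *m Y) = 0.
Proof.
move=> Yh; have [a [ap ax tE ah]] := real_root_vector; have hU := ctorus_h mtU ap.
split; last first.
  have : \tr (moment h (lact X x) *m Y) = 0.
    by rewrite tr_moment -wedge_lact Yh wedge0l.
  rewrite real_root_moment -scalemxAl linearZ /= => /eqP.
  by rewrite mulf_eq0 oppr_eq0 !mulf_eq0 pnatr_eq0 (negbTE tau0) (negbTE la0) => /eqP.
apply: (@map_mx_inj _ _ c); rewrite !map_mxM -/Xc.
have hcU := real_root_coroot.
have aZ s z : ctorus c U z -> a (s *: z) = s * a z.
  move=> zU; have t0 : \tr (Xc *m Xc) != 0 by rewrite tE fmorph_eq0.
  apply: (mulfI t0); apply: oppr_inj; rewrite -(wedge_h ap (ctorusZ s zU)) wedgeZr (wedge_h ap zU).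
  by rewrite /=; ring.
have ahc : a (cx h) = 2%:R * al * c tau.
  by rewrite hv aZ // ah; ring.
apply: (root_centralizer ap hcU) => /=.
- by rewrite ahc !mulf_neq0 ?pnatr_eq0 // fmorph_eq0.
- rewrite ahc tE hv; congr (_ *: _); field; by rewrite fmorph_eq0.
- by rewrite tE fmorph_eq0.
have : lact (map_mx c Y) (cx h) = 0 by rewrite -cx_lact Yh cx0.
by rewrite hv lactZr => /eqP; rewrite scaler_eq0 oppr_eq0 (negbTE al0) => /eqP.
Qed.
End RootVectors.

(** * Coordinate four-vectors and the Hodge star *)

Section SetBasis.
Variable K : numFieldType.
Implicit Types (S T : {set 'I_8}) (Y : 'M[K]_8) (u v w : ext4 K).
Local Notation eS := (eS K).

Lemma eS_sub4 S (S4 : #|S| = 4%N) : exists2 I : sub4, val I = S & eS S = e4 K I.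
Proof. by have /eqP h := S4; exists (Sub S h); rewrite ?e4_eS. Qed.

Lemma cardsC4 S : #|S| = 4%N -> #|~: S| = 4%N.
Proof. by move=> h; have := cardsC S; rewrite h card_ord; lia. Qed.

Lemma lact_delta_eS0 S k l : k != l -> ~~ ((l \in S) && (k \notin S)) ->
  lact (delta_mx k l) (eS S) = 0.
Proof.
move=> kl h; have [S4|S4] := eqVneq #|S| 4%N; last by rewrite eS_card // linear0.
have [J JS ->] := eS_sub4 S4; apply/ffunP => I; rewrite ext4_0; apply/eqP.
apply: contraNT h => /(lact_delta_e4 kl)[h1 h2 _].
by rewrite -JS h1.
Qed.

Lemma wedge_eS0 S T : T != ~: S -> wedge (eS S) (eS T) = 0.
Proof.
move=> h; have [S4|S4] := eqVneq #|S| 4%N; last by rewrite eS_card // wedge0l.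
have [T4|T4] := eqVneq #|T| 4%N; last by rewrite (eS_card _ T4) wedge0r.
have [I IS ->] := eS_sub4 S4; have [J JT ->] := eS_sub4 T4.
by apply: wedge_e4_neq; apply: contraNneq h => e; rewrite -JT e /= IS.
Qed.

Definition sgS S : K := wedge (eS S) (eS (~: S)).

Lemma sgSC S : sgS (~: S) = sgS S.
Proof. by rewrite /sgS setCK wedgeC. Qed.

Lemma sgS_sqr S : #|S| = 4%N -> sgS S * sgS S = 1.
Proof.
move=> S4; rewrite /sgS; have [I <- _] := eS_sub4 S4; rewrite -e4_eS.
have -> : eS (~: val I) = e4 K (compl4 I) by rewrite e4_eS.
exact: (sg4_sqr K I).
Qed.

Lemma sgS_neq0 S : #|S| = 4%N -> sgS S != 0.
Proof. by move=> /sgS_sqr h; apply/eqP => e; move/eqP: h; rewrite e mul0r eq_sym oner_eq0. Qed.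

Definition wS S : ext4 K := sgS S *: eS (~: S).

Lemma wedge_eS_wS S : #|S| = 4%N -> wedge (eS S) (wS S) = 1.
Proof. by move=> S4; rewrite wedgeZr sgS_sqr. Qed.

Lemma set_neqC S : S != ~: S.
Proof. by apply/eqP/setP => /(_ ord0); rewrite inE; case: (_ \in _). Qed.

Lemma wedge_eS_same S : wedge (eS S) (eS S) = 0.
Proof. exact/wedge_eS0/set_neqC. Qed.

Definition sd S : 'M[K]_8 := diag_mx (\row_i (-1) ^+ (i \notin S)).

Lemma sdE S i j : sd S i j = (-1) ^+ (i \notin S) *+ (i == j).
Proof. by rewrite !mxE; case: eqP => // ->. Qed.

Lemma sdC S : sd (~: S) = - sd S.
Proof. by apply/matrixP => i j; rewrite !mxE !inE; case: (i \in S) => /=; case: (j \in S); case: (i == j); rewrite /= ?mulr1n ?mulr0n ?oppr0 ?opprK. Qed.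

Lemma sd_sqr S : sd S *m sd S = 1%:M.
Proof.
rewrite mulmx_diag -diag_const_mx; congr diag_mx; apply/rowP => i.
by rewrite !mxE -expr2 sqrr_sign.
Qed.

Lemma tr_sd_mul S Y : \tr (sd S *m Y) = \sum_k (-1) ^+ (k \notin S) * Y k k.
Proof.
by apply: eq_bigr => k _; rewrite mul_diag_mx !mxE.
Qed.

Lemma tr_sd_sd S T : \tr (sd S *m sd T) = \sum_k (-1) ^+ ((k \in S) != (k \in T)).
Proof.
rewrite tr_sd_mul; apply: eq_bigr => k _; rewrite sdE eqxx mulr1n -signr_addb.
by case: (k \in S); case: (k \in T).
Qed.

(** Such a [Y] preserves the span of the e_i with i in S and acts on its top exterior power by the
    trace of that block; subtracting half the trace of [Y] leaves half of tr (sd S Y). *)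
Lemma lact_comm_sd S Y : Y *m sd S = sd S *m Y ->
  lact Y (eS S) = (\tr (sd S *m Y) / 2%:R) *: eS S.
Proof.
move=> cY; rewrite {1}(matrix_sum_delta Y) lact_suml.
rewrite tr_sd_mul mulr_suml scaler_suml; apply: eq_bigr => k _.
rewrite lact_suml (bigD1 k) //= big1 => [|l lk].
  rewrite lactZl lact_diag_eS scalerA addr0; congr (_ *: _).
  by case: (k \in S) => /=; rewrite ?expr0 ?expr1; field.
rewrite lactZl; have kl : k != l by rewrite eq_sym.
have [/andP[lS kS]|h] := boolP ((l \in S) && (k \notin S)); last first.
  by rewrite lact_delta_eS0 // scaler0.
suff -> : Y k l = 0 by rewrite scale0r.
have /matrixP/(_ k l) := cY; rewrite mul_mx_diag mul_diag_mx !mxE lS kS /= expr0 expr1.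
by move/eqP; rewrite mulr1 mulN1r -addr_eq0 -mulr2n -mulr_natl mulf_eq0 pnatr_eq0 => /eqP.
Qed.

Lemma lact_comm_sdC S Y : Y *m sd S = sd S *m Y ->
  lact Y (eS (~: S)) = - (\tr (sd S *m Y) / 2%:R) *: eS (~: S).
Proof.
move=> cY; rewrite lact_comm_sd sdC ?mulNmx ?mulmxN ?cY //.
by rewrite linearN /= mulNr.
Qed.

Lemma sd_comm S T : sd S *m sd T = sd T *m sd S.
Proof. by rewrite !mulmx_diag; congr diag_mx; apply/rowP => i; rewrite !mxE mulrC. Qed.

Lemma tr_sd_same S : \tr (sd S *m sd S) = 8%:R.
Proof. by rewrite sd_sqr mxtrace1. Qed.

Lemma lact_sd_eS S : lact (sd S) (eS S) = 4%:R *: eS S.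
Proof. by rewrite lact_comm_sd // tr_sd_same; congr (_ *: _); field. Qed.

Lemma lact_sd_eSC S : lact (sd S) (eS (~: S)) = - 4%:R *: eS (~: S).
Proof. by rewrite lact_comm_sdC // tr_sd_same; congr (_ *: _); field. Qed.

Lemma tr_sd_full S T : \tr (sd S *m sd T) = 8%:R -> S = T.
Proof.
move=> h; apply/setP => k; apply/eqP; apply: contraT => kST.
have : \sum_k (1 - (-1) ^+ ((k \in S) != (k \in T)) : K) = 0.
  by rewrite sumrB -tr_sd_sd h sumr_const card_ord subrr.
move/eqP; rewrite psumr_eq0 => [/allP/(_ k (mem_index_enum k))/=|i _]; last first.
  by case: (_ != _); rewrite ?expr0 ?subrr // expr1 opprK addr_ge0.
by rewrite kST expr1 opprK -mulr2n pnatr_eq0.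
Qed.

Lemma sd_eigenvector S w : #|S| = 4%N -> lact (sd S) w = 4%:R *: w -> exists a, w = a *: eS S.
Proof.
move=> S4 h; have [I0 IS eSI] := eS_sub4 S4; exists (w I0); apply/ffunP => I.
rewrite ext4Z eSE -IS val_eqE; case: (eqVneq I I0) => [->|II0]; first by rewrite mulr1.
rewrite mulr0; apply/eqP; apply: contraNT II0 => wI.
have := congr1 (fun z : ext4 K => z I) h; rewrite /= ext4Z {1}(ext4E w) lact_sumr ext4_sum.
have sE J : lact (sd S) (e4 K J) = (\tr (sd (val J) *m sd S) / 2%:R) *: e4 K J.
  by rewrite e4_eS lact_comm_sd // sd_comm.
rewrite (bigD1 I) //= big1 => [|J JI].
  rewrite lactZr sE !ext4Z e4E eqxx mulr1 addr0 mulrC => /(mulIf wI) e.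
  rewrite -val_eqE IS; apply/eqP/tr_sd_full; rewrite -[LHS](@divfK _ 2%:R) ?pnatr_eq0 // e.
  by rewrite -natrM.
by rewrite lactZr sE !ext4Z e4E eq_sym (negbTE JI) !mulr0.
Qed.
End SetBasis.

Section Star.
Variable K : numFieldType.
Implicit Types (S T : {set 'I_8}) (Y : 'M[K]_8) (u v w : ext4 K).
Local Notation eS := (eS K).

(** An elementary matrix changes at most one element of [T], so the result still meets [S] and is
    not complementary to it. *)
Lemma moment_eS0 S T : (1 < #|S :&: T|)%N -> moment (eS S) (eS T) = 0.
Proof.
move=> h; have nC (A : {set 'I_8}) x : A = ~: S -> T :\ x \subset A -> False.
  move=> -> sub; have : S :&: T \subset [set x].
    apply/subsetP => y; rewrite !inE => /andP[yS yT]; apply: contraTT yS => yx.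
    by have := subsetP sub y; rewrite !inE yx yT => /(_ isT).
  by move/subset_leq_card; rewrite cards1 leqNgt h.
apply/matrixP => i j; rewrite moment_entry mxE; apply/eqP; rewrite oppr_eq0.
have [ij|ij] := eqVneq j i.
  rewrite ij lact_diag_eS wedgeZr wedge_eS0 ?mulr0 //.
  apply/eqP => e; apply: (nC T ord0) => //; exact: subsetDl.
have [/andP[iT jT]|] := boolP ((i \in T) && (j \notin T)); last first.
  by move=> h'; rewrite lact_delta_eS0 // wedge0r.
have [s _ ->] := lact_delta_eS K iT jT; rewrite wedgeZr wedge_eS0 ?mulr0 //.
by apply/eqP => e; apply: (nC _ i e); apply: subsetUr.
Qed.

Lemma moment_eS_wS S : #|S| = 4%N -> moment (eS S) (wS K S) = 2%:R^-1 *: sd K S.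
Proof.
move=> S4; apply/matrixP => i j; rewrite moment_entry mxE sdE lactZr wedgeZr eq_sym.
have [<-|ij] := eqVneq j i.
  rewrite lact_diag_eS wedgeZr mulrCA -/(sgS K S) sgS_sqr // mulr1.
  by rewrite inE mulr1n; case: (j \in S) => /=; rewrite ?expr0 ?expr1; field.
rewrite mulr0n mulr0; apply/eqP; rewrite oppr_eq0.
have [/andP[iT jT]|] := boolP ((i \in ~: S) && (j \notin ~: S)); last first.
  by move=> h'; rewrite lact_delta_eS0 // wedge0r mulr0.
have [s _ ->] := lact_delta_eS K iT jT; rewrite wedgeZr wedge_eS0 ?mulr0 //.
by apply/eqP/setP => /(_ i); rewrite iT !inE eqxx /= orbF eq_sym (negbTE ij).
Qed.

Definition dot u v : K := \sum_I u I * v I.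
Definition star v : ext4 K := [ffun I => sg4 K I * v (compl4 I)].

Lemma starE v I : star v I = sg4 K I * v (compl4 I). Proof. exact: ffunE. Qed.

Fact star_is_linear : linear star.
Proof. by move=> a u v; apply/ffunP => I; rewrite starE !ext4D !ext4Z !starE; ring. Qed.
HB.instance Definition _ := GRing.isLinear.Build K (ext4 K) (ext4 K) _ star star_is_linear.

Lemma dotC u v : dot u v = dot v u.
Proof. by apply: eq_bigr => I _; rewrite mulrC. Qed.

Fact dot_is_linear u : linear (dot u : ext4 K -> K^o).
Proof.
move=> a v w; rewrite /dot scaler_sumr -big_split; apply: eq_bigr => I _ /=.
by rewrite ext4D ext4Z regE; ring.
Qed.
HB.instance Definition _ u :=
  GRing.isLinear.Build K (ext4 K) K^o _ (dot u) (dot_is_linear u).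

Lemma dotNr u v : dot u (- v) = - dot u v. Proof. exact: linearN. Qed.
Lemma dotNl u v : dot (- u) v = - dot u v. Proof. by rewrite dotC dotNr dotC. Qed.
Lemma dotZr a u v : dot u (a *: v) = a * dot u v. Proof. exact: linearZ. Qed.
Lemma dotZl a u v : dot (a *: u) v = a * dot u v. Proof. by rewrite dotC dotZr dotC. Qed.

Lemma wedge_star u v : wedge u (star v) = dot u v.
Proof.
rewrite wedgeE; apply: eq_bigr => I _; rewrite starE compl4K sg4C.
by rewrite -[RHS]mulr1 -(sg4_sqr K I); ring.
Qed.

Lemma starK : involutive star.
Proof.
move=> v; apply/ffunP => I; rewrite !starE sg4C compl4K.
by rewrite -[RHS]mulr1 -(sg4_sqr K I); ring.
Qed.

Lemma dot_star u v : dot (star u) (star v) = dot u v.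
Proof. by rewrite -wedge_star starK wedgeC wedge_star dotC. Qed.

Lemma dot_act P u v : dot (ext4_act P u) v = dot u (ext4_act P^T v).
Proof.
rewrite /dot; under eq_bigr => I _ do rewrite ffunE mulr_suml.
rewrite exchange_big; apply: eq_bigr => J _; rewrite ffunE mulr_sumr.
apply: eq_bigr => I _; rewrite /minor4 -det_tr mulrAC mulrC; congr (_ * (\det _ * _)).
by apply/matrixP => a b; rewrite !mxE.
Qed.

Lemma lact_diag_coord k v I : lact (delta_mx k k) v I = ((k \in val I)%:R - 2%:R^-1) * v I :> K.
Proof.
rewrite {1}(ext4E v) lact_sumr ext4_sum (bigD1 I) //= big1 => [|J JI].
  by rewrite lactZr lact_diag_e4 !ext4Z e4E eqxx addr0 mulr1 mulrC.
by rewrite lactZr lact_diag_e4 !ext4Z e4E eq_sym (negbTE JI) !mulr0.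
Qed.

Lemma dot_lact Y u v : dot (lact Y u) v = dot u (lact Y^T v).
Proof.
have E i j : dot (lact (delta_mx i j) u) v = dot u (lact (delta_mx j i) v).
  have [<-|ij] := eqVneq i j.
    by apply: eq_bigr => I _; rewrite !lact_diag_coord; ring.
  have h := dot_act (1%:M + 1 *: delta_mx i j) u v.
  rewrite linearD /= trmx1 linearZ /= trmx_delta !act_transvection // ?scale1r in h; last by rewrite eq_sym.
  move: h; rewrite dotC !(linearD (dot _)) /= dotC => /(addrI); by rewrite dotC.
rewrite [in LHS](matrix_sum_delta Y) [in RHS](matrix_sum_delta Y) lact_suml dotC linear_sum /=.
rewrite linear_sum lact_suml linear_sum; apply: eq_bigr => i _.
rewrite lact_suml linear_sum /= linear_sum lact_suml linear_sum; apply: eq_bigr => j _ /=.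
by rewrite linearZ /= trmx_delta !lactZl !linearZ /= dotC E.
Qed.

Lemma star_lact Y v : star (lact Y v) = - lact Y^T (star v).
Proof.
apply/eqP; rewrite -subr_eq0 opprK; apply/eqP/wedge_nondeg => u.
rewrite wedgeC wedgeDr wedge_star dotC dot_lact dotC -[dot _ v]wedge_star wedge_lact.
by rewrite addNr.
Qed.

Lemma star_eS S : #|S| = 4%N -> star (eS S) = wS K S.
Proof.
move=> S4; apply/ffunP => I; rewrite starE ext4Z !eSE /=.
have -> : (~: val I == S) = (val I == ~: S) by rewrite -(inj_eq (@setC_inj _)) setCK.
case: eqP => [e|_]; last by rewrite !mulr0.
by rewrite !mulr1 -sgSC -e /sgS /sg4 !e4_eS.
Qed.

Lemma star_wS S : #|S| = 4%N -> star (wS K S) = eS S.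
Proof. by move=> S4; rewrite -star_eS // starK. Qed.
End Star.

Lemma split_semisimple_reduced (K : closedFieldType) (V : vectType K) (f : 'End(V)) :
  (forall r p, f (f p - r *: p) = r *: (f p - r *: p) -> f p = r *: p) -> split_semisimple f.
Proof.
move=> red; have [p p0 pk] := killing_poly f; have [rs pE] := closed_field_poly_normal p.
exists (undup rs) => [|x]; first exact: undup_uniq.
have : peval f (\prod_(r <- rs) ('X - r%:P)) x = 0.
  have := pk x; rewrite pE pevalZ => /eqP.
  by rewrite scaler_eq0 lead_coef_eq0 (negbTE p0) => /eqP.
elim: rs {pE} x => [|r rs IH] x; first by rewrite /= big_nil.
rewrite big_cons /= => h; case: ifP => [rin|_].
  apply: IH; move: h; rewrite (big_rem r) //= !pevalM !pevalXsubC => /eqP.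
  by rewrite subr_eq0 => /eqP/red ->; rewrite subrr.
rewrite big_cons mulrC pevalM; apply: IH.
by rewrite -pevalM mulrC h.
Qed.

Section SelfDual.
Variables (R : rcfType) (C : numClosedFieldType) (c : complexification R C).
Local Notation cx := (cx c).

Lemma tr_moment_star (K : numFieldType) (x v : ext4 K) (Z : 'M[K]_8) eta : star x = eta *: x ->
  \tr (moment x v *m Z^T) = - (eta * dot (lact Z x) v).
Proof.
move=> sx; rewrite tr_moment -wedge_lact -[v in LHS]starK wedge_star -dot_star starK star_lact.
by rewrite trmxK sx lactZr dotNl dotZl.
Qed.

Definition herm (p q : ee C) : C :=
  \tr (p.1 *m (map_mx Num.conj q.1)^T) + dot p.2 (emap Num.conj q.2).

Lemma herm_conj p q : herm q p = Num.conj (herm p q).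
Proof.
rewrite /herm rmorphD /=; congr (_ + _).
  rewrite -mxtrace_tr trmx_mul trmxK -trace_map_mx map_mxM map_trmx; congr (\tr (_ *m _)).
    by apply/matrixP => i j; rewrite !mxE /= conjCK.
rewrite /dot rmorph_sum; apply: eq_bigr => I _; rewrite rmorphM /= !emapE conjCK.
by rewrite [LHS]mulrC.
Qed.

Lemma herm_linl q : linear (herm^~ q : ee C -> C^o).
Proof.
move=> a p p'; rewrite /herm /= mulmxDl linearD -scalemxAl linearZ /= dotC linearP /=.
by rewrite scalerDr !regE ![dot (emap _ _) _]dotC addrACA.
Qed.

Lemma herm_Dop x eta p q : star x = eta *: x -> eta * eta = 1 ->
  herm (Dop (cx x) p) q = c eta * herm p (Dop (cx x) q).
Proof.
move=> sx e2; have sX : star (cx x) = c eta *: cx x.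
  rewrite -cxZ -sx; apply/ffunP => I; rewrite !(starE, emapE) rmorphM /=.
  by congr (_ * _); rewrite /sg4 -cx_wedge /cx !emap_e4.
have cX : emap Num.conj (cx x) = cx x by apply: conj_cx.
have E2 : c eta * c eta = 1 by rewrite -rmorphM e2 rmorph1.
rewrite /herm !DopE /= (tr_moment_star _ _ sX) -mxtrace_tr trmx_mul trmxK -emap_moment cX.
rewrite (tr_moment_star _ _ sX).
rewrite emapN emap_lact cX dotNr dotNl mulrDr !mulrN mulrA E2 mul1r.
by rewrite [dot p.2 _]dotC addrC.
Qed.

Lemma herm_eq0 p : herm p p = 0 -> p = 0.
Proof.
have -> : herm p p = \sum_i \sum_j `|p.1 i j| ^+ 2 + \sum_I `|p.2 I : C| ^+ 2.
  rewrite /herm; congr (_ + _); last by apply: eq_bigr => I _; rewrite emapE normCK.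
  by apply: eq_bigr => i _; rewrite mxE; apply: eq_bigr => j _; rewrite !mxE normCK.
have n0 (z : C) : 0 <= `|z| ^+ 2 by rewrite exprn_ge0.
have s0 i : 0 <= \sum_j `|p.1 i j| ^+ 2 by apply: sumr_ge0.
move/eqP; rewrite paddr_eq0 ?sumr_ge0 // => /andP[/eqP h1 /eqP h2].
apply: injective_projections => /=.
  apply/matrixP => i j; rewrite mxE; apply/eqP; rewrite -normr_eq0 -sqrf_eq0.
  have e1 : \sum_j `|p.1 i j| ^+ 2 = 0 by apply: (psumr_eq0P _ h1).
  by apply/eqP; apply: (psumr_eq0P _ e1).
apply/ffunP => I; rewrite ext4_0; apply/eqP; rewrite -normr_eq0 -sqrf_eq0.
by apply/eqP; apply: (psumr_eq0P _ h2).
Qed.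

(** The adjoint of [Dop x] for the positive definite form [herm] is [Dop x] or its negative, so its
    eigenvalues satisfy r = eta conj r and it has no Jordan block of size 2. *)
Lemma star_split x eta : star x = eta *: x -> eta * eta = 1 -> split_semisimple (Dop (cx x)).
Proof.
move=> sx e2; set D := Dop _; apply: split_semisimple_reduced => r p.
set u := D p - r *: p => Du; apply/eqP; rewrite -subr_eq0 -/u; apply/eqP.
have hZl a v w : herm (a *: v) w = a * herm v w.
  by have := herm_linl w a v 0; rewrite !addr0 => ->; rewrite {2}/herm /= mul0mx mxtrace0 dotC linear0 !addr0.
have hZr a v w : herm v (a *: w) = Num.conj a * herm v w.
  by rewrite herm_conj hZl rmorphM /= -herm_conj.
have hDr v w w' : herm v (w + w') = herm v w + herm v w'.
  have := herm_linl v 1 w w'; rewrite scale1r => h.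
  by rewrite herm_conj h scale1r rmorphD /= -!herm_conj.
apply: herm_eq0; apply/eqP; apply: contraT => u0.
have E2 : c eta * c eta = 1 by rewrite -rmorphM e2 rmorph1.
have rE : r = c eta * Num.conj r.
  by have := herm_Dop u u sx e2; rewrite -/D Du hZl hZr mulrA => /(mulIf u0).
case/eqP: u0; rewrite {2}/u -scaleNr hDr hZr rmorphN.
have -> : herm u (D p) = c eta * herm (D u) p by rewrite (herm_Dop _ _ sx e2) mulrA E2 mul1r.
by rewrite Du hZl mulrA {1}rE mulrA E2 mul1r mulNr subrr.
Qed.
End SelfDual.

(** * The standard tori *)

Definition bit n k := odd (k %/ 2 ^ n).
(** The pairing sum of a_j k_j on F_2^3, numbers below 8 being read as bit vectors. *)
Definition chi a k := (bit 0 a && bit 0 k) (+) (bit 1 a && bit 1 k) (+) (bit 2 a && bit 2 k).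

(* With the eight coordinates labelled by the points of F_2^3, the planes through the
   origin, indexed by the nonzero linear forms. *)
Definition plane (a : 'I_7) : {set 'I_8} := [set k : 'I_8 | ~~ chi a.+1 k].

Lemma card_set8 (P : pred nat) : #|[set k : 'I_8 | P k]| = count P (iota 0 8).
Proof. by rewrite cardsE -val_enum_ord count_map cardE size_filter enumT. Qed.

Lemma card_plane a : #|plane a| = 4%N.
Proof.
rewrite /plane (card_set8 (fun k => ~~ chi a.+1 k)).
by case: a; do 7?[case=> //].
Qed.

Lemma card_planeI (a b : 'I_7) (x y : bool) : a != b ->
  #|[set k : 'I_8 | (chi a.+1 k == x) && (chi b.+1 k == y)]| = 2%N.
Proof.
rewrite (card_set8 (fun k => (chi a.+1 k == x) && (chi b.+1 k == y))) => ab.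
have {}ab : (a == b :> nat) = false by apply: negbTE.
have : all (fun a => all (fun b => (a == b) || all (fun x => all (fun y =>
    count (fun k => (chi a.+1 k == x) && (chi b.+1 k == y)) (iota 0 8) == 2%N)
    [:: false; true]) [:: false; true]) (iota 0 7)) (iota 0 7) by [].
have mi (i : 'I_7) : (i : nat) \in iota 0 7 by rewrite mem_iota; case: i.
move=> /allP/(_ _ (mi a))/allP/(_ _ (mi b)); rewrite ab /= => h.
by apply/eqP; move: h; case: x; case: y => /and3P[/and3P[? ? _] /and3P[? ? _] _].
Qed.

Lemma frame_mem (K : fieldType) (V : vectType K) n (v : 'I_n -> V) x :
  reflect (exists k, x = \sum_i k i *: v i) (x \in \sum_i <[v i]>)%VS.
Proof.
apply: (iffP memv_sumP) => [[w wv ->]|[k ->]].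
  have h i : exists a, w i == a *: v i by have /vlineP[a ->] := wv i isT; exists a.
  by exists (fun i => xchoose (h i)); apply: eq_bigr => i _; apply/eqP/(xchooseP (h i)).
by exists (fun i => k i *: v i) => // i _; rewrite rpredZ ?memv_line.
Qed.

Section Frames.
Variable K : numFieldType.
Implicit Types (a b : 'I_7) (e f : K).
Local Notation eS := (eS K).
Local Notation wS := (wS K).
Local Notation sd := (sd K).

Definition hvec a e : ext4 K := eS (plane a) + e *: wS (plane a).
(** For nonzero e, the vectors [hvec a e], [yvec a e] and the matrix [sd (plane a)] span a copy of
    sl2. *)
Definition yvec a e : ext4 K := eS (plane a) - e *: wS (plane a).

Lemma plane_meet a b (x y : bool) : a != b ->
  (1 < #|(if x then ~: plane a else plane a) :&: (if y then ~: plane b else plane b)|)%N.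
Proof.
move=> ab; have [h1 h2] : (1 < 2)%N /\ [set k : 'I_8 | (chi a.+1 k == x) && (chi b.+1 k == y)] \subset
    (if x then ~: plane a else plane a) :&: (if y then ~: plane b else plane b); last first.
  by apply: leq_trans (subset_leq_card h2); rewrite card_planeI.
split=> //; apply/subsetP => k.
rewrite inE => /andP[/eqP hx /eqP hy]; move: hx hy.
by case: x; case: y => hx hy; rewrite !inE hx hy.
Qed.

Lemma moment_planes a b e f : a != b ->
  moment (eS (plane a) + e *: wS (plane a)) (eS (plane b) + f *: wS (plane b)) = 0.
Proof.
move=> ab; rewrite momentDl !momentDr !momentZl !momentZr.
rewrite (moment_eS0 K (plane_meet false false ab)) (moment_eS0 K (plane_meet false true ab)).
by rewrite (moment_eS0 K (plane_meet true false ab)) (moment_eS0 K (plane_meet true true ab)) !scaler0 !addr0.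
Qed.

Lemma moment_hvec a b e f : a != b -> moment (hvec a e) (hvec b f) = 0.
Proof. exact: moment_planes. Qed.

Lemma moment_hvec_yvec a b e f : a != b -> moment (hvec a e) (yvec b f) = 0.
Proof. by rewrite /yvec -scaleNr; apply: moment_planes. Qed.

Lemma moment_hy a e : moment (hvec a e) (yvec a e) = - e *: sd (plane a).
Proof.
have := moment_eS_wS K (card_plane a); rewrite /hvec /yvec.
move: (eS _) (wS _) (sd _) => u w s key.
rewrite momentDl !momentBr !momentZl !momentZr !moment_same !scaler0 sub0r subr0.
rewrite [moment w u]momentC key !scalerN -opprD scalerA -scalerDl -scaleNr.
by congr (_ *: _); field.
Qed.

Lemma tr_sd_planes a b : a != b -> \tr (sd (plane a) *m sd (plane b)) = 0.
Proof.
move=> ab; rewrite tr_sd_sd; under eq_bigr => k _ do rewrite !inE.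
have P x y := card_planeI x y ab.
transitivity (\sum_(x : bool) \sum_(y : bool) \sum_(k : 'I_8 | (chi a.+1 k == x) && (chi b.+1 k == y))
   (-1) ^+ (x != y) : K).
  rewrite (partition_big (fun k : 'I_8 => chi a.+1 k) xpredT) //=; apply: eq_bigr => x _.
  rewrite (partition_big (fun k : 'I_8 => chi b.+1 k) xpredT) //=; apply: eq_bigr => y _.
  by apply: eq_bigr => k /andP[/eqP -> /eqP ->]; case: x; case: y.
have S x y : \sum_(k : 'I_8 | (chi a.+1 k == x) && (chi b.+1 k == y)) (-1) ^+ (x != y) =
    (-1) ^+ (x != y) *+ 2 :> K.
  by rewrite sumr_const; congr (_ *+ _); rewrite -[RHS](P x y) cardsE.
rewrite !big_bool /= !S /= !expr0 !expr1; ring.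
Qed.

Lemma lact_sd_hvec a e : lact (sd (plane a)) (hvec a e) = 4%:R *: yvec a e.
Proof.
rewrite lactDr lactZr lactZr lact_sd_eS lact_sd_eSC /yvec scalerBr; congr (_ + _).
by rewrite !scaleNr !scalerN !scalerA; congr (- (_ *: _)); ring.
Qed.

Lemma lact_sd_hvec0 a b e : a != b -> lact (sd (plane a)) (hvec b e) = 0.
Proof.
move=> ab; rewrite lactDr !lactZr lact_comm_sd ?lact_comm_sdC; try exact: sd_comm.
by rewrite tr_sd_planes 1?eq_sym // mul0r oppr0 !scale0r !scaler0 addr0.
Qed.

Lemma star_hvec a e : e * e = 1 -> star (hvec a e) = e *: hvec a e.
Proof.
move=> e2; rewrite (linearD (@star K)) (linearZZ (@star K)) /= star_eS ?star_wS ?card_plane //.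
by rewrite scalerDr scalerA e2 scale1r addrC.
Qed.

Lemma wedge_hvec a e : wedge (hvec a e) (hvec a e) = 2%:R * e.
Proof.
have h1 := wedge_eS_wS K (card_plane a).
have h2 : wedge (wS (plane a)) (wS (plane a)) = 0.
  by rewrite /wS wedgeZl wedgeZr wedge_eS_same !mulr0.
move: h1 h2 (wedge_eS_same K (plane a)); rewrite /hvec; move: (eS _) (wS _) => u w h1 h2 h3.
by rewrite wedgeDl !wedgeDr !wedgeZl !wedgeZr (wedgeC w u) h1 h2 h3; ring.
Qed.

Lemma wedge_hvec0 a b e f : a != b -> wedge (hvec a e) (hvec b f) = 0.
Proof.
move=> ab; have N (x y : bool) : wedge (eS (if x then ~: plane a else plane a))
    (eS (if y then ~: plane b else plane b)) = 0.
  apply: wedge_eS0; apply/eqP => E; have := plane_meet x y ab.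
  by rewrite E setICr cards0.
rewrite wedgeDl !wedgeDr !wedgeZl !wedgeZr.
rewrite (N false false) (N false true) (N true false) (N true true); ring.
Qed.
End Frames.

Lemma frame_span (K : fieldType) (V : vectType K) n (v : 'I_n -> V) :
  (\sum_i <[v i]>)%VS = <<[tuple v i | i < n]>>%VS.
Proof. by rewrite span_def big_tuple; apply: eq_bigr => i _; rewrite tnth_mktuple. Qed.

Lemma frame_dim (K : fieldType) (V : vectType K) n (v : 'I_n -> V) :
  (forall k : 'I_n -> K, \sum_i k i *: v i = 0 -> forall i, k i = 0) -> \dim (\sum_i <[v i]>)%VS = n.
Proof.
move=> fr; rewrite frame_span; have /eqP -> : free [tuple v i | i < n].
  apply/freeP => k k0; apply: fr; rewrite -[RHS]k0; apply: eq_bigr => i _.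
  by rewrite -tnth_nth tnth_mktuple.
by rewrite size_tuple.
Qed.

Section StandardTorus.
Variables (R : rcfType) (C : numClosedFieldType) (c : complexification R C).
Local Notation cx := (cx c).

Lemma torus_sub_max V : torus c V -> exists2 W, max_torus c W & (V <= W)%VS.
Proof.
have [n] := ubnP (\dim {:ext4 R} - \dim V); elim: n V => // n IH V hn tV.
have [mx|nmx] := Classical_Prop.classic (max_torus c V); first by exists V.
have [V' [tV' VV' ne]] : exists V', [/\ torus c V', (V <= V')%VS & V' <> V].
  apply: Classical_Prop.NNPP => none; apply: nmx; split=> // V' tV' VV'.
  by apply: Classical_Prop.NNPP => ne; apply: none; exists V'.
have lt : (\dim V < \dim V')%N.
  by rewrite ltn_neqAle dimvS // andbT; apply: contra_notN ne => /eqP h; apply/eqP; rewrite eq_sym eqEdim VV' h leqnn.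
have le : (\dim V' <= \dim {:ext4 R})%N by apply/dimvS/subvf.
have [|W mW sW] := IH V' _ tV'; first by move: (\dim {:_}) hn lt le; lia.
by exists W => //; apply: subv_trans sW.
Qed.

Definition stdU (e : 'I_7 -> R) : {vspace ext4 R} := (\sum_a <[hvec a (e a)]>)%VS.

Implicit Types e k : 'I_7 -> R.

Lemma moment_sum2 (u v : 'I_7 -> ext4 R) k l :
  moment (\sum_a k a *: u a) (\sum_b l b *: v b) = \sum_a \sum_b (k a * l b) *: moment (u a) (v b).
Proof.
rewrite momentC linear_sum /= -sumrN; apply: eq_bigr => a _.
rewrite -momentC momentZl linear_sum scaler_sumr; apply: eq_bigr => b _ /=.
by rewrite momentZr scalerA.
Qed.

Lemma moment_std e k l : moment (\sum_a k a *: hvec a (e a)) (\sum_b l b *: hvec b (e b)) = 0.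
Proof.
rewrite moment_sum2 big1 // => a _; rewrite big1 // => b _.
have [->|ab] := eqVneq a b; first by rewrite moment_same scaler0.
by rewrite moment_hvec // scaler0.
Qed.

Lemma wedge_std e k b : wedge (\sum_a k a *: hvec a (e a)) (hvec b (e b)) = 2%:R * k b * e b.
Proof.
rewrite wedge_suml (bigD1 b) //= big1 => [|a ab].
  by rewrite wedgeZl wedge_hvec addr0; ring.
by rewrite wedgeZl wedge_hvec0 // mulr0.
Qed.

Lemma star_std e k eta : eta * eta = 1 -> (forall a, k a != 0 -> e a = eta) ->
  star (\sum_a k a *: hvec a (e a)) = eta *: (\sum_a k a *: hvec a (e a)).
Proof.
move=> eta2 h; rewrite linear_sum scaler_sumr; apply: eq_bigr => a _ /=.
have [->|/h ea] := eqVneq (k a) 0; first by rewrite !scale0r linear0 scaler0.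
by rewrite (linearZZ (@star R)) /= ea star_hvec // !scalerA mulrC.
Qed.

Lemma dim_stdU e : (forall a, e a != 0) -> \dim (stdU e) = 7%N.
Proof.
move=> e0; apply: frame_dim => k k0 a; have := wedge_std e k a.
rewrite k0 wedge0l => /esym/eqP; rewrite -mulrA mulf_eq0 pnatr_eq0 /= mulf_eq0 (negbTE (e0 a)) orbF.
by move/eqP.
Qed.

Hypothesis jac : jacobi C.

(** Sorting the terms by sign writes a vector as the sum of a self-dual and an anti-self-dual one;
    these commute, and each is semisimple by [star_split]. *)
Lemma torus_std e : (forall a, e a = 1 \/ e a = -1) -> torus c (stdU e).
Proof.
move=> e1; split=> [x /frame_mem[k ->]|x y /frame_mem[k ->] /frame_mem[l ->]]; last exact: moment_std.
pose kp a := if e a == 1 then k a else 0; pose km a := if e a == 1 then 0 else k a.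
have -> : \sum_a k a *: hvec a (e a) =
    \sum_a kp a *: hvec a (e a) + \sum_a km a *: hvec a (e a).
  rewrite -big_split; apply: eq_bigr => a _ /=; rewrite /kp /km.
  by case: ifP; rewrite scale0r ?addr0 ?add0r.
rewrite cxD DopD -[X in _ + X]scale1r; apply: split_semisimpleD.
- apply/(moment_Dop_comm _ _ jac).
  by apply: moment_cx; apply: moment_std.
- apply: (@star_split _ _ _ _ 1); rewrite ?mulr1 //; apply: star_std; rewrite ?mulr1 // => a.
  by rewrite /kp; case: (e a =P 1) => // h; rewrite eqxx.
- apply: (@star_split _ _ _ _ (-1)); rewrite ?mulrNN ?mulr1 //; apply: star_std; rewrite ?mulrNN ?mulr1 // => a.
  by rewrite /km; case: (e a =P 1) => [h|h _]; rewrite ?eqxx //; case: (e1 a).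
Qed.

(** A maximal torus containing it has dimension 7 too, so no centralizer has to be computed. *)
Lemma max_torus_std e : (forall a, e a = 1 \/ e a = -1) -> max_torus c (stdU e).
Proof.
move=> e1; have [W mW sW] := torus_sub_max (torus_std e1).
have [d7 _ _] := torus_structure jac mW.
have -> // : stdU e = W; apply/eqP; rewrite eqEdim sW d7 dim_stdU // => a.
by case: (e1 a) => ->; rewrite ?oppr_eq0 oner_eq0.
Qed.
End StandardTorus.

(** * Invariants of the standard tori *)

Section Conjugation.
Variable R : rcfType.
Implicit Types (U V : {vspace ext4 R}) (P Q : 'M[R]_8) (x : ext4 R).

Lemma det1_unit P : \det P = 1 -> P \in unitmx.
Proof. by move=> h; rewrite unitmxE h unitr1. Qed.

Lemma det_inv1 P : \det P = 1 -> \det (invmx P) = 1.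
Proof. by move=> h; rewrite det_inv h invr1. Qed.

Lemma ext4_actKV P x : P \in unitmx -> ext4_act P (ext4_act (invmx P) x) = x.
Proof. by move=> uP; rewrite -ext4_actM mulmxV // ext4_act1. Qed.

Lemma SL8_conjugate_sym U V : SL8_conjugate U V -> SL8_conjugate V U.
Proof.
case=> P dP h; have uP := det1_unit dP; exists (invmx P); first exact: det_inv1.
move=> y; split=> [yU|[x /h[z zU ->] ->]]; last by rewrite ext4_actK.
by exists (ext4_act P y); rewrite ?ext4_actK //; apply/h; exists y.
Qed.

Lemma SL8_conjugate_trans U V W : SL8_conjugate U V -> SL8_conjugate V W -> SL8_conjugate U W.
Proof.
case=> P dP hP [Q dQ hQ]; exists (Q *m P); first by rewrite det_mulmx dP dQ mulr1.
move=> y; split=> [/hQ[z /hP[x xU ->] ->]|[x xU ->]].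
  by exists x; rewrite // ext4_actM.
by apply/hQ; exists (ext4_act P x); rewrite ?ext4_actM //; apply/hP; exists x.
Qed.

Lemma rootop_act P x Y : \det P = 1 ->
  rootop (ext4_act P x) (P *m Y *m invmx P) = P *m rootop x Y *m invmx P.
Proof.
move=> dP; have uP := det1_unit dP; rewrite /rootop -lact_act // moment_act // dP scale1r.
by rewrite mulmxN mulNmx.
Qed.

Definition sign_part (eta : R) U x :=
  x \in U /\ forall X t, eta * t < 0 -> rootop x X = t *: X -> X = 0.

Lemma sign_part_act eta U V P x : \det P = 1 ->
  (forall y, y \in V <-> exists2 x, x \in U & y = ext4_act P x) ->
  sign_part eta U x -> sign_part eta V (ext4_act P x).
Proof.
move=> dP hP [xU h]; have uP := det1_unit dP; split; first by apply/hP; exists x.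
move=> X t et rX; pose Y := invmx P *m X *m P.
have XE : X = P *m Y *m invmx P by rewrite /Y !mulmxA mulmxV // mul1mx -mulmxA mulmxV // mulmx1.
have Y0 : Y = 0.
  apply: (h _ t) => //; move: rX; rewrite {1}XE rootop_act // => e.
  have -> : rootop x Y = invmx P *m (P *m rootop x Y *m invmx P) *m P.
    by rewrite !mulmxA mulVmx // mul1mx -mulmxA mulVmx // mulmx1.
  by rewrite e -scalemxAr -scalemxAl.
by rewrite XE Y0 mulmx0 mul0mx.
Qed.

Definition noncommuting (eta : R) U := exists X Y : 'M[R]_8,
  (forall x, sign_part eta U x -> lact X x = 0 /\ lact Y x = 0) /\ X *m Y <> Y *m X.

Lemma noncommuting_conj eta U V : SL8_conjugate U V -> noncommuting eta U -> noncommuting eta V.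
Proof.
case=> P dP hP [X [Y [ann nc]]]; have uP := det1_unit dP.
have hQ y : y \in U <-> exists2 x, x \in V & y = ext4_act (invmx P) x.
  split=> [yU|[x /hP[z zU ->] ->]]; last by rewrite ext4_actK.
  by exists (ext4_act P y); rewrite ?ext4_actK //; apply/hP; exists y.
exists (P *m X *m invmx P), (P *m Y *m invmx P); split=> [x xV|e].
  have [] := ann _ (sign_part_act (det_inv1 dP) hQ xV) => hX hY.
  by rewrite -(ext4_actKV x uP) -!lact_act // hX hY linear0.
have conjM (A B : 'M[R]_8) : P *m A *m invmx P *m (P *m B *m invmx P) = P *m (A *m B) *m invmx P.
  by rewrite !mulmxA -[_ *m invmx P *m P]mulmxA mulVmx // mulmx1.
apply: nc; apply: (can_inj (mulKmx uP)); apply: (can_inj (mulmxK (_ : invmx P \in unitmx))); first by rewrite unitmx_inv.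
by rewrite -!conjM.
Qed.

End Conjugation.

Section StandardSigns.
Variable R : rcfType.
Implicit Types (e k : 'I_7 -> R) (x : ext4 R).

Lemma tr_mul_trmx_eq0 n (X : 'M[R]_n) : \tr (X *m X^T) <= 0 -> X = 0.
Proof.
have E : \tr (X *m X^T) = \sum_i \sum_j X i j ^+ 2.
  by apply: eq_bigr => i _; rewrite mxE; apply: eq_bigr => j _; rewrite mxE expr2.
rewrite E => le; have n0 i : 0 <= \sum_j X i j ^+ 2 by apply: sumr_ge0 => j _; apply: sqr_ge0.
have e0 : \sum_i \sum_j X i j ^+ 2 = 0 by apply/eqP; rewrite eq_le le sumr_ge0.
apply/matrixP => i j; rewrite mxE; apply/eqP; rewrite -sqrf_eq0.
have e1 : \sum_j X i j ^+ 2 = 0 by apply: (psumr_eq0P _ e0).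
by apply/eqP; apply: (psumr_eq0P _ e1) => // l _; apply: sqr_ge0.
Qed.

Lemma dot_ge0 x : 0 <= dot x x.
Proof. by apply: sumr_ge0 => I _; rewrite -expr2 sqr_ge0. Qed.

Lemma rootop_sd e k b :
  rootop (\sum_a k a *: hvec a (e a)) (sd R (plane b)) = (4%:R * k b ^+ 2 * e b) *: sd R (plane b).
Proof.
have E : lact (sd R (plane b)) (\sum_a k a *: hvec a (e a)) = (4%:R * k b) *: yvec b (e b).
  rewrite lact_sumr (bigD1 b) //= big1 => [|a ab].
    by rewrite lactZr lact_sd_hvec scalerA addr0 mulrC.
  by rewrite lactZr lact_sd_hvec0 ?scaler0 // eq_sym.
rewrite /rootop E momentZr momentC linear_sum /= (bigD1 b) //= big1 => [|a ab]; last first.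
  by rewrite momentZr momentC moment_hvec_yvec // oppr0 scaler0.
rewrite addr0 momentZr momentC moment_hy !(scalerN, scaleNr, opprK) !scalerA.
by congr (_ *: _); ring.
Qed.

(** If k_b is nonzero with e_b = - eta, then [sd (plane b)] is an eigenvector with an eigenvalue of
    the forbidden sign. Conversely, when star y = eta y, eta times [rootop y] is positive
    semidefinite for tr (X X^T). *)
Lemma sign_part_std e eta x : (forall a, e a = 1 \/ e a = -1) -> (eta = 1 \/ eta = -1) ->
  sign_part eta (stdU e) x <->
  exists2 k, x = \sum_a k a *: hvec a (e a) & forall a, k a != 0 -> e a = eta.
Proof.
move=> e1 eta1; have eta2 : eta * eta = 1 by case: eta1 => ->; rewrite ?mulrNN mulr1.
split=> [[/frame_mem[k ->] h]|[k -> ke]].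
  exists k => // b kb; apply: Classical_Prop.NNPP => ne.
  have et : eta * (4%:R * k b ^+ 2 * e b) < 0.
    have k2 : 0 < k b ^+ 2 by rewrite lt_def sqrf_eq0 kb sqr_ge0.
    by case: (e1 b) ne => ->; case: eta1 => -> // _; lra.
  have /matrixP/(_ ord0 ord0) := h _ _ et (rootop_sd e k b).
  by rewrite sdE mxE eqxx mulr1n => /eqP; rewrite signr_eq0.
split; first by apply/frame_mem; exists k.
set y := \sum_a _; have sy : star y = eta *: y by apply: star_std.
move=> X t et rX; apply: tr_mul_trmx_eq0.
have : \tr (rootop y X *m X^T) = eta * dot (lact X y) (lact X y).
  by rewrite /rootop mulNmx linearN /= (tr_moment_star _ _ sy) opprK.
rewrite rX -scalemxAl linearZ /= => E.
have : 0 <= (eta * t) * \tr (X *m X^T) by rewrite -mulrA E mulrA eta2 mul1r dot_ge0.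
by rewrite nmulr_rge0.
Qed.

(** The coordinate at S with j replaced by i isolates X i j: this set is one exchange away from S,
    and more than one away from the complement of S. *)
Lemma lact_eq0_entry (X : 'M[R]_8) S (al be : R) i j : al != 0 ->
  lact X (al *: eS R S + be *: eS R (~: S)) = 0 -> #|S| = 4%N -> j \in S -> i \notin S -> X i j = 0.
Proof.
move=> al0 h S4 jS iS; have ij : i != j by apply: contraNneq iS => ->.
have [J JS eJ] := eS_sub4 R S4; have [J' J'S eJ'] := eS_sub4 R (cardsC4 S4).
have T4 : #|i |: S :\ j| = 4%N.
  rewrite cardsU1; have -> : i \notin S :\ j by rewrite !inE (negbTE iS) andbF.
  by have := cardsD1 j S; rewrite jS S4.
have [I IT eI] := eS_sub4 R T4.
have [s s0 sE] := lact_delta_eS R jS iS.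
have E0 (k l : 'I_8) : (k, l) != (i, j) -> lact (delta_mx k l) (eS R S) I = 0 :> R.
  move=> kl; apply/eqP; apply: contraT; have [<-|nkl] := eqVneq k l.
    rewrite eJ lact_diag_e4 ext4Z e4E -val_eqE IT JS; case: (_ =P S) => [e|_]; last by rewrite mulr0 eqxx.
    by move: iS; rewrite -e !inE eqxx.
  rewrite eJ => /(lact_delta_e4 nkl)[lS kS]; rewrite IT JS in lS kS * => e.
  have ki : k = i.
    have : k \in i |: S :\ j by rewrite e !inE eqxx.
    by rewrite !inE (negbTE kS) andbF orbF => /eqP.
  have : l \notin i |: S :\ j by rewrite e !inE eqxx /= orbF eq_sym.
  rewrite !inE lS andbT negb_or negbK => /andP[_ /eqP lj].
  by rewrite ki lj eqxx in kl.
have E1 (k l : 'I_8) : lact (delta_mx k l) (eS R (~: S)) I = 0 :> R.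
  have big : ~ (S :\ j \subset [set k]).
    by move/subset_leq_card; have := cardsD1 j S; rewrite jS S4 cards1; lia.
  apply/eqP; apply: contraT; have [<-|nkl] := eqVneq k l.
    rewrite eJ' lact_diag_e4 ext4Z e4E -val_eqE IT J'S; case: (_ =P ~: S) => [e|_]; last by rewrite mulr0 eqxx.
    case: big; apply/subsetP => y yS; have : y \in i |: S :\ j by rewrite inE yS orbT.
    by rewrite e inE; case/setD1P: yS => _ ->.
  rewrite eJ' => /(lact_delta_e4 nkl)[_ _]; rewrite IT J'S => e.
  case: big; apply/subsetP => y yS; have : y \in i |: S :\ j by rewrite inE yS orbT.
  by rewrite e !inE; case/setD1P: yS => _ ->; rewrite andbF orbF.
have := congr1 (fun z : ext4 R => z I) h; rewrite /= ext4_0 {1}(matrix_sum_delta X) lact_suml ext4_sum.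
rewrite (bigD1 i) //= [X in _ + X]big1 => [|k ki]; last first.
  rewrite lact_suml ext4_sum big1 // => l _; rewrite lactZl ext4Z lactDr !lactZr ext4D !ext4Z E1 E0 ?mulr0 ?addr0 ?mulr0 //.
  by rewrite xpair_eqE (negbTE ki).
rewrite addr0 lact_suml ext4_sum (bigD1 j) //= [X in _ + X]big1 => [|l lj]; last first.
  rewrite lactZl ext4Z lactDr !lactZr ext4D !ext4Z E1 E0 ?mulr0 ?addr0 ?mulr0 //.
  by rewrite xpair_eqE (negbTE lj) andbF.
rewrite addr0 lactZl ext4Z lactDr !lactZr ext4D !ext4Z E1 sE ext4Z eSE IT eqxx mulr1 mulr0 addr0.
by move/eqP; rewrite !mulf_eq0 (negbTE al0) (negbTE s0) !orbF => /eqP.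
Qed.
End StandardSigns.

(** [k] is the bitwise sum of [i] and [j], found by enumeration. *)
Lemma chi_xor (i j : 'I_8) : i != j ->
  exists2 k : 'I_8, k != ord0 & forall a : 'I_7, chi a.+1 k = chi a.+1 i (+) chi a.+1 j.
Proof.
have : all (fun i => all (fun j => (i == j) || has (fun k => all (fun a =>
    chi a.+1 k == chi a.+1 i (+) chi a.+1 j) (iota 0 7)) (iota 1 7)) (iota 0 8)) (iota 0 8) by [].
have m8 (l : 'I_8) : (l : nat) \in iota 0 8 by rewrite mem_iota; case: l.
move=> /allP/(_ _ (m8 i))/allP/(_ _ (m8 j)) h ij; move: h.
have -> : (i == j :> nat) = false by apply: negbTE.
rewrite orFb => /hasP[k]; rewrite mem_iota => /andP[k0 k8] /allP h.
exists (Ordinal k8) => [|a]; first by rewrite -val_eqE /= -lt0n.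
by apply/eqP/h; rewrite mem_iota; case: a.
Qed.

Section StandardInvariants.
Variable R : rcfType.
Implicit Types (e : 'I_7 -> R) (eta : R).

Definition pm e := forall a, e a = 1 \/ e a = -1.

Lemma sign_part_hvec e eta a : pm e -> (eta = 1 \/ eta = -1) -> e a = eta ->
  sign_part eta (stdU e) (hvec a (e a)).
Proof.
move=> e1 eta1 ea; apply/sign_part_std => //; exists (fun b => (b == a)%:R).
  by rewrite (bigD1 a) //= eqxx scale1r big1 ?addr0 // => b /negbTE ->; rewrite scale0r.
by move=> b; case: (b =P a) => [->|_] //; rewrite eqxx.
Qed.

Lemma lact_hvec_entry (X : 'M[R]_8) a (e : R) (i j : 'I_8) : e != 0 -> lact X (hvec a e) = 0 ->
  chi a.+1 i != chi a.+1 j -> X i j = 0.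
Proof.
move=> e0 h ij; have [S4 S4'] := (card_plane a, cardsC4 (card_plane a)).
have sg0 := sgS_neq0 R S4.
have [ja|ja] := boolP (j \in plane a); move: (ja); rewrite !inE => cj.
  apply: (@lact_eq0_entry _ X (plane a) 1 (e * sgS R (plane a))) => //.
  - exact: oner_neq0.
  - by rewrite scale1r -scalerA.
  - by rewrite inE negbK; move: ij; rewrite (negbTE cj); case: (chi _ i).
apply: (@lact_eq0_entry _ X (~: plane a) (e * sgS R (plane a)) 1) => //.
- by rewrite mulf_neq0.
- by rewrite setCK scale1r addrC -scalerA.
- by rewrite inE.
- by rewrite !inE negbK; move: ij; rewrite negbK in cj; rewrite cj; case: (chi _ i).
Qed.

(** If the forms of sign eta separate the eight points, every matrix annihilating the sign part is
    diagonal, and such matrices commute. If they all vanish at some k different from 0, then E_0k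
    and E_k0 annihilate it and do not commute. *)
Lemma noncommuting_std e eta : pm e -> (eta = 1 \/ eta = -1) ->
  noncommuting eta (stdU e) <->
  exists2 k : 'I_8, k != ord0 & forall a : 'I_7, e a = eta -> ~~ chi a.+1 k.
Proof.
move=> e1 eta1; split=> [[X [Y [ann nc]]]|[k k0 hk]].
  apply: Classical_Prop.NNPP => none; apply: nc.
  have dg (Z : 'M[R]_8) : (forall x, sign_part eta (stdU e) x -> lact Z x = 0) -> is_diag_mx Z.
    move=> hZ; apply/is_diag_mxP => i j ij; have [//|k k0 hk] := @chi_xor i j.
    apply: Classical_Prop.NNPP => Zij; apply: none; exists k => // a ea.
    apply/negP; rewrite hk => h; apply: Zij.
    apply: (@lact_hvec_entry _ a (e a)).
    - by rewrite ea; case: eta1 => ->; rewrite ?oppr_eq0 oner_eq0.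
    - by apply: hZ; apply: sign_part_hvec.
    - by move: h; case: (chi _ i); case: (chi _ j).
  have /diag_mxP[dX ->] : is_diag_mx X by apply: dg => x /ann[].
  have /diag_mxP[dY ->] : is_diag_mx Y by apply: dg => x /ann[].
  by rewrite !mulmx_diag; congr diag_mx; apply/rowP => i; rewrite !mxE mulrC.
exists (delta_mx ord0 k), (delta_mx k ord0); split=> [x|].
  case/(sign_part_std _ e1 eta1)=> l -> lh.
  have z0 a : chi a.+1 0 = false by rewrite /chi !andbF.
  split; rewrite lact_sumr big1 // => a _; rewrite lactZr; have [->|/lh/hk ca] := eqVneq (l a) 0;
    rewrite ?scale0r // lactDr !lactZr !lact_delta_eS0 ?inE ?z0 ?(negbTE ca) ?scaler0 ?addr0 ?scaler0 //; by rewrite eq_sym.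
rewrite !mul_delta_mx => /matrixP/(_ ord0 ord0); rewrite !mxE !eqxx /= eq_sym (negbTE k0) /=.
by move/eqP; rewrite oner_eq0.
Qed.

Lemma free_dim_sub (V : vectType R) n (v : 'I_n -> V) (p : pred 'I_n) : free [tuple v i | i < n] ->
  \dim (\sum_(i | p i) <[v i]>)%VS = #|p|.
Proof.
move=> fr; have -> : (\sum_(i | p i) <[v i]> = <<[seq v i | i <- filter p (index_enum 'I_n)]>>)%VS.
  by rewrite span_def big_map big_filter.
have /eqP -> : free [seq v i | i <- filter p (index_enum 'I_n)].
  have : free ([seq v i | i <- filter p (index_enum 'I_n)] ++ [seq v i | i <- filter (predC p) (index_enum 'I_n)]).
    rewrite -map_cat; have /perm_free -> // : perm_eq [seq v i | i <- filter p (index_enum 'I_n) ++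
        filter (predC p) (index_enum 'I_n)] [tuple v i | i < n].
    by rewrite /= -[X in perm_eq _ (map _ X)]/(enum 'I_n) enumT perm_map // perm_filterC.
  by move/catl_free.
by rewrite size_map size_filter cardE size_filter.
Qed.

Lemma sign_part_count e e' eta : pm e -> pm e' -> (eta = 1 \/ eta = -1) ->
  SL8_conjugate (stdU e) (stdU e') -> (#|[pred a | e a == eta]| <= #|[pred a | e' a == eta]|)%N.
Proof.
move=> e1 e1' eta1 [P dP hP]; have uP := det1_unit dP.
have fr f : pm f -> free [tuple hvec a (f a) | a < 7].
  move=> f1; apply/freeP => k k0 a; apply: contraTeq isT => ka.
  have := wedge_std f k a.
  have -> : \sum_a k a *: hvec a (f a) = 0.
    by rewrite -[RHS]k0; apply: eq_bigr => i _; rewrite -tnth_nth tnth_mktuple.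
  rewrite wedge0l => /esym/eqP; rewrite !mulf_eq0 pnatr_eq0 (negbTE ka) /=.
  by case: (f1 a) => ->; rewrite ?oppr_eq0 oner_eq0.
pose W f := (\sum_(a | [pred a | f a == eta] a) <[hvec a (f a)]>)%VS.
have dW f : pm f -> \dim (W f) = #|[pred a | f a == eta]|.
  by move=> /fr/(free_dim_sub [pred a | f a == eta]) <-.
rewrite -(dW e e1) -(dW e' e1').
pose A : 'End(ext4 R) := linfun (ext4_act P).
have <- : \dim (A @: W e) = \dim (W e).
  apply: limg_dim_eq; apply/eqP; rewrite -subv0; apply/subvP => z.
  rewrite memv_cap memv_ker memv0 lfunE /= => /andP[_ /eqP h].
  by rewrite -(ext4_actK z uP) h linear0.
apply: dimvS; apply/subvP => _ /memv_imgP[x xs ->]; rewrite lfunE /=.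
have : sign_part eta (stdU e) x.
  apply/sign_part_std => //; have /memv_sumP[w wv ->] := xs.
  have h i : exists a, (e i == eta) ==> (w i == a *: hvec i (e i)).
    have [/eqP ei|//] := boolP (e i == eta); last by exists 0.
    by have /vlineP[a ->] := wv i (introT eqP ei); exists a; rewrite eqxx implybT.
  have [kk hk] : exists kk : 'I_7 -> R, forall i, (e i == eta) ==> (w i == kk i *: hvec i (e i)).
    by exists (fun i => xchoose (h i)) => i; apply: (xchooseP (h i)).
  exists (fun i => if e i == eta then kk i else 0) => [|a]; last by case: (e a =P eta) => //; rewrite eqxx.
  rewrite big_mkcond; apply: eq_bigr => i _ /=; case: ifP => [ei|_]; last by rewrite scale0r.
  by have := hk i; rewrite ei /= => /eqP.
move/(sign_part_act dP hP)/(sign_part_std _ e1' eta1) => [k -> kh].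
apply: rpred_sum => a _; have [->|ka] := eqVneq (k a) 0; first by rewrite scale0r mem0v.
have sub : (<[hvec a (e' a)]> <= W e')%VS.
  by apply: (sumv_sup a); [apply/eqP/kh | apply: subvv].
by apply: rpredZ; apply: (subvP sub); apply: memv_line.
Qed.
End StandardInvariants.

(* Up to the action of GL(3, 2) on the Fano plane, with lines of the form
   a, b, a xor b, these are the subsets of {1, ..., 7}; the fourth is a line and
   the fifth a triangle. *)
Definition fano_reps : seq (seq nat) :=
  [:: [::]; [:: 1]; [:: 1; 2]; [:: 1; 2; 3]; [:: 1; 2; 4]; [:: 4; 5; 6; 7]; [:: 3; 5; 6; 7];
      [:: 3; 4; 5; 6; 7]; [:: 2; 3; 4; 5; 6; 7]; [:: 1; 2; 3; 4; 5; 6; 7]]%N.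

Definition fano_mem (i a : nat) : bool := a.+1 \in nth [::] fano_reps i.

(** The criterion of [noncommuting_std] in computable form; [true] stands for the sign -1. *)
Definition fano_flag (b : bool) (i : nat) : bool :=
  has (fun k => all (fun a => (fano_mem i a == b) ==> ~~ chi a.+1 k) (iota 0 7)) (iota 1 7).

Lemma fano_reps_distinct (i j : 'I_10) :
  count (fano_mem i) (iota 0 7) = count (fano_mem j) (iota 0 7) ->
  (forall b, fano_flag b i = fano_flag b j) -> i = j.
Proof.
have : all (fun i => all (fun j =>
    [&& count (fano_mem i) (iota 0 7) == count (fano_mem j) (iota 0 7),
        fano_flag true i == fano_flag true j & fano_flag false i == fano_flag false j] ==> (i == j))
    (iota 0 10)) (iota 0 10) by [].
have mi (l : 'I_10) : (l : nat) \in iota 0 10 by rewrite mem_iota; case: l.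
move=> /allP/(_ _ (mi i))/allP/(_ _ (mi j))/implyP h e1 e2.
by apply/val_inj/eqP/h; rewrite e1 !e2 !eqxx.
Qed.

Section Representatives.
Variable R : rcfType.

Definition rep_sign (i : 'I_10) (a : 'I_7) : R := (-1) ^+ fano_mem i a.

Lemma rep_sign_pm i : pm (rep_sign i).
Proof. by move=> a; rewrite /rep_sign; case: (fano_mem _ _); [right|left]. Qed.

Lemma rep_sign_eq i a (b : bool) : (rep_sign i a == (-1) ^+ b) = (fano_mem i a == b).
Proof. by rewrite /rep_sign (inj_eq (@signr_inj R)). Qed.

Lemma noncommuting_rep i (b : bool) : noncommuting ((-1) ^+ b : R) (stdU (rep_sign i)) <-> fano_flag b i.
Proof.
have b1 : (-1) ^+ b = 1 :> R \/ (-1) ^+ b = -1 :> R by case: b; [right|left].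
rewrite (noncommuting_std (@rep_sign_pm i) b1); split=> [[k k0 h]|/hasP[k]].
  apply/hasP; exists (k : nat).
    by rewrite mem_iota lt0n; case: k k0 {h} => k /= k8; rewrite -val_eqE /= => -> .
  apply/allP => a; rewrite mem_iota => /andP[_ a7]; apply/implyP.
  by rewrite -(rep_sign_eq i (Ordinal a7)) => /eqP/h.
rewrite mem_iota => /andP[k0 k8] /allP h; exists (Ordinal k8); first by rewrite -val_eqE /= -lt0n.
move=> a /eqP; rewrite rep_sign_eq => ab.
have ai : (a : nat) \in iota 0 7 by rewrite mem_iota; case: (a).
by have := h _ ai; rewrite ab.
Qed.

Lemma rep_not_conjugate i j : SL8_conjugate (stdU (rep_sign i)) (stdU (rep_sign j)) -> i = j.
Proof.
move=> cij; have cji := SL8_conjugate_sym cij; apply: fano_reps_distinct => [|b]; last first.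
  apply/idP/idP => /noncommuting_rep h; apply/noncommuting_rep.
    exact: noncommuting_conj h.
  exact: noncommuting_conj h.
have cE l : #|[pred a | rep_sign l a == (-1 : R)]| = count (fano_mem l) (iota 0 7).
  rewrite -val_enum_ord count_map cardE size_filter enumT; apply: eq_count => a.
  by transitivity (fano_mem l a == true); [rewrite -rep_sign_eq expr1 | apply: eqb_id].
have m1 : -1 = 1 :> R \/ -1 = -1 :> R by right.
by apply/eqP; rewrite eqn_leq -!cE !sign_part_count //; apply: rep_sign_pm.
Qed.
End Representatives.

(** * Seven commuting real roots *)

Section Involutions.
Variable K : numFieldType.
Implicit Types (S : {set 'I_8}) (X Y M : 'M[K]_8).

Lemma sd_commP S M : reflect (forall i j, (i \in S) != (j \in S) -> M i j = 0)
  (sd K S *m M == M *m sd K S).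
Proof.
apply: (iffP eqP) => [/matrixP h i j|h].
  have := h i j; rewrite mul_diag_mx mul_mx_diag !mxE.
  case: (i \in S); case: (j \in S) => //=; rewrite ?expr0 ?expr1 ?mulr1 ?mul1r ?mulN1r ?mulrN1.
    by move=> /eqP; rewrite -addr_eq0 -mulr2n -mulr_natl mulf_eq0 pnatr_eq0 => /eqP.
  by move=> /esym/eqP; rewrite -addr_eq0 -mulr2n -mulr_natl mulf_eq0 pnatr_eq0 => /eqP.
apply/matrixP => i j; rewrite mul_diag_mx mul_mx_diag !mxE.
have [ij|ij] := eqVneq (i \in S) (j \in S); first by rewrite ij mulrC.
by rewrite h // mulr0 mul0r.
Qed.

Lemma tr_sd_card S : \tr (sd K S) = 2%:R * #|S|%:R - 8%:R.
Proof.
rewrite /mxtrace; under eq_bigr => i _ do rewrite sdE eqxx mulr1n.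
transitivity (\sum_i (2%:R * (i \in S)%:R - 1) : K).
  by apply: eq_bigr => i _; case: (i \in S); rewrite /= ?expr0 ?expr1; ring.
rewrite sumrB -mulr_sumr sumr_const card_ord; congr (_ * _ - _).
rewrite -natr_sum; congr (_%:R); rewrite -sum1_card [RHS]big_mkcond.
by apply: eq_bigr => i _; case: (i \in S).
Qed.

Lemma card4_of_tr S : \tr (sd K S) = 0 -> #|S| = 4%N.
Proof.
rewrite tr_sd_card => /eqP; rewrite subr_eq0 -natrM eqr_nat => /eqP.
by move: #|S| => n; lia.
Qed.

Lemma involutions_codiag (Xs : seq 'M[K]_8) : {in Xs, forall X, X *m X = 1%:M} ->
  {in Xs &, forall X Y, X *m Y = Y *m X} ->
  exists2 Q : 'M[K]_8, Q \in unitmx & {in Xs, forall X, exists S, Q *m X *m invmx Q = sd K S}.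
Proof.
move=> h1 h2.
have /codiagonalizableP[Q uQ /allP hQ] :
    {in Xs &, forall A B, comm_mx A B} /\ {in Xs, forall A, diagonalizable A}.
  split=> [X Y XX YX|X XX]; first by apply: h2.
  apply/diagonalizableP; exists [:: 1; - 1 : K].
    by rewrite /= inE andbT -subr_eq0 opprK -mulr2n pnatr_eq0.
  apply: mxminpoly_min; rewrite !big_cons big_nil mulr1 rmorphM !rmorphB /= !horner_mx_X !horner_mx_C.
  rewrite (raddfN (@scalar_mx K 8)) /= opprK mulrBl !mulrDr -![_ * _]/(_ *m _) h1 // mul1mx.
  by rewrite mulmx1 mul1mx [X + _]addrC subrr.
exists Q => // X XX; have := hQ X XX; move=> /= /is_diag_mxP; rewrite conjumx // => /is_diag_mxP/diag_mxP[d dE].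
exists [set i | d 0 i == 1]; rewrite dE; congr diag_mx; apply/rowP => i; rewrite !mxE inE.
have : diag_mx d *m diag_mx d = 1%:M.
  by rewrite -dE !mulmxA mulmxKV // -[_ *m X *m X]mulmxA h1 // mulmx1 mulmxV.
move/matrixP/(_ i i); rewrite mulmx_diag !mxE eqxx !mulr1n -expr2 => /eqP.
by rewrite sqrf_eq1 => /orP[]/eqP ->; rewrite ?eqxx // -subr_eq0 -opprD oppr_eq0 -mulr2n pnatr_eq0.
Qed.

(** The converse of [real_root_centralizer]. Diagonalizing [X] as some [sd S] makes [w] a multiple
    of e_S, on which a matrix commuting with [sd S] acts by half its trace against [sd S]. *)
Lemma involution_annihilator X Y w : X *m X = 1%:M -> \tr X = 0 -> lact X w = 4%:R *: w ->
  X *m Y = Y *m X -> \tr (X *m Y) = 0 -> lact Y w = 0.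
Proof.
move=> X2 tX Xw XY tXY; have [||Q uQ hQ] := @involutions_codiag [:: X].
- by move=> Z; rewrite inE => /eqP ->.
- by move=> Z Z'; rewrite !inE => /eqP -> /eqP ->.
have [S SE] := hQ X (mem_head _ _).
have trC (Z : 'M[K]_8) : \tr (Q *m Z *m invmx Q) = \tr Z by rewrite mxtrace_mulC mulmxA mulVmx // mul1mx.
have S4 : #|S| = 4%N by apply: card4_of_tr; rewrite -SE trC.
have conjM (A B : 'M[K]_8) : Q *m A *m invmx Q *m (Q *m B *m invmx Q) = Q *m (A *m B) *m invmx Q.
  by rewrite !mulmxA mulmxKV.
have [|a wE] := @sd_eigenvector K S (ext4_act Q w) S4.
  by rewrite -SE -lact_act // Xw linearZ.
have cY : Q *m Y *m invmx Q *m sd K S = sd K S *m (Q *m Y *m invmx Q).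
  by rewrite -SE !conjM XY.
have : lact (Q *m Y *m invmx Q) (ext4_act Q w) = 0.
  by rewrite wE linearZ /= lact_comm_sd // -SE conjM trC tXY mul0r scale0r scaler0.
by rewrite -lact_act // => h'; rewrite -(ext4_actK (lact Y w) uQ) h' linear0.
Qed.

Lemma involution_annihilator2 X Y w : X *m X = 1%:M -> \tr X = 0 ->
  lact X (lact X w) = 16%:R *: w -> X *m Y = Y *m X -> \tr (X *m Y) = 0 -> lact Y w = 0.
Proof.
move=> X2 tX Xw XY tXY.
pose wp := w + 4%:R^-1 *: lact X w; pose wm := w - 4%:R^-1 *: lact X w.
have p0 : lact Y wp = 0.
  apply: (involution_annihilator X2 tX _ XY tXY).
  rewrite /wp lactDr lactZr Xw scalerDr !scalerA addrC; congr (_ *: _ + _); first by field.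
  by rewrite divff ?scale1r // pnatr_eq0.
have m0 : lact Y wm = 0.
  apply: (@involution_annihilator (- X)).
  - by rewrite mulNmx mulmxN opprK.
  - by rewrite linearN /= tX oppr0.
  - rewrite /wm lactNl lactBr lactZr Xw scalerBr !scalerA opprB; congr (_ *: _ - _); first by field.
    by rewrite divff ?scale1r // pnatr_eq0.
  - by rewrite mulNmx XY mulmxN.
  - by rewrite mulNmx linearN /= tXY oppr0.
have : lact Y (wp + wm) = 0 by rewrite lactDr p0 m0 addr0.
by rewrite /wp /wm addrACA subrr addr0 -mulr2n -scaler_nat lactZr => /eqP; rewrite scaler_eq0 pnatr_eq0 => /eqP.
Qed.
End Involutions.

Section Meet.
Variables (K : fieldType) (V W : vectType K) (T : Type) (f : T -> 'Hom(V, W)) (V0 : {vspace V}).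

Definition ker_meet (s : seq T) : {vspace V} := foldr (fun a U => lker (f a) :&: U)%VS V0 s.

Lemma mem_ker_meet s v : (v \in ker_meet s) = (v \in V0) && all (fun a => f a v == 0) s.
Proof.
elim: s => [|a s IH] /=; first by rewrite andbT.
by rewrite memv_cap memv_ker IH andbCA.
Qed.
End Meet.

(** * The signature of the trace form on annihilators of coroots *)

Section SymmetricPart.
Variables (R : rcfType) (Ss : seq {set 'I_8}).
Implicit Types (M : 'M[R]_8).

(** In coordinates where the known roots are the [sd S], these are the traceless matrices
    annihilating their coroots. The condition is stable under transposition, so symmetric and skew
    parts can be taken. *)
Definition ann_cond M := \tr M = 0 /\ {in Ss, forall S : {set 'I_8},
  (forall i j, (i \in S) != (j \in S) -> M i j = 0) /\ \tr (sd R S *m M) = 0}.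

Lemma ann_cond_tr M : ann_cond M -> ann_cond M^T.
Proof.
case=> t0 h; split=> [|S SS]; first by rewrite mxtrace_tr.
have [h1 h2] := h S SS; split=> [i j ij|]; first by rewrite mxE h1 // eq_sym.
by rewrite -[RHS]h2 !tr_sd_mul; apply: eq_bigr => k _; rewrite mxE.
Qed.

Lemma ann_condB M N : ann_cond M -> ann_cond N -> ann_cond (M - N).
Proof.
case=> t0 h [t0' h']; split=> [|S SS]; first by rewrite linearB /= t0 t0' subrr.
have [h1 h2] := h S SS; have [h1' h2'] := h' S SS; split=> [i j ij|].
  by rewrite !mxE h1 // h1' // subrr.
by rewrite mulmxBr linearB /= h2 h2' subrr.
Qed.

(** Changing the sign below the diagonal turns skew matrices into symmetric ones with zero diagonal
    and preserves the pattern of zero entries. *)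
Definition twist M : 'M[R]_8 :=
  \matrix_(i, j) ((i < j)%N%:R * M i j - (j < i)%N%:R * M i j).

Lemma twist_is_linear : linear twist.
Proof. by move=> a M N; apply/matrixP => i j; rewrite !mxE; ring. Qed.
HB.instance Definition _ := GRing.isLinear.Build R 'M[R]_8 'M[R]_8 _ twist twist_is_linear.

Lemma twist_diag M i : twist M i i = 0.
Proof. by rewrite mxE ltnn !mul0r subr0. Qed.

Lemma twist_ann M : ann_cond M -> ann_cond (twist M).
Proof.
case=> t0 h; split=> [|S SS]; first by rewrite /mxtrace big1 // => i _; apply: twist_diag.
have [h1 h2] := h S SS; split=> [i j ij|]; first by rewrite mxE h1 // !mulr0 subr0.
by rewrite tr_sd_mul big1 // => i _; rewrite twist_diag mulr0.
Qed.

Lemma twist_skew M : M^T = - M -> (twist M)^T = twist M.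
Proof.
move=> /matrixP h; apply/matrixP => i j; rewrite !mxE.
by have := h i j; rewrite !mxE => ->; ring.
Qed.

Lemma twist_skew_eq0 M : M^T = - M -> twist M = 0 -> M = 0.
Proof.
move=> /matrixP h /matrixP t; apply/matrixP => i j; have := t i j; rewrite !mxE.
have := h i j; rewrite !mxE; case: (ltngtP i j) => [ij|ij|/val_inj ->] h1; rewrite /= ?mul1r ?mul0r ?subr0 ?sub0r => h2; lra.
Qed.

(* There are fewer linear conditions than diagonal entries. *)
Lemma diag_ann : (size Ss < 7)%N -> exists2 d : 'rV[R]_8, d != 0 & ann_cond (diag_mx d).
Proof.
move=> s7; pose A : 'M[R]_(8, (size Ss).+1) := \matrix_(i, j)
  (if unlift ord0 j is Some l then (-1) ^+ (i \notin nth set0 Ss l) else 1).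
have : kermx A != 0.
  rewrite -mxrank_eq0 mxrank_ker -lt0n subn_gt0.
  by apply: leq_ltn_trans (rank_leq_col A) _.
case/rowV0Pn=> d /sub_kermxP dA d0; exists d => //.
have dE j : \sum_i d 0 i * A i j = 0 by have /matrixP/(_ 0 j) := dA; rewrite !mxE.
have dd i : diag_mx d i i = d 0 i by rewrite mxE eqxx mulr1n.
split=> [|S SS]; first by rewrite -[RHS](dE ord0) mxtrace_diag; apply: eq_bigr => i _; rewrite mxE unlift_none mulr1.
split=> [i j ij|].
  by rewrite mxE; case: (i =P j) => [e|_]; [rewrite e eqxx in ij | rewrite mulr0n].
have iS : (index S Ss < size Ss)%N by rewrite index_mem.
rewrite tr_sd_mul -[RHS](dE (lift ord0 (Ordinal iS))); apply: eq_bigr => i _.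
by rewrite [A _ _]mxE liftK dd /= nth_index // mulrC.
Qed.

(** After conjugation by Q the trace form is positive on symmetric and negative on skew matrices.
    [twist] embeds the skew part into the symmetric part, and a nonzero diagonal matrix from
    [diag_ann] lies outside the image, so the symmetric part is strictly larger. *)
Lemma ann_positive_dim (Z : {vspace 'M[R]_8}) (Q : 'M[R]_8) : Q \in unitmx -> (size Ss < 7)%N ->
  (forall Y, Y \in Z <-> ann_cond (Q *m Y *m invmx Q)) ->
  exists P : {vspace 'M[R]_8}, [/\ (P <= Z)%VS, (\dim Z < 2 * \dim P)%N &
    forall Y, Y \in P -> Y != 0 -> 0 < \tr (Y *m Y)].
Proof.
move=> uQ s7 ZE; pose cj (Y : 'M[R]_8) : 'M[R]_8 := Q *m Y *m invmx Q.
pose ci (Y : 'M[R]_8) : 'M[R]_8 := invmx Q *m Y *m Q.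
have cjK Y : ci (cj Y) = Y by rewrite /ci /cj !mulmxA mulVmx // mul1mx mulmxKV.
have ciK Y : cj (ci Y) = Y by rewrite /ci /cj !mulmxA mulmxV // mul1mx mulmxK.
pose sk (Y : 'M[R]_8) := cj Y - (cj Y)^T.
have skl : linear sk.
  move=> a Y W; rewrite /sk /cj mulmxDr mulmxDl -scalemxAr -scalemxAl linearD linearZ /= scalerBr.
  by rewrite opprD addrACA.
pose skL : {linear 'M[R]_8 -> 'M[R]_8} := HB.pack sk (GRing.isLinear.Build R _ _ _ sk skl).
pose k : 'Hom('M[R]_8, 'M[R]_8) := linfun skL.
have kE Y : k Y = sk Y by rewrite lfunE.
pose tw (Y : 'M[R]_8) := ci (twist Y).
have twl : linear tw.
  by move=> a Y W; rewrite /tw /ci linearP /= mulmxDr mulmxDl -scalemxAr -scalemxAl.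
pose twL : {linear 'M[R]_8 -> 'M[R]_8} := HB.pack tw (GRing.isLinear.Build R _ _ _ tw twl).
pose L : 'Hom('M[R]_8, 'M[R]_8) := linfun twL.
have LE Y : L Y = tw Y by rewrite lfunE.
pose P := (Z :&: lker k)%VS; exists P.
have PE Y : (Y \in P) = (Y \in Z) && ((cj Y)^T == cj Y).
  by rewrite memv_cap memv_ker kE /sk subr_eq0 eq_sym.
split; first exact: capvSl.
  have kz W : W \in (k @: Z)%VS -> W^T = - W /\ ann_cond W.
    case/memv_imgP=> Y /ZE YZ ->; rewrite kE /sk; split; first by rewrite linearB /= trmxK opprB.
    by apply: ann_condB => //; apply: ann_cond_tr.
  have dk : \dim (L @: (k @: Z)) = \dim (k @: Z).
    apply: limg_dim_eq; apply/eqP; rewrite -subv0; apply/subvP => W.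
    rewrite memv_cap memv_ker memv0 LE => /andP[/kz[skW _] /eqP h].
    by apply/eqP/(twist_skew_eq0 skW); rewrite -[LHS]ciK -/(tw W) h /cj mulmx0 mul0mx.
  have sub : (L @: (k @: Z) <= P)%VS.
    apply/subvP => _ /memv_imgP[W /kz[skW aW] ->]; rewrite PE LE /tw ciK twist_skew // eqxx andbT.
    by apply/ZE; rewrite -/(cj _) ciK; apply: twist_ann.
  have [d d0 dann] := diag_ann s7.
  have dP : ci (diag_mx d) \in P.
    by rewrite PE ciK tr_diag_mx eqxx andbT; apply/ZE; rewrite -/(cj _) ciK.
  have lt : (\dim (L @: (k @: Z)) < \dim P)%N.
    rewrite ltn_neqAle dimvS // andbT; apply/eqP => e.
    have /eqP eP : (L @: (k @: Z))%VS == P by rewrite eqEdim sub e leqnn.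
    move: dP; rewrite -eP => /memv_imgP[W _]; rewrite LE => /(congr1 cj); rewrite !ciK => /matrixP h.
    case/eqP: d0; apply/rowP => i; have := h i i; rewrite twist_diag !mxE eqxx mulr1n; exact.
  have := limg_ker_dim k Z; rewrite -/P => <-; rewrite -dk mul2n -addnn ltn_add2l.
  exact: lt.
move=> Y; rewrite PE => /andP[_ /eqP sY] Y0; rewrite lt_neqAle.
have E : \tr (Y *m Y) = \tr (cj Y *m (cj Y)^T).
  rewrite sY; have -> : cj Y *m cj Y = cj (Y *m Y) by rewrite /cj !mulmxA mulmxKV.
  by rewrite /cj [RHS]mxtrace_mulC mulmxA mulVmx // mul1mx.
have : ~~ (\tr (Y *m Y) <= 0).
  apply: contra Y0; rewrite E => /tr_mul_trmx_eq0 h.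
  by rewrite -(cjK Y) h /ci mulmx0 mul0mx.
by rewrite -ltNge lt_neqAle.
Qed.
End SymmetricPart.

Section RootInduction.
Variables (R : rcfType) (C : numClosedFieldType) (c : complexification R C).
Local Notation cx := (cx c).
Hypothesis jac : jacobi C.
Variable U : {vspace ext4 R}.
Hypothesis mtU : max_torus c U.
Variable x : ext4 R.
Hypothesis xU : x \in U.
Hypothesis gx : forall p l, p != 0 -> Dop (cx x) p = l *: p ->
  exists a, [/\ weight c U a p, a (cx x) = l & l = 0 -> forall z, ctorus c U z -> a z = 0].
Implicit Types (X Y : 'M[R]_8).

Definition root_matrix X := X *m X = 1%:M /\ exists2 la, la != 0 & rootop x X = la *: X.
Definition coroot X : ext4 R := lact X (lact X x).

Lemma root_matrix_tr2 X : root_matrix X -> \tr (X *m X) = 8%:R.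
Proof. by case=> -> _; rewrite mxtrace1. Qed.

Lemma root_matrix_tr X : root_matrix X -> \tr X = 0.
Proof.
case=> _ [la la0 e]; apply: (mulfI la0); rewrite mulr0 -[la * _]/(la *: _) -linearZ /= -e.
by rewrite /rootop linearN /= tr_moment0 oppr0.
Qed.

Section Facts.
Variable X : 'M[R]_8.
Hypothesis rX : root_matrix X.

Let X8 : \tr (X *m X) != 0.
Proof. by rewrite root_matrix_tr2 // pnatr_eq0. Qed.

Lemma coroot_mem : coroot X \in U.
Proof. by case: (rX) => _ [la la0 e]; apply: (real_root_coroot jac mtU xU gx e la0 X8). Qed.

Lemma coroot_lact2 : lact X (lact X (coroot X)) = 16%:R *: coroot X.
Proof.
case: (rX) => _ [la la0 e]; rewrite (real_root_lact jac mtU xU gx e la0 X8) lactZr.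
by rewrite root_matrix_tr2 // -natrM.
Qed.

Lemma coroot_wedge : wedge (coroot X) (coroot X) != 0.
Proof.
case: (rX) => _ [la la0 e]; rewrite (real_root_wedge jac mtU xU gx e la0 X8).
by rewrite root_matrix_tr2 // !mulf_neq0 ?expf_neq0 ?pnatr_eq0.
Qed.

Lemma coroot_annihilator Y : lact Y (coroot X) = 0 <-> X *m Y = Y *m X /\ \tr (X *m Y) = 0.
Proof.
split=> [h|[h1 h2]].
  by case: (rX) => _ [la la0 e]; apply: (real_root_centralizer jac mtU xU gx e la0 X8 h).
case: (rX) => X2 _; apply: (involution_annihilator2 X2 _ coroot_lact2 h1 h2).
exact: root_matrix_tr.
Qed.
End Facts.

Lemma rootop_linear : linear (rootop x).
Proof.
move=> a Y W; rewrite /rootop lact_linl momentDr momentZr opprD scalerN.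
by [].
Qed.

(** Here [lact Y x] centralizes x, so it lies in [U]; it is also orthogonal to [U], hence 0. Then
    (Y, 0) has weight zero, [Y] annihilates [U], and [Y] is scalar. This makes the eigenvalues met
    in [root_matrix_extend] nonzero. *)
Lemma rootop_kernel Y : rootop x Y = 0 -> \tr Y = 0 -> Y = 0.
Proof.
move=> Y0 tY; have [_ z0 _] := torus_structure jac mtU.
have h : lact Y x = 0.
  have wU : lact Y x \in U.
    apply: (centralizer_generic jac mtU xU gx); apply/eqP.
    by rewrite -oppr_eq0 -/(rootop x Y) Y0.
  apply: (@cx_inj _ _ c); rewrite cx0; apply: (ctorus_nondeg jac mtU) => [|u uU].
    exact: ctorus_cx.
  have [[_ com] _] := mtU.
  by rewrite cx_wedge wedgeC -[wedge _ _]opprK -tr_moment com // mul0mx mxtrace0 oppr0 rmorph0.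
apply/eqP; apply: contraT => nY.
have p0 : (map_mx c Y, 0) != 0 :> ee C.
  apply: contraNneq nY => -[e]; apply/eqP/(@map_mx_inj _ _ c); by rewrite e map_mx0.
have [|a [ap _ /(_ erefl) a0]] := gx p0 (l := 0).
  by rewrite DopE /= moment0r -cx_lact h cx0 oppr0 scale0r.
have [s sE] : exists s, map_mx c Y = s%:M.
  apply: z0 => u uU; have := ap _ (ctorus_cx mtU uU); rewrite a0 ?scale0r; last exact: ctorus_cx.
  by rewrite DopE => /(congr1 snd) /= /eqP; rewrite oppr_eq0 => /eqP.
have : \tr (map_mx c Y) = 0 by rewrite trace_map_mx tY rmorph0.
rewrite sE mxtrace_scalar => /eqP; rewrite -mulr_natr mulf_eq0 pnatr_eq0 orbF => /eqP s0.
by move: nY; rewrite -(inj_eq (@map_mx_inj _ _ c _ _)) sE s0 map_mx0 -scalemx1 scale0r eqxx.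
Qed.

(** [rootop x] is the square of [Dop x] on gl(8), so the squares of the eigenvalues of [Dop x]
    suffice; their conjugates are added because [positive_eigenvector] wants a conjugation-stable
    list. *)
Lemma rootop_killed : exists2 ts : seq C, uniq ts & {in ts, forall t, Num.conj t \in ts} /\
  forall (A : 'End('M[R]_8)), (forall Y, A Y = rootop x Y) ->
  forall q, {in ts, forall t, (map_poly c q).[t] = 0} -> forall Y, peval A q Y = 0.
Proof.
have [[/(_ x xU)[rs urs kill] _] _] := mtU.
pose ts0 := [seq r ^+ 2 | r <- rs]; exists (undup (ts0 ++ map Num.conj ts0)); first exact: undup_uniq.
split=> [t|A AE q hq Y].
  rewrite !mem_undup !mem_cat => /orP[h|/mapP[s h ->]]; first by rewrite map_f ?orbT.
  by rewrite conjCK h.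
pose j (Y : 'M[R]_8) : ee C := (map_mx c Y, 0).
have jA W : j (A W) = Dop (cx x) (Dop (cx x) (j W)).
  rewrite AE !DopE /= moment0r -cx_lact momentNr cx_moment.
  by rewrite lact0l oppr0 /j /rootop map_mxN.
have jp (p : {poly R}) W : j (peval A p W) = peval (Dop (cx x)) (map_poly c p \Po 'X^2) (j W).
  elim/poly_ind: p W => [|p a IH] W.
    by rewrite rmorph0 comp_poly0 !peval0 /j map_mx0.
  rewrite rmorphD rmorphM /= map_polyX map_polyC /= comp_polyD comp_polyM comp_polyX comp_polyC.
  rewrite !pevalD !pevalMX !pevalC pevalM.
  have -> : j (peval A p (A W) + a *: W) = j (peval A p (A W)) + c a *: j W.
    by apply: injective_projections; rewrite /= ?map_mxD ?map_mxZ ?scaler0 ?addr0.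
  by rewrite IH jA expr2 pevalM !pevalX.
suff : j (peval A q Y) = 0.
  by move/(congr1 fst) => /= h; apply: (@map_mx_inj _ _ c); rewrite h map_mx0.
rewrite jp; have /dvdpP[g ->] : \prod_(r <- rs) ('X - r%:P) %| map_poly c q \Po 'X^2.
  apply: uniq_roots_dvdp; last by rewrite uniq_rootsE.
  apply/allP => r rrs; rewrite /root horner_comp !hornerE hq // mem_undup mem_cat.
  by rewrite (map_f (fun r => r ^+ 2) rrs).
by rewrite pevalM kill linear0.
Qed.

(** [positive_eigenvector] is applied to [rootop x] on the traceless matrices annihilating the
    coroots of [Xs]. This space is stable because the coroots commute with x, and its elements
    commute with [Xs] and are trace-orthogonal to it. *)
Lemma root_matrix_extend (Xs : seq 'M[R]_8) : (size Xs < 7)%N -> {in Xs, forall X, root_matrix X} ->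
  {in Xs &, forall X Y, X *m Y = Y *m X} ->
  exists2 X, root_matrix X & {in Xs, forall Y, Y *m X = X *m Y /\ \tr (Y *m X) = 0}.
Proof.
move=> s7 rXs cXs.
have [Q uQ hQ] := involutions_codiag (fun X XX => proj1 (rXs X XX)) cXs.
pose Z := ker_meet (fun X => linfun (lactl (coroot X))) (lker (linfun (@mxtrace R 8 : 'M[R]_8 -> R^o))) Xs.
have ZE Y : Y \in Z <-> \tr Y = 0 /\ {in Xs, forall X, lact Y (coroot X) = 0}.
  rewrite mem_ker_meet memv_ker lfunE /=; split=> [/andP[/eqP -> /allP h]|[-> h]].
    by split=> // X XX; have := h X XX; rewrite lfunE /= => /eqP.
  by rewrite eqxx; apply/allP => X XX; rewrite lfunE /= [lactl _ _]h.
pose Ss := [seq [set i | (Q *m X *m invmx Q) i i == 1] | X <- Xs].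
have sdX X : X \in Xs -> Q *m X *m invmx Q = sd R [set i | (Q *m X *m invmx Q) i i == 1].
  move=> XX; have [S SE] := hQ X XX; rewrite {1}SE; congr (sd R _); apply/setP => i.
  rewrite inE SE sdE eqxx mulr1n; case: (i \in S); rewrite /= ?expr0 ?expr1 ?eqxx //.
  by rewrite -subr_eq0 -opprD oppr_eq0 -mulr2n pnatr_eq0.
have trC (Y : 'M[R]_8) : \tr (Q *m Y *m invmx Q) = \tr Y by rewrite mxtrace_mulC mulmxA mulVmx // mul1mx.
have conjM (A B : 'M[R]_8) : Q *m A *m invmx Q *m (Q *m B *m invmx Q) = Q *m (A *m B) *m invmx Q.
  by rewrite !mulmxA mulmxKV.
have conj_inj (A B : 'M[R]_8) : Q *m A *m invmx Q = Q *m B *m invmx Q -> A = B.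
  by move=> /(can_inj (mulmxKV uQ))/(can_inj (mulKmx uQ)).
have ZQ Y : Y \in Z <-> ann_cond Ss (Q *m Y *m invmx Q).
  rewrite ZE /ann_cond trC; split=> -[tY h]; split=> //; [move=> _ /mapP[X XX ->] | move=> X XX].
    have [h1 h2] := (coroot_annihilator (rXs X XX) Y).1 (h X XX).
    split; last by rewrite -sdX // conjM trC.
    by apply/sd_commP; rewrite -sdX // !conjM h1.
  have [/sd_commP/eqP h1 h2] := h _ (map_f _ XX); rewrite -sdX // !conjM ?trC in h1 h2.
  by apply/(coroot_annihilator (rXs X XX)); split=> //; apply: conj_inj.
have [|P [PZ dP Ppos]] := ann_positive_dim uQ _ ZQ; first by rewrite size_map.
pose AL : {linear 'M[R]_8 -> 'M[R]_8} := HB.pack (rootop x) (GRing.isLinear.Build R _ _ _ (rootop x) rootop_linear).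
pose A : 'End('M[R]_8) := linfun AL.
have AE Y : A Y = rootop x Y by rewrite lfunE.
have [ts uts [cts kill]] := rootop_killed.
have [||||t [X [XZ AX X0]]] := @positive_eigenvector R C c _ A (fun Y W => \tr (Y *m W)) _ _ _ ts uts cts (kill A AE) Z P _ PZ Ppos dP.
- by move=> Y a W W'; rewrite mulmxDr linearD -scalemxAr linearZ.
- by move=> Y W; rewrite mxtrace_mulC.
- move=> Y W; rewrite !AE /rootop mulNmx mulmxN !linearN /= tr_moment mxtrace_mulC tr_moment.
  by rewrite -!wedge_lact (wedge_lact Y) (wedge_lact W (lact Y x)) wedgeC.
- move=> Y /ZE[tY h]; apply/ZE; rewrite AE; split=> [|X XX].
    by rewrite /rootop linearN /= tr_moment0 oppr0.
  have [[_ com] _] := mtU.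
  have /(moment_Dop_comm _ _ (jacobi_real c jac)) hcom := com _ _ (coroot_mem (rXs X XX)) xU.
  have e : Dop (coroot X) (Y, 0) = 0.
    by rewrite DopE /= moment0r h // oppr0.
  have : Dop (coroot X) (Dop x (Dop x (Y, 0))) = 0.
    by rewrite (hcom (Dop x (Y, 0))) (hcom (Y, 0)) e 2!(linear0 (Dop x)).
  by rewrite !DopE /rootop => /(congr1 snd) /=; rewrite momentNr => /eqP; rewrite oppr_eq0 => /eqP.
have [tX hX] := (ZE X).1 XZ; rewrite AE in AX.
have t0 : t != 0.
  apply/eqP => t0; move: X0; rewrite (rootop_kernel _ tX) ?mul0mx ?mxtrace0 ?ltxx //.
  by rewrite AX t0 scale0r.
(* X^2 is the scalar tau / 8, and tau > 0 by the choice of [X], so s X is a real involution. *)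
set tau := \tr (X *m X) in X0; pose s := Num.sqrt (8%:R / tau).
have s2 : s * s = 8%:R / tau by rewrite -expr2 sqr_sqrtr // ltW // divr_gt0 ?ltr0n.
have X2 : X *m X = (tau / 8%:R)%:M by apply: (real_root_sqr jac mtU xU gx AX t0); rewrite gt_eqF.
exists (s *: X).
  split.
    rewrite -scalemxAl -scalemxAr scalerA s2 X2 scale_scalar_mx; congr (_%:M).
    by rewrite mulrA divfK ?gt_eqF // divff // pnatr_eq0.
  by exists t => //; rewrite -AE (linearZZ A) /= AE AX !scalerA mulrC.
move=> Y YX; have [h1 h2] := (coroot_annihilator (rXs Y YX) X).1 (hX Y YX).
by rewrite -scalemxAr -scalemxAl h1 -h1 linearZ /= h2 mulr0.
Qed.
End RootInduction.

(** * Transfer from the given Lie algebra *)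

Lemma cpx_conj (R : rcfType) (a : R) : Num.conj (real_complex R a : R[i]%C) = real_complex R a.
Proof.
apply: conj_Creal; rewrite realE.
have := num_real a; rewrite realE => /orP[h|h]; apply/orP; [left|right].
  by rewrite ler0c.
by rewrite -oppr_ge0 -rmorphN /= ler0c oppr_ge0.
Qed.

Lemma cpx_rect (R : rcfType) (z : R[i]%C) : z = real_complex R (complex.Re z) + 'i * real_complex R (complex.Im z).
Proof. by rewrite -complexiE; apply: complexE. Qed.

Definition complexi (R : rcfType) : complexification R (complex R) :=
  @Complexification R (complex R) (real_complex R) (@complex.Re R) (@complex.Im R) (@cpx_conj R) (@cpx_rect R).

Lemma complexify_cx (R : rcfType) (v : ext4 R) : ext4_complexify v = cx (complexi R) v.
Proof. exact: complexify_emap. Qed.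

Lemma cartan_max_torus
  (R : realType) (g : vectType R[i]%C) (ad : 'Hom(g, 'End(g)))
  (lie_g : lie_algebra ad) (simple_g : simple_lie ad)
  (Phi : seq 'rV[int]_7) (h : 'I_7 -> g) (e : 'rV[int]_7 -> g) (a0 : 'rV[int]_7)
  (theta : 'End(g)) (inv_theta : E7_involution ad e a0 theta)
  (psi : 'Hom('M[R[i]%C]_8, g)) (iso_psi : sl8_iso ad e a0 theta psi)
  (Psi : 'M[R[i]%C]_8 -> 'End(g)) (lift_Psi : sl8_lift ad psi Psi)
  (iota : 'Hom(ext4 R[i]%C, g))
  (ident : ext4_identification Phi h e theta Psi iota) :
  jacobi (complex R) /\
  forall U : {vspace ext4 R}, cartan_subspace ad iota U <-> max_torus (complexi R) U.
Proof.
have [[theta_ad _] [theta2 _] _ _] := inv_theta.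
have [psi_br psi_inj psi_im _ _] := iso_psi.
have [_ _ lexp] := lift_Psi.
have [iinj iim iequiv _] := ident.
have adp X v := @ad_psi _ _ _ lie_g simple_g _ _ _ psi_br lexp iequiv X v.
have [c c0 adi] := ad_iota lie_g simple_g theta_ad theta2 psi_br psi_inj psi_im lexp iinj iim iequiv.
split; first by move=> u v w; apply: (moment_jacobi lie_g iinj adp c0 adi).
have ss x : ad_semisimple ad (iota (ext4_complexify x)) <-> split_semisimple (Dop (cx (complexi R) x)).
  rewrite complexify_cx.
  exact: (ad_semisimpleP lie_g theta2 psi_inj psi_im iinj iim adp c0 adi).
have cm x y : ad (iota (ext4_complexify x)) (iota (ext4_complexify y)) = 0 <-> moment x y = 0.
  rewrite (ad_commuteP psi_inj c0 adi) !complexify_cx cx_moment.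
  split=> [|->]; last by rewrite map_mx0.
  by rewrite -(map_mx0 (complexi R)) => /map_mx_inj.
have tt U : commuting_semisimple ad iota U <-> torus (complexi R) U.
  by split=> -[h1 h2]; split=> [x /h1/ss//|x y xU yU]; apply/cm/h2.
move=> U; split=> -[/tt h1 h2]; split=> // V /tt tV; exact: h2.
Qed.

(** * Normal form of a maximal torus *)

Section Monomial.
Variable R : rcfType.
Implicit Types (S : {set 'I_8}) (s : {perm 'I_8}) (t : 'I_8 -> R).

Definition monomial s t : 'M[R]_8 := \matrix_(i, j) (t j * (i == s j)%:R).

Lemma act_monomial_bv s t (f : quad) :
  ext4_act (monomial s t) (bv R f) = (\prod_b t (f b)) *: bv R [ffun b => s (f b)].
Proof.
rewrite act_bv (bigD1 [ffun b => s (f b)]) //= [X in _ + X]big1 => [|g gf].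
  by rewrite addr0; congr (_ *: _); apply: eq_bigr => b _; rewrite mxE ffunE eqxx mulr1.
have [b gb] : exists b, g b != s (f b).
  apply/existsP; apply: contraNT gf; rewrite negb_exists => /forallP h.
  by apply/eqP/ffunP => b; rewrite ffunE; apply/eqP/negbNE.
by rewrite (bigD1 b) //= mxE (negbTE gb) mulr0 mul0r scale0r.
Qed.

Lemma act_monomial s t S : (forall k, t k != 0) ->
  exists2 c : R, c != 0 & ext4_act (monomial s t) (eS R S) = c *: eS R (s @: S).
Proof.
move=> t0; have [S4|S4] := eqVneq #|S| 4%N; last first.
  exists 1; first exact: oner_neq0.
  by rewrite (eS_card _ S4) linear0 eS_card ?scaler0 // card_imset //; apply: perm_inj.
have [J JS ->] := eS_sub4 R S4; rewrite -bv_idx act_monomial_bv.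
have si : injective [ffun b => s (idx J b)].
  by move=> b b'; rewrite [LHS]ffunE [RHS]ffunE => /perm_inj; apply: idx_inj.
have [a a0 ->] := bv_eS R si; exists (\prod_b t (idx J b) * a).
  by rewrite mulf_neq0 //; apply/prodf_neq0.
rewrite scalerA; congr (_ *: eS R _); apply/setP => i; apply/imsetP/imsetP => [[b _ ->]|[k kS ->]].
  by exists (idx J b); [rewrite -JS; apply: mem_idx | rewrite ffunE].
by move: kS; rewrite -JS => /idxP[b ->]; exists b => //; rewrite [RHS]ffunE.
Qed.

Lemma act_diagonal t S : ext4_act (diag_mx (\row_i t i)) (eS R S) = (\prod_(k in S) t k) *: eS R S.
Proof.
have [S4|S4] := eqVneq #|S| 4%N; last by rewrite (eS_card _ S4) linear0 scaler0.
have [J <- _] := eS_sub4 R S4; rewrite -e4_eS -bv_idx.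
have -> : diag_mx (\row_i t i) = monomial 1%g t.
  by apply/matrixP => i j; rewrite !mxE perm1; case: eqP => [->|_]; rewrite ?mulr1n ?mulr0n ?mulr1 ?mulr0.
rewrite act_monomial_bv; congr (_ *: bv R _); last by apply/ffunP => b; rewrite ffunE perm1.
rewrite -(big_imset _ (in2W (@idx_inj J))) /=; apply: eq_bigl => k.
by apply/imsetP/idP => [[b _ ->]|/idxP[b ->]]; [apply: mem_idx | exists b].
Qed.

Lemma det_monomial_neq0 s t : (forall k, t k != 0) -> \det (monomial s t) != 0.
Proof.
move=> t0; have -> : monomial s t = (perm_mx s)^T *m diag_mx (\row_i t i).
  by apply/matrixP => i j; rewrite mul_mx_diag !mxE mulrC eq_sym.
rewrite det_mulmx det_tr det_perm det_diag mulf_neq0 ?signr_eq0 //.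
by apply/prodf_neq0 => k _; rewrite mxE.
Qed.

(** One column of the permutation matrix is rescaled to reach determinant 1; only the nonvanishing
    of the resulting factors matters later. *)
Lemma act_perm_det1 s : exists2 P : 'M[R]_8, \det P = 1 &
  forall S, exists2 c : R, c != 0 & ext4_act P (eS R S) = c *: eS R (s @: S).
Proof.
pose d := \det (monomial s (fun _ => 1)); have d0 : d != 0.
  by apply: det_monomial_neq0 => _; apply: oner_neq0.
pose t (k : 'I_8) : R := if k == ord0 then d^-1 else 1.
have t0 k : t k != 0 by rewrite /t; case: ifP; rewrite ?invr_eq0 ?oner_neq0.
exists (monomial s t); last by move=> S; apply: act_monomial.
have -> : monomial s t = monomial s (fun _ => 1) *m diag_mx (\row_i t i).
  by apply/matrixP => i j; rewrite mul_mx_diag !mxE mul1r mulrC.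
rewrite det_mulmx -/d det_diag (bigD1 ord0) //= big1 => [|k /negbTE k0].
  by rewrite mxE /t eqxx mulr1 mulfV.
by rewrite mxE /t k0.
Qed.

Definition uvec S (b : R) : ext4 R := eS R S + b *: wS R S.

Lemma wedge_uvec S b : #|S| = 4%N -> wedge (uvec S b) (uvec S b) = 2%:R * b.
Proof.
move=> S4; have h1 := wedge_eS_wS R S4.
have h2 : wedge (wS R S) (wS R S) = 0.
  by rewrite /wS wedgeZl wedgeZr wedge_eS_same !mulr0.
move: h1 h2 (wedge_eS_same R S); rewrite /uvec; move: (eS _ _) (wS _ _) => u w h1 h2 h3.
by rewrite wedgeDl !wedgeDr !wedgeZl !wedgeZr (wedgeC w u) h1 h2 h3; ring.
Qed.

Lemma eSC_wS S : #|S| = 4%N -> eS R (~: S) = sgS R S *: wS R S.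
Proof. by move=> S4; rewrite /wS scalerA sgS_sqr // scale1r. Qed.

(** Passing to the complement replaces b by 1/b and so keeps its sign. *)
Lemma uvecC S b : #|S| = 4%N -> b != 0 ->
  uvec (~: S) b = (b * sgS R S) *: uvec S b^-1.
Proof.
move=> S4 b0; transitivity (sgS R S *: wS R S + (b * sgS R S) *: eS R S).
  by rewrite /uvec eSC_wS // /wS setCK sgSC !scalerA.
by rewrite /uvec scalerDr [RHS]addrC (scalerA (b * sgS R S) b^-1); congr (_ *: _ + _); field.
Qed.

Lemma pair_uvec S (al be : R) : #|S| = 4%N -> al != 0 ->
  al *: eS R S + be *: eS R (~: S) = al *: uvec S (be * sgS R S / al).
Proof.
move=> S4 al0; rewrite /uvec scalerDr scalerA mulrC divfK // eSC_wS // !scalerA.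
by congr (_ + _ *: _).
Qed.

(** The sign of b is preserved because wedge u u = 2 b on [uvec S b] and a matrix of determinant 1
    preserves [wedge]. *)
Lemma act_uvec P S S' (c c' b : R) : \det P = 1 -> #|S| = 4%N -> #|S'| = 4%N -> b != 0 ->
  c != 0 -> ext4_act P (eS R S) = c *: eS R S' -> ext4_act P (eS R (~: S)) = c' *: eS R (~: S') ->
  exists2 b', 0 < b * b' & ext4_act P (uvec S b) = c *: uvec S' b'.
Proof.
move=> dP S4 S4' b0 c0 h1 h2; pose b' := b * sgS R S * c' * sgS R S' / c.
have E : ext4_act P (uvec S b) = c *: uvec S' b'.
  rewrite /b' -pair_uvec // /uvec linearD linearZ /= linearZ /= h1 h2 !scalerA.
  by [].
exists b' => //; have : wedge (ext4_act P (uvec S b)) (ext4_act P (uvec S b)) = 2%:R * b.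
  by rewrite wedge_act dP mul1r wedge_uvec.
rewrite E wedgeZl wedgeZr wedge_uvec // => e.
have -> : b = c ^+ 2 * b' by apply: (@mulfI _ 2%:R); rewrite ?pnatr_eq0 // -e; ring.
have b'0 : b' != 0 by apply: contraNneq b0 => b'0; move: e; rewrite b'0 !mulr0 => /esym/eqP; rewrite mulf_eq0 pnatr_eq0 => /eqP ->.
by rewrite -mulrA -expr2 mulr_gt0 // lt_def sqrf_eq0 ?c0 ?b'0 sqr_ge0.
Qed.

Lemma stdU_uvec (b : 'I_7 -> R) : stdU b = (\sum_a <[uvec (plane a) (b a)]>)%VS.
Proof. by []. Qed.

Lemma frame_conjugate n (u v : 'I_n -> ext4 R) (c : 'I_n -> R) P : \det P = 1 ->
  (forall i, c i != 0) -> (forall i, ext4_act P (u i) = c i *: v i) ->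
  SL8_conjugate (\sum_i <[u i]>)%VS (\sum_i <[v i]>)%VS.
Proof.
move=> dP c0 h; exists P => // y; split=> [/frame_mem[k ->]|[x /frame_mem[k ->] ->]].
  exists (\sum_i (k i / c i) *: u i); first by apply/frame_mem; exists (fun i => k i / c i).
  rewrite linear_sum; apply: eq_bigr => i _; rewrite linearZ /= h scalerA.
  by rewrite divfK.
apply/frame_mem; exists (fun i => k i * c i); rewrite linear_sum; apply: eq_bigr => i _.
by rewrite linearZ /= h scalerA.
Qed.

(* The diagonal matrix with entries t_k = prod_a (g_a or 1/g_a), according to whether
   k lies on the a-th plane, multiplies b_a by g_a^(-8). *)
Lemma stdU_rescale (b : 'I_7 -> R) : (forall a, b a != 0) ->
  SL8_conjugate (stdU b) (stdU (fun a => if 0 < b a then 1 else -1)).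
Proof.
move=> b0; pose g a := Num.sqrt (Num.sqrt (Num.sqrt `|b a|)).
have g0 a : 0 < g a by rewrite !sqrtr_gt0 normr_gt0.
have g8 a : g a ^+ 8 = `|b a|.
  by rewrite -[8%N]/(2 * (2 * 2))%N !exprM !sqr_sqrtr ?sqrtr_ge0.
pose ch a (k : 'I_8) := if k \in plane a then g a else (g a)^-1.
pose t k := \prod_a ch a k.
have chE (A : {set 'I_8}) a : \prod_(k in A) ch a k = g a ^+ #|A :&: plane a| * g a ^- #|A :&: ~: plane a|.
  rewrite (bigID (mem (plane a))) /= -exprVn; congr (_ * _).
    rewrite (eq_bigr (fun=> g a)) => [|k /andP[_ ka]]; last by rewrite /ch ka.
    by rewrite prodr_const; congr (_ ^+ _); apply: eq_card => k; rewrite in_setI.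
  rewrite (eq_bigr (fun=> (g a)^-1)) => [|k /andP[_ ka]]; last by rewrite /ch (negbTE ka).
  by rewrite prodr_const; congr (_ ^+ _); apply: eq_card => k; rewrite in_setI in_setC.
(* Any other plane meets [A], a plane or the complement of one, in two points and leaves out two, so
   its factors cancel. *)
have other (A : {set 'I_8}) a : #|A :&: plane a| = 2%N -> #|A :&: ~: plane a| = 2%N ->
    \prod_(k in A) ch a k = 1.
  by move=> h1 h2; rewrite chE h1 h2 mulfV // expf_neq0 // lt0r_neq0.
have exch (A : {set 'I_8}) : \prod_(k in A) t k = \prod_a \prod_(k in A) ch a k by rewrite exchange_big.
have tA a : \prod_(k in plane a) t k = g a ^+ 4.
  rewrite exch (bigD1 a) //= [X in _ * X]big1 => [|a' a'a].
    by rewrite chE setIid setICr cards0 card_plane expr0 invr1 !mulr1.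
  apply: other.
    by rewrite -[RHS](card_planeI false false a'a); apply: eq_card => k; rewrite !inE andbC !eqbF_neg.
  by rewrite -[RHS](card_planeI true false a'a); apply: eq_card => k; rewrite !inE negbK andbC eqb_id eqbF_neg.
have tC a : \prod_(k in ~: plane a) t k = g a ^- 4.
  rewrite exch (bigD1 a) //= [X in _ * X]big1 => [|a' a'a].
    by rewrite chE setIid [~: _ :&: _]setIC setICr cards0 cardsC4 ?card_plane // expr0 mul1r mulr1.
  apply: other.
    by rewrite -[RHS](card_planeI false true a'a); apply: eq_card => k; rewrite !inE negbK andbC eqb_id eqbF_neg.
  by rewrite -[RHS](card_planeI true true a'a); apply: eq_card => k; rewrite !inE !negbK andbC !eqb_id.
have dD : \det (diag_mx (\row_k t k)) = 1.
  rewrite det_diag (bigID (mem (plane ord0))) /=.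
  under eq_bigr => k _ do rewrite mxE.
  under [X in _ * X]eq_bigr => k _ do rewrite mxE.
  rewrite tA (eq_bigl (fun k => k \in ~: plane ord0)) => [|k]; last by rewrite in_setC.
  by rewrite tC mulfV // expf_neq0 // lt0r_neq0.
have c0 a : g a ^+ 4 != 0 by rewrite expf_neq0 // lt0r_neq0.
apply: (frame_conjugate dD c0) => a.
rewrite /hvec /wS linearD linearZ /= linearZ /= !act_diagonal tA tC scalerDr !scalerA.
congr (_ + _ *: _); rewrite mulrAC [RHS]mulrA; congr (_ * _); apply: (mulIf (c0 a)); rewrite divfK //.
have e : g a ^+ 4 * g a ^+ 4 = `|b a| by rewrite -exprD g8.
rewrite mulrAC e; case: ltP => [h|h]; first by rewrite mulr1 gtr0_norm.
by rewrite mulrN1 ler0_norm ?opprK.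
Qed.
End Monomial.

Section FramePermutation.
Variable R : rcfType.

Lemma frame_reindex (K : fieldType) (V : vectType K) n (v : 'I_n -> V) (q : 'I_n -> 'I_n) :
  injective q -> (\sum_i <[v i]> = \sum_i <[v (q i)]>)%VS.
Proof. by move=> qi; rewrite (reindex_inj qi). Qed.

Lemma imset_permC (s : {perm 'I_8}) (S : {set 'I_8}) : s @: (~: S) = ~: (s @: S).
Proof.
apply/setP => k; have -> : k = s (s^-1%g k) by rewrite permKV.
by rewrite in_setC !mem_imset ?in_setC //; apply: perm_inj.
Qed.

Lemma uvec_frame_perm (S : 'I_7 -> {set 'I_8}) (b : 'I_7 -> R) (s : {perm 'I_8}) (q : 'I_7 -> 'I_7) :
  (forall i, #|S i| = 4%N) -> (forall i, b i != 0) -> injective q ->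
  (forall i, s @: S i = plane (q i) \/ s @: S i = ~: plane (q i)) ->
  exists2 b' : 'I_7 -> R, forall i, 0 < b i * b' (q i) &
    SL8_conjugate (\sum_i <[uvec (S i) (b i)]>)%VS (stdU b').
Proof.
move=> S4 b0 qi hS; have [P dP hP] := act_perm_det1 R s.
have step i : exists cb : R * R, [/\ cb.1 != 0, 0 < b i * cb.2 &
    ext4_act P (uvec (S i) (b i)) = cb.1 *: uvec (plane (q i)) cb.2].
  have [c c0 h1] := hP (S i); have [c' _ h2] := hP (~: S i); rewrite imset_permC in h2.
  have sS4 : #|s @: S i| = 4%N by rewrite card_imset //; apply: perm_inj.
  have [b1 bb1 E] := act_uvec dP (S4 i) sS4 (b0 i) c0 h1 h2.
  have b10 : b1 != 0 by apply/eqP => e; rewrite e mulr0 ltxx in bb1.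
  have [e|e] := hS i; first by exists (c, b1); rewrite -e.
  exists (c * (b1 * sgS R (plane (q i))), b1^-1); split=> /=.
  - by rewrite !mulf_neq0 // sgS_neq0 // card_plane.
  - rewrite -(pmulr_lgt0 _ (_ : 0 < b1 ^+ 2)); last by rewrite lt_def sqrf_eq0 b10 sqr_ge0.
    by rewrite -mulrA expr2 mulKf.
  - have u : uvec (~: plane (q i)) b1 = (b1 * sgS R (plane (q i))) *: uvec (plane (q i)) b1^-1.
      exact: uvecC (card_plane _) b10.
    by rewrite E e u; apply: scalerA.
have [cb hcb] := fin_all_exists step.
have [q' qK q'K] := injF_bij qi.
pose b2 a := (cb (q' a)).2; exists b2 => [i|]; first by rewrite /b2 qK; case: (hcb i).
have -> : stdU b2 = (\sum_i <[uvec (plane (q i)) (cb i).2]>)%VS.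
  apply: (etrans (stdU_uvec b2)).
  apply: (etrans (frame_reindex (fun a => uvec (plane a) (b2 a)) qi)).
  by apply: eq_bigr => i _; rewrite /b2 qK.
by apply: (frame_conjugate dP (c := fun i => (cb i).1)) => i; case: (hcb i).
Qed.
End FramePermutation.

(** The linear conditions on the eight cells leave one free parameter, the last cell, which is 0, 1
    or 2. The value 1 gives one point per cell; the extreme values empty four cells and make h the
    sum of f and g up to a constant. *)
Lemma sum_bool_cells (f g h : 'I_8 -> bool) : let n x y z := (\sum_k ([&& f k == x, g k == y & h k == z] : nat))%N in
  (\sum_k f k = 4)%N -> (\sum_k g k = 4)%N -> (\sum_k h k = 4)%N ->
  (\sum_k (f k != g k) = 4)%N -> (\sum_k (f k != h k) = 4)%N -> (\sum_k (g k != h k) = 4)%N ->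
  (forall x y z, n x y z = 1%N) \/ exists c, forall k, h k = f k (+) g k (+) c.
Proof.
move=> n; pose T x y z := n x y z.
have E (F : bool -> bool -> bool -> bool) : (\sum_k F (f k) (g k) (h k) =
   F true true true * T true true true + F true true false * T true true false +
   F true false true * T true false true + F true false false * T true false false +
   F false true true * T false true true + F false true false * T false true false +
   F false false true * T false false true + F false false false * T false false false)%N.
  rewrite /T /n !big_distrr -!big_split; apply: eq_bigr => k _ /=.
  by case: (f k); case: (g k); case: (h k); rewrite /= ?muln0 ?muln1 ?addn0 ?add0n.
rewrite (E (fun x y z => x)) (E (fun x y z => y)) (E (fun x y z => z)).
rewrite (E (fun x y z => x != y)) (E (fun x y z => x != z)) (E (fun x y z => y != z)).
have := E (fun x y z => true); rewrite sum_nat_const card_ord muln1 /= !mul1n !mul0n !addn0 !add0n.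
move=> e0 e1 e2 e3 e4 e5 e6.
have zero x y z : T x y z = 0%N -> forall k, ~ (f k = x /\ g k = y /\ h k = z).
  move=> /eqP; rewrite sum_nat_eq0 => /forallP t k [fk [gk hk]].
  by have := t k; rewrite fk gk hk !eqxx.
have : (T false false false <= 2)%N by lia.
have [o|o|o] : [\/ T false false false = 1, T false false false = 0 | 2 <= T false false false]%N.
  by case: (T false false false) => [|[|?]]; [constructor 2 | constructor 1 | constructor 3].
- move=> _; left; case; case; case; rewrite -/(T _ _ _); lia.
- move=> _; right; exists true => k.
  have := zero _ _ _ o k; have := @zero true true false _ k; have := @zero true false true _ k; have := @zero false true true _ k.
  by case: (f k); case: (g k); case: (h k) => //= h1 h2 h3 h4; exfalso; intuition lia.
move=> o2; right; exists false => k.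
have := @zero true true true _ k; have := @zero true false false _ k; have := @zero false true false _ k; have := @zero false false true _ k.
by case: (f k); case: (g k); case: (h k) => //= h1 h2 h3 h4; exfalso; intuition lia.
Qed.

Fixpoint bools n : seq (seq bool) :=
  if n is n'.+1 then map (cons true) (bools n') ++ map (cons false) (bools n') else [:: [::]].

Lemma bools_mem (s : seq bool) : s \in bools (size s).
Proof.
elim: s => //= b s IH; rewrite mem_cat; case: b; first by rewrite map_f.
by rewrite map_f ?orbT.
Qed.

Definition mism (s t : seq bool) := count (fun p => p.1 != p.2) (zip s t).

(** Enumeration of the 256 Boolean functions on F_2^3: one orthogonal to the constant and to the
    three coordinate functions is affine. *)
Lemma affine_check (s : seq bool) : size s = 8%N -> count id s = 4%N ->
  (forall j, (j < 3)%N -> mism s (map (bit j) (iota 0 8)) = 4%N) ->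
  exists a c, (a < 7)%N /\ s = [seq chi a.+1 l (+) c | l <- iota 0 8].
Proof.
have : all (fun s => (count id s == 4%N) && all (fun j => mism s (map (bit j) (iota 0 8)) == 4%N) (iota 0 3) ==>
    has (fun a => has (fun c => s == [seq chi a.+1 l (+) c | l <- iota 0 8]) [:: true; false]) (iota 0 7)) (bools 8).
  by vm_compute.
move=> /allP h s8 c4 hj; have sb : s \in bools 8 by rewrite -s8 bools_mem.
have pre : (count id s == 4%N) && all (fun j => mism s (map (bit j) (iota 0 8)) == 4%N) (iota 0 3).
  rewrite c4 eqxx; apply/allP => j; rewrite mem_iota => /andP[_ j3]; exact/eqP/hj.
have /implyP/(_ pre)/hasP[a] := h s sb.
rewrite mem_iota => /andP[_ a7] /hasP[c _ /eqP ->]; by exists a, c.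
Qed.

Definition code3 (x y z : bool) : nat := (x + 2 * y + 4 * z)%N.

Lemma code3_lt x y z : (code3 x y z < 8)%N. Proof. by case: x; case: y; case: z. Qed.

Lemma code3_bits x y z : [/\ bit 0 (code3 x y z) = x, bit 1 (code3 x y z) = y & bit 2 (code3 x y z) = z].
Proof. by case: x; case: y; case: z. Qed.

Lemma sum_iota8 (F : nat -> bool) : (\sum_(k < 8) F k = count F (iota 0 8))%N.
Proof.
rewrite -sum1_count [RHS]big_mkcond -(big_mkord xpredT (fun k => nat_of_bool (F k))) /index_iota subn0.
by apply: eq_bigr => k _; case: (F k).
Qed.

Definition discrepancy (S T : {set 'I_8}) : nat := (\sum_k ((k \in S) != (k \in T) : nat))%N.

Lemma discrepancy_tr (R : numFieldType) (S T : {set 'I_8}) :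
  \tr (sd R S *m sd R T) = 0 -> discrepancy S T = 4%N.
Proof.
rewrite tr_sd_sd => h; have : 8%:R - 2%:R * (discrepancy S T)%:R = 0 :> R.
  rewrite -[RHS]h /discrepancy natr_sum mulr_sumr.
  have -> : 8%:R = \sum_(k < 8) 1 :> R by rewrite sumr_const card_ord.
  rewrite -sumrB; apply: eq_bigr => k _; case: (_ != _) => /=; rewrite ?expr0 ?expr1; ring.
move/eqP; rewrite subr_eq0 -natrM eqr_nat => /eqP; move: (discrepancy S T) => n; lia.
Qed.

(** Uniqueness of the Hadamard matrix of order 8. Three independent rows label the columns by F_2^3,
    and [affine_check] then makes every other row an affine function; distinct rows have distinct
    linear parts, since otherwise they would agree up to sign. *)
Lemma hadamard_planes (S : 'I_7 -> {set 'I_8}) : (forall i, #|S i| = 4%N) ->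
  (forall i j, i != j -> discrepancy (S i) (S j) = 4%N) ->
  exists (s : {perm 'I_8}) (q : 'I_7 -> 'I_7), injective q /\
    forall i, s @: S i = plane (q i) \/ s @: S i = ~: plane (q i).
Proof.
move=> S4 hd; pose o n : 'I_7 := inord n.
have oE n m : (n < 7)%N -> (m < 7)%N -> n != m -> o n != o m.
  by move=> n7 m7; apply: contra => /eqP/(congr1 val); rewrite /= !inordK // => ->.
have c4 i : (\sum_k (k \in S i) = 4)%N by rewrite -[RHS](S4 i) -sum1_card [RHS]big_mkcond; apply: eq_bigr => k _; case: (k \in S i).
have cells n : (1 < n)%N -> (n < 7)%N ->
    (forall x y z, (\sum_k ([&& (k \in S (o 0)) == x, (k \in S (o 1)) == y & (k \in S (o n)) == z] : nat) = 1)%N) \/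
    exists c, forall k, (k \in S (o n)) = (k \in S (o 0)) (+) (k \in S (o 1)) (+) c.
  move=> n1 n7; apply: (@sum_bool_cells (fun k => k \in S (o 0)) (fun k => k \in S (o 1)) (fun k => k \in S (o n))) => //.
  - exact: (hd (o 0) (o 1) (oE 0 1 isT isT isT)).
  - by apply: (hd (o 0) (o n)); apply: oE => //; lia.
  - by apply: (hd (o 1) (o n)); apply: oE => //; lia.
have const (A B : {set 'I_8}) c : (forall k, (k \in A) = (k \in B) (+) c) -> discrepancy A B <> 4%N.
  move=> h; rewrite /discrepancy (eq_bigr (fun=> (c : nat))) => [|k _]; last by rewrite h; case: (k \in B); case: c {h}.
  by rewrite sum_nat_const card_ord; case: c {h}.
(* Rows 2 and 3 cannot both be the product of rows 0 and 1 up to sign, for then they would agree up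
   to sign with each other. *)
have [n [n1 n7 hn]] : exists n, [/\ (1 < n)%N, (n < 7)%N & forall x y z,
    (\sum_k ([&& (k \in S (o 0)) == x, (k \in S (o 1)) == y & (k \in S (o n)) == z] : nat) = 1)%N].
  have [h|[c hc]] := cells 2%N isT isT; first by exists 2%N.
  have [h|[c' hc']] := cells 3%N isT isT; first by exists 3%N.
  case: (const (S (o 2)) (S (o 3)) (c (+) c') _); last by apply: hd; apply: oE.
  by move=> k; rewrite hc hc'; case: (k \in S (o 0)); case: (k \in S (o 1)); case: c {hc}; case: c' {hc'}.
pose code (k : 'I_8) : 'I_8 := Ordinal (code3_lt (k \in S (o 0)) (k \in S (o 1)) (k \in S (o n))).
have codei : injective code.
  move=> k l kl; apply/eqP; apply: contraT => nkl.
  have e3 := congr1 val kl; rewrite /= in e3.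
  have [b0 b1 b2] := code3_bits (k \in S (o 0)) (k \in S (o 1)) (k \in S (o n)).
  have [b0' b1' b2'] := code3_bits (l \in S (o 0)) (l \in S (o 1)) (l \in S (o n)).
  rewrite e3 b0' in b0; rewrite e3 b1' in b1; rewrite e3 b2' in b2.
  have := hn (k \in S (o 0)) (k \in S (o 1)) (k \in S (o n)).
  by rewrite (bigD1 k) //= (bigD1 l) 1?eq_sym //= b0 b1 b2 !eqxx.
pose s := perm codei.
pose F i (l : nat) : bool := (s^-1%g (inord l : 'I_8)) \in S i.
have FE i k : F i (code k) = (k \in S i).
  have sk : s k = code k by rewrite permE.
  by rewrite /F inord_val -sk permK.
have sumF (G : 'I_8 -> bool) : (\sum_k G k = \sum_k G (s^-1%g k))%N.
  by apply: (reindex_inj (h := s^-1%g)); apply: perm_inj.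
have cnt i : count (F i) (iota 0 8) = 4%N.
  rewrite -sum_iota8 -[RHS](c4 i) (sumF (fun k => k \in S i)); apply: eq_bigr => k _.
  by rewrite /F inord_val.
have cnt2 i j : i != j -> count (fun l => F i l != F j l) (iota 0 8) = 4%N.
  move=> ij; rewrite -sum_iota8 -[RHS](hd i j ij) /discrepancy (sumF (fun k => (k \in S i) != (k \in S j))).
  by apply: eq_bigr => k _; rewrite /F inord_val.
have bitE (j : nat) (m : nat) : (j, m) \in [:: (0, 0); (1, 1); (2, n)]%N -> forall l : 'I_8, F (o m) l = bit j l.
  move=> jm l; have -> : l = code (s^-1%g l).
    by rewrite -[RHS](permE codei) -/s permKV.
  rewrite FE; have [b0 b1 b2] := code3_bits (s^-1%g l \in S (o 0)) (s^-1%g l \in S (o 1)) (s^-1%g l \in S (o n)).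
  by move: jm; rewrite !inE => /or3P[] /eqP[-> ->]; rewrite ?b0 ?b1 ?b2.
have aff i : exists a c, (a < 7)%N /\ forall l : 'I_8, F i l = chi a.+1 l (+) c.
  have viaBit j m : (j, m) \in [:: (0, 0); (1, 1); (2, n)]%N -> i = o m -> exists a c, (a < 7)%N /\ forall l : 'I_8, F i l = chi a.+1 l (+) c.
    move=> jm ->; exists (2 ^ j).-1, false; split; first by move: jm; rewrite !inE => /or3P[] /eqP[-> _].
    move=> l; rewrite (bitE _ _ jm) addbF; move: jm; rewrite !inE => /or3P[] /eqP[-> _]; rewrite /chi /=.
    - by rewrite !addbF.
    - by rewrite addbF.
    - by [].
  have [i0|i0] := eqVneq i (o 0); first exact: (viaBit 0%N 0%N).
  have [i1|i1] := eqVneq i (o 1); first exact: (viaBit 1%N 1%N).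
  have [i2|i2] := eqVneq i (o n); first by apply: (viaBit 2%N n) => //; rewrite !inE eqxx !orbT.
  have [//|||a [c [a7 e]]] := @affine_check (map (F i) (iota 0 8)).
  - by rewrite count_map -[RHS](cnt i); apply: eq_count.
  - move=> j j3; pose m := nth 0%N [:: 0; 1; n]%N j.
    have jm : (j, m) \in [:: (0, 0); (1, 1); (2, n)]%N.
      by rewrite /m; case: j j3 {m} => [|[|[|]]] //= _; rewrite !inE eqxx ?orbT.
    have im : i != o m by rewrite /m; case: j j3 {m jm} => [|[|[|]]].
    rewrite -[RHS](cnt2 i (o m) im) /mism zip_map count_map; apply: eq_in_count => l.
    rewrite mem_iota => /andP[_ l8] /=; by rewrite (bitE _ _ jm (Ordinal l8)).
  exists a, c; split=> // l.
  have := congr1 (fun t => nth false t l) e; rewrite !(nth_map 0%N) ?size_iota // nth_iota //.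
have aff' i : exists a : 'I_7, exists c, forall l : 'I_8, F i l = chi a.+1 l (+) c.
  by have [a [c [a7 h]]] := aff i; exists (Ordinal a7), c.
have [q hq] := fin_all_exists aff'.
exists s, q; split=> [i j qij|i].
  apply/eqP; apply: contraT => ij; have [c hc] := hq i; have [c' hc'] := hq j.
  case: (const (S i) (S j) (c (+) c') _); last exact: hd.
  move=> k; rewrite -!FE hc hc' qij; by case: (chi _ _); case: c {hc}; case: c' {hc'}.
have [c hc] := hq i; have mE (l : 'I_8) : (l \in s @: S i) = chi (q i).+1 l (+) c.
  by rewrite -hc /F inord_val -[l in LHS](permKV s) mem_imset //; apply: perm_inj.
case: c mE {hc} => mE; [left|right]; apply/setP => l; rewrite mE !inE ?addbT ?addbF //.
by rewrite negbK.
Qed.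

(* Linear automorphisms of F_2^3, given by the images of the unit vectors 1, 2, 4. *)
Definition fano_maps : seq (nat * nat * nat) :=
  [:: (2, 4, 1); (7, 2, 6); (3, 7, 6); (6, 5, 2); (6, 5, 7); (4, 2, 5); (2, 7, 4); (1, 4, 7);
      (5, 3, 1); (1, 3, 7); (7, 4, 1); (4, 3, 5); (3, 2, 5); (4, 2, 3); (6, 1, 5); (6, 2, 1);
      (7, 5, 3); (2, 3, 5); (5, 1, 3); (2, 5, 4); (7, 5, 4); (5, 2, 1); (6, 4, 7); (3, 7, 2);
      (2, 6, 1); (2, 6, 3); (3, 6, 4); (1, 7, 5)]%N.

Definition fano_point (m : nat * nat * nat) (l : nat) : nat :=
  let x j := (bit 0 l && bit j m.1.1) (+) (bit 1 l && bit j m.1.2) (+) (bit 2 l && bit j m.2) in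
  code3 (x 0%N) (x 1%N) (x 2%N).

(** The pullback of a linear form under [m]; the shifts by one come from indexing nonzero forms from
    0. *)
Definition fano_form (m : nat * nat * nat) (a : nat) : nat :=
  (code3 (chi a.+1 m.1.1) (chi a.+1 m.1.2) (chi a.+1 m.2)).-1.

Lemma fano_maps_linear m : m \in fano_maps ->
  [/\ uniq (map (fano_point m) (iota 0 8)), uniq (map (fano_form m) (iota 0 7)) &
   all (fun a => (fano_form m a < 7)%N && all (fun l =>
     chi a.+1 (fano_point m l) == chi (fano_form m a).+1 l) (iota 0 8)) (iota 0 7)].
Proof.
have : all (fun m => [&& uniq (map (fano_point m) (iota 0 8)), uniq (map (fano_form m) (iota 0 7)) &
   all (fun a => (fano_form m a < 7)%N && all (fun l =>
     chi a.+1 (fano_point m l) == chi (fano_form m a).+1 l) (iota 0 8)) (iota 0 7)]) fano_maps.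
  by vm_compute.
by move=> /allP h mm; apply/and3P; apply: h.
Qed.

(** Checked on all 128 subsets. The triangles form an orbit of 28 elements with a single
    representative, so 28 is the least possible length for [fano_maps]. *)
Lemma fano_reps_exhaust (N : nat -> bool) :
  exists m i, [/\ m \in fano_maps, (i < 10)%N &
    forall a, (a < 7)%N -> fano_mem i a = N (fano_form m a)].
Proof.
have : all (fun s => has (fun m => has (fun i =>
    all (fun a => fano_mem i a == nth false s (fano_form m a)) (iota 0 7)) (iota 0 10)) fano_maps) (bools 7).
  by vm_compute.
move=> /allP H; have sb : map N (iota 0 7) \in bools 7.
  by have := bools_mem (map N (iota 0 7)); rewrite size_map size_iota.
have /hasP[m mm /hasP[j]] := H _ sb.
rewrite mem_iota => /andP[_ j10] /allP h; exists m, j; split=> // a a7.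
have ai : a \in iota 0 7 by rewrite mem_iota.
have /eqP -> := h a ai; have [_ _ /allP/(_ a ai)/andP[f7 _]] := fano_maps_linear mm.
by rewrite (nth_map 0%N) ?size_iota // nth_iota.
Qed.

Section Classification.
Variables (R : rcfType) (C : numClosedFieldType) (c : complexification R C).
Local Notation cx := (cx c).

Lemma stdU_eq (b b' : 'I_7 -> R) : b =1 b' -> stdU b = stdU b'.
Proof. by move=> h; apply: eq_bigr => a _; rewrite h. Qed.

Lemma stdU_classify (b : 'I_7 -> R) : (forall a, b a != 0) ->
  exists i, SL8_conjugate (stdU b) (stdU (@rep_sign R i)).
Proof.
move=> b0; pose N (a : nat) : bool := ~~ (0 < b (inord a)).
have [m [i [mm i10 hN]]] := fano_reps_exhaust N.
have [uT uP /allP hT] := fano_maps_linear mm.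
have ai (a : 'I_7) : (a : nat) \in iota 0 7 by rewrite mem_iota; case: a.
have li (l : 'I_8) : (l : nat) \in iota 0 8 by rewrite mem_iota; case: l.
have f7 (a : 'I_7) : (fano_form m a < 7)%N by have /andP[] := hT _ (ai a).
have p8 (l : 'I_8) : (fano_point m l < 8)%N by apply: code3_lt.
pose f (a : 'I_7) : 'I_7 := Ordinal (f7 a); pose p (l : 'I_8) : 'I_8 := Ordinal (p8 l).
have fi : injective f.
  move=> a a' /(congr1 val) /= e; apply/val_inj => /=.
  have := nth_uniq 0%N _ _ uP; rewrite size_map size_iota => /(_ a a' (ltn_ord a) (ltn_ord a')).
  by rewrite !(nth_map 0%N) ?size_iota // !nth_iota // !add0n e eqxx => /esym/eqP.
have pi : injective p.
  move=> l l' /(congr1 val) /= e; apply/val_inj => /=.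
  have := nth_uniq 0%N _ _ uT; rewrite size_map size_iota => /(_ l l' (ltn_ord l) (ltn_ord l')).
  by rewrite !(nth_map 0%N) ?size_iota // !nth_iota // !add0n e eqxx => /esym/eqP.
have [q fK qK] := injF_bij fi.
have qi : injective q by apply: (can_inj qK).
(* The plane of a form goes to the plane of the form whose pullback it is, which explains the
   inverse [q] of [f]. *)
have pl a : (perm pi) @: plane a = plane (q a).
  apply/setP => k; have -> : k = perm pi ((perm pi)^-1%g k) by rewrite permKV.
  rewrite mem_imset; last exact: perm_inj.
  move: ((perm pi)^-1%g k) => l; rewrite permE /plane !in_set.
  have /andP[_ /allP/(_ _ (li l))/eqP /= ->] := hT _ (ai (q a)).
  by rewrite -[fano_form m (q a)]/(f (q a) : nat) qK.
have [b' bb' cb'] := uvec_frame_perm (card_plane) b0 qi (fun a => or_introl (pl a)).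
have b'0 a : b' a != 0 by have := bb' (f a); rewrite fK; apply: contraTneq => ->; rewrite mulr0 ltxx.
have sgn a : @rep_sign R (Ordinal i10) a = if 0 < b' a then 1 else -1.
  rewrite /rep_sign /= hN // /N; have := bb' (f a); rewrite fK.
  have -> : inord (fano_form m a) = f a by apply/val_inj; rewrite /= inordK.
  have [h|h] := ltP 0 (b (f a)); first by rewrite pmulr_rgt0 // => ->.
  have hn : b (f a) < 0 by rewrite lt_neqAle b0.
  by rewrite nmulr_rgt0 // => /ltW; rewrite leNgt => /negbTE ->; rewrite expr1.
exists (Ordinal i10); apply: SL8_conjugate_trans cb' _.
have -> : stdU (@rep_sign R (Ordinal i10)) = stdU (fun a => if 0 < b' a then 1 else -1).
  apply: stdU_eq => a; exact: sgn.
exact: stdU_rescale.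
Qed.
End Classification.

Section TorusNormalForm.
Variables (R : rcfType) (C : numClosedFieldType) (c : complexification R C).
Local Notation cx := (cx c).
Hypothesis jac : jacobi C.
Variable U : {vspace ext4 R}.
Hypothesis mtU : max_torus c U.

(** Rescaling one coordinate brings a diagonalizing matrix into SL(8) without disturbing the
    diagonal forms. *)
Lemma diagonal_det1 (Q : 'M[R]_8) : Q \in unitmx -> exists2 D : 'M[R]_8, \det (D *m Q) = 1 &
  forall S, D *m sd R S = sd R S *m D.
Proof.
move=> uQ; have d0 : \det Q != 0 by rewrite -unitfE -unitmxE.
pose t : 'rV[R]_8 := \row_k (if k == ord0 then (\det Q)^-1 else 1).
exists (diag_mx t) => [|S]; last first.
  by rewrite !mulmx_diag; congr diag_mx; apply/rowP => i; rewrite !mxE mulrC.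
rewrite det_mulmx det_diag (bigD1 ord0) //= big1 => [|k /negbTE k0]; last by rewrite mxE k0.
by rewrite mxE eqxx mulr1 mulVf.
Qed.

Lemma root_family x : x \in U -> (forall p l, p != 0 -> Dop (cx x) p = l *: p ->
    exists a, [/\ weight c U a p, a (cx x) = l & l = 0 -> forall z, ctorus c U z -> a z = 0]) ->
  forall n, (n <= 7)%N -> exists Xs : seq 'M[R]_8, [/\ size Xs = n, {in Xs, forall X, root_matrix x X},
    {in Xs &, forall X Y, X *m Y = Y *m X} & pairwise (fun X Y => \tr (X *m Y) == 0) Xs].
Proof.
move=> xU gx; elim=> [|n IH] n7; first by exists [::].
have [|Xs [s1 rXs cXs pXs]] := IH; first exact: ltnW.
have [|X rX hX] := root_matrix_extend jac mtU xU gx _ rXs cXs; first by rewrite s1.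
exists (X :: Xs); split=> /=; first by rewrite s1.
- by move=> Y; rewrite inE => /orP[/eqP -> //|]; apply: rXs.
- move=> Y Y'; rewrite !inE => /orP[/eqP ->|YX] /orP[/eqP ->|YX'] //.
  + by have [-> _] := hX _ YX'.
  + by have [-> _] := hX _ YX.
  + exact: cXs.
- by rewrite pXs andbT; apply/allP => Y YX; rewrite mxtrace_mulC; apply/eqP; case: (hX _ YX).
Qed.

Lemma coroot_form (S : {set 'I_8}) (w : ext4 R) : #|S| = 4%N ->
  lact (sd R S) (lact (sd R S) w) = 16%:R *: w ->
  exists al be, w = al *: eS R S + be *: eS R (~: S).
Proof.
move=> S4 h; have S4' := cardsC4 S4.
pose wp := w + 4%:R^-1 *: lact (sd R S) w; pose wm := w - 4%:R^-1 *: lact (sd R S) w.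
have [al e1] : exists a, wp = a *: eS R S.
  apply: sd_eigenvector => //; rewrite /wp lactDr lactZr h scalerDr !scalerA addrC.
  congr (_ *: _ + _); first by field.
  by rewrite divff ?scale1r // pnatr_eq0.
have [be e2] : exists a, wm = a *: eS R (~: S).
  apply: sd_eigenvector => //; rewrite sdC lactNl /wm lactBr lactZr h scalerBr !scalerA opprB.
  congr (_ *: _ - _); first by field.
  by rewrite divff ?scale1r // pnatr_eq0.
exists (al / 2%:R), (be / 2%:R); rewrite ![_ / 2%:R]mulrC -!scalerA -e1 -e2 -scalerDr.
by rewrite /wp /wm addrACA subrr addr0 -mulr2n -scaler_nat scalerA mulVf ?scale1r // pnatr_eq0.
Qed.

(** A single matrix of determinant 1 diagonalizes the seven roots. Each coroot then becomes a
    combination of e_S and its complementary vector, and both coefficients are nonzero because its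
    norm is a multiple of their product. *)
Lemma torus_frame : exists (S : 'I_7 -> {set 'I_8}) (b : 'I_7 -> R),
  [/\ forall i, #|S i| = 4%N, forall i, b i != 0,
      forall i j, i != j -> discrepancy (S i) (S j) = 4%N &
      SL8_conjugate U (\sum_i <[uvec (S i) (b i)]>)%VS].
Proof.
have [x xU gx] := generic_element jac mtU; have [d7 _ _] := torus_structure jac mtU.
have [Xs [s7 rXs cXs pXs]] := root_family xU gx (leqnn 7).
have [Q0 uQ0 hQ0] := involutions_codiag (fun X XX => proj1 (rXs X XX)) cXs.
pose X (i : 'I_7) := nth 0 Xs i.
have XX i : X i \in Xs by apply: mem_nth; rewrite s7.
have [P dP XS] : exists2 P : 'M[R]_8, \det P = 1 & forall i, exists S, P *m X i *m invmx P = sd R S.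
  have [D dP hD] := diagonal_det1 uQ0; have uP := det1_unit dP.
  exists (D *m Q0) => // i; have [S SE] := hQ0 _ (XX i); exists S.
  have QX : Q0 *m X i = sd R S *m Q0 by rewrite -SE mulmxKV.
  have -> : D *m Q0 *m X i = sd R S *m (D *m Q0) by rewrite -mulmxA QX mulmxA hD mulmxA.
  by rewrite mulmxK.
have uP := det1_unit dP.
have [S SE] := fin_all_exists XS.
have trC (Y : 'M[R]_8) : \tr (P *m Y *m invmx P) = \tr Y by rewrite mxtrace_mulC mulmxA mulVmx // mul1mx.
have conjM (A B : 'M[R]_8) : P *m A *m invmx P *m (P *m B *m invmx P) = P *m (A *m B) *m invmx P.
  by rewrite !mulmxA mulmxKV.
have S4 i : #|S i| = 4%N.
  by apply: (@card4_of_tr R); rewrite -SE trC; apply: (root_matrix_tr (rXs _ (XX i))).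
have Str i j : i != j -> \tr (sd R (S i) *m sd R (S j)) = 0.
  wlog lt : i j / (i < j)%N => [hw ij|ij].
    have [lt|] := ltnP i j; first exact: hw.
    by rewrite leq_eqVlt => /orP[/eqP/val_inj e|lt]; [rewrite e eqxx in ij | rewrite mxtrace_mulC; apply: hw; rewrite 1?eq_sym].
  rewrite -!SE conjM trC; apply/eqP.
  by have /(pairwiseP 0) := pXs; apply; rewrite ?inE ?s7.
pose w i := ext4_act P (coroot x (X i)).
have wE i : lact (sd R (S i)) (lact (sd R (S i)) (w i)) = 16%:R *: w i.
  rewrite -SE -!lact_act // (coroot_lact2 jac mtU xU gx (rXs _ (XX i))).
  by rewrite linearZ.
have w2 i : wedge (w i) (w i) != 0.
  by rewrite wedge_act dP mul1r; apply: (coroot_wedge jac mtU xU gx (rXs _ (XX i))).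
have form i : exists ab : R * R, w i = ab.1 *: eS R (S i) + ab.2 *: eS R (~: S i).
  by have [al [be e]] := coroot_form (S4 i) (wE i); exists (al, be).
have [ab abE] := fin_all_exists form.
have neqS i j : i != j -> S i != S j /\ S j != ~: S i.
  move=> ij; split; apply/eqP => e; have := Str i j ij.
    by rewrite e tr_sd_same => /eqP; rewrite pnatr_eq0.
  by rewrite e sdC mulmxN linearN /= tr_sd_same => /eqP; rewrite oppr_eq0 pnatr_eq0.
have worth i j : i != j -> wedge (w i) (w j) = 0.
  move=> ij; have [n1 n2] := neqS i j ij; rewrite !abE wedgeDl !wedgeDr !wedgeZl !wedgeZr.
  have -> : wedge (eS R (S i)) (eS R (S j)) = 0 by apply: wedge_eS0.
  have -> : wedge (eS R (S i)) (eS R (~: S j)) = 0 by apply: wedge_eS0; rewrite (inj_eq (@setC_inj _)) eq_sym.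
  have -> : wedge (eS R (~: S i)) (eS R (S j)) = 0 by apply: wedge_eS0; rewrite setCK eq_sym.
  have -> : wedge (eS R (~: S i)) (eS R (~: S j)) = 0.
    by apply: wedge_eS0; rewrite (inj_eq (@setC_inj _)).
  by rewrite !mulr0 !addr0.
have ww i : wedge (w i) (w i) = 2%:R * (ab i).1 * (ab i).2 * sgS R (S i).
  rewrite abE wedgeDl !wedgeDr !wedgeZl !wedgeZr !wedge_eS_same.
  by rewrite [wedge (eS R (~: S i)) (eS R (S i))]wedgeC -/(sgS R (S i)); ring.
have a0 i : (ab i).1 != 0 by apply: contraNneq (w2 i) => e; rewrite ww e mulr0 !mul0r.
have b0 i : (ab i).2 != 0 by apply: contraNneq (w2 i) => e; rewrite ww e mulr0 !mul0r.
exists S, (fun i => (ab i).2 * sgS R (S i) / (ab i).1); split=> //.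
- by move=> i; rewrite !mulf_neq0 ?invr_eq0 ?sgS_neq0.
- by move=> i j ij; apply/(@discrepancy_tr R)/Str.
(* The coroots are pairwise orthogonal for [wedge] with nonzero norms, hence independent, and seven
   of them span [U]. *)
have UE : U = (\sum_i <[coroot x (X i)]>)%VS.
  apply/esym/eqP; rewrite eqEdim; apply/andP; split.
    apply/subv_sumP => i _; rewrite -memvE.
    exact: (coroot_mem jac mtU xU gx (rXs _ (XX i))).
  rewrite d7 frame_dim // => k k0 i; have : wedge (ext4_act P (\sum_i k i *: coroot x (X i))) (w i) = 0.
    by rewrite k0 linear0 wedge0l.
  rewrite linear_sum wedge_suml (bigD1 i) //= big1 => [|j ji]; last first.
    by rewrite linearZ wedgeZl worth // mulr0.
  by rewrite linearZ wedgeZl addr0 => /eqP; rewrite mulf_eq0 (negbTE (w2 i)) orbF => /eqP.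
rewrite UE; apply: (frame_conjugate dP a0) => i.
by rewrite -/(w i) abE pair_uvec.
Qed.

Lemma torus_classify : exists i, SL8_conjugate (stdU (@rep_sign R i)) U.
Proof.
have [S [b [S4 b0 Sd conj1]]] := torus_frame.
have [s [q [qi hq]]] := hadamard_planes S4 Sd.
have [b' bb' conj2] := uvec_frame_perm S4 b0 qi hq.
have [q' qK q'K] := injF_bij qi.
have [|i conj3] := @stdU_classify R b'.
  by move=> a; have := bb' (q' a); rewrite q'K; apply: contraTneq => ->; rewrite mulr0 ltxx.
exists i; apply: SL8_conjugate_sym; apply: SL8_conjugate_trans conj3.
exact: SL8_conjugate_trans conj1 conj2.
Qed.
End TorusNormalForm.

Local Open Scope complex_scope.
Unset Implicit Arguments.

Theorem mainTheorem2
  (R : realType) (g : vectType R[i]) (ad : 'Hom(g, 'End(g)))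
  (lie_g : lie_algebra ad) (simple_g : simple_lie ad)
  (Phi : seq 'rV[int]_7) (h : 'I_7 -> g) (e : 'rV[int]_7 -> g)
  (chev : chevalley_basis ad E7_cartan Phi h e)
  (a0 : 'rV[int]_7) (low : lowest_root Phi a0)
  (theta : 'End(g)) (inv_theta : E7_involution ad e a0 theta)
  (psi : 'Hom('M[R[i]]_8, g)) (iso_psi : sl8_iso ad e a0 theta psi)
  (Psi : 'M[R[i]]_8 -> 'End(g)) (lift_Psi : sl8_lift ad psi Psi)
  (iota : 'Hom(ext4 R[i], g))
  (ident : ext4_identification Phi h e theta Psi iota) :
  exists C : 'I_10 -> {vspace ext4 R},
    [/\ forall i, cartan_subspace ad iota (C i),
        forall i j, SL8_conjugate (C i) (C j) -> i = j
      & forall U : {vspace ext4 R}, cartan_subspace ad iota U ->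
          exists i, SL8_conjugate (C i) U].
Proof.
have [jac cmt] := cartan_max_torus lie_g simple_g inv_theta iso_psi lift_Psi ident.
exists (fun i => stdU (rep_sign R i)); split=> [i|i j|U].
- by apply/cmt; apply: max_torus_std jac _ _; apply: rep_sign_pm.
- exact: rep_not_conjugate.
- by move/cmt; apply: torus_classify jac _.
Qed.
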